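(* Let $k,l$ be positive integers. Then for $\operatorname{Re}s>1$, $$F_{1,l}(s)=\zeta(s),\qquad F_{2,l}(s)=\frac{\zeta(2s)\,\zeta((2l+1)s)}{\zeta(2(2l+1)s)}.$$ When $k\ge3$, $F_{k,l}(s)$ extends to a meromorphic function on the half-plane $\operatorname{Re}s>0$, and the line $\operatorname{Re}s=0$ is a natural boundary: every point of $\operatorname{Re}s=0$ is a limit point of poles of $F_{k,l}$ in $\operatorname{Re}s>0$, so $F_{k,l}$ admits no meromorphic continuation to a neighbourhood of any point of this line.
   Context: A positive integer $n$ is an $l$-step $k$-powerful number if for every prime $p$, $\operatorname{ord}_pn\in\{0,k,2k,\dots,(l-1)k\}$ or $\operatorname{ord}_pn\ge lk$ ($\operatorname{ord}_pn$ the exponent of $p$ in $n$). $F_{k,l}(s):=\sum_n n^{-s}$ over all $l$-step $k$-powerful numbers $n$ (absolutely convergent for $\operatorname{Re}s>1$). $\zeta$ is the Riemann zeta function. *)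

(* Defs.v *)
From Stdlib Require Import Reals ClassicalDescription.
From Coquelicot Require Import Coquelicot.
From mathcomp Require prime.

Open Scope R_scope.

Definition ord (p n : nat) : nat := prime.logn p n.

Definition step_powerful (k l n : nat) : Prop :=
  (0 < n)%nat /\
  forall p : nat, prime.prime p = true ->
    (exists j : nat, (j < l)%nat /\ ord p n = (j * k)%nat) \/ (l * k <= ord p n)%nat.

(* complex power n^(-s) for a positive integer n: exp(-s ln n) *)
Definition npow_neg (n : nat) (s : C) : C :=
  (exp (- Re s * ln (INR n)) * cos (Im s * ln (INR n)),
   - (exp (- Re s * ln (INR n)) * sin (Im s * ln (INR n)))).

Definition CSeries (a : nat -> C) : C :=
  (Series (fun n => Re (a n)), Series (fun n => Im (a n))).

(* Riemann zeta function (Dirichlet series, meaningful for Re s > 1) *)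
Definition zeta (s : C) : C := CSeries (fun n => npow_neg (S n) s).

Definition F (k l : nat) (s : C) : C :=
  CSeries (fun n => if excluded_middle_informative (step_powerful k l n)
                    then npow_neg n s else 0%C).

Definition C_differentiable (f : C -> C) (z : C) : Prop :=
  @ex_derive C_AbsRing C_NormedModule f z.

Definition meromorphic_on (U : C -> Prop) (f : C -> C) (P : C -> Prop) : Prop :=
  (forall z, U z -> exists r, 0 < r /\ forall c, Cmod (c - z)%C < r -> U c) /\
  (forall p, P p -> U p) /\
  (forall z, U z -> exists r, 0 < r /\
       forall w, P w -> w <> z -> r <= Cmod (w - z)%C) /\
  (forall z, U z -> ~ P z -> C_differentiable f z) /\
  (forall p, P p -> filterlim (fun w => Cmod (f w)) (locally' p) (Rbar_locally p_infty)).

Definition right_half_plane (z : C) : Prop := 0 < Re z.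

Definition Cdisc (c : C) (r : R) (z : C) : Prop := Cmod (z - c)%C < r.

Definition iy (y : R) : C := (0%R, y).

(* Main.v *)
(* With u = p^-s the Euler factor of F_{k,l} is Q(u) / (1 - u^k), where Q(u) = 1 + u^{lk+1} + ... + u^{lk+k-1}.
   For k <= 2 this is a ratio of cyclotomic factors. For k >= 3 write Q(u) = prod_j (1 - beta_j u); pairing the
   values at 1/2 and 2 shows that r = max |beta_j| > 1. Formally Q(u) = prod_n (1 - u^n)^{-b_n} with integers b_n,
   where -sum_{d | n} d b_d is the n-th power sum of the beta_j, so |b_n| is of order r^n / n for a positive proportion
   of n, with a negative sign. Truncating the product at N gives
   F_{k,l}(s) = zeta(ks) prod_{n <= N} zeta(ns)^{b_n} P_N(s), with P_N an Euler product converging for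
   Re s > 1/(N+1): this is the continuation. A zero rho of zeta yields a candidate pole rho / n of high order -b_n.

   Zeros rho = b + i y x with b > 1/40 and x arbitrarily large exist for every y <> 0: otherwise zeta has no zeros
   near that height, hence by Borel-Caratheodory satisfies a Lindelof bound there, which contradicts the size of a
   binomially averaged twisted alternating zeta sum. Choose rho with no further zero on the ray beyond it, and n near
   x. In the order at rho / n the factors with n' > n do not contribute; those with n' <= n - K are negligible because
   b_{n'} is exponentially smaller; those with n - K < n' < n vanish at rho / n only for few n by Jensen's formula,
   and so do the local factors Q(p^{-rho/n}). Hence some n gives a pole close to i y. *)

Require Import Defs.
From mathcomp Require ssreflect ssrfun ssrbool eqtype ssrnat seq div prime choice fintype bigop ssralg ssrnum ssrint
  poly polydiv Rstruct complex.
From mathcomp.algebra_tactics Require ring.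
From Stdlib Require Import ZArith Reals Lra Lia Psatz List Classical ClassicalEpsilon FunctionalExtensionality.
From Stdlib Require FinFun.
From Coquelicot Require Import Coquelicot.
Open Scope R_scope.

(** * Complex analysis *)

(** Two obstacles shape the argument. Zeta enters through its continuation to Re s > 0 and a
    polynomial bound there, so its zeros are obtained indirectly, by exhibiting an average that is
    too large. The stationary point X = Y^4 of that average is chosen so that Y terms have nearly
    equal phase, while the weight has died out at distance Y^2/2 from X, before any phase passes
    pi/2. The second obstacle is cancellation: other zeros rho' may satisfy rho'/n' = rho/n, and
    such coincidences cannot be excluded one by one, so they are counted. With q about n^(1/4), a
    window of q^2 indices holds of order q^2 good exponents, while each of the q nearest competitors
    spoils only O(log n) indices. Competitors further away lose a factor r^q, which beats every
    power of n, and a window of length q^2 keeps rho/n within O(1/q) of i y. Exponents are kept as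
    differences of two natural sequences and the continuation as a quotient of two holomorphic
    functions, so that orders of vanishing are compared as natural numbers. *)

Definition ccont (f : C -> C) (z : C) : Prop :=
  forall eps, 0 < eps -> exists del, 0 < del /\
    forall w, Cmod (w - z) < del -> Cmod (f w - f z) < eps.

(** Caratheodory's form of the derivative: the slope [phi] is a function continuous at [z]. Product,
    chain and inverse rules become algebra on slopes. *)
Definition cderiv (f : C -> C) (z d : C) : Prop :=
  exists phi : C -> C, ccont phi z /\ phi z = d /\
    forall w, (f w = f z + phi w * (w - z))%C.

(** Continuity of the derivative is built in: it is what differentiation under the integral sign
    asks for in the proof of Cauchy's formula. Uniform limits recover this form because they again
    satisfy Cauchy's formula. *)
Definition hol (f : C -> C) (z : C) : Prop :=
  exists r (df : C -> C), 0 < r /\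
    forall w, Cmod (w - z) < r -> cderiv f w (df w) /\ ccont df w.

Lemma Cmod_minus_sym (a b : C) : Cmod (a - b) = Cmod (b - a).
Proof.
  replace (a - b)%C with (- (b - a))%C by ring. apply Cmod_opp.
Qed.

Lemma Cmod_tri_minus (a b c : C) : Cmod (a - c) <= Cmod (a - b) + Cmod (b - c).
Proof.
  replace (a - c)%C with ((a - b) + (b - c))%C by ring. apply Cmod_triangle.
Qed.

Lemma Cmod_tri_inv (a b : C) : Cmod a - Cmod b <= Cmod (a - b).
Proof.
  pose proof (Cmod_triangle (a - b) b) as H.
  replace (a - b + b)%C with a in H by ring. lra.
Qed.

Lemma Cmod_self (a : C) : Cmod (a - a) = 0.
Proof. replace (a - a)%C with (RtoC 0) by ring. apply Cmod_0. Qed.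

Lemma Cminus_0_eq (a b : C) : (a - b = 0)%C -> a = b.
Proof. intros H. replace a with (a - b + b)%C by ring. rewrite H. ring. Qed.

Lemma Cmod_RtoC_mult (a : R) (z : C) : Cmod (RtoC a * z) = Rabs a * Cmod z.
Proof. rewrite Cmod_mult, Cmod_R. reflexivity. Qed.

Lemma ccont_const (c z : C) : ccont (fun _ => c) z.
Proof. intros e He. exists 1. split; [lra|]. intros. rewrite Cmod_self. lra. Qed.

Lemma ccont_id (z : C) : ccont (fun w => w) z.
Proof. intros e He. exists e. split; auto. Qed.

Lemma ccont_plus (f g : C -> C) (z : C) :
  ccont f z -> ccont g z -> ccont (fun w => (f w + g w)%C) z.
Proof.
  intros Hf Hg e He.
  destruct (Hf (e/2)) as [d1 [D1 H1]]; [lra|]. destruct (Hg (e/2)) as [d2 [D2 H2]]; [lra|].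
  exists (Rmin d1 d2). split; [apply Rmin_pos; lra|]. intros w Hw.
  pose proof (Rmin_l d1 d2). pose proof (Rmin_r d1 d2).
  replace (f w + g w - (f z + g z))%C with ((f w - f z) + (g w - g z))%C by ring.
  eapply Rle_lt_trans; [apply Cmod_triangle|].
  specialize (H1 w ltac:(lra)). specialize (H2 w ltac:(lra)). lra.
Qed.

Lemma ccont_bounded (f : C -> C) (z : C) : ccont f z ->
  exists del M, 0 < del /\ 0 < M /\ forall w, Cmod (w - z) < del -> Cmod (f w) <= M.
Proof.
  intros H. destruct (H 1) as [d [D HH]]; [lra|].
  exists d, (Cmod (f z) + 1). split; auto. split; [pose proof (Cmod_ge_0 (f z)); lra|].
  intros w Hw. specialize (HH w Hw). pose proof (Cmod_tri_inv (f w) (f z)). lra.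
Qed.

Lemma ccont_mult (f g : C -> C) (z : C) :
  ccont f z -> ccont g z -> ccont (fun w => (f w * g w)%C) z.
Proof.
  intros Hf Hg e He.
  destruct (ccont_bounded f z Hf) as [d0 [M [D0 [HM HB]]]].
  pose proof (Cmod_ge_0 (g z)) as Hgz.
  destruct (Hf (e / 2 / (Cmod (g z) + 1))) as [d1 [D1 H1]].
  { apply Rdiv_lt_0_compat; lra. }
  destruct (Hg (e / 2 / M)) as [d2 [D2 H2]]. { apply Rdiv_lt_0_compat; lra. }
  exists (Rmin d0 (Rmin d1 d2)). split; [repeat apply Rmin_pos; lra|]. intros w Hw.
  pose proof (Rmin_l d0 (Rmin d1 d2)). pose proof (Rmin_r d0 (Rmin d1 d2)).
  pose proof (Rmin_l d1 d2). pose proof (Rmin_r d1 d2).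
  replace (f w * g w - f z * g z)%C with (f w * (g w - g z) + (f w - f z) * g z)%C by ring.
  eapply Rle_lt_trans; [apply Cmod_triangle|]. rewrite !Cmod_mult.
  specialize (H1 w ltac:(lra)). specialize (H2 w ltac:(lra)). specialize (HB w ltac:(lra)).
  assert (Cmod (f w) * Cmod (g w - g z) < e / 2).
  { apply Rle_lt_trans with (M * Cmod (g w - g z)).
    - apply Rmult_le_compat_r; auto. apply Cmod_ge_0.
    - apply Rlt_le_trans with (M * (e / 2 / M)); [apply Rmult_lt_compat_l; auto|].
      right; field; lra. }
  assert (Cmod (f w - f z) * Cmod (g z) <= e / 2).
  { apply Rle_trans with (e / 2 / (Cmod (g z) + 1) * (Cmod (g z) + 1)).
    - apply Rmult_le_compat; try apply Cmod_ge_0; lra.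
    - right; field; lra. }
  lra.
Qed.

Lemma ccont_ext_loc (f g : C -> C) (z : C) (r : R) : 0 < r ->
  (forall w, Cmod (w - z) < r -> f w = g w) -> ccont f z -> ccont g z.
Proof.
  intros Hr He Hf e E. destruct (Hf e E) as [d [D H]].
  exists (Rmin d r). split; [apply Rmin_pos; lra|]. intros w Hw.
  pose proof (Rmin_l d r). pose proof (Rmin_r d r).
  rewrite <- !He by (try rewrite Cmod_self; lra). apply H. lra.
Qed.

Lemma ccont_comp (f g : C -> C) (z : C) :
  ccont f z -> ccont g (f z) -> ccont (fun w => g (f w)) z.
Proof.
  intros Hf Hg e He. destruct (Hg e He) as [d [D H]]. destruct (Hf d D) as [d' [D' H']].
  exists d'. split; auto.
Qed.

Lemma ccont_neq0 (f : C -> C) (z : C) : ccont f z -> f z <> 0 ->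
  exists r, 0 < r /\ forall w, Cmod (w - z) < r -> Cmod (f z) / 2 < Cmod (f w).
Proof.
  intros Hf Hz. pose proof (proj1 (Cmod_gt_0 _) Hz) as P.
  destruct (Hf (Cmod (f z) / 2)) as [d [D H]]; [lra|].
  exists d. split; auto. intros w Hw. specialize (H w Hw).
  pose proof (Cmod_tri_inv (f z) (f w)) as T. rewrite Cmod_minus_sym in H. lra.
Qed.

Lemma ccont_inv (f : C -> C) (z : C) : ccont f z -> f z <> 0 ->
  ccont (fun w => (/ f w)%C) z.
Proof.
  intros Hf Hz e He. pose proof (proj1 (Cmod_gt_0 _) Hz) as P.
  destruct (ccont_neq0 f z Hf Hz) as [r [Hr HB]].
  destruct (Hf (e * (Cmod (f z) * Cmod (f z) / 2))) as [d [D H]].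
  { apply Rmult_lt_0_compat; auto. nra. }
  exists (Rmin d r). split; [apply Rmin_pos; lra|]. intros w Hw.
  pose proof (Rmin_l d r). pose proof (Rmin_r d r).
  specialize (HB w ltac:(lra)). specialize (H w ltac:(lra)).
  assert (Nw : f w <> 0). { intros E0. rewrite E0, Cmod_0 in HB. lra. }
  replace (/ f w - / f z)%C with ((f z - f w) / (f w * f z))%C by (field; auto).
  rewrite Cmod_div by (apply Cmult_neq_0; auto). rewrite Cmod_mult, Cmod_minus_sym.
  apply Rmult_lt_reg_r with (Cmod (f w) * Cmod (f z)). { nra. }
  unfold Rdiv. rewrite Rmult_assoc, Rinv_l, Rmult_1_r by nra.
  eapply Rlt_le_trans; [exact H|]. apply Rmult_le_compat_l; [lra|]. nra.
Qed.

Lemma ccont_pow (f : C -> C) (z : C) (n : nat) : ccont f z -> ccont (fun w => (f w ^ n)%C) z.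
Proof.
  intros Hf. induction n as [|n IH]; simpl; [apply ccont_const|].
  apply ccont_mult; auto.
Qed.

Lemma cderiv_ccont (f : C -> C) (z d : C) : cderiv f z d -> ccont f z.
Proof.
  intros [phi [Hc [_ He]]].
  apply ccont_ext_loc with (fun w => f z + phi w * (w + - z))%C 1; [lra| |].
  - intros w _. rewrite (He w). ring.
  - apply ccont_plus; [apply ccont_const|]. apply ccont_mult; auto.
    apply ccont_plus; [apply ccont_id|apply ccont_const].
Qed.

Lemma cderiv_const (c z : C) : cderiv (fun _ => c) z 0.
Proof. exists (fun _ => 0%C). split; [apply ccont_const|]. split; auto. intros; ring. Qed.

Lemma cderiv_id (z : C) : cderiv (fun w => w) z 1.
Proof. exists (fun _ => 1%C). split; [apply ccont_const|]. split; auto. intros; ring. Qed.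

Lemma cderiv_plus (f g : C -> C) (z a b : C) : cderiv f z a -> cderiv g z b ->
  cderiv (fun w => (f w + g w)%C) z (a + b).
Proof.
  intros [p [P1 [P2 P3]]] [q [Q1 [Q2 Q3]]].
  exists (fun w => (p w + q w)%C). split; [apply ccont_plus; auto|].
  split; [rewrite P2, Q2; auto|]. intros w. rewrite (P3 w), (Q3 w). ring.
Qed.

Lemma cderiv_mult (f g : C -> C) (z a b : C) : cderiv f z a -> cderiv g z b ->
  cderiv (fun w => (f w * g w)%C) z (a * g z + f z * b).
Proof.
  intros Hf Hg. pose proof (cderiv_ccont _ _ _ Hg) as Hgc.
  destruct Hf as [p [P1 [P2 P3]]]. destruct Hg as [q [Q1 [Q2 Q3]]].
  exists (fun w => (p w * g w + f z * q w)%C). split; [|split].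
  - apply ccont_plus; apply ccont_mult; auto. apply ccont_const.
  - rewrite P2, Q2. auto.
  - intros w. rewrite (P3 w), (Q3 w). ring.
Qed.

Lemma cderiv_comp (f g : C -> C) (z a b : C) : cderiv f z a -> cderiv g (f z) b ->
  cderiv (fun w => g (f w)) z (b * a).
Proof.
  intros Hf Hg. pose proof (cderiv_ccont _ _ _ Hf) as Hfc.
  destruct Hf as [p [P1 [P2 P3]]]. destruct Hg as [q [Q1 [Q2 Q3]]].
  exists (fun w => (q (f w) * p w)%C). split; [|split].
  - apply ccont_mult; auto. apply (ccont_comp f q z Hfc Q1).
  - rewrite P2, Q2. auto.
  - intros w. rewrite (Q3 (f w)). rewrite (P3 w) at 2. ring.
Qed.

(* Away from [z] the slope is forced, so a local identity upgrades to the global one demanded by [cderiv]. *)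
Lemma cderiv_local (f : C -> C) (z d : C) (phi : C -> C) (r : R) : 0 < r ->
  ccont phi z -> phi z = d ->
  (forall w, Cmod (w - z) < r -> (f w = f z + phi w * (w - z))%C) -> cderiv f z d.
Proof.
  intros Hr Hc Hz He.
  exists (fun w => if Rlt_dec (Cmod (w - z)) r then phi w else ((f w - f z) / (w - z))%C).
  split; [|split].
  - apply ccont_ext_loc with phi r; auto. intros w Hw. destruct (Rlt_dec _ _); tauto.
  - destruct (Rlt_dec _ _) as [|n]; auto. exfalso; apply n. rewrite Cmod_self; auto.
  - intros w. destruct (Rlt_dec _ _) as [l|n]; [auto|].
    field. intros E. apply n. rewrite E, Cmod_0. auto.
Qed.

Lemma cderiv_ext_loc (f g : C -> C) (z d : C) (r : R) : 0 < r ->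
  (forall w, Cmod (w - z) < r -> f w = g w) -> cderiv f z d -> cderiv g z d.
Proof.
  intros Hr He [p [P1 [P2 P3]]]. apply cderiv_local with p r; auto.
  intros w Hw. rewrite <- !He; auto. rewrite Cmod_self; auto.
Qed.

Lemma cderiv_inv (f : C -> C) (z a : C) : cderiv f z a -> f z <> 0 ->
  cderiv (fun w => (/ f w)%C) z (- a / (f z * f z)).
Proof.
  intros Hf Hz. pose proof (cderiv_ccont _ _ _ Hf) as Hfc.
  destruct (ccont_neq0 f z Hfc Hz) as [r [Hr HB]].
  destruct Hf as [p [P1 [P2 P3]]].
  apply cderiv_local with (fun w => (- (1) * p w * / (f w * f z))%C) r; auto.
  - apply ccont_mult.
    + apply ccont_mult; auto. apply ccont_const.
    + apply ccont_inv; [|apply Cmult_neq_0; auto]. apply ccont_mult; auto. apply ccont_const.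
  - rewrite P2. field; auto.
  - intros w Hw. specialize (HB w Hw).
    assert (Nw : f w <> 0).
    { intros E0. rewrite E0, Cmod_0 in HB. pose proof (Cmod_ge_0 (f z)). lra. }
    assert (E : (p w * (w - z) = f w - f z)%C). { rewrite (P3 w). ring. }
    replace (- (1) * p w * / (f w * f z) * (w - z))%C
      with (- (p w * (w - z)) / (f w * f z))%C by (field; auto).
    rewrite E. field; auto.
Qed.

Lemma cderiv_unique (f : C -> C) (z a b : C) : cderiv f z a -> cderiv f z b -> a = b.
Proof.
  intros [p [P1 [P2 P3]]] [q [Q1 [Q2 Q3]]].
  destruct (Ceq_dec a b) as [E|N]; auto. exfalso.
  assert (Hpos : 0 < Cmod (a - b)). { apply Cmod_gt_0. intros E. apply N, Cminus_0_eq, E. }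
  destruct (P1 (Cmod (a - b) / 2)) as [d1 [D1 H1]]; [lra|].
  destruct (Q1 (Cmod (a - b) / 2)) as [d2 [D2 H2]]; [lra|].
  set (d := Rmin d1 d2 / 2).
  assert (Hd : 0 < d). { unfold d. pose proof (Rmin_pos d1 d2 D1 D2). lra. }
  pose proof (Rmin_l d1 d2). pose proof (Rmin_r d1 d2).
  assert (Hw : Cmod (z + RtoC d - z) = d).
  { replace (z + RtoC d - z)%C with (RtoC d) by ring. rewrite Cmod_R, Rabs_pos_eq; lra. }
  assert (d < d1 /\ d < d2) as [L1 L2] by (unfold d; split; lra).
  specialize (H1 (z + RtoC d)%C ltac:(rewrite Hw; auto)).
  specialize (H2 (z + RtoC d)%C ltac:(rewrite Hw; auto)).
  assert (E : p (z + RtoC d)%C = q (z + RtoC d)%C).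
  { apply Cminus_0_eq.
    assert (E1 : ((p (z + RtoC d) - q (z + RtoC d)) * RtoC d = 0)%C).
    { pose proof (P3 (z + RtoC d)%C) as A. rewrite (Q3 (z + RtoC d)%C) in A.
      replace (z + RtoC d - z)%C with (RtoC d) in A by ring.
      replace ((p (z + RtoC d) - q (z + RtoC d)) * RtoC d)%C
        with ((f z + p (z + RtoC d) * RtoC d) - (f z + q (z + RtoC d) * RtoC d))%C by ring.
      rewrite <- A. ring. }
    assert (Nd : RtoC d <> 0). { intros E0. apply RtoC_inj in E0. lra. }
    apply (f_equal (fun x => (x * / RtoC d)%C)) in E1.
    rewrite Cmult_0_l in E1. rewrite <- E1. field; auto. }
  rewrite P2 in H1. rewrite Q2, <- E in H2.
  pose proof (Cmod_tri_minus a (p (z + RtoC d)%C) b) as T.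
  rewrite (Cmod_minus_sym a (p _)) in T. lra.
Qed.

Lemma hol_cderiv (f : C -> C) (z : C) : hol f z -> exists d, cderiv f z d.
Proof. intros [r [df [Hr H]]]. exists (df z). apply H. rewrite Cmod_self; auto. Qed.

Lemma hol_ccont (f : C -> C) (z : C) : hol f z -> ccont f z.
Proof. intros H. destruct (hol_cderiv f z H) as [d Hd]. apply (cderiv_ccont _ _ _ Hd). Qed.

Lemma hol_open (f : C -> C) (z : C) : hol f z ->
  exists r, 0 < r /\ forall w, Cmod (w - z) < r -> hol f w.
Proof.
  intros [r [df [Hr H]]]. exists r. split; auto. intros w Hw.
  exists (r - Cmod (w - z)), df. split; [lra|]. intros v Hv. apply H.
  pose proof (Cmod_tri_minus v w z). lra.
Qed.

Lemma hol_ext_loc (f g : C -> C) (z : C) (r : R) : 0 < r ->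
  (forall w, Cmod (w - z) < r -> f w = g w) -> hol f z -> hol g z.
Proof.
  intros Hr He [r' [df [Hr' H]]]. exists (Rmin r r'), df. split; [apply Rmin_pos; auto|].
  intros w Hw. pose proof (Rmin_l r r'). pose proof (Rmin_r r r').
  destruct (H w ltac:(lra)) as [A B]. split; auto.
  apply cderiv_ext_loc with f (r - Cmod (w - z)); auto; [lra|].
  intros v Hv. apply He. pose proof (Cmod_tri_minus v w z). lra.
Qed.

Lemma hol_const (c z : C) : hol (fun _ => c) z.
Proof.
  exists 1, (fun _ => 0%C). split; [lra|]. intros. split; [apply cderiv_const|apply ccont_const].
Qed.

Lemma hol_id (z : C) : hol (fun w => w) z.
Proof.
  exists 1, (fun _ => 1%C). split; [lra|]. intros. split; [apply cderiv_id|apply ccont_const].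
Qed.

Lemma hol_plus (f g : C -> C) (z : C) : hol f z -> hol g z -> hol (fun w => (f w + g w)%C) z.
Proof.
  intros [r [df [Hr H]]] [r' [dg [Hr' H']]].
  exists (Rmin r r'), (fun w => (df w + dg w)%C). split; [apply Rmin_pos; auto|].
  intros w Hw. pose proof (Rmin_l r r'). pose proof (Rmin_r r r').
  destruct (H w ltac:(lra)). destruct (H' w ltac:(lra)).
  split; [apply cderiv_plus|apply ccont_plus]; auto.
Qed.

Lemma hol_mult (f g : C -> C) (z : C) : hol f z -> hol g z -> hol (fun w => (f w * g w)%C) z.
Proof.
  intros [r [df [Hr H]]] [r' [dg [Hr' H']]].
  exists (Rmin r r'), (fun w => (df w * g w + f w * dg w)%C). split; [apply Rmin_pos; auto|].
  intros w Hw. pose proof (Rmin_l r r'). pose proof (Rmin_r r r').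
  destruct (H w ltac:(lra)) as [A B]. destruct (H' w ltac:(lra)) as [A' B'].
  split; [apply cderiv_mult; auto|].
  apply ccont_plus; apply ccont_mult; auto; eapply cderiv_ccont; eauto.
Qed.

Lemma hol_opp (f : C -> C) (z : C) : hol f z -> hol (fun w => (- f w)%C) z.
Proof.
  intros H. apply hol_ext_loc with (fun w => (- (1) * f w)%C) 1; [lra| |].
  - intros; ring.
  - apply hol_mult; auto. apply hol_const.
Qed.

Lemma hol_minus (f g : C -> C) (z : C) : hol f z -> hol g z -> hol (fun w => (f w - g w)%C) z.
Proof. intros. apply hol_plus; auto. apply hol_opp; auto. Qed.

Lemma hol_pow (f : C -> C) (z : C) (n : nat) : hol f z -> hol (fun w => (f w ^ n)%C) z.
Proof.
  intros Hf. induction n as [|n IH]; simpl; [apply hol_const|]. apply hol_mult; auto.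
Qed.

Lemma hol_inv (f : C -> C) (z : C) : hol f z -> f z <> 0 -> hol (fun w => (/ f w)%C) z.
Proof.
  intros Hf Hz. pose proof (hol_ccont _ _ Hf) as Hc.
  destruct (ccont_neq0 f z Hc Hz) as [r' [Hr' HB]].
  destruct Hf as [r [df [Hr H]]].
  exists (Rmin r r'), (fun w => (- (1) * df w * / (f w * f w))%C). split; [apply Rmin_pos; auto|].
  intros w Hw. pose proof (Rmin_l r r'). pose proof (Rmin_r r r').
  destruct (H w ltac:(lra)) as [A B]. specialize (HB w ltac:(lra)).
  assert (Nw : f w <> 0).
  { intros E0. rewrite E0, Cmod_0 in HB. pose proof (Cmod_ge_0 (f z)). lra. }
  pose proof (cderiv_ccont _ _ _ A). split.
  - replace (- (1) * df w * / (f w * f w))%C with (- df w / (f w * f w))%C by (field; auto).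
    apply cderiv_inv; auto.
  - apply ccont_mult; [apply ccont_mult; auto; apply ccont_const|].
    apply ccont_inv; [apply ccont_mult; auto|apply Cmult_neq_0; auto].
Qed.

Lemma hol_div (f g : C -> C) (z : C) : hol f z -> hol g z -> g z <> 0 ->
  hol (fun w => (f w / g w)%C) z.
Proof. intros. apply hol_mult; auto. apply hol_inv; auto. Qed.

Lemma hol_comp (f g : C -> C) (z : C) : hol f z -> hol g (f z) -> hol (fun w => g (f w)) z.
Proof.
  intros Hf [r' [dg [Hr' H']]]. pose proof (hol_ccont _ _ Hf) as Hc.
  destruct (Hc r' Hr') as [d [D Hd]]. destruct Hf as [r [df [Hr H]]].
  exists (Rmin r d), (fun w => (dg (f w) * df w)%C). split; [apply Rmin_pos; auto|].
  intros w Hw. pose proof (Rmin_l r d). pose proof (Rmin_r r d).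
  destruct (H w ltac:(lra)) as [A B]. destruct (H' (f w) ltac:(apply Hd; lra)) as [A' B'].
  split; [apply cderiv_comp; auto|]. apply ccont_mult; auto.
  apply (ccont_comp f dg); auto. eapply cderiv_ccont; eauto.
Qed.

(** [hol] supplies a derivative near each point separately; uniqueness of derivatives glues them
    into one function. *)
Lemma hol_global_deriv (f : C -> C) (U : C -> Prop) : (forall z, U z -> hol f z) ->
  exists df : C -> C, forall z, U z -> cderiv f z (df z) /\ ccont df z.
Proof.
  intros H.
  set (df := fun z => epsilon (inhabits (RtoC 0)) (fun d => cderiv f z d)).
  exists df. intros z Hz. destruct (H z Hz) as [r [g [Hr Hg]]].
  assert (E : forall w, Cmod (w - z) < r -> g w = df w).
  { intros w Hw. destruct (Hg w Hw) as [A _]. apply (cderiv_unique f w); auto.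
    unfold df. apply epsilon_spec. exists (g w); auto. }
  assert (Z0 : Cmod (z - z) < r) by (rewrite Cmod_self; auto).
  split.
  - rewrite <- E by auto. apply Hg; auto.
  - apply ccont_ext_loc with g r; auto. apply Hg; auto.
Qed.

(** * Complex-valued functions of a real variable *)

Definition rcat (g : R -> C) (t : R) : Prop :=
  forall eps, 0 < eps -> exists del, 0 < del /\
    forall t', Rabs (t' - t) < del -> Cmod (g t' - g t) < eps.

Definition rc (g : R -> C) : Prop := forall t, rcat g t.

Definition rderiv (g : R -> C) (t : R) (v : C) : Prop :=
  exists phi : R -> C, rcat phi t /\ phi t = v /\
    forall t', (g t' = g t + phi t' * RtoC (t' - t))%C.

Lemma im_le_Cmod (c : C) : Rabs (Im c) <= Cmod c.
Proof.
  eapply Rle_trans; [|apply Rmax_Cmod]. apply Rmax_r.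
Qed.

Lemma Cmod_le_re_im (c : C) : Cmod c <= Rabs (Re c) + Rabs (Im c).
Proof.
  destruct c as [a b]. change (Cmod (a, b) <= Rabs a + Rabs b).
  assert (E : (a, b) = (RtoC a + RtoC b * Ci)%C).
  { apply injective_projections; simpl; ring. }
  rewrite E. eapply Rle_trans; [apply Cmod_triangle|].
  rewrite Cmod_mult, !Cmod_R, Cmod_Ci, Rmult_1_r. apply Rle_refl.
Qed.

Lemma rcat_const (c : C) (t : R) : rcat (fun _ => c) t.
Proof. intros e He. exists 1. split; [lra|]. intros. rewrite Cmod_self. lra. Qed.

Lemma rcat_comp (f : C -> C) (g : R -> C) (t : R) :
  rcat g t -> ccont f (g t) -> rcat (fun u => f (g u)) t.
Proof.
  intros Hg Hf e He. destruct (Hf e He) as [d [D H]]. destruct (Hg d D) as [d' [D' H']].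
  exists d'. split; auto.
Qed.

Lemma rcat_plus (f g : R -> C) (t : R) :
  rcat f t -> rcat g t -> rcat (fun u => (f u + g u)%C) t.
Proof.
  intros Hf Hg e He.
  destruct (Hf (e/2)) as [d1 [D1 H1]]; [lra|]. destruct (Hg (e/2)) as [d2 [D2 H2]]; [lra|].
  exists (Rmin d1 d2). split; [apply Rmin_pos; lra|]. intros w Hw.
  pose proof (Rmin_l d1 d2). pose proof (Rmin_r d1 d2).
  replace (f w + g w - (f t + g t))%C with ((f w - f t) + (g w - g t))%C by ring.
  eapply Rle_lt_trans; [apply Cmod_triangle|].
  specialize (H1 w ltac:(lra)). specialize (H2 w ltac:(lra)). lra.
Qed.

Lemma rcat_mult (f g : R -> C) (t : R) :
  rcat f t -> rcat g t -> rcat (fun u => (f u * g u)%C) t.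
Proof.
  intros Hf Hg e He.
  pose proof (Cmod_ge_0 (g t)) as Hgt. pose proof (Cmod_ge_0 (f t)) as Hft.
  destruct (Hf 1) as [d0 [D0 H0]]; [lra|].
  destruct (Hf (e / 2 / (Cmod (g t) + 1))) as [d1 [D1 H1]]. { apply Rdiv_lt_0_compat; lra. }
  destruct (Hg (e / 2 / (Cmod (f t) + 1))) as [d2 [D2 H2]]. { apply Rdiv_lt_0_compat; lra. }
  exists (Rmin d0 (Rmin d1 d2)). split; [repeat apply Rmin_pos; lra|]. intros w Hw.
  pose proof (Rmin_l d0 (Rmin d1 d2)). pose proof (Rmin_r d0 (Rmin d1 d2)).
  pose proof (Rmin_l d1 d2). pose proof (Rmin_r d1 d2).
  replace (f w * g w - f t * g t)%C with (f w * (g w - g t) + (f w - f t) * g t)%C by ring.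
  eapply Rle_lt_trans; [apply Cmod_triangle|]. rewrite !Cmod_mult.
  specialize (H0 w ltac:(lra)). specialize (H1 w ltac:(lra)). specialize (H2 w ltac:(lra)).
  assert (Cmod (f w) <= Cmod (f t) + 1) by (pose proof (Cmod_tri_inv (f w) (f t)); lra).
  assert (Cmod (f w) * Cmod (g w - g t) <= e / 2 / (Cmod (f t) + 1) * (Cmod (f t) + 1)).
  { rewrite Rmult_comm. apply Rmult_le_compat; try apply Cmod_ge_0; lra. }
  assert (Cmod (f w - f t) * Cmod (g t) < e / 2 / (Cmod (g t) + 1) * (Cmod (g t) + 1)).
  { apply Rle_lt_trans with (e / 2 / (Cmod (g t) + 1) * Cmod (g t)).
    - apply Rmult_le_compat_r; lra.
    - apply Rmult_lt_compat_l; [|lra]. apply Rdiv_lt_0_compat; lra. }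
  replace (e / 2 / (Cmod (f t) + 1) * (Cmod (f t) + 1)) with (e / 2) in * by (field; lra).
  replace (e / 2 / (Cmod (g t) + 1) * (Cmod (g t) + 1)) with (e / 2) in * by (field; lra).
  lra.
Qed.

Lemma rcat_inv (f : R -> C) (t : R) : rcat f t -> f t <> 0 -> rcat (fun u => (/ f u)%C) t.
Proof.
  intros Hf Hn. apply (rcat_comp (fun z => / z)%C f); auto.
  apply (ccont_inv (fun z => z)); auto. apply ccont_id.
Qed.

Lemma rcat_pow (f : R -> C) (t : R) (n : nat) : rcat f t -> rcat (fun u => (f u ^ n)%C) t.
Proof.
  intros Hf. induction n as [|n IH]; simpl; [apply rcat_const|]. apply rcat_mult; auto.
Qed.

Lemma rcat_ext (f g : R -> C) (t : R) : (forall u, f u = g u) -> rcat f t -> rcat g t.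
Proof. intros H. replace g with f; auto. apply functional_extensionality; auto. Qed.

Lemma rderiv_rcat (g : R -> C) (t : R) (v : C) : rderiv g t v -> rcat g t.
Proof.
  intros [p [P1 [P2 P3]]].
  apply rcat_ext with (fun t' => g t + p t' * RtoC (t' - t))%C; [intros; rewrite <- P3; auto|].
  apply rcat_plus; [apply rcat_const|]. apply rcat_mult; auto.
  intros e He. exists e. split; auto. intros t' Ht.
  rewrite <- RtoC_minus, Cmod_R. replace (t' - t - (t - t)) with (t' - t) by ring. auto.
Qed.

Lemma rderiv_comp (f : C -> C) (g : R -> C) (t : R) (d v : C) :
  rderiv g t v -> cderiv f (g t) d -> rderiv (fun u => f (g u)) t (d * v).
Proof.
  intros Hg [q [Q1 [Q2 Q3]]]. pose proof (rderiv_rcat _ _ _ Hg) as Hc.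
  destruct Hg as [p [P1 [P2 P3]]].
  exists (fun u => (q (g u) * p u)%C). split; [|split].
  - apply rcat_mult; auto. apply (rcat_comp q g); auto.
  - rewrite P2, Q2; auto.
  - intros u. rewrite (Q3 (g u)). rewrite (P3 u) at 2. ring.
Qed.

Lemma rderiv_re_im (g : R -> C) (t : R) (v : C) : rderiv g t v ->
  is_derive (fun u => Re (g u)) t (Re v) /\ is_derive (fun u => Im (g u)) t (Im v).
Proof.
  intros [p [P1 [P2 P3]]].
  assert (E : forall h, h <> 0 -> ((Re (g (t + h)%R) - Re (g t)) / h = Re (p (t + h)%R) /\
     (Im (g (t + h)%R) - Im (g t)) / h = Im (p (t + h)%R))%R).
  { intros h Hh. rewrite (P3 (t + h)). replace (t + h - t) with h by ring.
    destruct (p (t + h)) as [a b]; destruct (g t) as [c d]. simpl.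
    split; field; auto. }
  split; apply is_derive_Reals; intros e He; destruct (P1 e He) as [d [D H]];
  exists (mkposreal d D); intros h Hh Hd; simpl in Hd.
  - rewrite (proj1 (E h Hh)). rewrite <- P2.
    eapply Rle_lt_trans; [|apply (H (t + h))].
    + replace (Re (p (t + h)) - Re (p t)) with (Re (p (t + h)%R - p t)%C) by reflexivity.
      apply re_le_Cmod.
    + replace (t + h - t) with h by ring. auto.
  - rewrite (proj2 (E h Hh)). rewrite <- P2.
    eapply Rle_lt_trans; [|apply (H (t + h))].
    + replace (Im (p (t + h)) - Im (p t)) with (Im (p (t + h)%R - p t)%C) by reflexivity.
      apply im_le_Cmod.
    + replace (t + h - t) with h by ring. auto.
Qed.

Lemma rderiv_of_re_im (a b : R -> R) (t da db : R) :
  is_derive a t da -> is_derive b t db -> rderiv (fun u => (a u, b u)) t (da, db).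
Proof.
  intros Ha Hb. apply is_derive_Reals in Ha. apply is_derive_Reals in Hb.
  exists (fun u => if Req_EM_T u t then (da, db)
     else ((a u - a t) / (u - t), (b u - b t) / (u - t))%R).
  split; [|split].
  - intros e He. destruct (Ha (e / 2)) as [d1 H1]; [lra|]. destruct (Hb (e / 2)) as [d2 H2]; [lra|].
    exists (Rmin d1 d2). split; [apply Rmin_pos; apply cond_pos|]. intros u Hu.
    pose proof (Rmin_l d1 d2). pose proof (Rmin_r d1 d2).
    destruct (Req_EM_T t t) as [_|n]; [|tauto].
    destruct (Req_EM_T u t) as [->|n]; [rewrite Cmod_self; lra|].
    eapply Rle_lt_trans; [apply Cmod_le_re_im|]. simpl.
    specialize (H1 (u - t) ltac:(lra) ltac:(lra)). specialize (H2 (u - t) ltac:(lra) ltac:(lra)).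
    replace (t + (u - t)) with u in * by ring. unfold Rminus in *. lra.
  - destruct (Req_EM_T t t); tauto.
  - intros u. destruct (Req_EM_T u t) as [->|n].
    + replace (t - t) with 0 by ring. apply injective_projections; simpl; ring.
    + apply injective_projections; simpl; field; lra.
Qed.

Lemma rderiv_affine (A B : C) (t : R) : rderiv (fun u => (A + RtoC u * B)%C) t B.
Proof.
  exists (fun _ => B). split; [apply rcat_const|]. split; auto. intros u. rewrite RtoC_minus. ring.
Qed.

Definition cis (t : R) : C := (cos t, sin t).

Lemma cis_mod (t : R) : Cmod (cis t) = 1.
Proof.
  unfold Cmod, cis; simpl. replace (cos t * (cos t * 1) + sin t * (sin t * 1)) with 1.
  - apply sqrt_1.
  - pose proof (sin2_cos2 t) as H. unfold Rsqr in H. lra.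
Qed.

Lemma cis_neq0 (t : R) : cis t <> 0.
Proof. apply Cmod_gt_0. rewrite cis_mod; lra. Qed.

Lemma cis_plus (a b : R) : cis (a + b) = (cis a * cis b)%C.
Proof.
  unfold cis. rewrite cos_plus, sin_plus. apply injective_projections; simpl; ring.
Qed.

Lemma cis_0 : cis 0 = 1.
Proof. unfold cis. rewrite cos_0, sin_0. reflexivity. Qed.

Lemma cis_opp (t : R) : (cis (- t) = / cis t)%C.
Proof.
  pose proof (cis_plus (- t) t) as H. rewrite Rplus_opp_l, cis_0 in H.
  replace (cis (- t)) with (cis (- t) * cis t * / cis t)%C by (field; apply cis_neq0).
  rewrite <- H. ring.
Qed.

Lemma cis_pow (t : R) (n : nat) : (cis t ^ n)%C = cis (INR n * t).
Proof.
  induction n as [|n IH]; simpl Cpow.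
  - simpl. rewrite Rmult_0_l, cis_0; auto.
  - rewrite IH, <- cis_plus, S_INR. f_equal. ring.
Qed.

Lemma cis_2PI : cis (2 * PI) = 1.
Proof. unfold cis. rewrite cos_2PI, sin_2PI. reflexivity. Qed.

Lemma rderiv_cis (t : R) : rderiv cis t (Ci * cis t).
Proof.
  replace (Ci * cis t)%C with (- sin t, cos t)%R
    by (apply injective_projections; simpl; ring).
  apply (rderiv_of_re_im cos sin).
  - apply is_derive_Reals. apply derivable_pt_lim_cos.
  - apply is_derive_Reals. apply derivable_pt_lim_sin.
Qed.

Lemma rc_cis : rc cis.
Proof. intros t. eapply rderiv_rcat, rderiv_cis. Qed.

Lemma rc_continuous_re (g : R -> C) (t : R) : rcat g t -> continuous (fun u => Re (g u)) t.
Proof.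
  intros H. apply continuity_pt_filterlim. intros e He. destruct (H e He) as [d [D HH]].
  exists d. split; auto. intros x [_ Hx]. simpl in *. unfold R_dist in *.
  eapply Rle_lt_trans; [|apply (HH x Hx)].
  replace (Re (g x) - Re (g t)) with (Re (g x - g t)%C) by reflexivity. apply re_le_Cmod.
Qed.

Lemma rc_continuous_im (g : R -> C) (t : R) : rcat g t -> continuous (fun u => Im (g u)) t.
Proof.
  intros H. apply continuity_pt_filterlim. intros e He. destruct (H e He) as [d [D HH]].
  exists d. split; auto. intros x [_ Hx]. simpl in *. unfold R_dist in *.
  eapply Rle_lt_trans; [|apply (HH x Hx)].
  replace (Im (g x) - Im (g t)) with (Im (g x - g t)%C) by reflexivity. apply im_le_Cmod.
Qed.

(** * Integrals over one period *)

Definition CI (g : R -> C) : C :=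
  (RInt (fun t => Re (g t)) 0 (2 * PI), RInt (fun t => Im (g t)) 0 (2 * PI)).

Lemma ex_RInt_re (g : R -> C) (a b : R) : rc g -> ex_RInt (fun t => Re (g t)) a b.
Proof. intros H. apply (ex_RInt_continuous (V := R_CompleteNormedModule)). intros t _. apply rc_continuous_re, H. Qed.

Lemma ex_RInt_im (g : R -> C) (a b : R) : rc g -> ex_RInt (fun t => Im (g t)) a b.
Proof. intros H. apply (ex_RInt_continuous (V := R_CompleteNormedModule)). intros t _. apply rc_continuous_im, H. Qed.

Lemma CI_ext (f g : R -> C) : (forall t, f t = g t) -> CI f = CI g.
Proof. intros H. replace g with f; auto. apply functional_extensionality; auto. Qed.

Lemma CI_plus (f g : R -> C) : rc f -> rc g -> (CI (fun t => f t + g t) = CI f + CI g)%C.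
Proof.
  intros Hf Hg. unfold CI. apply injective_projections.
  - apply (RInt_plus (V := R_CompleteNormedModule)); apply ex_RInt_re; auto.
  - apply (RInt_plus (V := R_CompleteNormedModule)); apply ex_RInt_im; auto.
Qed.

Lemma CI_scal (k : C) (g : R -> C) : rc g -> (CI (fun t => k * g t) = k * CI g)%C.
Proof.
  intros Hg. unfold CI. destruct k as [a b].
  assert (E1 := ex_RInt_re g 0 (2 * PI) Hg). assert (E2 := ex_RInt_im g 0 (2 * PI) Hg).
  pose proof (fun c => RInt_scal (V := R_CompleteNormedModule) _ _ _ c E1) as S1.
  pose proof (fun c => RInt_scal (V := R_CompleteNormedModule) _ _ _ c E2) as S2.
  pose proof (fun c => ex_RInt_scal (V := R_NormedModule) _ _ _ c E1) as X1.
  pose proof (fun c => ex_RInt_scal (V := R_NormedModule) _ _ _ c E2) as X2.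
  apply injective_projections.
  - etransitivity; [apply (RInt_minus (V := R_CompleteNormedModule) _ _ _ _ (X1 a) (X2 b))|].
    rewrite S1, S2. reflexivity.
  - etransitivity; [apply (RInt_plus (V := R_CompleteNormedModule) _ _ _ _ (X2 a) (X1 b))|].
    rewrite S1, S2. reflexivity.
Qed.

Lemma CI_minus (f g : R -> C) : rc f -> rc g -> (CI (fun t => f t - g t) = CI f - CI g)%C.
Proof.
  intros Hf Hg.
  rewrite (CI_ext _ (fun t => f t + (- (1)) * g t)%C) by (intros; ring).
  rewrite CI_plus, CI_scal; auto; [ring|].
  intros t. apply rcat_mult; [apply rcat_const|apply Hg].
Qed.

Lemma CI_const (k : C) : (CI (fun _ => k) = 2 * PI * k)%C.
Proof.
  unfold CI. rewrite !RInt_const. destruct k as [a b].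
  apply injective_projections; simpl; unfold scal; simpl; unfold mult; simpl; ring.
Qed.

(** A unit factor [k] rotates the integral to a nonnegative real, so only a real integral is
    estimated and no constant is lost to splitting into components. *)
Lemma CI_bound (g : R -> C) (M : R) : rc g -> (forall t, Cmod (g t) <= M) ->
  Cmod (CI g) <= 2 * PI * M.
Proof.
  intros Hg HM. pose proof PI_RGT_0 as HPI.
  assert (M0 : 0 <= M). { eapply Rle_trans; [apply Cmod_ge_0|apply (HM 0)]. }
  destruct (Ceq_dec (CI g) 0) as [E|N].
  { rewrite E, Cmod_0. nra. }
  pose proof (proj1 (Cmod_gt_0 _) N) as P.
  set (k := (Cconj (CI g) / RtoC (Cmod (CI g)))%C).
  assert (Nm : RtoC (Cmod (CI g)) <> 0). { intros E. apply RtoC_inj in E. lra. }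
  assert (Hk : Cmod k = 1).
  { unfold k. rewrite Cmod_div by auto. rewrite Cmod_conj, Cmod_R, Rabs_pos_eq by lra.
    field; lra. }
  assert (HE : (k * CI g)%C = RtoC (Cmod (CI g))).
  { unfold k. replace (Cconj (CI g) / RtoC (Cmod (CI g)) * CI g)%C
      with ((CI g * Cconj (CI g)) / RtoC (Cmod (CI g)))%C by (field; auto).
    rewrite <- Cmod2_conj, RtoC_pow. field; auto. }
  rewrite <- CI_scal in HE by auto.
  assert (Hrc : rc (fun t => k * g t)%C).
  { intros t. apply rcat_mult; [apply rcat_const|apply Hg]. }
  apply (f_equal Re) in HE.
  change (RInt (fun t => Re (k * g t)%C) 0 (2 * PI) = Cmod (CI g)) in HE. rewrite <- HE.
  apply Rle_trans with (RInt (fun _ => M) 0 (2 * PI)).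
  - apply RInt_le; [lra|apply (ex_RInt_re _ 0 (2 * PI) Hrc)| |].
    + apply ex_RInt_const.
    + intros t _. eapply Rle_trans; [apply Rle_abs|]. eapply Rle_trans; [apply re_le_Cmod|].
      rewrite Cmod_mult, Hk, Rmult_1_l. apply HM.
  - rewrite RInt_const. unfold scal; simpl; unfold mult; simpl. lra.
Qed.

Lemma CI_derive (g dg : R -> C) : rc dg -> (forall t, rderiv g t (dg t)) ->
  CI dg = (g (2 * PI)%R - g 0)%C.
Proof.
  intros Hc Hd. unfold CI. apply injective_projections; simpl.
  - apply (is_RInt_unique (V := R_CompleteNormedModule)).
    apply (is_RInt_derive (V := R_CompleteNormedModule) (fun t => Re (g t))).
    + intros t _. apply (rderiv_re_im g t (dg t)); auto.
    + intros t _. apply rc_continuous_re, Hc.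
  - apply (is_RInt_unique (V := R_CompleteNormedModule)).
    apply (is_RInt_derive (V := R_CompleteNormedModule) (fun t => Im (g t))).
    + intros t _. apply (rderiv_re_im g t (dg t)); auto.
    + intros t _. apply rc_continuous_im, Hc.
Qed.

(** Joint continuity, the condition for differentiating an integral with respect to a parameter. *)
Definition c2at (g : R -> R -> C) (x y : R) : Prop :=
  forall eps, 0 < eps -> exists del, 0 < del /\
    forall u v, Rabs (u - x) < del -> Rabs (v - y) < del -> Cmod (g u v - g x y) < eps.

Lemma c2at_fst (f : R -> C) (x y : R) : rcat f x -> c2at (fun u _ => f u) x y.
Proof. intros H e He. destruct (H e He) as [d [D HH]]. exists d. split; auto. Qed.

Lemma c2at_snd (f : R -> C) (x y : R) : rcat f y -> c2at (fun _ v => f v) x y.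
Proof. intros H e He. destruct (H e He) as [d [D HH]]. exists d. split; auto. Qed.

Lemma c2at_comp (f : C -> C) (g : R -> R -> C) (x y : R) :
  c2at g x y -> ccont f (g x y) -> c2at (fun u v => f (g u v)) x y.
Proof.
  intros Hg Hf e He. destruct (Hf e He) as [d [D H]]. destruct (Hg d D) as [d' [D' H']].
  exists d'. split; auto.
Qed.

Lemma c2at_plus (f g : R -> R -> C) (x y : R) :
  c2at f x y -> c2at g x y -> c2at (fun u v => (f u v + g u v)%C) x y.
Proof.
  intros Hf Hg e He.
  destruct (Hf (e/2)) as [d1 [D1 H1]]; [lra|]. destruct (Hg (e/2)) as [d2 [D2 H2]]; [lra|].
  exists (Rmin d1 d2). split; [apply Rmin_pos; lra|]. intros u v Hu Hv.
  pose proof (Rmin_l d1 d2). pose proof (Rmin_r d1 d2).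
  replace (f u v + g u v - (f x y + g x y))%C with ((f u v - f x y) + (g u v - g x y))%C by ring.
  eapply Rle_lt_trans; [apply Cmod_triangle|].
  specialize (H1 u v ltac:(lra) ltac:(lra)). specialize (H2 u v ltac:(lra) ltac:(lra)). lra.
Qed.

Lemma c2at_mult (f g : R -> R -> C) (x y : R) :
  c2at f x y -> c2at g x y -> c2at (fun u v => (f u v * g u v)%C) x y.
Proof.
  intros Hf Hg e He.
  pose proof (Cmod_ge_0 (g x y)) as Hgt. pose proof (Cmod_ge_0 (f x y)) as Hft.
  destruct (Hf 1) as [d0 [D0 H0]]; [lra|].
  destruct (Hf (e / 2 / (Cmod (g x y) + 1))) as [d1 [D1 H1]]. { apply Rdiv_lt_0_compat; lra. }
  destruct (Hg (e / 2 / (Cmod (f x y) + 1))) as [d2 [D2 H2]]. { apply Rdiv_lt_0_compat; lra. }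
  exists (Rmin d0 (Rmin d1 d2)). split; [repeat apply Rmin_pos; lra|]. intros u v Hu Hv.
  pose proof (Rmin_l d0 (Rmin d1 d2)). pose proof (Rmin_r d0 (Rmin d1 d2)).
  pose proof (Rmin_l d1 d2). pose proof (Rmin_r d1 d2).
  replace (f u v * g u v - f x y * g x y)%C
    with (f u v * (g u v - g x y) + (f u v - f x y) * g x y)%C by ring.
  eapply Rle_lt_trans; [apply Cmod_triangle|]. rewrite !Cmod_mult.
  specialize (H0 u v ltac:(lra) ltac:(lra)). specialize (H1 u v ltac:(lra) ltac:(lra)).
  specialize (H2 u v ltac:(lra) ltac:(lra)).
  assert (Cmod (f u v) <= Cmod (f x y) + 1) by (pose proof (Cmod_tri_inv (f u v) (f x y)); lra).
  assert (Cmod (f u v) * Cmod (g u v - g x y) <= e / 2 / (Cmod (f x y) + 1) * (Cmod (f x y) + 1)).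
  { rewrite Rmult_comm. apply Rmult_le_compat; try apply Cmod_ge_0; lra. }
  assert (Cmod (f u v - f x y) * Cmod (g x y) < e / 2 / (Cmod (g x y) + 1) * (Cmod (g x y) + 1)).
  { apply Rle_lt_trans with (e / 2 / (Cmod (g x y) + 1) * Cmod (g x y)).
    - apply Rmult_le_compat_r; lra.
    - apply Rmult_lt_compat_l; [|lra]. apply Rdiv_lt_0_compat; lra. }
  replace (e / 2 / (Cmod (f x y) + 1) * (Cmod (f x y) + 1)) with (e / 2) in * by (field; lra).
  replace (e / 2 / (Cmod (g x y) + 1) * (Cmod (g x y) + 1)) with (e / 2) in * by (field; lra).
  lra.
Qed.

Lemma rcat_RtoC (x : R) : rcat RtoC x.
Proof. intros e He. exists e. split; auto. intros. rewrite <- RtoC_minus, Cmod_R. auto. Qed.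

Lemma c2at_continuity_2d (g : R -> R -> C) (x y : R) :
  c2at g x y -> continuity_2d_pt (fun u v => Re (g u v)) x y.
Proof.
  intros H e. destruct (H e (cond_pos e)) as [d [D HH]]. exists (mkposreal d D).
  intros u v Hu Hv. eapply Rle_lt_trans; [|apply (HH u v Hu Hv)].
  replace (Re (g u v) - Re (g x y)) with (Re (g u v - g x y)%C) by reflexivity. apply re_le_Cmod.
Qed.

Lemma CI_re (k : C) (g : R -> C) : rc g ->
  RInt (fun t => Re (k * g t)%C) 0 (2 * PI) = Re (k * CI g)%C.
Proof. intros H. rewrite <- CI_scal by auto. reflexivity. Qed.

(** Testing against every multiplier [k] turns a complex identity into real ones, so that parametric
    integrals need only be differentiated for real integrands. *)
Lemma C_eq_by_re (a b : C) : (forall k, Re (k * a)%C = Re (k * b)%C) -> a = b.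
Proof.
  intros H. pose proof (H 1%C) as H1. pose proof (H (- Ci)%C) as H2.
  destruct a as [a1 a2]. destruct b as [b1 b2]. simpl in *.
  apply injective_projections; simpl; lra.
Qed.

(** * Cauchy's formula and Taylor expansions *)

Lemma circ_sub_mod (z w : C) (r : R) : Cmod z = r -> r - Cmod w <= Cmod (z - w).
Proof. intros H1. pose proof (Cmod_tri_inv z w). lra. Qed.

Lemma circ_mod (r t : R) : 0 < r -> Cmod (RtoC r * cis t) = r.
Proof. intros H. rewrite Cmod_mult, cis_mod, Cmod_R, Rabs_pos_eq; lra. Qed.

Lemma circ_sub_neq0 (r t : R) (w : C) : Cmod w < r -> (RtoC r * cis t - w)%C <> 0.
Proof.
  intros H. pose proof (Cmod_ge_0 w). apply Cmod_gt_0.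
  pose proof (circ_sub_mod _ w r (circ_mod r t ltac:(lra))). lra.
Qed.

Lemma rc_circ (r : R) : rc (fun t => RtoC r * cis t)%C.
Proof. intros t. apply rcat_mult; [apply rcat_const|apply rc_cis]. Qed.

Lemma rc_circ_sub_inv (r : R) (w : C) : Cmod w < r -> rc (fun t => / (RtoC r * cis t - w))%C.
Proof.
  intros H t. apply rcat_inv; [|apply circ_sub_neq0; auto].
  apply (rcat_plus _ (fun _ => (- w)%C)); [apply rc_circ|apply rcat_const].
Qed.

(** Up to the factor [l * Ci], the integrand is the [t]-derivative of [f] along a closed curve. At
    [l = 0] that factor vanishes, but then [df] is evaluated at a fixed point and [cis] itself has
    mean zero. *)
Lemma CI_zero_path (f df : C -> C) (c w : C) (r l : R) : 0 < r ->
  (forall t, cderiv f (c + w + l * (r * cis t - w))%C (df (c + w + l * (r * cis t - w))%C)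
     /\ ccont df (c + w + l * (r * cis t - w))%C) ->
  CI (fun t => df (c + w + l * (r * cis t - w)) * (r * cis t))%C = 0.
Proof.
  intros Hr Hd.
  assert (Rg : rc (fun t => c + w + l * (r * cis t - w))%C).
  { intros t. apply rcat_plus; [apply rcat_const|]. apply rcat_mult; [apply rcat_const|].
    apply (rcat_plus _ (fun _ => (- w)%C)); [apply rc_circ|apply rcat_const]. }
  assert (Rh : rc (fun t => df (c + w + l * (r * cis t - w)) * (r * cis t))%C).
  { intros t. apply rcat_mult; [|apply rc_circ]. apply (rcat_comp df); [apply Rg|apply Hd]. }
  destruct (Req_dec l 0) as [->|Nl].
  - rewrite (CI_ext _ (fun t => (df (c + w) * r * (- Ci)) * (Ci * cis t))%C).
    + rewrite CI_scal.
      * rewrite (CI_derive cis); [|intros t; apply rcat_mult; [apply rcat_const|apply rc_cis]|apply rderiv_cis].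
        rewrite cis_2PI, cis_0. ring.
      * intros t; apply rcat_mult; [apply rcat_const|apply rc_cis].
    + intros t. replace (c + w + 0 * (r * cis t - w))%C with (c + w)%C by ring.
      replace (df (c + w) * r * - Ci * (Ci * cis t))%C
        with (- (Ci * Ci) * (df (c + w) * r * cis t))%C by ring.
      replace (Ci * Ci)%C with (- (1))%C by (apply injective_projections; simpl; ring). ring.
  - assert (E : CI (fun t => (l * Ci) * (df (c + w + l * (r * cis t - w)) * (r * cis t)))%C = 0).
    { rewrite (CI_derive (fun t => f (c + w + l * (r * cis t - w))%C)).
      - rewrite cis_2PI, cis_0. ring.
      - intros t. apply rcat_mult; [apply rcat_const|apply Rh].
      - intros t.
        replace (l * Ci * (df (c + w + l * (r * cis t - w)) * (r * cis t)))%C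
          with (df (c + w + l * (r * cis t - w)) * (l * r * (Ci * cis t)))%C by ring.
        apply (rderiv_comp f (fun t => c + w + l * (r * cis t - w))%C); [|apply Hd].
        apply (rderiv_comp (fun z => c + w + l * (r * z - w))%C cis t); [apply rderiv_cis|].
        exists (fun _ => (l * r)%C). split; [apply ccont_const|]. split; auto. intros; ring. }
    rewrite CI_scal in E by auto.
    assert (N : (l * Ci)%C <> 0).
    { apply Cmult_neq_0; [intros E0; apply RtoC_inj in E0; auto|]. intros E0.
      apply (f_equal Im) in E0. simpl in E0. lra. }
    apply (f_equal (fun x => / (l * Ci) * x)%C) in E. rewrite Cmult_0_r in E. rewrite <- E.
    field. split; auto; intros E0; apply N; rewrite E0; ring.
Qed.

(* Deforming the circle [c + r e^{it}] radially onto the point [c + w]: the integral does not depend on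
   the deformation variable [l], and at [l = 0] the integrand is constant in [f]. *)
Lemma cauchy_deform (f : C -> C) (c w : C) (r r' : R) : 0 < r < r' -> Cmod w < r ->
  (forall z, Cmod (z - c) < r' -> hol f z) ->
  CI (fun t => f (c + r * cis t) * (r * cis t * / (r * cis t - w)))%C
  = CI (fun t => f (c + w) * (r * cis t * / (r * cis t - w)))%C.
Proof.
  intros [Hr Hr'] Hw Hf.
  destruct (hol_global_deriv f (fun z => Cmod (z - c) < r')%R Hf) as [df Hdf].
  set (d := (r' - r) / (4 * r)).
  assert (Hd : 0 < d). { unfold d. apply Rdiv_lt_0_compat; lra. }
  pose proof (Cmod_ge_0 w) as Hw0.
  assert (In : forall l t, - d < l < 1 + d -> Cmod (c + w + l * (r * cis t - w) - c) < r').
  { intros l t Hl. replace (c + w + l * (r * cis t - w) - c)%C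
      with ((RtoC (1 - l)) * w + l * (r * cis t))%C by (rewrite RtoC_minus; ring).
    eapply Rle_lt_trans; [apply Cmod_triangle|].
    rewrite (Cmod_mult (RtoC l)), circ_mod, Cmod_mult, !Cmod_R by auto.
    assert (E4 : 4 * (d * r) = r' - r) by (unfold d; field; lra).
    assert (P1 : Rabs (1 - l) * Cmod w <= Rabs (1 - l) * r).
    { apply Rmult_le_compat_l; [apply Rabs_pos|lra]. }
    assert (Rabs (1 - l) + Rabs l <= 1 + 2 * d).
    { unfold Rabs. destruct (Rcase_abs (1 - l)), (Rcase_abs l); lra. }
    apply Rle_lt_trans with ((Rabs (1 - l) + Rabs l) * r); [lra|].
    apply Rle_lt_trans with ((1 + 2 * d) * r); [apply Rmult_le_compat_r; lra|].
    nra. }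
  set (K := fun t => (r * cis t * / (r * cis t - w))%C).
  assert (RK : rc K).
  { intros t. apply rcat_mult; [apply rc_circ|apply rc_circ_sub_inv; auto]. }
  assert (Rg : forall l, rc (fun t => c + w + l * (r * cis t - w))%C).
  { intros l t. apply rcat_plus; [apply rcat_const|]. apply rcat_mult; [apply rcat_const|].
    apply (rcat_plus _ (fun _ => (- w)%C)); [apply rc_circ|apply rcat_const]. }
  assert (RF : forall l, - d < l < 1 + d -> rc (fun t => f (c + w + l * (r * cis t - w)) * K t)%C).
  { intros l Hl t. apply rcat_mult; [|apply RK]. apply (rcat_comp f); [apply Rg|].
    apply hol_ccont, Hf, In; auto. }
  apply C_eq_by_re. intros k.
  set (phi := fun l t : R => Re (k * (f (c + w + l * (r * cis t - w)) * K t))%C).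
  (* The factor [r cis t - w] produced by the chain rule cancels the denominator of the kernel; what
     is left is the integrand of [CI_zero_path]. *)
  assert (Dphi : forall l t, - d < l < 1 + d ->
    is_derive (fun u => phi u t) l (Re (k * (df (c + w + l * (r * cis t - w)) * (r * cis t)))%C)).
  { intros l t Hl. unfold phi.
    apply (rderiv_re_im (fun u => k * (f (c + w + u * (r * cis t - w)) * K t))%C l
      (k * (df (c + w + l * (r * cis t - w)) * (r * cis t)))%C).
    replace (k * (df (c + w + l * (r * cis t - w)) * (r * cis t)))%C
      with ((k * K t * df (c + w + l * (r * cis t - w))) * (r * cis t - w))%C.
    2:{ unfold K. field. apply circ_sub_neq0; auto. }
    apply (rderiv_comp (fun z => k * (f z * K t))%C (fun u => c + w + u * (r * cis t - w))%C l).
    - apply rderiv_affine.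
    - destruct (Hdf _ (In l t Hl)) as [A _].
      pose proof (cderiv_mult _ _ _ _ _ (cderiv_const (k * K t) (c + w + l * (r * cis t - w))%C) A) as B.
      simpl in B. rewrite Cmult_0_l, Cplus_0_l in B.
      apply cderiv_ext_loc with (fun z => k * K t * f z)%C 1; auto; [lra|]. intros; ring. }
  assert (Loc : forall l, - d < l < 1 + d -> exists e : posreal, forall u, Rabs (u - l) < e -> - d < u < 1 + d).
  { intros l Hl. assert (P : 0 < Rmin (l + d) (1 + d - l)) by (apply Rmin_pos; lra).
    exists (mkposreal _ P). simpl. intros u Hu.
    pose proof (Rmin_l (l + d) (1 + d - l)). pose proof (Rmin_r (l + d) (1 + d - l)).
    apply Rabs_def2 in Hu. lra. }
  assert (Main : forall l, 0 <= l <= 1 ->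
    is_derive (fun l => RInt (fun t => phi l t) 0 (2 * PI)) l zero).
  { intros l Hl. assert (Hl' : - d < l < 1 + d) by lra.
    destruct (Loc l Hl') as [e He].
    assert (E0 : RInt (fun t => Derive (fun u => phi u t) l) 0 (2 * PI) = 0);
      [|refine (eq_ind _ (fun v : R =>
        is_derive (fun l0 => RInt (fun t => phi l0 t) 0 (2 * PI)) l v) _ _ E0)].
    2:{ apply (is_derive_RInt_param phi 0 (2 * PI) l).
      + exists e. intros u Hu t _. eexists. apply Dphi. apply He, Hu.
      + intros t _.
        apply continuity_2d_pt_ext_loc with
          (fun u v => Re (k * (df (c + w + u * (r * cis v - w)) * (r * cis v)))%C).
        * exists e. intros u v Hu Hv. symmetry. apply is_derive_unique. apply Dphi. auto.
        * apply c2at_continuity_2d.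
          assert (C0 : c2at (fun u v => r * cis v)%C l t).
          { apply (c2at_snd (fun v => r * cis v)%C). apply rc_circ. }
          apply c2at_mult; [apply (c2at_snd (fun _ => k)); apply rcat_const|].
          apply c2at_mult; auto.
          apply (c2at_comp df); [|apply Hdf, In; auto].
          apply c2at_plus; [apply (c2at_snd (fun _ => (c + w)%C)); apply rcat_const|].
          apply c2at_mult; [apply (c2at_fst RtoC), rcat_RtoC|].
          apply (c2at_plus _ (fun _ _ => (- w)%C)); auto.
          apply (c2at_snd (fun _ => (- w)%C)); apply rcat_const.
      + exists e. intros u Hu. unfold phi.
        apply (ex_RInt_re (fun t => k * (f (c + w + u * (r * cis t - w)) * K t))%C).
        intros t. apply rcat_mult; [apply rcat_const|]. apply RF. apply He, Hu. }
    - rewrite (RInt_ext _ (fun t => Re (k * (df (c + w + l * (r * cis t - w)) * (r * cis t)))%C)).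
      + rewrite (CI_re k (fun t => df (c + w + l * (r * cis t - w)) * (r * cis t))%C).
        * assert (Z0 : forall t, Cmod (c + w + l * (r * cis t - w) - c) < r') by auto.
          rewrite (CI_zero_path f df c w r l Hr (fun t => Hdf _ (Z0 t))).
          rewrite Cmult_0_r. reflexivity.
        * intros t. apply rcat_mult; [|apply rc_circ].
          apply (rcat_comp df (fun t => c + w + l * (r * cis t - w))%C); [apply Rg|apply Hdf, In; auto].
      + intros t _. apply is_derive_unique. apply Dphi; auto. }
  assert (E : RInt (fun t => phi 0 t) 0 (2 * PI) = RInt (fun t => phi 1 t) 0 (2 * PI)).
  { apply (eq_is_derive (fun l => RInt (fun t => phi l t) 0 (2 * PI))); [|lra].
    intros t Ht. apply Main; auto. }
  unfold phi in E. rewrite (CI_re k (fun t => f (c + w + 0 * (r * cis t - w)) * K t)%C) in E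
    by (apply RF; lra).
  rewrite (CI_re k (fun t => f (c + w + 1 * (r * cis t - w)) * K t)%C) in E by (apply RF; lra).
  symmetry.
  rewrite (CI_ext (fun t => f (c + w) * (r * cis t * / (r * cis t - w)))%C
    (fun t => f (c + w + 0 * (r * cis t - w)) * K t)%C).
  - rewrite E. do 2 f_equal. apply CI_ext. intros t. unfold K.
    replace (c + w + 1 * (r * cis t - w))%C with (c + r * cis t)%C by ring. auto.
  - intros t. unfold K. replace (c + w + 0 * (r * cis t - w))%C with (c + w)%C by ring. auto.
Qed.

Fixpoint csum (a : nat -> C) (n : nat) : C :=
  match n with O => 0%C | S m => (csum a m + a m)%C end.

Lemma csum_ext (a b : nat -> C) (n : nat) :
  (forall i, (i < n)%nat -> a i = b i) -> csum a n = csum b n.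
Proof. intros H. induction n as [|n IH]; simpl; auto. rewrite IH, H; auto. Qed.

Lemma csum_plus (a b : nat -> C) (n : nat) :
  (csum (fun i => a i + b i) n = csum a n + csum b n)%C.
Proof. induction n as [|n IH]; simpl; [ring|rewrite IH; ring]. Qed.

Lemma csum_scal (c : C) (a : nat -> C) (n : nat) :
  (csum (fun i => c * a i) n = c * csum a n)%C.
Proof. induction n as [|n IH]; simpl; [ring|rewrite IH; ring]. Qed.

(** Turns estimates available at every truncation order into an exact vanishing. *)
Lemma geom_small (x A q : R) : 0 <= q < 1 -> (forall n, x <= A * q ^ n) -> x <= 0.
Proof.
  intros Hq H. destruct (Rle_or_lt x 0) as [|P]; auto. exfalso.
  pose proof (H 0%nat) as H0. simpl in H0.
  assert (HA : 0 < A) by lra.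
  destruct (pow_lt_1_zero q) with (y := x / (2 * A)) as [N HN].
  - rewrite Rabs_pos_eq; lra.
  - apply Rdiv_lt_0_compat; lra.
  - specialize (HN N (Nat.le_refl N)). rewrite Rabs_pos_eq in HN by (apply pow_le; lra).
    specialize (H N). apply (Rmult_lt_compat_l A) in HN; auto.
    replace (A * (x / (2 * A))) with (x / 2) in HN by (field; lra). lra.
Qed.

Lemma ratio_lt1 (x r : R) : 0 <= x < r -> 0 <= x / r < 1.
Proof.
  intros H. split.
  - apply Rmult_le_pos; [lra|]. apply Rlt_le, Rinv_0_lt_compat; lra.
  - apply Rmult_lt_reg_r with r; [lra|]. unfold Rdiv. rewrite Rmult_assoc, Rinv_l; lra.
Qed.

Lemma kernel_mod (r t : R) (w : C) : Cmod w < r ->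
  Cmod (r * cis t * / (r * cis t - w)) <= r / (r - Cmod w).
Proof.
  intros H. pose proof (Cmod_ge_0 w). pose proof (circ_sub_neq0 r t w H).
  rewrite Cmod_mult, circ_mod, Cmod_inv by (auto; lra). apply Rmult_le_compat_l; [lra|].
  apply Rinv_le_contravar; [lra|]. apply circ_sub_mod, circ_mod; lra.
Qed.

Lemma circ_neq0 (r t : R) : 0 < r -> (r * cis t)%C <> 0.
Proof. intros. apply Cmod_gt_0. rewrite circ_mod; lra. Qed.

Lemma rc_circ_inv_pow (r : R) (k : nat) : 0 < r -> rc (fun t => / (r * cis t) ^ k)%C.
Proof.
  intros Hr t. apply rcat_inv; [|apply Cpow_nz, circ_neq0; auto].
  apply (rcat_pow (fun t => r * cis t)%C). apply rc_circ.
Qed.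

(** The kernel [z / (z - w)] is expanded in the geometric series of [w / z]. As the density is
    arbitrary, the expansion serves both for the integral of the kernel alone and, with boundary
    values of [f], for Taylor's theorem with remainder. *)
Lemma kernel_series (g : R -> C) (r M : R) (w : C) (n : nat) : 0 < r -> Cmod w < r -> rc g ->
  (forall t, Cmod (g t) <= M) ->
  Cmod (CI (fun t => g t * (r * cis t * / (r * cis t - w))) -
        csum (fun k => w ^ k * CI (fun t => g t * / (r * cis t) ^ k)) n)%C
  <= 2 * PI * (M * (r / (r - Cmod w))) * (Cmod w / r) ^ n.
Proof.
  intros Hr Hw Hg HM.
  set (K := fun t => (r * cis t * / (r * cis t - w))%C).
  assert (RK : rc K).
  { intros t. apply rcat_mult; [apply rc_circ|apply rc_circ_sub_inv; auto]. }
  assert (Rk : forall k, rc (fun t => g t * / (r * cis t) ^ k)%C).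
  { intros k t. apply rcat_mult; [apply Hg|apply rc_circ_inv_pow; auto]. }
  assert (RR : forall m, rc (fun t => g t * (/ (r * cis t) ^ m * K t))%C).
  { intros m t. apply rcat_mult; [apply Hg|]. apply rcat_mult; [apply rc_circ_inv_pow; auto|apply RK]. }
  assert (E : forall m, (CI (fun t => g t * K t) =
     csum (fun k => w ^ k * CI (fun t => g t * / (r * cis t) ^ k)) m
     + w ^ m * CI (fun t => g t * (/ (r * cis t) ^ m * K t)))%C).
  { induction m as [|m IH]; simpl csum.
    - simpl Cpow. rewrite Cplus_0_l, Cmult_1_l. apply CI_ext. intros t. field.
    - rewrite IH, <- Cplus_assoc. f_equal. simpl Cpow.
      replace (w ^ m * CI (fun t => g t * / (r * cis t) ^ m) +
          w * w ^ m * CI (fun t => g t * (/ (r * cis t * (r * cis t) ^ m) * K t)))%C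
        with (w ^ m * (CI (fun t => g t * / (r * cis t) ^ m) +
          w * CI (fun t => g t * (/ (r * cis t * (r * cis t) ^ m) * K t))))%C by ring.
      f_equal. rewrite <- CI_scal by (apply (RR (S m))).
      rewrite <- CI_plus; [|apply Rk|intros t; apply rcat_mult; [apply rcat_const|apply (RR (S m))]].
      apply CI_ext. intros t. unfold K.
      pose proof (circ_neq0 r t Hr) as N1. pose proof (circ_sub_neq0 r t w Hw) as N2.
      set (z := (r * cis t)%C) in *. clearbody z.
      field. repeat split; auto; apply Cpow_nz; auto. }
  change (fun t => g t * (r * cis t * / (r * cis t - w)))%C with (fun t => g t * K t)%C.
  rewrite (E n).
  set (S0 := csum _ n).
  replace (S0 + w ^ n * CI (fun t => g t * (/ (r * cis t) ^ n * K t)) - S0)%C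
    with (w ^ n * CI (fun t => g t * (/ (r * cis t) ^ n * K t)))%C by ring.
  rewrite Cmod_mult, Cmod_pow.
  assert (B : Cmod (CI (fun t => g t * (/ (r * cis t) ^ n * K t))%C)
     <= 2 * PI * (M * ((/ r) ^ n * (r / (r - Cmod w))))).
  { apply CI_bound; [apply RR|]. intros t. rewrite !Cmod_mult.
    apply Rmult_le_compat; auto using Cmod_ge_0.
    - apply Rmult_le_pos; apply Cmod_ge_0.
    - apply Rmult_le_compat; auto using Cmod_ge_0.
      + rewrite Cmod_inv by (apply Cpow_nz, circ_neq0; auto).
        rewrite Cmod_pow, circ_mod, pow_inv by auto. lra.
      + apply kernel_mod; auto. }
  eapply Rle_trans; [apply Rmult_le_compat_l; [apply pow_le, Cmod_ge_0|exact B]|].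
  unfold Rdiv. rewrite (Rpow_mult_distr (Cmod w)). right; ring.
Qed.

Lemma rderiv_cis_lin (a t : R) : rderiv (fun t => cis (a * t)) t (a * Ci * cis (a * t))%C.
Proof.
  replace (a * Ci * cis (a * t))%C with (a * - sin (a * t), a * cos (a * t))%R
    by (apply injective_projections; simpl; ring).
  apply (rderiv_of_re_im (fun t => cos (a * t)) (fun t => sin (a * t))); auto_derive; auto; ring.
Qed.

Lemma CI_cis_pow (k : nat) : (0 < k)%nat -> CI (fun t => / (cis t) ^ k)%C = 0.
Proof.
  intros Hk. assert (Hk' : INR k <> 0) by (apply not_0_INR; lia).
  assert (N : (RtoC (- INR k) * Ci)%C <> 0).
  { intros E. apply (f_equal Im) in E. simpl in E. lra. }
  assert (Rc : rc (fun t => cis (- INR k * t))).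
  { intros t. eapply rderiv_rcat, rderiv_cis_lin. }
  rewrite (CI_ext _ (fun t => cis (- INR k * t))).
  2:{ intros t. rewrite cis_pow, <- cis_opp. f_equal. ring. }
  assert (E : CI (fun t => RtoC (- INR k) * Ci * cis (- INR k * t))%C = 0).
  { rewrite (CI_derive (fun t => cis (- INR k * t))).
    - replace (- INR k * (2 * PI)) with (- (INR k * (2 * PI))) by ring.
      rewrite Rmult_0_r, cis_opp, <- cis_pow, cis_2PI, Cpow_1_l, cis_0.
      field.
    - intros t. apply rcat_mult; [apply rcat_const|apply Rc].
    - intros t. apply rderiv_cis_lin. }
  rewrite CI_scal in E by auto.
  destruct (Ceq_dec (CI (fun t => cis (- INR k * t))) 0) as [|N2]; auto.
  exfalso. revert E. apply Cmult_neq_0; auto.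
Qed.

(** Expansion with density 1: every term but the constant one integrates to zero. Order [S n] is
    used so that the constant term is always present. *)
Lemma CI_kernel (r : R) (w : C) : 0 < r -> Cmod w < r ->
  CI (fun t => r * cis t * / (r * cis t - w))%C = (2 * PI)%C.
Proof.
  intros Hr Hw. apply Cminus_0_eq, Cmod_eq_0. apply Rle_antisym; [|apply Cmod_ge_0].
  apply geom_small with (2 * PI * (1 * (r / (r - Cmod w))) * (Cmod w / r)) (Cmod w / r).
  { apply ratio_lt1. split; auto. apply Cmod_ge_0. }
  intros n.
  pose proof (kernel_series (fun _ => 1%C) r 1 w (S n) Hr Hw (fun t => rcat_const 1%C t)
      (fun t => Req_le _ _ Cmod_1)) as B.
  rewrite (CI_ext _ (fun t => r * cis t * / (r * cis t - w))%C) in B by (intros; ring).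
  replace (csum (fun k => w ^ k * CI (fun t => 1 * / (r * cis t) ^ k)) (S n))%C with (2 * PI)%C in B.
  { eapply Rle_trans; [exact B|right; simpl pow; ring]. }
  clear B. induction n as [|n IH].
  - change (2 * PI = 0 + 1 * CI (fun t => 1 * / 1))%C.
    rewrite (CI_ext _ (fun _ => 1%C)) by (intros; field).
    rewrite CI_const. ring.
  - change (csum (fun k => w ^ k * CI (fun t => 1 * / (r * cis t) ^ k)) (S (S n)))%C
        with (csum (fun k => w ^ k * CI (fun t => 1 * / (r * cis t) ^ k)) (S n)
              + w ^ S n * CI (fun t => 1 * / (r * cis t) ^ S n))%C.
    rewrite <- IH.
    rewrite (CI_ext (fun t => 1 * / (r * cis t) ^ S n)%C (fun t => / r ^ S n * / cis t ^ S n)%C).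
    + rewrite CI_scal, CI_cis_pow; [ring|lia|].
      intros t. apply rcat_inv; [apply (rcat_pow cis), rc_cis|apply Cpow_nz, cis_neq0].
    + intros t. rewrite Cpow_mult_l. pose proof (cis_neq0 t).
      assert (N : RtoC r <> 0) by (intros E; apply RtoC_inj in E; lra).
      pose proof (Cpow_nz _ (S n) N). pose proof (Cpow_nz _ (S n) H).
      set (x := (RtoC r ^ S n)%C) in *. set (y := (cis t ^ S n)%C) in *. clearbody x y.
      field. auto.
Qed.

(** Cauchy's formula isolated as a property of [f] on one circle: it survives uniform limits, and by
    itself yields Taylor coefficients and holomorphy inside. *)
Definition cauchy_rep (f : C -> C) (c : C) (r : R) : Prop :=
  rc (fun t => f (c + r * cis t)%C) /\
  forall w, Cmod w < r ->
    (2 * PI * f (c + w) = CI (fun t => f (c + r * cis t) * (r * cis t * / (r * cis t - w))))%C.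

Lemma rc_comp_circ (f : C -> C) (c : C) (r : R) :
  (forall t, ccont f (c + r * cis t)%C) -> rc (fun t => f (c + r * cis t)%C).
Proof.
  intros H t. apply (rcat_comp f (fun t => c + r * cis t)%C); auto.
  apply (rcat_plus (fun _ => c)); [apply rcat_const|apply rc_circ].
Qed.

Lemma cauchy_formula (f : C -> C) (c : C) (r r' : R) : 0 < r < r' ->
  (forall z, Cmod (z - c) < r' -> hol f z) -> cauchy_rep f c r.
Proof.
  intros Hr Hf. split.
  - apply rc_comp_circ. intros t. apply hol_ccont, Hf.
    replace (c + r * cis t - c)%C with (r * cis t)%C by ring. rewrite circ_mod; lra.
  - intros w Hw. rewrite (cauchy_deform f c w r r') by auto.
    rewrite CI_scal, CI_kernel; [ring|lra|auto|].
    intros t. apply rcat_mult; [apply rc_circ|apply rc_circ_sub_inv; auto].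
Qed.

Lemma two_PI_neq0 : (2 * PI)%C <> 0.
Proof. rewrite <- RtoC_mult. intros E. apply RtoC_inj in E. pose proof PI_RGT_0. lra. Qed.

Lemma Cmod_2PI : Cmod (2 * PI) = 2 * PI.
Proof. rewrite <- RtoC_mult, Cmod_R, Rabs_pos_eq; auto. pose proof PI_RGT_0. lra. Qed.

Lemma taylor (f : C -> C) (c : C) (r M : R) : 0 < r -> cauchy_rep f c r ->
  (forall t, Cmod (f (c + r * cis t)%C) <= M) ->
  exists a : nat -> C, (forall k, Cmod (a k) * r ^ k <= M) /\
    forall w n, Cmod w < r ->
      Cmod (f (c + w) - csum (fun k => a k * w ^ k) n)%C <= M * (r / (r - Cmod w)) * (Cmod w / r) ^ n.
Proof.
  intros Hr [Hc HE] HM. pose proof PI_RGT_0 as HPI. pose proof two_PI_neq0 as N2.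
  exists (fun k => (/ (2 * PI) * CI (fun t => f (c + r * cis t) * / (r * cis t) ^ k))%C). split.
  - intros k.
    assert (B : Cmod (CI (fun t => f (c + r * cis t) * / (r * cis t) ^ k)%C) <= 2 * PI * (M * / r ^ k)).
    { apply CI_bound.
      - intros t. apply rcat_mult; [apply Hc|apply rc_circ_inv_pow; auto].
      - intros t. rewrite Cmod_mult, Cmod_inv by (apply Cpow_nz, circ_neq0; auto).
        rewrite Cmod_pow, circ_mod by auto. apply Rmult_le_compat_r; auto.
        apply Rlt_le, Rinv_0_lt_compat, pow_lt; auto. }
    rewrite Cmod_mult, Cmod_inv, Cmod_2PI by auto.
    pose proof (pow_lt r k Hr) as P.
    apply Rle_trans with (/ (2 * PI) * (2 * PI * (M * / r ^ k)) * r ^ k).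
    + apply Rmult_le_compat_r; [lra|]. apply Rmult_le_compat_l; auto.
      apply Rlt_le, Rinv_0_lt_compat; lra.
    + right. field. split; lra.
  - intros w n Hw.
    pose proof (kernel_series (fun t => f (c + r * cis t)%C) r M w n Hr Hw Hc HM) as B.
    rewrite <- HE in B by auto.
    apply Rmult_le_reg_l with (2 * PI); [lra|].
    rewrite <- Cmod_2PI at 1. rewrite <- Cmod_mult.
    eapply Rle_trans; [|eapply Rle_trans; [exact B|right; ring]].
    right. f_equal. unfold Cminus. rewrite Cmult_plus_distr_l. f_equal.
    replace (2 * PI * - csum (fun k => / (2 * PI) *
        CI (fun t => f (c + r * cis t) * / (r * cis t) ^ k) * w ^ k) n)%C
      with (- (2 * PI * csum (fun k => / (2 * PI) *
        CI (fun t => f (c + r * cis t) * / (r * cis t) ^ k) * w ^ k) n))%C by ring.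
    f_equal. rewrite <- csum_scal. apply csum_ext. intros i _.
    set (p := (2 * PI)%C) in *. clearbody p. field. auto.
Qed.

(* Cauchy-type integrals: the density [g] need not be the boundary value of anything. *)
Definition CT (g : R -> C) (r : R) (w : C) : C := CI (fun t => g t * / (r * cis t - w))%C.

Lemma rc_CT (g : R -> C) (r : R) (w : C) : rc g -> Cmod w < r ->
  rc (fun t => g t * / (r * cis t - w))%C.
Proof. intros Hg Hw t. apply rcat_mult; [apply Hg|apply rc_circ_sub_inv; auto]. Qed.

Lemma rc_periodic_circ_bound (g : R -> C) (M : R) (r : R) (w : C) : (forall t, Cmod (g t) <= M) ->
  Cmod w < r -> forall t, Cmod (g t * / (r * cis t - w)) <= M / (r - Cmod w).
Proof.
  intros HM Hw t. pose proof (circ_sub_neq0 r t w Hw). pose proof (Cmod_ge_0 w).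
  rewrite Cmod_mult, Cmod_inv by auto. apply Rmult_le_compat; auto using Cmod_ge_0.
  - rewrite <- Cmod_inv by auto. apply Cmod_ge_0.
  - apply Rinv_le_contravar; [lra|]. apply circ_sub_mod, circ_mod; lra.
Qed.

(** By partial fractions the slope of a Cauchy-type integral is exactly another one, with density
    divided by [r cis t - w]. Continuity of such integrals therefore already gives
    differentiability. *)
Lemma CT_diff (g : R -> C) (r : R) (w v : C) : rc g -> Cmod w < r -> Cmod v < r ->
  (CT g r v = CT g r w + CT (fun t => g t * / (r * cis t - w)) r v * (v - w))%C.
Proof.
  intros Hg Hw Hv. unfold CT.
  rewrite (Cmult_comm _ (v - w)), <- CI_scal.
  - rewrite <- CI_plus.
    + apply CI_ext. intros t. pose proof (circ_sub_neq0 r t w Hw). pose proof (circ_sub_neq0 r t v Hv).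
      field. auto.
    + apply rc_CT; auto.
    + intros t. apply rcat_mult; [apply rcat_const|]. apply (rc_CT _ r v); auto. apply rc_CT; auto.
  - apply (rc_CT _ r v); auto. apply rc_CT; auto.
Qed.

Lemma CT_bound (g : R -> C) (M r : R) (w : C) : rc g -> (forall t, Cmod (g t) <= M) -> Cmod w < r ->
  Cmod (CT g r w) <= 2 * PI * (M / (r - Cmod w)).
Proof.
  intros Hg HM Hw. apply CI_bound; [apply rc_CT; auto|]. apply rc_periodic_circ_bound; auto.
Qed.

Lemma CT_ccont (g : R -> C) (M r : R) (w : C) : rc g -> (forall t, Cmod (g t) <= M) -> Cmod w < r ->
  ccont (CT g r) w.
Proof.
  intros Hg HM Hw e He. pose proof PI_RGT_0 as HPI. pose proof (Cmod_ge_0 w).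
  assert (M0 : 0 <= M). { eapply Rle_trans; [apply Cmod_ge_0|apply (HM 0)]. }
  set (s := (r - Cmod w) / 2). assert (Hs : 0 < s) by (unfold s; lra).
  set (A := 2 * PI * (M / (r - Cmod w) / s) + 1).
  assert (HA : 0 < A).
  { unfold A. assert (0 <= M / (r - Cmod w) / s).
    { apply Rmult_le_pos; [|apply Rlt_le, Rinv_0_lt_compat; auto].
      apply Rmult_le_pos; auto. apply Rlt_le, Rinv_0_lt_compat; lra. }
    assert (0 <= 2 * PI * (M / (r - Cmod w) / s)) by (apply Rmult_le_pos; lra). lra. }
  exists (Rmin s (e / A)). split; [apply Rmin_pos; auto; apply Rdiv_lt_0_compat; auto|].
  intros v Hv. pose proof (Rmin_l s (e / A)). pose proof (Rmin_r s (e / A)).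
  pose proof (Cmod_tri_inv v w) as T.
  assert (Hvr : Cmod v <= r - s) by (unfold s in *; lra).
  rewrite (CT_diff g r w v) by (auto; lra).
  replace (CT g r w + CT (fun t => g t * / (r * cis t - w)) r v * (v - w) - CT g r w)%C
    with (CT (fun t => g t * / (r * cis t - w)) r v * (v - w))%C by ring.
  rewrite Cmod_mult.
  assert (B : Cmod (CT (fun t => g t * / (r * cis t - w))%C r v) <= A).
  { eapply Rle_trans; [apply (CT_bound _ (M / (r - Cmod w))); [apply rc_CT; auto| |lra]|].
    - apply rc_periodic_circ_bound; auto.
    - unfold A. assert (M / (r - Cmod w) / (r - Cmod v) <= M / (r - Cmod w) / s); [|nra].
      apply Rmult_le_compat_l.
      + apply Rmult_le_pos; auto. apply Rlt_le, Rinv_0_lt_compat; lra.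
      + apply Rinv_le_contravar; lra. }
  apply Rle_lt_trans with (A * Cmod (v - w)); [apply Rmult_le_compat_r; auto using Cmod_ge_0|].
  apply Rlt_le_trans with (A * (e / A)); [apply Rmult_lt_compat_l; lra|].
  right; field; lra.
Qed.

Lemma CT_cderiv (g : R -> C) (M r : R) (w : C) : rc g -> (forall t, Cmod (g t) <= M) -> Cmod w < r ->
  cderiv (CT g r) w (CT (fun t => g t * / (r * cis t - w))%C r w).
Proof.
  intros Hg HM Hw.
  apply cderiv_local with (CT (fun t => g t * / (r * cis t - w))%C r) (r - Cmod w); auto; [lra| |].
  - apply CT_ccont with (M / (r - Cmod w)); auto; [apply rc_CT; auto|].
    apply rc_periodic_circ_bound; auto.
  - intros v Hv. apply CT_diff; auto. pose proof (Cmod_tri_inv v w). lra.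
Qed.

(** The density of the derivative moves with the point. [E] rewrites it over the density frozen at
    [v], plus a bounded term with the factor [u - v]. *)
Lemma CT_hol (g : R -> C) (M r : R) (w : C) : rc g -> (forall t, Cmod (g t) <= M) -> Cmod w < r ->
  hol (CT g r) w.
Proof.
  intros Hg HM Hw.
  set (dF := fun v => CT (fun t => g t * / (r * cis t - v))%C r v).
  exists ((r - Cmod w) / 2), dF. split; [lra|].
  intros v Hv. pose proof (Cmod_tri_inv v w). assert (Hvr : Cmod v < r) by lra.
  split; [apply CT_cderiv with M; auto|].
  set (h := fun t => (g t * / (r * cis t - v))%C).
  assert (Rh : rc h) by (apply rc_CT; auto).
  assert (Bh : forall t, Cmod (h t) <= M / (r - Cmod v)) by (apply rc_periodic_circ_bound; auto).
  assert (M0 : 0 <= M). { eapply Rle_trans; [apply Cmod_ge_0|apply (HM 0)]. }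
  pose proof PI_RGT_0 as HPI.
  assert (E : forall u, Cmod u < r ->
    (dF u = CT h r u + (u - v) * CT (fun t => h t * / (r * cis t - u)) r u)%C).
  { intros u Hu. unfold dF, CT.
    rewrite <- CI_scal; [|apply (rc_CT _ r u); auto; apply rc_CT; auto].
    rewrite <- CI_plus; [|apply rc_CT; auto|].
    - apply CI_ext. intros t. unfold h.
      pose proof (circ_sub_neq0 r t v Hvr). pose proof (circ_sub_neq0 r t u Hu).
      set (z := (r * cis t)%C) in *. clearbody z. field. auto.
    - intros t. apply rcat_mult; [apply rcat_const|]. apply (rc_CT _ r u); auto; apply rc_CT; auto. }
  set (s := (r - Cmod v) / 2). assert (Hs : 0 < s) by (unfold s; lra).
  set (B := 2 * PI * (M / (r - Cmod v) / s / s) + 1).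
  assert (Q0 : forall x y, 0 <= x -> 0 < y -> 0 <= x / y).
  { intros x y Hx Hy. apply Rmult_le_pos; auto. apply Rlt_le, Rinv_0_lt_compat; auto. }
  assert (HB : 0 < B).
  { unfold B. assert (0 <= 2 * PI * (M / (r - Cmod v) / s / s)); [|lra].
    apply Rmult_le_pos; [lra|]. repeat apply Q0; lra. }
  intros e He.
  destruct (CT_ccont h (M / (r - Cmod v)) r v Rh Bh Hvr (e / 2)) as [d [D HD]]; [lra|].
  exists (Rmin d (Rmin s (e / 2 / B))). split.
  { repeat apply Rmin_pos; auto. apply Rdiv_lt_0_compat; lra. }
  intros u Hu.
  pose proof (Rmin_l d (Rmin s (e / 2 / B))). pose proof (Rmin_r d (Rmin s (e / 2 / B))).
  pose proof (Rmin_l s (e / 2 / B)). pose proof (Rmin_r s (e / 2 / B)).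
  pose proof (Cmod_tri_inv u v) as T. assert (Hur : Cmod u <= r - s) by (unfold s in *; lra).
  rewrite (E u), (E v) by (auto; lra).
  replace (CT h r u + (u - v) * CT (fun t => h t * / (r * cis t - u)) r u -
    (CT h r v + (v - v) * CT (fun t => h t * / (r * cis t - v)) r v))%C
    with ((CT h r u - CT h r v) + (u - v) * CT (fun t => h t * / (r * cis t - u)) r u)%C by ring.
  eapply Rle_lt_trans; [apply Cmod_triangle|]. rewrite Cmod_mult.
  specialize (HD u ltac:(lra)).
  assert (Cmod (CT (fun t => h t * / (r * cis t - u))%C r u) <= B).
  { eapply Rle_trans; [apply (CT_bound _ (M / (r - Cmod v) / (r - Cmod u)))|].
    - apply rc_CT; auto; lra.
    - apply rc_periodic_circ_bound; auto; lra.
    - lra.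
    - unfold B. assert (M / (r - Cmod v) / (r - Cmod u) / (r - Cmod u) <= M / (r - Cmod v) / s / s); [|nra].
      assert (I1 : / (r - Cmod u) <= / s) by (apply Rinv_le_contravar; lra).
      assert (0 < / (r - Cmod u)) by (apply Rinv_0_lt_compat; lra).
      apply Rmult_le_compat; auto; try lra.
      + apply Q0; try lra. apply Q0; lra.
      + apply Rmult_le_compat_l; auto. apply Q0; lra. }
  assert (Cmod (u - v) * Cmod (CT (fun t => h t * / (r * cis t - u))%C r u) <= e / 2 / B * B).
  { apply Rmult_le_compat; auto using Cmod_ge_0; lra. }
  replace (e / 2 / B * B) with (e / 2) in * by (field; lra). lra.
Qed.

Definition cauchy_density (f : C -> C) (c : C) (r : R) (t : R) : C :=
  (/ (2 * PI) * (f (c + r * cis t) * (r * cis t)))%C.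

Lemma cauchy_rep_CT (f : C -> C) (c w : C) (r : R) : cauchy_rep f c r -> Cmod w < r ->
  f (c + w)%C = CT (cauchy_density f c r) r w.
Proof.
  intros [Hc HE] Hw. pose proof two_PI_neq0 as N2. pose proof (Cmod_ge_0 w).
  replace (f (c + w)%C) with (/ (2 * PI) * (2 * PI * f (c + w)))%C
    by (set (p := (2 * PI)%C) in *; clearbody p; field; auto).
  rewrite HE by auto. rewrite <- CI_scal.
  - unfold CT, cauchy_density. apply CI_ext. intros t. rewrite !Cmult_assoc. reflexivity.
  - intros t. apply rcat_mult; [apply Hc|]. apply rcat_mult; [apply rc_circ|apply rc_circ_sub_inv; auto].
Qed.

Lemma rc_cauchy_density (f : C -> C) (c : C) (r : R) : cauchy_rep f c r -> rc (cauchy_density f c r).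
Proof.
  intros [Hc _] t. apply rcat_mult; [apply rcat_const|]. apply rcat_mult; [apply Hc|apply rc_circ].
Qed.

Lemma cauchy_density_bound (f : C -> C) (c : C) (r M : R) : 0 < r ->
  (forall t, Cmod (f (c + r * cis t)%C) <= M) ->
  forall t, Cmod (cauchy_density f c r t) <= / (2 * PI) * (M * r).
Proof.
  intros Hr HM t. unfold cauchy_density. pose proof PI_RGT_0.
  rewrite Cmod_mult, Cmod_inv, Cmod_2PI by apply two_PI_neq0.
  rewrite Cmod_mult, circ_mod by auto. apply Rmult_le_compat_l.
  - apply Rlt_le, Rinv_0_lt_compat; lra.
  - apply Rmult_le_compat_r; [lra|auto].
Qed.

Lemma hol_shift (f : C -> C) (a z : C) : hol f (z + a)%C -> hol (fun w => f (w + a)%C) z.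
Proof.
  intros H. apply (hol_comp (fun w => (w + a)%C) f); auto.
  apply hol_plus; [apply hol_id|apply hol_const].
Qed.

Lemma cauchy_rep_hol (f : C -> C) (c z : C) (r M : R) : 0 < r -> cauchy_rep f c r ->
  (forall t, Cmod (f (c + r * cis t)%C) <= M) -> Cmod (z - c) < r -> hol f z.
Proof.
  intros Hr HR HM Hz.
  apply hol_ext_loc with (fun v => CT (cauchy_density f c r) r (v + - c)%C) (r - Cmod (z - c)); [lra| |].
  - intros v Hv. rewrite <- cauchy_rep_CT; auto.
    + f_equal. ring.
    + pose proof (Cmod_tri_minus v z c). unfold Cminus in *. lra.
  - apply (hol_shift (CT (cauchy_density f c r) r) (- c)%C z).
    apply CT_hol with (/ (2 * PI) * (M * r)); auto.
    + apply rc_cauchy_density; auto.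
    + apply cauchy_density_bound; auto.
Qed.

(** Uniform approximation carries Cauchy's formula on the circle of radius [r] over to [f], and the
    formula implies holomorphy. [B] collects the errors made at the point and under the integral. *)
Lemma hol_weierstrass (f : C -> C) (c : C) (r r' M : R) : 0 < r < r' ->
  (forall z, Cmod (z - c) < r' -> Cmod (f z) <= M) ->
  (forall eps, 0 < eps -> exists g : C -> C, (forall z, Cmod (z - c) < r' -> hol g z) /\
     forall z, Cmod (z - c) < r' -> Cmod (f z - g z) <= eps) ->
  forall z, Cmod (z - c) < r -> hol f z.
Proof.
  intros Hr HM Happ z Hz. pose proof PI_RGT_0 as HPI.
  assert (Hcirc : forall t, Cmod (c + r * cis t - c) < r').
  { intros t. replace (c + r * cis t - c)%C with (r * cis t)%C by ring. rewrite circ_mod; lra. }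
  apply cauchy_rep_hol with c r M; auto; [lra|].
  assert (Hrc : rc (fun t => f (c + r * cis t)%C)).
  { intros t e He. destruct (Happ (e / 4)) as [g [Hg Hfg]]; [lra|].
    destruct (cauchy_formula g c r r' Hr Hg) as [Rg _].
    destruct (Rg t (e / 4)) as [d [D HD]]; [lra|]. exists d. split; auto. intros t' Ht.
    specialize (HD t' Ht). pose proof (Hfg _ (Hcirc t)) as A1. pose proof (Hfg _ (Hcirc t')) as A2.
    rewrite Cmod_minus_sym in A1.
    pose proof (Cmod_tri_minus (f (c + r * cis t')%C) (g (c + r * cis t')%C) (f (c + r * cis t)%C)) as T1.
    pose proof (Cmod_tri_minus (g (c + r * cis t')%C) (g (c + r * cis t)%C) (f (c + r * cis t)%C)) as T2.
    lra. }
  split; auto. intros w Hw. pose proof (Cmod_ge_0 w).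
  apply Cminus_0_eq, Cmod_eq_0. apply Rle_antisym; [|apply Cmod_ge_0].
  apply Rnot_lt_le. intros Hpos. set (A := Cmod _) in Hpos.
  set (B := 2 * PI + 2 * PI * (r / (r - Cmod w))).
  assert (HB : 0 < B).
  { unfold B. assert (0 < r / (r - Cmod w)) by (apply Rdiv_lt_0_compat; lra). nra. }
  destruct (Happ (A / B / 2)) as [g [Hg Hfg]].
  { apply Rdiv_lt_0_compat; [|lra]. apply Rdiv_lt_0_compat; auto. }
  destruct (cauchy_formula g c r r' Hr Hg) as [Rg Eg]. specialize (Eg w Hw).
  set (K := fun t => (r * cis t * / (r * cis t - w))%C).
  assert (RK : rc K).
  { intros t. apply rcat_mult; [apply rc_circ|apply rc_circ_sub_inv; auto]. }
  assert (HA : A <= A / B / 2 * B); [|replace (A / B / 2 * B) with (A / 2) in HA by (field; lra); lra].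
  unfold A at 1.
  replace (2 * PI * f (c + w) - CI (fun t => f (c + r * cis t) * (r * cis t * / (r * cis t - w))))%C
    with (2 * PI * (f (c + w) - g (c + w)) + CI (fun t => (g (c + r * cis t) - f (c + r * cis t)) * K t))%C.
  - eapply Rle_trans; [apply Cmod_triangle|]. rewrite Cmod_mult, Cmod_2PI.
    assert (Cmod (f (c + w) - g (c + w))%C <= A / B / 2).
    { apply Hfg. replace (c + w - c)%C with w by ring. lra. }
    assert (Cmod (CI (fun t => (g (c + r * cis t) - f (c + r * cis t)) * K t)%C)
       <= 2 * PI * (A / B / 2 * (r / (r - Cmod w)))).
    { apply CI_bound.
      - intros t. apply rcat_mult; [|apply RK]. apply (rcat_plus _ (fun t => - f (c + r * cis t))%C); [apply Rg|].
        apply rcat_ext with (fun t => - (1) * f (c + r * cis t))%C; [intros; ring|].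
        apply rcat_mult; [apply rcat_const|apply Hrc].
      - intros t. rewrite Cmod_mult. apply Rmult_le_compat; auto using Cmod_ge_0.
        + rewrite Cmod_minus_sym. apply Hfg, Hcirc.
        + apply kernel_mod; auto. }
    unfold B at 2. nra.
  - rewrite (CI_ext _ (fun t => g (c + r * cis t) * K t - f (c + r * cis t) * K t)%C) by (intros; ring).
    rewrite CI_minus.
    + unfold K at 1. rewrite <- Eg. unfold K. ring.
    + intros t. apply rcat_mult; [apply Rg|apply RK].
    + intros t. apply rcat_mult; [apply Hrc|apply RK].
Qed.

Lemma deriv_bound (f : C -> C) (c d : C) (r r' M : R) : 0 < r < r' ->
  (forall z, Cmod (z - c) < r' -> hol f z) -> (forall z, Cmod (z - c) < r' -> Cmod (f z) <= M) ->
  cderiv f c d -> Cmod d <= M / r.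
Proof.
  intros Hr Hf HM Hd. pose proof PI_RGT_0 as HPI.
  pose proof (cauchy_formula f c r r' Hr Hf) as HR.
  assert (HMc : forall t, Cmod (f (c + r * cis t)%C) <= M).
  { intros t. apply HM. replace (c + r * cis t - c)%C with (r * cis t)%C by ring. rewrite circ_mod; lra. }
  set (g := cauchy_density f c r).
  assert (Rg : rc g) by (apply rc_cauchy_density; auto).
  assert (Bg := cauchy_density_bound f c r M ltac:(lra) HMc). fold g in Bg.
  assert (H0 : Cmod 0 < r) by (rewrite Cmod_0; lra).
  pose proof (CT_cderiv g _ r 0 Rg Bg H0) as D.
  assert (E : d = CT (fun t => g t * / (r * cis t - 0))%C r 0).
  { apply (cderiv_unique f c); auto.
    apply cderiv_ext_loc with (fun v => CT g r (v + - c)%C) r; [lra| |].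
    - intros v Hv. unfold g. rewrite <- cauchy_rep_CT; auto. f_equal. ring.
    - replace (CT (fun t => g t * / (r * cis t - 0)) r 0)%C with
        (CT (fun t => g t * / (r * cis t - 0)) r 0 * (1 + 0))%C by ring.
      apply (cderiv_comp (fun v => v + - c)%C (CT g r)).
      + apply cderiv_plus; [apply cderiv_id|apply cderiv_const].
      + replace (c + - c)%C with (RtoC 0) by ring. auto. }
  rewrite E.
  eapply Rle_trans; [apply (CT_bound _ (/ (2 * PI) * (M * r) / (r - Cmod 0)))|]; auto.
  - apply rc_CT; auto.
  - apply rc_periodic_circ_bound; auto.
  - rewrite Cmod_0. right. field. lra.
Qed.

(** * Zeros, the maximum principle and Jensen's inequality *)

Lemma hol_bounded_near (f : C -> C) (z : C) : hol f z ->
  exists r M, 0 < r /\ 0 < M /\ (forall w, Cmod (w - z) < r -> hol f w) /\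
    forall w, Cmod (w - z) < r -> Cmod (f w) <= M.
Proof.
  intros H. destruct (hol_open f z H) as [r [Hr H1]].
  destruct (ccont_bounded f z (hol_ccont f z H)) as [d [M [Hd [HM H2]]]].
  exists (Rmin r d), M. pose proof (Rmin_l r d). pose proof (Rmin_r r d).
  split; [apply Rmin_pos; auto|]. split; auto.
  split; intros w Hw; [apply H1|apply H2]; lra.
Qed.

(** Near [a] the quotient is the slope of the Cauchy-type integral representing [f], hence
    holomorphic across the zero; elsewhere it is an ordinary quotient. One [g] works wherever [f] is
    holomorphic, so no domain has to be named. *)
Lemma hol_divide (f : C -> C) (a : C) : hol f a -> f a = 0 ->
  exists g : C -> C, (forall w, f w = (w - a) * g w)%C /\ forall z, hol f z -> hol g z.
Proof.
  intros Hf Ha. destruct (hol_bounded_near f a Hf) as [r [M [Hr [HM [H1 H2]]]]].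
  set (s := r / 2). assert (Hs : 0 < s < r) by (unfold s; lra).
  pose proof (cauchy_formula f a s r Hs H1) as HR.
  assert (HMc : forall t, Cmod (f (a + s * cis t)%C) <= M).
  { intros t. apply H2. replace (a + s * cis t - a)%C with (s * cis t)%C by ring. rewrite circ_mod; lra. }
  set (h := cauchy_density f a s).
  assert (Rh : rc h) by (apply rc_cauchy_density; auto).
  assert (Bh := cauchy_density_bound f a s M ltac:(lra) HMc). fold h in Bh.
  assert (H0 : Cmod 0 < s) by (rewrite Cmod_0; lra).
  set (G := fun v => CT (fun t => h t * / (s * cis t - 0))%C s (v + - a)%C).
  assert (EG : forall v, Cmod (v - a) < s -> f v = ((v - a) * G v)%C).
  { intros v Hv. unfold G. pose proof (CT_diff h s 0 (v - a)%C Rh H0 Hv) as E.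
    unfold h at 1 2 in E. rewrite <- !cauchy_rep_CT in E by auto.
    replace (a + (v - a))%C with v in E by ring. rewrite E.
    rewrite Cplus_0_r, Ha. unfold Cminus. ring. }
  exists (fun v => if Ceq_dec v a then G a else (f v / (v - a))%C). split.
  - intros w. destruct (Ceq_dec w a) as [->|N]; [rewrite Ha; ring|].
    field. intros E. apply N, Cminus_0_eq, E.
  - intros z Hz. destruct (Ceq_dec z a) as [->|N].
    + apply hol_ext_loc with G s; [lra| |].
      * intros v Hv. destruct (Ceq_dec v a) as [->|N]; auto. rewrite EG by auto.
        field. intros E. apply N, Cminus_0_eq, E.
      * apply (hol_shift (CT (fun t => h t * / (s * cis t - 0))%C s) (- a)%C a).
        apply CT_hol with (/ (2 * PI) * (M * s) / (s - Cmod 0)).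
        -- apply rc_CT; auto.
        -- apply rc_periodic_circ_bound; auto.
        -- replace (a + - a)%C with (RtoC 0) by ring. auto.
    + assert (P : 0 < Cmod (z - a)). { apply Cmod_gt_0. intros E. apply N, Cminus_0_eq, E. }
      apply hol_ext_loc with (fun v => f v / (v - a))%C (Cmod (z - a)); auto.
      * intros v Hv. destruct (Ceq_dec v a) as [->|N']; auto.
        exfalso. rewrite Cmod_minus_sym in Hv. lra.
      * apply hol_div; auto; [apply hol_minus; [apply hol_id|apply hol_const]|].
        intros E. apply N, Cminus_0_eq, E.
Qed.

Lemma pow_bounded_le1 (x A : R) : 0 <= x -> (forall n, x ^ n <= A) -> x <= 1.
Proof.
  intros Hx H. apply Rnot_lt_le. intros H1.
  destruct (Pow_x_infinity x) with (b := A + 1) as [N HN]; [rewrite Rabs_pos_eq; lra|].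
  specialize (HN N (Nat.le_refl N)). rewrite Rabs_pos_eq in HN by (apply pow_le; auto).
  specialize (H N). lra.
Qed.

(* The Cauchy integral gives the maximum principle up to a constant factor; applying it to [f^n] removes the factor. *)
Lemma max_modulus (f : C -> C) (c z : C) (r r' M : R) : 0 < r < r' -> 0 < M ->
  (forall z, Cmod (z - c) < r' -> hol f z) -> (forall w, Cmod (w - c) = r -> Cmod (f w) <= M) ->
  Cmod (z - c) < r -> Cmod (f z) <= M.
Proof.
  intros Hr HM Hf HB Hz. set (w := (z - c)%C) in *.
  assert (E : z = (c + w)%C) by (unfold w; ring). pose proof (Cmod_ge_0 w).
  assert (H1 : Cmod (f z) / M <= 1).
  { apply pow_bounded_le1 with (r / (r - Cmod w)).
    - apply Rmult_le_pos; [apply Cmod_ge_0|]. apply Rlt_le, Rinv_0_lt_compat; auto.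
    - intros n.
      destruct (taylor (fun z => f z ^ n)%C c r (M ^ n)) as [a [_ Ha]]; [lra| | |].
      + apply cauchy_formula with r'; auto. intros v Hv. apply hol_pow; auto.
      + intros t. rewrite Cmod_pow. apply pow_incr. split; [apply Cmod_ge_0|].
        apply HB. replace (c + r * cis t - c)%C with (r * cis t)%C by ring. apply circ_mod; lra.
      + specialize (Ha w 0%nat Hz). simpl in Ha. rewrite Rmult_1_r in Ha.
        replace (f (c + w) ^ n - 0)%C with (f (c + w) ^ n)%C in Ha by ring.
        rewrite Cmod_pow, <- E in Ha. unfold Rdiv at 1. rewrite Rpow_mult_distr, pow_inv.
        pose proof (pow_lt M n HM).
        apply Rmult_le_reg_r with (M ^ n); auto. rewrite Rmult_assoc, Rinv_l, Rmult_1_r by lra. lra. }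
  apply Rmult_le_reg_r with (/ M); [apply Rinv_0_lt_compat; auto|].
  rewrite (Rinv_r M) by lra. auto.
Qed.

Lemma Cmod2 (z : C) : Cmod z ^ 2 = Re z * Re z + Im z * Im z.
Proof. rewrite Cmod2_alt. ring. Qed.

Lemma blaschke_identity (R0 : R) (u al : C) :
  Cmod (R0 * R0 - Cconj al * u) ^ 2 - R0 * R0 * Cmod (u - al) ^ 2
  = (R0 * R0 - Cmod u ^ 2) * (R0 * R0 - Cmod al ^ 2).
Proof. rewrite !Cmod2. destruct u as [a b]. destruct al as [x y]. simpl. ring. Qed.

(** Division by the Blaschke factor of [a]: it has modulus 1 on the bounding circle, so the quotient
    keeps the bound [M]. As [f] is controlled only on the open disc, the maximum principle is
    applied on circles of radius [s < r], and [s] then approaches [r]. *)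
Lemma schwarz_pick (f : C -> C) (c a : C) (r M : R) : 0 < M ->
  (forall z, Cmod (z - c) < r -> hol f z) -> (forall z, Cmod (z - c) < r -> Cmod (f z) <= M) ->
  Cmod (a - c) < r -> f a = 0 ->
  exists g : C -> C, (forall z, Cmod (z - c) < r -> hol g z) /\
    (forall z, Cmod (z - c) < r -> Cmod (g z) <= M) /\
    forall z, Cmod (z - c) < r ->
      (f z * (r * r - Cconj (a - c) * (z - c)) = r * (z - a) * g z)%C.
Proof.
  intros HM Hf HB Ha Hfa.
  pose proof (Cmod_ge_0 (a - c)) as Ha0.
  assert (Hr : 0 < r) by lra.
  assert (Nr : RtoC r <> 0) by (intros E; apply RtoC_inj in E; lra).
  destruct (hol_divide f a (Hf a Ha) Hfa) as [q [Hq1 Hq2]].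
  set (al := (a - c)%C) in *.
  set (g := fun z => (/ r * (q z * (r * r - Cconj al * (z - c))))%C).
  assert (Hg : forall z, Cmod (z - c) < r -> hol g z).
  { intros z Hz. apply hol_mult; [apply hol_const|]. apply hol_mult; [apply Hq2, Hf; auto|].
    apply hol_minus; [apply hol_const|]. apply hol_mult; [apply hol_const|].
    apply hol_minus; [apply hol_id|apply hol_const]. }
  assert (Heq : forall z, (f z * (r * r - Cconj al * (z - c)) = r * (z - a) * g z)%C).
  { intros z. rewrite (Hq1 z). unfold g. field. auto. }
  exists g. split; auto. split; auto.
  intros z Hz. pose proof (Cmod_ge_0 (z - c)) as Hz0.
  (* on the circle of radius [s < r], [|f| = |B| |g|] with [1 - |B|^2 = O(r - s)] *)
  set (D := (r * r - r * Cmod al)).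
  assert (HD : 0 < D) by (unfold D; nra).
  assert (Main : forall s, Cmod (z - c) < s < r -> Cmod al < s ->
    Cmod (g z) * sqrt (1 - (r * r - s * s) * (r * r) / (D * D)) <= M \/
    1 - (r * r - s * s) * (r * r) / (D * D) <= 0).
  { intros s Hs Hals. set (eta := (r * r - s * s) * (r * r) / (D * D)).
    destruct (Rle_or_lt (1 - eta) 0) as [|He]; [right; auto|left].
    pose proof (sqrt_lt_R0 _ He) as Hsq.
    apply Rmult_le_reg_r with (/ sqrt (1 - eta)); [apply Rinv_0_lt_compat; auto|].
    rewrite Rmult_assoc, Rinv_r, Rmult_1_r by lra.
    apply (max_modulus g c z s r); auto; [lra|apply Rdiv_lt_0_compat; auto| |lra].
    intros w Hw.
    assert (Hwr : Cmod (w - c) < r) by lra.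
    pose proof (Heq w) as E. apply (f_equal Cmod) in E. rewrite !Cmod_mult, Cmod_R, (Rabs_pos_eq r) in E by lra.
    pose proof (blaschke_identity r (w - c) al) as BI.
    replace (w - c - al)%C with (w - a)%C in BI by (unfold al; ring).
    set (X := Cmod (r * r - Cconj al * (w - c))%C) in *. set (Y := Cmod (w - a)) in *.
    assert (X0 : 0 <= X) by apply Cmod_ge_0. assert (Y0 : 0 <= Y) by apply Cmod_ge_0.
    assert (XD : D <= X).
    { unfold X, D. eapply Rle_trans; [|apply Cmod_tri_inv].
      rewrite <- RtoC_mult, Cmod_R, Rabs_pos_eq by nra.
      rewrite Cmod_mult, Cmod_conj, Hw. nra. }
    rewrite Hw in BI.
    assert (Key : X * X * (1 - eta) <= r * r * (Y * Y)).
    { assert (I1 : (r * r - s ^ 2) * (r * r - Cmod al ^ 2) <= X * X * eta).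
      { apply Rle_trans with (D * D * eta).
        - unfold eta. replace (D * D * ((r * r - s * s) * (r * r) / (D * D)))
            with ((r * r - s * s) * (r * r)) by (clearbody D; field; lra).
          replace (s ^ 2) with (s * s) by ring. apply Rmult_le_compat_l; [nra|]. nra.
        - apply Rmult_le_compat_r; [|nra]. unfold eta. apply Rmult_le_pos; [apply Rmult_le_pos; nra|].
          apply Rlt_le, Rinv_0_lt_compat. nra. }
      nra. }
    assert (K2 : X * sqrt (1 - eta) <= r * Y).
    { apply Rsqr_incr_0_var; [|nra]. unfold Rsqr.
      replace (X * sqrt (1 - eta) * (X * sqrt (1 - eta))) with (X * X * (sqrt (1 - eta) * sqrt (1 - eta))) by ring.
      rewrite sqrt_sqrt by lra. nra. }
    specialize (HB w Hwr). pose proof (Cmod_ge_0 (g w)) as G0.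
    assert (X1 : 0 < X) by lra.
    apply Rmult_le_reg_r with (X * sqrt (1 - eta)); [apply Rmult_lt_0_compat; auto|].
    replace (M * / sqrt (1 - eta) * (X * sqrt (1 - eta))) with (M * X) by (field; lra).
    apply Rle_trans with (Cmod (g w) * (r * Y)); [apply Rmult_le_compat_l; auto|].
    replace (Cmod (g w) * (r * Y)) with (r * Y * Cmod (g w)) by ring. rewrite <- E.
    apply Rmult_le_compat_r; auto. }
  apply Rnot_lt_le. intros Hlt. set (G := Cmod (g z)) in *.
  (* choose eta with [G^2 (1 - eta) > M^2] *)
  set (e0 := 1 - (M * M) / (G * G)).
  assert (He0 : 0 < e0 < 1).
  { unfold e0. assert (0 < M * M / (G * G)) by (apply Rdiv_lt_0_compat; nra).
    assert (M * M / (G * G) < 1); [|lra].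
    apply Rmult_lt_reg_r with (G * G); [nra|]. unfold Rdiv. rewrite Rmult_assoc, Rinv_l by nra. nra. }
  set (m := Rmax (Cmod (z - c)) (Cmod al)).
  assert (Hm : Cmod (z - c) <= m /\ Cmod al <= m /\ m < r).
  { unfold m. split; [apply Rmax_l|]. split; [apply Rmax_r|]. apply Rmax_lub_lt; auto. }
  set (del := e0 * (D * D) / (4 * (r * r * r))).
  assert (Hdel : 0 < del).
  { unfold del. assert (0 < D * D) by nra. assert (0 < r * r) by nra. apply Rdiv_lt_0_compat; nra. }
  set (s := Rmax ((m + r) / 2) (r - del)).
  assert (Hs : m < s < r).
  { split.
    - eapply Rlt_le_trans; [|apply Rmax_l]. lra.
    - apply Rmax_lub_lt; lra. }
  assert (Hsd : r - s <= del). { pose proof (Rmax_r ((m + r) / 2) (r - del)). unfold s. lra. }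
  assert (Heta : (r * r - s * s) * (r * r) / (D * D) < e0).
  { apply Rmult_lt_reg_r with (D * D); [nra|]. unfold Rdiv. rewrite Rmult_assoc, Rinv_l, Rmult_1_r by nra.
    assert (E4 : 4 * (r * r * r) * del = e0 * (D * D)). { unfold del. field. lra. }
    assert (r * r - s * s <= 2 * r * del) by nra.
    assert (0 < r * r) by nra.
    apply Rle_lt_trans with (2 * r * del * (r * r)); [apply Rmult_le_compat_r; lra|].
    assert (0 < e0 * (D * D)) by (apply Rmult_lt_0_compat; nra).
    replace (2 * r * del * (r * r)) with (e0 * (D * D) / 2) by (rewrite <- E4; field). lra. }
  destruct (Main s) as [H|H]; [lra|lra| |lra].
  assert (Hq : M * M < G * G * (1 - (r * r - s * s) * (r * r) / (D * D))).
  { apply Rle_lt_trans with (G * G * (1 - e0)).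
    - unfold e0. right. field. lra.
    - apply Rmult_lt_compat_l; nra. }
  set (q0 := 1 - (r * r - s * s) * (r * r) / (D * D)) in *.
  assert (0 < q0) by (unfold q0; lra).
  pose proof (sqrt_pos q0). pose proof (sqrt_sqrt q0 ltac:(lra)).
  assert (G * sqrt q0 * (G * sqrt q0) <= M * M).
  { apply Rmult_le_compat; auto; apply Rmult_le_pos; lra. }
  nra.
Qed.

Lemma blaschke_center (g f : C -> C) (c a : C) (r : R) : 0 < r ->
  (forall z, Cmod (z - c) < r -> (f z * (r * r - Cconj (a - c) * (z - c)) = r * (z - a) * g z)%C) ->
  Cmod (f c) = Cmod (a - c) / r * Cmod (g c).
Proof.
  intros Hr H. specialize (H c ltac:(rewrite Cmod_self; auto)).
  replace (r * r - Cconj (a - c) * (c - c))%C with (RtoC (r * r)) in H by (rewrite RtoC_mult; ring).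
  apply (f_equal Cmod) in H. rewrite !Cmod_mult, !Cmod_R, !Rabs_pos_eq, (Cmod_minus_sym c a) in H by nra.
  apply Rmult_eq_reg_r with (r * r); [|nra]. rewrite H. field. lra.
Qed.

(** Removing a zero gains a factor at most [s / r] at the centre and keeps the bound [M]; the other
    points remain zeros of the quotient because they are distinct from the one removed. *)
Lemma jensen_zeros (zs : list C) : forall (f : C -> C) (c : C) (s r M : R), 0 < M -> 0 <= s < r ->
  (forall z, Cmod (z - c) < r -> hol f z) -> (forall z, Cmod (z - c) < r -> Cmod (f z) <= M) ->
  NoDup zs -> (forall z, In z zs -> Cmod (z - c) <= s /\ f z = 0) ->
  Cmod (f c) <= M * (s / r) ^ length zs.
Proof.
  induction zs as [|a zs IH]; intros f c s r M HM Hs Hf HB Hnd Hz.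
  - simpl. rewrite Rmult_1_r. apply HB. rewrite Cmod_self; lra.
  - destruct (Hz a (or_introl eq_refl)) as [Ha Hfa].
    destruct (schwarz_pick f c a r M HM Hf HB ltac:(lra) Hfa) as [g [Hg [HBg Heq]]].
    rewrite (blaschke_center g f c a r ltac:(lra) Heq).
    inversion Hnd as [|? ? Hnin Hnd']; subst.
    assert (IHg : Cmod (g c) <= M * (s / r) ^ length zs).
    { apply IH; auto. intros z Hin. destruct (Hz z (or_intror Hin)) as [H1 H2]. split; auto.
      specialize (Heq z ltac:(lra)). rewrite H2, Cmult_0_l in Heq.
      destruct (Ceq_dec (g z) 0) as [|N]; auto. exfalso. symmetry in Heq. revert Heq.
      apply Cmult_neq_0; auto. apply Cmult_neq_0.
      - intros E. apply RtoC_inj in E. lra.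
      - intros E. apply Cminus_0_eq in E. subst. auto. }
    simpl. rewrite (Rmult_comm (s / r)), <- Rmult_assoc, Rmult_comm.
    apply Rmult_le_compat; auto using Cmod_ge_0.
    + apply Rmult_le_pos; [apply Cmod_ge_0|]. apply Rlt_le, Rinv_0_lt_compat; lra.
    + apply Rmult_le_compat_r; auto. apply Rlt_le, Rinv_0_lt_compat; lra.
Qed.

(** Vanishing to order at least [m], with a merely continuous cofactor and the point itself
    excluded: in this form the property passes directly to the quotient by a Blaschke factor. *)
Definition vanishes (f : C -> C) (z : C) (m : nat) : Prop :=
  exists rho h, 0 < rho /\ ccont h z /\
    forall w, Cmod (w - z) < rho -> w <> z -> (f w = (w - z) ^ m * h w)%C.

Lemma ccont_punctured_eq (f g : C -> C) (z : C) (rho : R) : 0 < rho -> ccont f z -> ccont g z ->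
  (forall w, Cmod (w - z) < rho -> w <> z -> f w = g w) -> f z = g z.
Proof.
  intros Hr Hf Hg H. apply Cminus_0_eq. destruct (Ceq_dec (f z - g z) 0) as [|N]; auto. exfalso.
  apply Cmod_gt_0 in N.
  destruct (Hf (Cmod (f z - g z) / 2)) as [d1 [D1 H1]]; [lra|].
  destruct (Hg (Cmod (f z - g z) / 2)) as [d2 [D2 H2]]; [lra|].
  set (d := Rmin rho (Rmin d1 d2) / 2).
  assert (Hd : 0 < d < rho /\ d < d1 /\ d < d2).
  { unfold d. pose proof (Rmin_pos rho (Rmin d1 d2) Hr (Rmin_pos _ _ D1 D2)).
    pose proof (Rmin_l rho (Rmin d1 d2)). pose proof (Rmin_r rho (Rmin d1 d2)).
    pose proof (Rmin_l d1 d2). pose proof (Rmin_r d1 d2). lra. }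
  set (w := (z + RtoC d)%C).
  assert (Hw : Cmod (w - z) = d).
  { unfold w. replace (z + RtoC d - z)%C with (RtoC d) by ring. rewrite Cmod_R, Rabs_pos_eq; lra. }
  assert (Nw : w <> z). { intros E. rewrite E, Cmod_self in Hw. lra. }
  specialize (H1 w ltac:(lra)). specialize (H2 w ltac:(lra)). specialize (H w ltac:(lra) Nw).
  rewrite H, Cmod_minus_sym in H1.
  pose proof (Cmod_tri_minus (f z) (g w) (g z)). lra.
Qed.

Lemma vanishes_S_zero (f : C -> C) (z : C) (m : nat) : ccont f z -> vanishes f z (S m) -> f z = 0.
Proof.
  intros Hf [rho [h [Hr [Hh H]]]].
  rewrite (ccont_punctured_eq f (fun w => (w + - z) ^ S m * h w)%C z rho); auto.
  - replace (z + - z)%C with (RtoC 0) by ring. simpl Cpow. ring.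
  - apply ccont_mult; auto. apply (ccont_pow (fun w => w + - z)%C).
    apply ccont_plus; [apply ccont_id|apply ccont_const].
Qed.

Lemma jensen_mult (m : nat) : forall (f : C -> C) (c z : C) (r M : R), 0 < M ->
  (forall z, Cmod (z - c) < r -> hol f z) -> (forall z, Cmod (z - c) < r -> Cmod (f z) <= M) ->
  Cmod (z - c) < r -> vanishes f z m ->
  Cmod (f c) <= M * (Cmod (z - c) / r) ^ m.
Proof.
  induction m as [|m IH]; intros f c z r M HM Hf HB Hz Hv; pose proof (Cmod_ge_0 (z - c)).
  - simpl. rewrite Rmult_1_r. apply HB. rewrite Cmod_self; lra.
  - assert (Hfz : f z = 0) by (apply vanishes_S_zero with m; auto; apply hol_ccont; auto).
    destruct (schwarz_pick f c z r M HM Hf HB Hz Hfz) as [g [Hg [HBg Heq]]].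
    rewrite (blaschke_center g f c z r ltac:(lra) Heq).
    assert (IHg : Cmod (g c) <= M * (Cmod (z - c) / r) ^ m).
    { apply IH; auto. destruct Hv as [rho [h [Hr [Hh Hv]]]].
      exists (Rmin rho (r - Cmod (z - c))), (fun w => / r * h w * (r * r - Cconj (z - c) * (w + - c)))%C.
      split; [apply Rmin_pos; lra|]. split.
      - apply ccont_mult; [apply ccont_mult; auto; apply ccont_const|].
        apply (ccont_plus _ (fun w => - (Cconj (z - c) * (w + - c)))%C); [apply ccont_const|].
        apply ccont_ext_loc with (fun w => - Cconj (z - c) * (w + - c))%C 1; [lra|intros; ring|].
        apply ccont_mult; [apply ccont_const|]. apply ccont_plus; [apply ccont_id|apply ccont_const].
      - intros w Hw Nw. pose proof (Rmin_l rho (r - Cmod (z - c))). pose proof (Rmin_r rho (r - Cmod (z - c))).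
        specialize (Hv w ltac:(lra) Nw).
        specialize (Heq w ltac:(pose proof (Cmod_tri_minus w z c); lra)).
        rewrite Hv in Heq. simpl Cpow in Heq.
        assert (N1 : (w - z)%C <> 0) by (intros E; apply Nw, Cminus_0_eq, E).
        assert (N2 : RtoC r <> 0) by (intros E; apply RtoC_inj in E; lra).
        assert (E : (g w = / (r * (w - z)) * (r * (w - z) * g w))%C) by (field; auto).
        rewrite E, <- Heq. unfold Cminus. field. auto. }
    simpl. set (q := Cmod (z - c) / r) in *.
    replace (M * (q * q ^ m)) with (q * (M * q ^ m)) by ring. unfold q in *.
    apply Rmult_le_compat; auto using Cmod_ge_0; [|lra].
    apply Rmult_le_pos; auto. apply Rlt_le, Rinv_0_lt_compat; lra.
Qed.

Definition zord (f : C -> C) (z : C) (m : nat) : Prop :=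
  exists rho g, 0 < rho /\ hol g z /\ g z <> 0 /\
    forall w, Cmod (w - z) < rho -> (f w = (w - z) ^ m * g w)%C.

Lemma zord_vanishes (f : C -> C) (z : C) (m : nat) : zord f z m -> vanishes f z m.
Proof.
  intros [rho [g [Hr [Hg [_ H]]]]]. exists rho, g. split; auto. split; auto. apply hol_ccont; auto.
Qed.

(** A zero of every order would make [f c] smaller than [M] times every power of [|z - c| / r]. A
    bound on a disc whose centre is not a zero thus plays the part of the identity theorem. *)
Lemma zord_exists (f : C -> C) (c z : C) (r M : R) :
  (forall z, Cmod (z - c) < r -> hol f z) -> (forall z, Cmod (z - c) < r -> Cmod (f z) <= M) ->
  f c <> 0 -> Cmod (z - c) < r -> exists m, zord f z m.
Proof.
  intros Hf HB Hc Hz. pose proof (proj1 (Cmod_gt_0 _) Hc) as P. pose proof (Cmod_ge_0 (z - c)) as Hz0.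
  assert (HM : 0 < M). { apply Rlt_le_trans with (Cmod (f c)); auto. apply HB. rewrite Cmod_self; lra. }
  apply NNPP. intros Hno.
  assert (All : forall m, exists g : C -> C, hol g z /\ forall w, (f w = (w - z) ^ m * g w)%C).
  { induction m as [|m [g [Hg Hm]]].
    - exists f. split; auto. intros w. simpl. ring.
    - destruct (Ceq_dec (g z) 0) as [E|N].
      + destruct (hol_divide g z Hg E) as [q [Hq1 Hq2]]. exists q. split; auto.
        intros w. rewrite (Hm w), (Hq1 w). simpl. ring.
      + exfalso. apply Hno. exists m, 1, g. split; [lra|]. auto. }
  assert (Hle : Cmod (f c) <= 0); [|lra].
  apply geom_small with M (Cmod (z - c) / r).
  { apply ratio_lt1. lra. }
  intros m. apply jensen_mult; auto.
  destruct (All m) as [g [Hg Hm]]. exists 1, g. split; [lra|]. split; [apply hol_ccont; auto|]. auto.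
Qed.

(** * The mean value inequality, the exponential and higher derivatives *)

Lemma C_norm_by_re (D : C) : exists k, Cmod k = 1 /\ Re (k * D)%C = Cmod D.
Proof.
  destruct (Ceq_dec D 0) as [->|N].
  - exists 1%C. split; [apply Cmod_1|]. rewrite Cmod_0. simpl. ring.
  - pose proof (proj1 (Cmod_gt_0 _) N) as P.
    assert (Nm : RtoC (Cmod D) <> 0). { intros E. apply RtoC_inj in E. lra. }
    exists (Cconj D / RtoC (Cmod D))%C. split.
    + rewrite Cmod_div by auto. rewrite Cmod_conj, Cmod_R, Rabs_pos_eq by lra. field; lra.
    + replace (Cconj D / RtoC (Cmod D) * D)%C with ((D * Cconj D) / RtoC (Cmod D))%C by (field; auto).
      rewrite <- Cmod2_conj, RtoC_pow.
      replace (RtoC (Cmod D) ^ 2 / RtoC (Cmod D))%C with (RtoC (Cmod D)) by (field; auto). reflexivity.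
Qed.

(** A rotation by [k] makes the increment real, so that the real mean value theorem can be applied
    to a single component. *)
Lemma cmvt (g : R -> C) (dg : R -> C) (a b M : R) : a <= b ->
  (forall t, a <= t <= b -> rderiv g t (dg t)) -> (forall t, a <= t <= b -> Cmod (dg t) <= M) ->
  Cmod (g b - g a) <= M * (b - a).
Proof.
  intros Hab Hd HM. destruct (C_norm_by_re (g b - g a)%C) as [k [Hk HE]].
  set (u := fun t => Re (k * g t)%C).
  assert (Hu : forall t, a <= t <= b -> is_derive u t (Re (k * dg t)%C)).
  { intros t Ht. apply (rderiv_re_im (fun t => k * g t)%C t (k * dg t)%C).
    pose proof (rderiv_comp (fun z => k * z)%C g t k (dg t) (Hd t Ht)) as X. apply X.
    exists (fun _ => k). split; [apply ccont_const|]. split; auto. intros; ring. }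
  destruct (MVT_gen u a b (fun t => Re (k * dg t)%C)) as [c [Hc Ec]].
  - intros t Ht. apply Hu. rewrite Rmin_left, Rmax_right in Ht by auto. lra.
  - intros t Ht. apply continuity_pt_filterlim.
    apply (ex_derive_continuous (V := R_NormedModule)). eexists. apply Hu.
    rewrite Rmin_left, Rmax_right in Ht by auto. lra.
  - rewrite Rmin_left, Rmax_right in Hc by auto.
    rewrite <- HE. replace (Re (k * (g b - g a))%C) with (u b - u a).
    + rewrite Ec. apply Rmult_le_compat_r; [lra|].
      eapply Rle_trans; [apply Rle_abs|]. eapply Rle_trans; [apply re_le_Cmod|].
      rewrite Cmod_mult, Hk, Rmult_1_l. apply HM. lra.
    + unfold u. replace (k * (g b - g a))%C with (k * g b - k * g a)%C by ring. reflexivity.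
Qed.

Definition Cexp (z : C) : C := (exp (Re z) * cis (Im z))%C.

Lemma Cexp_plus (a b : C) : (Cexp (a + b) = Cexp a * Cexp b)%C.
Proof.
  unfold Cexp. replace (Re (a + b)%C) with (Re a + Re b) by reflexivity.
  replace (Im (a + b)%C) with (Im a + Im b) by reflexivity.
  rewrite exp_plus, cis_plus, RtoC_mult. ring.
Qed.

Lemma Cexp_mod (z : C) : Cmod (Cexp z) = exp (Re z).
Proof.
  unfold Cexp. rewrite Cmod_mult, cis_mod, Cmod_R, Rabs_pos_eq; [ring|]. apply Rlt_le, exp_pos.
Qed.

Lemma Cexp_neq0 (z : C) : Cexp z <> 0.
Proof. apply Cmod_gt_0. rewrite Cexp_mod. apply exp_pos. Qed.

Lemma Cexp_0 : Cexp 0 = 1.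
Proof. unfold Cexp. simpl. rewrite exp_0, cis_0. ring. Qed.

Lemma Cexp_RtoC (x : R) : Cexp x = RtoC (exp x).
Proof. unfold Cexp. simpl. rewrite cis_0. ring. Qed.

Lemma Cexp_pow (z : C) (n : nat) : (Cexp z ^ n)%C = Cexp (INR n * z).
Proof.
  induction n as [|n IH].
  - simpl. rewrite Cmult_0_l, Cexp_0. auto.
  - rewrite Cpow_S, IH, <- Cexp_plus, S_INR. f_equal. rewrite RtoC_plus. ring.
Qed.

Lemma rderiv_Cexp_lin (h : C) (t : R) : rderiv (fun t => Cexp (t * h)) t (h * Cexp (t * h))%C.
Proof.
  destruct h as [x y].
  assert (E : forall t : R, Cexp (t * (x, y)) = (exp (t * x) * cos (t * y), exp (t * x) * sin (t * y))).
  { intros u. unfold Cexp, cis. simpl.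
    replace (u * x - 0 * y) with (u * x) by ring. replace (u * y + 0 * x) with (u * y) by ring.
    apply injective_projections; simpl; ring. }
  rewrite E.
  replace ((x, y) * (exp (t * x) * cos (t * y), exp (t * x) * sin (t * y))%R)%C with
    (x * exp (t * x) * cos (t * y) + exp (t * x) * (y * - sin (t * y)),
     x * exp (t * x) * sin (t * y) + exp (t * x) * (y * cos (t * y)))
    by (apply injective_projections; simpl; ring).
  pose proof (rderiv_of_re_im (fun t => exp (t * x) * cos (t * y)) (fun t => exp (t * x) * sin (t * y)) t
    (x * exp (t * x) * cos (t * y) + exp (t * x) * (y * - sin (t * y)))
    (x * exp (t * x) * sin (t * y) + exp (t * x) * (y * cos (t * y)))) as H.
  replace (fun t : R => Cexp (t * (x, y))) with
    (fun t => (exp (t * x) * cos (t * y), exp (t * x) * sin (t * y))).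
  - apply H; auto_derive; auto; ring.
  - apply functional_extensionality. intros; rewrite E; auto.
Qed.

Lemma Cexp_lin_bound (h : C) : Cmod h <= 1 -> Cmod (Cexp h - 1) <= 3 * Cmod h.
Proof.
  intros Hh. pose proof (cmvt (fun t => Cexp (t * h)) (fun t => h * Cexp (t * h))%C 0 1 (3 * Cmod h)) as H.
  cbv beta in H. rewrite Cmult_0_l, Cmult_1_l, Cexp_0 in H.
  eapply Rle_trans; [apply H|right; ring]; [lra|intros; apply rderiv_Cexp_lin|].
  intros t Ht. rewrite Cmod_mult, Cexp_mod, Rmult_comm.
  apply Rmult_le_compat_r; [apply Cmod_ge_0|].
  apply Rle_trans with (exp 1); [|apply exp_le_3].
  assert (Re (t * h)%C <= 1).
  { eapply Rle_trans; [apply Rle_abs|]. eapply Rle_trans; [apply re_le_Cmod|].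
    rewrite Cmod_RtoC_mult, Rabs_pos_eq by lra. pose proof (Cmod_ge_0 h). nra. }
  destruct H0 as [H0|H0]; [left; apply exp_increasing; auto|rewrite H0; lra].
Qed.

Lemma Cexp_quad_bound (h : C) : Cmod h <= 1 -> Cmod (Cexp h - 1 - h) <= 3 * Cmod h * Cmod h.
Proof.
  intros Hh. pose proof (Cmod_ge_0 h).
  pose proof (cmvt (fun t => Cexp (t * h) + - (t * h))%C (fun t => h * Cexp (t * h) + - h)%C 0 1
    (3 * Cmod h * Cmod h)) as H0.
  cbv beta in H0. rewrite Cmult_0_l, Cmult_1_l, Cexp_0 in H0.
  replace (Cexp h - 1 - h)%C with (Cexp h + - h - (1 + - 0))%C by ring.
  eapply Rle_trans; [apply H0|right; ring]; [lra| |].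
  - intros t Ht. destruct (rderiv_Cexp_lin h t) as [p [P1 [P2 P3]]].
    exists (fun u => p u + - h)%C. split; [apply rcat_plus; auto; apply rcat_const|].
    split; [rewrite P2; auto|]. intros u. rewrite (P3 u), RtoC_minus. ring.
  - intros t Ht. replace (h * Cexp (t * h) + - h)%C with (h * (Cexp (t * h) - 1))%C by ring.
    rewrite Cmod_mult, (Rmult_comm (3 * _)). apply Rmult_le_compat_l; auto.
    assert (Ht' : Cmod (t * h) <= Cmod h).
    { rewrite Cmod_RtoC_mult, Rabs_pos_eq by lra. nra. }
    eapply Rle_trans; [apply Cexp_lin_bound; lra|]. lra.
Qed.

Lemma cderiv_Cexp (z : C) : cderiv Cexp z (Cexp z).
Proof.
  apply cderiv_local with
    (fun w => if Ceq_dec w z then Cexp z else ((Cexp w - Cexp z) / (w - z))%C) 1; [lra| | |].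
  - intros e He. pose proof (Cexp_neq0 z) as N. apply Cmod_gt_0 in N.
    exists (Rmin 1 (e / (3 * Cmod (Cexp z)))). split.
    { apply Rmin_pos; [lra|]. apply Rdiv_lt_0_compat; lra. }
    intros w Hw. pose proof (Rmin_l 1 (e / (3 * Cmod (Cexp z)))).
    pose proof (Rmin_r 1 (e / (3 * Cmod (Cexp z)))).
    destruct (Ceq_dec z z) as [_|]; [|tauto].
    destruct (Ceq_dec w z) as [->|Nw]; [rewrite Cmod_self; auto|].
    assert (Nh : (w - z)%C <> 0) by (intros E; apply Nw, Cminus_0_eq, E).
    set (h := (w - z)%C) in *. assert (E : w = (z + h)%C) by (unfold h; ring).
    rewrite E, Cexp_plus.
    replace ((Cexp z * Cexp h - Cexp z) / h - Cexp z)%C with (Cexp z * (Cexp h - 1 - h) / h)%C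
      by (field; auto).
    rewrite Cmod_div, Cmod_mult by auto. pose proof (proj1 (Cmod_gt_0 _) Nh) as Hh.
    pose proof (Cexp_quad_bound h ltac:(lra)) as Q.
    apply Rle_lt_trans with (3 * Cmod (Cexp z) * Cmod h).
    + apply Rmult_le_reg_r with (Cmod h); auto. unfold Rdiv. rewrite Rmult_assoc, Rinv_l, Rmult_1_r by lra.
      nra.
    + apply Rlt_le_trans with (3 * Cmod (Cexp z) * (e / (3 * Cmod (Cexp z)))).
      * apply Rmult_lt_compat_l; lra.
      * right. field. lra.
  - destruct (Ceq_dec z z); tauto.
  - intros w _. destruct (Ceq_dec w z) as [->|N]; [ring|].
    field. intros E. apply N, Cminus_0_eq, E.
Qed.

Lemma hol_Cexp (z : C) : hol Cexp z.
Proof.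
  exists 1, Cexp. split; [lra|]. intros w _. split; [apply cderiv_Cexp|].
  eapply cderiv_ccont, cderiv_Cexp.
Qed.

(** The derivative is a locally uniform limit of difference quotients with a fixed real step [e];
    Cauchy-type integrals bound the error by a multiple of [e]. *)
Lemma hol_deriv (f df : C -> C) (c : C) (r : R) :
  (forall z, Cmod (z - c) < r -> hol f z) -> (forall z, Cmod (z - c) < r -> cderiv f z (df z)) ->
  forall z, Cmod (z - c) < r -> hol df z.
Proof.
  intros Hf Hd z Hz. pose proof PI_RGT_0 as HPI.
  destruct (hol_bounded_near f z (Hf z Hz)) as [r1 [M [Hr1 [HM [H1 H2]]]]].
  set (r2 := Rmin r1 (r - Cmod (z - c))).
  assert (Hr2 : 0 < r2 <= r1 /\ r2 <= r - Cmod (z - c)).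
  { unfold r2. pose proof (Rmin_l r1 (r - Cmod (z - c))). pose proof (Rmin_r r1 (r - Cmod (z - c))).
    pose proof (Rmin_pos r1 (r - Cmod (z - c)) Hr1 ltac:(lra)). lra. }
  set (s := r2 / 2). assert (Hs : 0 < s < r2) by (unfold s; lra).
  assert (HR : cauchy_rep f z s).
  { apply cauchy_formula with r2; auto. intros w Hw. apply H1. lra. }
  assert (HMc : forall t, Cmod (f (z + s * cis t)%C) <= M).
  { intros t. apply H2. replace (z + s * cis t - z)%C with (s * cis t)%C by ring. rewrite circ_mod; lra. }
  set (g := cauchy_density f z s).
  assert (Rg : rc g) by (apply rc_cauchy_density; auto).
  assert (Bg := cauchy_density_bound f z s M ltac:(lra) HMc). fold g in Bg.
  set (B := / (2 * PI) * (M * s)) in *.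
  assert (HB : 0 <= B).
  { eapply Rle_trans; [apply Cmod_ge_0|apply (Bg 0)]. }
  set (h := fun v t => (g t * / (s * cis t - (v - z)))%C).
  assert (Rh : forall v, Cmod (v - z) < s -> rc (h v)) by (intros; apply rc_CT; auto).
  assert (Bh : forall v, Cmod (v - z) < s -> forall t, Cmod (h v t) <= B / (s - Cmod (v - z))).
  { intros. apply rc_periodic_circ_bound; auto. }
  assert (Ef : forall v, Cmod (v - z) < s -> f v = CT g s (v - z)%C).
  { intros v Hv. unfold g. rewrite <- cauchy_rep_CT by auto. f_equal. ring. }
  assert (Ed : forall v, Cmod (v - z) < s -> df v = CT (h v) s (v - z)%C).
  { intros v Hv. apply (cderiv_unique f v).
    - apply Hd. pose proof (Cmod_tri_minus v z c). lra.
    - apply cderiv_ext_loc with (fun u => CT g s (u + - z)%C) (s - Cmod (v - z)); [lra| |].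
      + intros u Hu. symmetry. apply Ef. pose proof (Cmod_tri_minus u v z). lra.
      + replace (CT (h v) s (v - z)%C) with (CT (h v) s (v - z) * (1 + 0))%C by ring.
        apply (cderiv_comp (fun u => u + - z)%C (CT g s)).
        * apply cderiv_plus; [apply cderiv_id|apply cderiv_const].
        * apply (CT_cderiv g B); auto. }
  (* With [v] within [2 q] and [v + e] within [3 q] of [z], both keep distance at least [q] from the
     circle of radius [s = 4 q]. *)
  set (q := s / 4). assert (Hq : 0 < q) by (unfold q; lra).
  assert (Q0 : forall x y, 0 <= x -> 0 < y -> 0 <= x / y).
  { intros x y Hx Hy. apply Rmult_le_pos; auto. apply Rlt_le, Rinv_0_lt_compat; auto. }
  assert (Qi : forall x, q <= x -> 0 < / x <= / q).
  { intros x Hx. split; [apply Rinv_0_lt_compat; lra|apply Rinv_le_contravar; lra]. }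
  assert (Quo : forall v e, Cmod (v - z) < 2 * q -> 0 < e < q ->
    Cmod (df v - (f (v + e) - f v) / e)%C <= e * (2 * PI * (B / q / q / q))).
  { intros v e Hv He. assert (Hv' : Cmod (v - z) < s) by (unfold q in *; lra).
    assert (Ne : RtoC e <> 0) by (intros E0; apply RtoC_inj in E0; lra).
    assert (Hve : Cmod (v + e - z) <= 3 * q).
    { replace (v + e - z)%C with ((v - z) + e)%C by ring.
      eapply Rle_trans; [apply Cmod_triangle|]. rewrite Cmod_R, Rabs_pos_eq; lra. }
    assert (Hve' : Cmod (v + e - z) < s) by (unfold q in *; lra).
    rewrite (Ef v), (Ef (v + e)%C), (CT_diff g s (v - z) (v + e - z)), (Ed v) by auto.
    fold (h v). replace (v + e - z - (v - z))%C with (RtoC e) by ring.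
    replace (CT (h v) s (v - z) -
      (CT g s (v - z) + CT (h v) s (v + e - z) * e - CT g s (v - z)) / e)%C
      with (CT (h v) s (v - z) - CT (h v) s (v + e - z))%C by (field; auto).
    rewrite (CT_diff (h v) s (v - z) (v + e - z)) by auto.
    replace (v + e - z - (v - z))%C with (RtoC e) by ring.
    set (X := CT (fun t => h v t * / (s * cis t - (v - z)))%C s (v + e - z)%C).
    replace (CT (h v) s (v - z) - (CT (h v) s (v - z) + X * e))%C with (- (RtoC e * X))%C by ring.
    rewrite Cmod_opp, Cmod_RtoC_mult, Rabs_pos_eq by lra. apply Rmult_le_compat_l; [lra|].
    unfold X. eapply Rle_trans; [apply (CT_bound _ (B / (s - Cmod (v - z)) / (s - Cmod (v - z))))|].
    - apply rc_CT; auto.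
    - apply rc_periodic_circ_bound; auto.
    - auto.
    - apply Rmult_le_compat_l; [lra|].
      destruct (Qi (s - Cmod (v - z))) as [I1 I2]; [unfold q in *; lra|].
      destruct (Qi (s - Cmod (v + e - z)%C)) as [I3 I4]; [unfold q in *; lra|].
      unfold Rdiv. apply Rmult_le_compat; try lra.
      + apply Rmult_le_pos; [apply Rmult_le_pos|]; lra.
      + apply Rmult_le_compat; try lra.
        * apply Rmult_le_pos; lra.
        * apply Rmult_le_compat_l; lra. }
  apply (hol_weierstrass df z q (2 * q) (2 * PI * (B / q / q))).
  - lra.
  - intros v Hv. assert (Hv' : Cmod (v - z) < s) by (unfold q in *; lra).
    rewrite Ed by auto. eapply Rle_trans; [apply (CT_bound _ (B / (s - Cmod (v - z)))); auto|].
    apply Rmult_le_compat_l; [lra|].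
    destruct (Qi (s - Cmod (v - z))) as [I1 I2]; [unfold q in *; lra|].
    unfold Rdiv. apply Rmult_le_compat; try lra.
    + apply Rmult_le_pos; lra.
    + apply Rmult_le_compat_l; lra.
  - intros eps He.
    set (K := 2 * PI * (B / q / q / q) + 1).
    assert (HK : 0 < K).
    { unfold K. assert (0 <= 2 * PI * (B / q / q / q)); [|lra].
      apply Rmult_le_pos; [lra|]. repeat apply Q0; lra. }
    set (e := Rmin (q / 2) (eps / K)).
    assert (He2 : 0 < e < q /\ e <= eps / K).
    { unfold e. pose proof (Rmin_l (q / 2) (eps / K)). pose proof (Rmin_r (q / 2) (eps / K)).
      pose proof (Rmin_pos (q / 2) (eps / K) ltac:(lra) ltac:(apply Rdiv_lt_0_compat; auto)). lra. }
    exists (fun v => (f (v + e) - f v) / e)%C. split.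
    + intros v Hv. apply hol_mult; [|apply hol_const].
      apply hol_minus.
      * apply (hol_shift f e v). apply H1.
        replace (v + e - z)%C with ((v - z) + e)%C by ring.
        eapply Rle_lt_trans; [apply Cmod_triangle|]. rewrite Cmod_R, Rabs_pos_eq by lra. unfold q, s in *. lra.
      * apply H1. unfold q, s in *. lra.
    + intros v Hv. eapply Rle_trans; [apply Quo; auto; lra|].
      apply Rle_trans with (eps / K * K); [|right; field; lra].
      apply Rmult_le_compat; try lra; [|unfold K; lra].
      apply Rmult_le_pos; [lra|]. repeat apply Q0; lra.
  - rewrite Cmod_self. auto.
Qed.

(** * Finite sums, limits and majorised series *)

Fixpoint rsum (b : nat -> R) (n : nat) : R :=
  match n with O => 0 | S m => rsum b m + b m end.

Lemma rsum_le (a b : nat -> R) (n : nat) : (forall i, (i < n)%nat -> a i <= b i) -> rsum a n <= rsum b n.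
Proof. intros H. induction n as [|n IH]; simpl; [lra|]. pose proof (H n ltac:(lia)). assert (rsum a n <= rsum b n) by auto. lra. Qed.

Lemma rsum_ext (a b : nat -> R) (n : nat) : (forall i, (i < n)%nat -> a i = b i) -> rsum a n = rsum b n.
Proof. intros H. induction n as [|n IH]; simpl; auto. rewrite IH, H; auto. Qed.

Lemma rsum_nonneg (a : nat -> R) (n : nat) : (forall i, (i < n)%nat -> 0 <= a i) -> 0 <= rsum a n.
Proof. intros H. induction n as [|n IH]; simpl; [lra|]. pose proof (H n ltac:(lia)). assert (0 <= rsum a n) by auto. lra. Qed.

Lemma rsum_scal (c : R) (a : nat -> R) (n : nat) : rsum (fun i => c * a i) n = c * rsum a n.
Proof. induction n as [|n IH]; simpl; [ring|rewrite IH; ring]. Qed.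

Lemma rsum_plus (a b : nat -> R) (n : nat) : rsum (fun i => a i + b i) n = rsum a n + rsum b n.
Proof. induction n as [|n IH]; simpl; [ring|rewrite IH; ring]. Qed.

Lemma rsum_const (c : R) (n : nat) : rsum (fun _ => c) n = INR n * c.
Proof. induction n as [|n IH]; [simpl; ring|]. rewrite S_INR. simpl rsum. rewrite IH. ring. Qed.

Lemma csum_diff_le (a : nat -> C) (b : nat -> R) (m n : nat) : (forall i, (m <= i)%nat -> Cmod (a i) <= b i) ->
  (m <= n)%nat -> Cmod (csum a n - csum a m) <= rsum b n - rsum b m.
Proof.
  intros H Hmn. induction Hmn as [|n Hmn IH].
  - rewrite Cmod_self. lra.
  - simpl. replace (csum a n + a n - csum a m)%C with ((csum a n - csum a m) + a n)%C by ring.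
    eapply Rle_trans; [apply Cmod_triangle|]. specialize (H n Hmn). lra.
Qed.

Lemma csum_bound (a : nat -> C) (b : nat -> R) (n : nat) : (forall i, (i < n)%nat -> Cmod (a i) <= b i) ->
  Cmod (csum a n) <= rsum b n.
Proof.
  intros H. induction n as [|n IH]; simpl.
  - rewrite Cmod_0. lra.
  - eapply Rle_trans; [apply Cmod_triangle|].
    assert (Cmod (csum a n) <= rsum b n) by auto. specialize (H n ltac:(lia)). lra.
Qed.

Lemma rsum_sum_n (b : nat -> R) (n : nat) : rsum b (S n) = sum_n b n.
Proof.
  induction n as [|n IH].
  - rewrite sum_O. simpl. ring.
  - rewrite sum_Sn, <- IH. reflexivity.
Qed.

(* [B m] dominates all the partial tails [b m + ... + b (n-1)]. *)
Definition tails (b B : nat -> R) : Prop :=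
  (forall m n, (m <= n)%nat -> rsum b n - rsum b m <= B m) /\
  forall eps, 0 < eps -> exists N, forall n, (N <= n)%nat -> B n < eps.

Definition clim (x : nat -> C) (l : C) : Prop :=
  forall eps, 0 < eps -> exists N, forall n, (N <= n)%nat -> Cmod (x n - l) < eps.

Lemma clim_unique (x : nat -> C) (l m : C) : clim x l -> clim x m -> l = m.
Proof.
  intros H1 H2. apply Cminus_0_eq. destruct (Ceq_dec (l - m) 0) as [|N]; auto. exfalso.
  apply Cmod_gt_0 in N.
  destruct (H1 (Cmod (l - m) / 2)) as [N1 K1]; [lra|].
  destruct (H2 (Cmod (l - m) / 2)) as [N2 K2]; [lra|].
  specialize (K1 (max N1 N2) ltac:(lia)). specialize (K2 (max N1 N2) ltac:(lia)).
  pose proof (Cmod_tri_minus l (x (max N1 N2)) m) as T. rewrite (Cmod_minus_sym l (x _)) in T. lra.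
Qed.

Lemma clim_const (l : C) : clim (fun _ => l) l.
Proof. intros e He. exists 0%nat. intros. rewrite Cmod_self. auto. Qed.

Lemma clim_ccont (f : C -> C) (x : nat -> C) (l : C) : clim x l -> ccont f l -> clim (fun n => f (x n)) (f l).
Proof.
  intros Hx Hf e He. destruct (Hf e He) as [d [D H]]. destruct (Hx d D) as [N HN]. exists N. auto.
Qed.

Lemma clim_plus (x y : nat -> C) (l m : C) : clim x l -> clim y m -> clim (fun n => x n + y n)%C (l + m).
Proof.
  intros H1 H2 e He. destruct (H1 (e / 2)) as [N1 K1]; [lra|]. destruct (H2 (e / 2)) as [N2 K2]; [lra|].
  exists (max N1 N2). intros n Hn. specialize (K1 n ltac:(lia)). specialize (K2 n ltac:(lia)).
  replace (x n + y n - (l + m))%C with ((x n - l) + (y n - m))%C by ring.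
  eapply Rle_lt_trans; [apply Cmod_triangle|]. lra.
Qed.

Lemma clim_mult (x y : nat -> C) (l m : C) : clim x l -> clim y m -> clim (fun n => x n * y n)%C (l * m).
Proof.
  intros H1 H2 e He. pose proof (Cmod_ge_0 l). pose proof (Cmod_ge_0 m).
  destruct (H1 1) as [N0 K0]; [lra|].
  destruct (H1 (e / 2 / (Cmod m + 1))) as [N1 K1]; [apply Rdiv_lt_0_compat; lra|].
  destruct (H2 (e / 2 / (Cmod l + 1))) as [N2 K2]; [apply Rdiv_lt_0_compat; lra|].
  exists (max N0 (max N1 N2)). intros n Hn. specialize (K0 n ltac:(lia)). specialize (K1 n ltac:(lia)).
  specialize (K2 n ltac:(lia)).
  replace (x n * y n - l * m)%C with (x n * (y n - m) + (x n - l) * m)%C by ring.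
  eapply Rle_lt_trans; [apply Cmod_triangle|]. rewrite !Cmod_mult.
  pose proof (Cmod_tri_inv (x n) l).
  assert (Cmod (x n) * Cmod (y n - m) <= (Cmod l + 1) * Cmod (y n - m)).
  { apply Rmult_le_compat_r; [apply Cmod_ge_0|lra]. }
  assert ((Cmod l + 1) * Cmod (y n - m) < (Cmod l + 1) * (e / 2 / (Cmod l + 1))) by (apply Rmult_lt_compat_l; lra).
  assert (Cmod (x n - l) * Cmod m <= (e / 2 / (Cmod m + 1)) * (Cmod m + 1)).
  { apply Rmult_le_compat; try apply Cmod_ge_0; lra. }
  replace ((Cmod l + 1) * (e / 2 / (Cmod l + 1))) with (e / 2) in * by (field; lra).
  replace ((e / 2 / (Cmod m + 1)) * (Cmod m + 1)) with (e / 2) in * by (field; lra). lra.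
Qed.

Lemma clim_ext (x y : nat -> C) (l : C) : (forall n, x n = y n) -> clim x l -> clim y l.
Proof. intros E H. replace y with x; auto. apply functional_extensionality; auto. Qed.

Lemma clim_subseq (x : nat -> C) (l : C) (s : nat -> nat) : (forall n, (n <= s n)%nat) -> clim x l ->
  clim (fun n => x (s n)) l.
Proof.
  intros Hs H e He. destruct (H e He) as [N HN]. exists N. intros n Hn. apply HN. specialize (Hs n). lia.
Qed.

Lemma clim_le (x : nat -> C) (l a : C) (M : R) (N : nat) : clim x l ->
  (forall n, (N <= n)%nat -> Cmod (x n - a) <= M) -> Cmod (l - a) <= M.
Proof.
  intros H HM. apply Rnot_lt_le. intros Hlt.
  destruct (H (Cmod (l - a) - M)) as [N1 K1]; [lra|].
  specialize (K1 (max N N1) ltac:(lia)). specialize (HM (max N N1) ltac:(lia)).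
  pose proof (Cmod_tri_minus l (x (max N N1)) a) as T. rewrite (Cmod_minus_sym l (x _)) in T. lra.
Qed.

Lemma clim_exists (x : nat -> C) (B : nat -> R) :
  (forall m n, (m <= n)%nat -> Cmod (x n - x m) <= B m) ->
  (forall eps, 0 < eps -> exists N, forall n, (N <= n)%nat -> B n < eps) -> exists l, clim x l.
Proof.
  intros H HB.
  assert (C1 : forall p : C -> R, (forall a b, Rabs (p a - p b) <= Cmod (a - b)) -> Cauchy_crit (fun n => p (x n))).
  { intros p Hp e He. destruct (HB e He) as [N HN]. exists N. intros n m Hn Hm. unfold R_dist.
    eapply Rle_lt_trans; [apply Hp|].
    destruct (Nat.le_ge_cases n m) as [L|L].
    - rewrite Cmod_minus_sym. eapply Rle_lt_trans; [apply H; auto|]. apply HN; lia.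
    - eapply Rle_lt_trans; [apply H; auto|]. apply HN; lia. }
  destruct (Rcomplete.R_complete _ (C1 Re (fun a b => re_le_Cmod (a - b)))) as [l1 H1].
  destruct (Rcomplete.R_complete _ (C1 Im (fun a b => im_le_Cmod (a - b)))) as [l2 H2].
  exists (l1, l2). intros e He. destruct (H1 (e / 2)) as [N1 K1]; [lra|].
  destruct (H2 (e / 2)) as [N2 K2]; [lra|]. exists (max N1 N2). intros n Hn.
  eapply Rle_lt_trans; [apply Cmod_le_re_im|].
  specialize (K1 n ltac:(lia)). specialize (K2 n ltac:(lia)). unfold R_dist in *.
  change (Re (x n - (l1, l2))%C) with (Re (x n) - l1). change (Im (x n - (l1, l2))%C) with (Im (x n) - l2). lra.
Qed.

Lemma cseries_exists (a : nat -> C) (b B : nat -> R) : (forall n, Cmod (a n) <= b n) -> tails b B ->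
  exists l, clim (csum a) l /\ forall n, Cmod (l - csum a n) <= B n.
Proof.
  intros Hab [HB1 HB2].
  assert (K : forall m n, (m <= n)%nat -> Cmod (csum a n - csum a m) <= B m).
  { intros m n Hmn. eapply Rle_trans; [apply (csum_diff_le a b); auto|]. auto. }
  destruct (clim_exists (csum a) B K HB2) as [l Hl]. exists l. split; auto.
  intros n. apply (clim_le (csum a) l _ _ n); auto.
Qed.

Lemma tails_geom (A q : R) : 0 <= A -> 0 <= q < 1 ->
  tails (fun n => A * q ^ n) (fun n => A * q ^ n * / (1 - q)).
Proof.
  intros HA Hq. split.
  - intros m n Hmn.
    assert (E : forall k, rsum (fun n => A * q ^ n) k = A * (1 - q ^ k) * / (1 - q)).
    { induction k as [|k IH]; simpl; [field; lra|]. rewrite IH. field. lra. }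
    rewrite !E. assert (0 <= A * q ^ n * / (1 - q)).
    { apply Rmult_le_pos; [apply Rmult_le_pos; auto; apply pow_le; lra|].
      apply Rlt_le, Rinv_0_lt_compat; lra. }
    lra.
  - intros e He. destruct (pow_lt_1_zero q) with (y := e * (1 - q) / (A + 1)) as [N HN].
    + rewrite Rabs_pos_eq; lra.
    + apply Rdiv_lt_0_compat; [|lra]. apply Rmult_lt_0_compat; lra.
    + exists N. intros n Hn. specialize (HN n Hn). rewrite Rabs_pos_eq in HN by (apply pow_le; lra).
      apply Rmult_lt_reg_r with (1 - q); [lra|]. rewrite Rmult_assoc, Rinv_l, Rmult_1_r by lra.
      apply Rle_lt_trans with ((A + 1) * q ^ n).
      * apply Rmult_le_compat_r; [apply pow_le|]; lra.
      * apply Rmult_lt_compat_l with (r := A + 1) in HN; [|lra].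
        replace ((A + 1) * (e * (1 - q) / (A + 1))) with (e * (1 - q)) in HN by (field; lra). auto.
Qed.

Lemma cis_reduce (t : R) : exists t0, 0 <= t0 <= 2 * PI /\ cis t0 = cis t.
Proof.
  pose proof PI_RGT_0 as HPI.
  assert (Hn : forall k : nat, cis (INR k * (2 * PI)) = 1).
  { intros k. rewrite <- cis_pow, cis_2PI. apply Cpow_1_l. }
  assert (Hz : forall z : Z, cis (IZR z * (2 * PI)) = 1).
  { intros z. destruct (Z.le_gt_cases 0 z) as [H|H].
    - rewrite <- (Z2Nat.id z) by auto. rewrite <- INR_IZR_INZ. apply Hn.
    - replace (IZR z * (2 * PI)) with (- (IZR (- z) * (2 * PI))) by (rewrite opp_IZR; ring).
      rewrite <- (Z2Nat.id (- z)) by lia. rewrite <- INR_IZR_INZ, cis_opp, Hn. field. }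
  destruct (archimed (t / (2 * PI))) as [H1 H2]. set (z := up (t / (2 * PI))) in *.
  exists (t + IZR (1 - z) * (2 * PI)). split.
  - rewrite minus_IZR. assert (E : t = t / (2 * PI) * (2 * PI)) by (field; lra). nra.
  - rewrite cis_plus, Hz. ring.
Qed.

Lemma circle_bounded (f : C -> C) (c : C) (r : R) : rc (fun t => f (c + r * cis t)%C) ->
  exists M, 0 < M /\ forall t, Cmod (f (c + r * cis t)%C) <= M.
Proof.
  intros H. pose proof PI_RGT_0 as HPI.
  destruct (continuity_ab_maj (fun t => Cmod (f (c + r * cis t)%C)) 0 (2 * PI)) as [x [Hx _]]; [lra| |].
  - intros t _ e He. destruct (H t e He) as [d [D HD]]. exists d. split; auto.
    intros u [_ Hu]. simpl in *. unfold R_dist in *. specialize (HD u Hu).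
    eapply Rle_lt_trans; [|apply HD].
    pose proof (Cmod_tri_inv (f (c + r * cis u)%C) (f (c + r * cis t)%C)).
    pose proof (Cmod_tri_inv (f (c + r * cis t)%C) (f (c + r * cis u)%C)) as T.
    rewrite Cmod_minus_sym in T. apply Rabs_le. lra.
  - exists (Cmod (f (c + r * cis x)%C) + 1). pose proof (Cmod_ge_0 (f (c + r * cis x)%C)). split; [lra|].
    intros t. destruct (cis_reduce t) as [t0 [Ht0 E]]. rewrite <- E. specialize (Hx t0 Ht0). simpl in Hx. lra.
Qed.

Lemma hol_csum (a : nat -> C -> C) (n : nat) (z : C) : (forall k, hol (a k) z) ->
  hol (fun w => csum (fun k => a k w) n) z.
Proof.
  intros H. induction n as [|n IH]; simpl; [apply hol_const|]. apply hol_plus; auto.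
Qed.

(** * Primitives, logarithms and the growth of zero-free functions *)

Lemma cderiv_pow_S (a c : C) (k : nat) (z : C) :
  cderiv (fun w => a * (w - c) ^ S k * / INR (S k))%C z (a * (z - c) ^ k).
Proof.
  assert (N : RtoC (INR (S k)) <> 0).
  { intros E. apply RtoC_inj in E. revert E. apply not_0_INR. lia. }
  assert (D : forall m, cderiv (fun w => (w - c) ^ S m)%C z (INR (S m) * (z - c) ^ m)).
  { induction m as [|m IH].
    - apply cderiv_ext_loc with (fun w => w + - c)%C 1; [lra|intros; simpl; ring|].
      replace (INR 1 * (z - c) ^ 0)%C with (1 + 0)%C by (simpl; ring).
      apply cderiv_plus; [apply cderiv_id|apply cderiv_const].
    - assert (I : cderiv (fun w => w - c)%C z 1).
      { replace (RtoC 1) with (1 + 0)%C by ring. apply cderiv_plus; [apply cderiv_id|apply cderiv_const]. }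
      pose proof (cderiv_mult _ _ _ _ _ I IH) as X. simpl in X.
      replace (INR (S (S m)) * (z - c) ^ S m)%C
        with (1 * (z - c) ^ S m + (z - c) * (INR (S m) * (z - c) ^ m))%C.
      + exact X.
      + rewrite (S_INR (S m)), RtoC_plus. simpl Cpow. ring. }
  pose proof (cderiv_mult _ _ _ _ _ (cderiv_const (a * / INR (S k)) z) (D k)) as X. simpl in X.
  apply cderiv_ext_loc with (fun w => a * / INR (S k) * (w - c) ^ S k)%C 1; [lra|intros; ring|].
  replace (a * (z - c) ^ k)%C with
    (0 * (z - c) ^ S k + a * / INR (S k) * (INR (S k) * (z - c) ^ k))%C; [exact X|].
  set (q := ((z - c) ^ k)%C). set (q' := ((z - c) ^ S k)%C). field. auto.
Qed.

Lemma cderiv_csum (a : nat -> C -> C) (da : nat -> C) (n : nat) (z : C) :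
  (forall k, cderiv (a k) z (da k)) -> cderiv (fun w => csum (fun k => a k w) n) z (csum da n).
Proof.
  intros H. induction n as [|n IH]; simpl; [apply cderiv_const|]. apply cderiv_plus; auto.
Qed.

(** The Taylor series of [h] is integrated term by term. The derivative of the result is identified
    with [h] by comparing both with the same partial sum: Cauchy's estimate for the tail of [L] on
    one side, the Taylor remainder of [h] on the other, each of size [q^n]. *)
Lemma primitive_exists (h : C -> C) (c : C) (r r' : R) : 0 < r < r' ->
  (forall z, Cmod (z - c) < r' -> hol h z) ->
  exists L : C -> C, forall z, Cmod (z - c) < r -> hol L z /\ cderiv L z (h z).
Proof.
  intros Hr Hh. set (r1 := (r + r') / 2). set (r2 := (r + r1) / 2).
  assert (Hr1 : r < r2 < r1 /\ r1 < r') by (unfold r2, r1; lra).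
  assert (HR : cauchy_rep h c r1) by (apply cauchy_formula with r'; auto; lra).
  destruct (circle_bounded h c r1 (proj1 HR)) as [M [HM HB]].
  destruct (taylor h c r1 M ltac:(lra) HR HB) as [a [Ha1 Ha2]].
  set (q := r2 / r1). assert (Hq : 0 <= q < 1) by (unfold q; apply ratio_lt1; lra).
  set (T := fun k w => (a k * (w - c) ^ S k * / INR (S k))%C).
  assert (HT : forall k w, Cmod (w - c) < r2 -> Cmod (T k w) <= M * r1 * q ^ k).
  { intros k w Hw. unfold T. rewrite !Cmod_mult.
    assert (N : RtoC (INR (S k)) <> 0).
    { intros E. apply RtoC_inj in E. revert E. apply not_0_INR. lia. }
    rewrite Cmod_inv, Cmod_R, Cmod_pow by auto. pose proof (Cmod_ge_0 (w - c)) as W0.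
    assert (I1 : / Rabs (INR (S k)) <= 1).
    { rewrite Rabs_pos_eq by apply pos_INR. rewrite <- Rinv_1. apply Rinv_le_contravar; [lra|].
      rewrite S_INR. pose proof (pos_INR k). lra. }
    assert (I2 : Cmod (w - c) ^ S k <= r2 ^ S k) by (apply pow_incr; lra).
    assert (P1 : 0 < r1 ^ k) by (apply pow_lt; lra).
    assert (I3 : Cmod (a k) <= M / r1 ^ k).
    { apply Rmult_le_reg_r with (r1 ^ k); auto. unfold Rdiv. rewrite Rmult_assoc, Rinv_l by lra.
      rewrite Rmult_1_r. auto. }
    apply Rle_trans with (M / r1 ^ k * r2 ^ S k * 1).
    - apply Rmult_le_compat; auto.
      + apply Rmult_le_pos; [apply Cmod_ge_0|apply pow_le; auto].
      + rewrite <- Rabs_inv. apply Rabs_pos.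
      + apply Rmult_le_compat; auto using Cmod_ge_0. apply pow_le; auto.
    - unfold q. unfold Rdiv at 2. rewrite Rpow_mult_distr, pow_inv. simpl.
      replace (M / r1 ^ k * (r2 * r2 ^ k) * 1) with (M * r2 * (r2 ^ k * / r1 ^ k)) by (field; lra).
      apply Rmult_le_compat_r; [|nra]. apply Rmult_le_pos; [apply pow_le; lra|].
      apply Rlt_le, Rinv_0_lt_compat; auto. }
  pose proof (tails_geom (M * r1) q ltac:(nra) Hq) as HTl.
  assert (Lex : forall w, exists l, Cmod (w - c) < r2 ->
     clim (csum (fun k => T k w)) l /\ forall n, Cmod (l - csum (fun k => T k w) n) <= M * r1 * q ^ n * / (1 - q)).
  { intros w. destruct (Rlt_or_le (Cmod (w - c)) r2) as [H|H].
    - destruct (cseries_exists (fun k => T k w) _ _ (fun k => HT k w H) HTl) as [l Hl]. exists l. auto.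
    - exists 0%C. intros; lra. }
  destruct (choice _ Lex) as [L HL].
  assert (HL2 : forall w n, Cmod (w - c) < r2 -> Cmod (L w - csum (fun k => T k w) n) <= M * r1 * q ^ n * / (1 - q)).
  { intros w n Hw. apply (HL w Hw). }
  exists L. intros z Hz.
  assert (HolL : forall z, Cmod (z - c) < (r + r2) / 2 -> hol L z).
  { apply (hol_weierstrass L c ((r + r2) / 2) r2 (M * r1 * q ^ 0 * / (1 - q))); [lra| |].
    - intros w Hw. pose proof (HL2 w 0%nat Hw) as B. cbn [csum] in B.
      replace (L w - 0)%C with (L w) in B by ring. auto.
    - intros e He. destruct HTl as [_ HTl]. destruct (HTl e He) as [N HN].
      exists (fun w => csum (fun k => T k w) N). split.
      + intros w Hw. apply hol_csum. intros k. unfold T. apply hol_mult; [|apply hol_const].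
        apply hol_mult; [apply hol_const|]. apply (hol_pow (fun w => w - c)%C).
        apply hol_minus; [apply hol_id|apply hol_const].
      + intros w Hw. eapply Rle_trans; [apply HL2; auto|]. left. apply HN; auto. }
  split; [apply HolL; lra|].
  destruct (hol_cderiv L z) as [d Hd]; [apply HolL; lra|].
  replace (h z) with d; auto. apply Cminus_0_eq, Cmod_eq_0, Rle_antisym; [|apply Cmod_ge_0].
  set (s := ((r + r2) / 2 - r) / 2). assert (Hs : 0 < s) by (unfold s; lra).
  apply geom_small with (M * r1 * / (1 - q) / s + M * (r1 / (r1 - Cmod (z - c)))) q; auto.
  intros n.
  pose proof (cderiv_csum T (fun k => a k * (z - c) ^ k)%C n z (fun k => cderiv_pow_S (a k) c k z)) as Dn.
  assert (B1 : Cmod (d - csum (fun k => a k * (z - c) ^ k) n)%C <= M * r1 * q ^ n * / (1 - q) / s).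
  { apply (deriv_bound (fun w => L w + - csum (fun k => T k w) n)%C z _ s (2 * s)).
    - lra.
    - intros w Hw. pose proof (Cmod_tri_minus w z c).
      apply hol_minus; [apply HolL; unfold s in *; lra|].
      apply hol_csum. intros k. unfold T. apply hol_mult; [|apply hol_const].
        apply hol_mult; [apply hol_const|]. apply (hol_pow (fun w => w - c)%C).
        apply hol_minus; [apply hol_id|apply hol_const].
    - intros w Hw. pose proof (Cmod_tri_minus w z c). apply HL2. unfold s in *. lra.
    - apply cderiv_plus; auto.
      pose proof (cderiv_mult _ _ _ _ _ (cderiv_const (- (1)) z) Dn) as X. cbv beta in X.
      apply cderiv_ext_loc with (fun w => - (1) * csum (fun k => T k w) n)%C 1; [lra|intros; ring|].
      replace (- csum (fun k => a k * (z - c) ^ k) n)%C with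
        (0 * csum (fun k => T k z) n + - (1) * csum (fun k => a k * (z - c) ^ k) n)%C by ring. exact X. }
  assert (B2 : Cmod (h z - csum (fun k => a k * (z - c) ^ k) n)%C <= M * (r1 / (r1 - Cmod (z - c))) * q ^ n).
  { pose proof (Ha2 (z - c)%C n ltac:(lra)) as B. replace (c + (z - c))%C with z in B by ring.
    eapply Rle_trans; [exact B|]. apply Rmult_le_compat_l.
    - apply Rmult_le_pos; [lra|]. apply Rlt_le, Rdiv_lt_0_compat; lra.
    - apply pow_incr. pose proof (Cmod_ge_0 (z - c)). split.
      + apply Rmult_le_pos; auto. apply Rlt_le, Rinv_0_lt_compat; lra.
      + apply Rmult_le_compat_r; [|lra]. apply Rlt_le, Rinv_0_lt_compat; lra. }
  pose proof (Cmod_tri_minus d (csum (fun k => a k * (z - c) ^ k) n)%C (h z)) as T1.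
  rewrite (Cmod_minus_sym (csum _ n) (h z)) in T1.
  replace ((M * r1 * / (1 - q) / s + M * (r1 / (r1 - Cmod (z - c)))) * q ^ n) with
    (M * r1 * q ^ n * / (1 - q) / s + M * (r1 / (r1 - Cmod (z - c))) * q ^ n) by (unfold Rdiv; ring).
  lra.
Qed.

(** [L] is a primitive of [f' / f] vanishing at [c]; then [f * exp (- L)] has zero derivative and is
    constant on segments from [c]. *)
Lemma log_exists (f : C -> C) (c : C) (r r' : R) : 0 < r < r' ->
  (forall z, Cmod (z - c) < r' -> hol f z) -> (forall z, Cmod (z - c) < r' -> f z <> 0) ->
  exists L : C -> C, L c = 0 /\ (forall z, Cmod (z - c) < r -> hol L z) /\
    forall z, Cmod (z - c) < r -> (f z = f c * Cexp (L z))%C.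
Proof.
  intros Hr Hf Hn.
  destruct (hol_global_deriv f (fun z => Cmod (z - c) < r')%R Hf) as [df Hdf].
  assert (Hdh : forall z, Cmod (z - c) < r' -> hol df z).
  { apply (hol_deriv f df c r'); auto. intros z Hz. apply Hdf; auto. }
  destruct (primitive_exists (fun z => df z / f z)%C c r r' Hr) as [L0 HL0].
  { intros z Hz. apply hol_div; auto. }
  set (L := fun z => (L0 z - L0 c)%C).
  exists L. split; [unfold L; ring|]. split.
  - intros z Hz. apply hol_minus; [apply HL0; auto|apply hol_const].
  - intros z Hz.
    set (Phi := fun w => (f w * Cexp (- (1) * L w))%C).
    assert (DPhi : forall w, Cmod (w - c) < r -> cderiv Phi w 0).
    { intros w Hw. destruct (HL0 w Hw) as [_ D0].
      assert (DL : cderiv L w (df w / f w)%C).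
      { replace (df w / f w)%C with (df w / f w + 0)%C by ring.
        apply cderiv_plus; auto. apply cderiv_const. }
      pose proof (cderiv_mult _ _ _ _ _ (cderiv_const (- (1)) w) DL) as D1. cbv beta in D1.
      pose proof (cderiv_comp _ Cexp _ _ _ D1 (cderiv_Cexp _)) as D2. cbv beta in D2.
      destruct (Hdf w ltac:(lra)) as [D3 _].
      pose proof (cderiv_mult _ _ _ _ _ D3 D2) as D4. cbv beta in D4.
      replace (RtoC 0) with (df w * Cexp (- (1) * L w) + f w * (Cexp (- (1) * L w) *
        (0 * L w + - (1) * (df w / f w))))%C; [exact D4|].
      pose proof (Hn w ltac:(lra)). field. auto. }
    assert (E : Phi z = Phi c).
    { apply Cminus_0_eq, Cmod_eq_0, Rle_antisym; [|apply Cmod_ge_0].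
      pose proof (cmvt (fun t => Phi (c + t * (z - c))%C) (fun t => 0 * (z - c))%C 0 1 0 ltac:(lra)) as X.
      cbv beta in X.
      replace (c + 1 * (z - c))%C with z in X by ring. replace (c + 0 * (z - c))%C with c in X by ring.
      apply Rle_trans with (0 * (1 - 0)); [apply X|lra].
      - intros t Ht. apply (rderiv_comp Phi (fun t => c + t * (z - c))%C); [apply rderiv_affine|].
        apply DPhi. replace (c + t * (z - c) - c)%C with (t * (z - c))%C by ring.
        rewrite Cmod_RtoC_mult, Rabs_pos_eq by lra. pose proof (Cmod_ge_0 (z - c)). nra.
      - intros t Ht. rewrite Cmult_0_l, Cmod_0. lra. }
    unfold Phi in E. replace (- (1) * L c)%C with (RtoC 0) in E by (unfold L; ring).
    rewrite Cexp_0, Cmult_1_r in E. rewrite <- E, <- Cmult_assoc, <- Cexp_plus.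
    replace (- (1) * L z + L z)%C with (RtoC 0) by ring. rewrite Cexp_0. ring.
Qed.

(** The map [L / (2 A - L)] sends the half-plane [Re <= A] into the unit disc and fixes 0. Schwarz's
    lemma, here [schwarz_pick] with its zero at the centre, bounds it by [|z - c| / r], and
    inverting the map gives the estimate. *)
Lemma borel_caratheodory (L : C -> C) (c z : C) (r A : R) : 0 < A ->
  (forall z, Cmod (z - c) < r -> hol L z) -> L c = 0 ->
  (forall z, Cmod (z - c) < r -> Re (L z) <= A) -> Cmod (z - c) < r ->
  Cmod (L z) <= 2 * A * Cmod (z - c) / (r - Cmod (z - c)).
Proof.
  intros HA HL H0 HRe Hz. pose proof (Cmod_ge_0 (z - c)) as Hz0.
  assert (Nd : forall w, Cmod (w - c) < r -> (2 * A - L w)%C <> 0).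
  { intros w Hw E. specialize (HRe w Hw). apply (f_equal Re) in E.
    destruct (L w) as [a b]. simpl in *. lra. }
  set (phi := fun w => (L w / (2 * A - L w))%C).
  assert (Hphi : forall w, Cmod (w - c) < r -> hol phi w).
  { intros w Hw. apply hol_div; auto. apply hol_minus; auto. apply hol_const. }
  assert (Bphi : forall w, Cmod (w - c) < r -> Cmod (phi w) <= 1).
  { intros w Hw. unfold phi. rewrite Cmod_div by auto.
    pose proof (Nd w Hw) as N. apply Cmod_gt_0 in N.
    apply Rmult_le_reg_r with (Cmod (2 * A - L w)); auto.
    unfold Rdiv. rewrite Rmult_assoc, Rinv_l, Rmult_1_r, Rmult_1_l by lra.
    apply Rsqr_incr_0_var; [|lra]. rewrite !Rsqr_pow2, !Cmod2. specialize (HRe w Hw).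
    destruct (L w) as [a b]. simpl in *. nra. }
  destruct (schwarz_pick phi c c r 1) as [g [_ [Bg Eg]]]; auto; try lra.
  { rewrite Cmod_self. lra. }
  { unfold phi. rewrite H0. unfold Cdiv. ring. }
  specialize (Bg z Hz). specialize (Eg z Hz).
  replace (r * r - Cconj (c - c) * (z - c))%C with (RtoC (r * r)) in Eg.
  2:{ replace (c - c)%C with (RtoC 0) by ring. rewrite RtoC_mult.
      replace (Cconj 0) with (RtoC 0) by (apply injective_projections; simpl; ring). ring. }
  assert (Hp : Cmod (phi z) <= Cmod (z - c) / r).
  { apply (f_equal Cmod) in Eg. rewrite !Cmod_mult, !Cmod_R, !Rabs_pos_eq in Eg by nra.
    apply Rmult_le_reg_r with (r * r); [nra|]. rewrite Eg.
    replace (Cmod (z - c) / r * (r * r)) with (r * Cmod (z - c) * 1) by (field; lra).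
    apply Rmult_le_compat_l; nra. }
  assert (Hlt : Cmod (z - c) / r < 1) by (apply ratio_lt1; lra).
  assert (N1 : (1 + phi z)%C <> 0).
  { intros E. assert (E1 : phi z = (- (1))%C) by (replace (phi z) with (1 + phi z - 1)%C by ring; rewrite E; ring).
    rewrite E1, Cmod_m1 in Hp. lra. }
  assert (EL : L z = (2 * A * phi z / (1 + phi z))%C).
  { unfold phi in *. pose proof (Nd z Hz).
    assert (RtoC A <> 0) by (intros E; apply RtoC_inj in E; lra).
    field. repeat split; auto. replace (2 * A - L z + L z)%C with (2 * A)%C by ring.
    apply Cmult_neq_0; auto. intros E; apply RtoC_inj in E; lra. }
  rewrite EL, Cmod_div, Cmod_mult by auto.
  rewrite <- RtoC_mult, Cmod_R, Rabs_pos_eq by lra.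
  assert (Hl : 1 - Cmod (z - c) / r <= Cmod (1 + phi z)).
  { pose proof (Cmod_tri_inv 1 (- phi z)%C) as T. rewrite Cmod_1, Cmod_opp in T.
    replace (1 - - phi z)%C with (1 + phi z)%C in T by ring. lra. }
  apply Rle_trans with (2 * A * (Cmod (z - c) / r) / (1 - Cmod (z - c) / r)).
  - unfold Rdiv at 1 3. apply Rmult_le_compat.
    + apply Rmult_le_pos; [lra|apply Cmod_ge_0].
    + apply Rlt_le, Rinv_0_lt_compat. lra.
    + apply Rmult_le_compat_l; lra.
    + apply Rinv_le_contravar; lra.
  - right. field. lra.
Qed.

(** Reconciles expansions obtained on circles of different radii. Once the lower coefficients agree,
    the remainders leave [|a k - b k| x^k <= K x^(k+1)] for small real [x]. *)
Lemma taylor_unique (f : C -> C) (c : C) (a b : nat -> C) (rho A B ra rb : R) : 0 < rho ->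
  rho < ra -> rho < rb -> 0 <= A -> 0 <= B ->
  (forall w n, Cmod w < rho -> Cmod (f (c + w) - csum (fun k => a k * w ^ k) n)%C <= A * (Cmod w / ra) ^ n) ->
  (forall w n, Cmod w < rho -> Cmod (f (c + w) - csum (fun k => b k * w ^ k) n)%C <= B * (Cmod w / rb) ^ n) ->
  forall k, a k = b k.
Proof.
  intros Hr Hra Hrb HA HB H1 H2 k. induction k as [k IH] using lt_wf_ind.
  apply Cminus_0_eq, Cmod_eq_0, Rle_antisym; [|apply Cmod_ge_0].
  apply Rnot_lt_le. intros Hpos. set (X := Cmod (a k - b k)) in *.
  set (K := (A + B) * (/ rho) ^ S k + 1).
  assert (HK : 0 < K).
  { unfold K. assert (0 <= (A + B) * (/ rho) ^ S k); [|lra].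
    apply Rmult_le_pos; [lra|]. apply pow_le, Rlt_le, Rinv_0_lt_compat; auto. }
  set (x := Rmin (rho / 2) (X / (2 * K))).
  assert (Hx : 0 < x < rho /\ x <= X / (2 * K)).
  { unfold x. pose proof (Rmin_l (rho / 2) (X / (2 * K))). pose proof (Rmin_r (rho / 2) (X / (2 * K))).
    pose proof (Rmin_pos (rho / 2) (X / (2 * K)) ltac:(lra) ltac:(apply Rdiv_lt_0_compat; lra)). lra. }
  assert (Hm : Cmod x = x) by (rewrite Cmod_R, Rabs_pos_eq; lra).
  specialize (H1 (RtoC x) (S k) ltac:(lra)). specialize (H2 (RtoC x) (S k) ltac:(lra)). rewrite Hm in H1, H2.
  cbn [csum] in H1, H2.
  rewrite (csum_ext (fun i => a i * x ^ i)%C (fun i => b i * x ^ i)%C) in H1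
    by (intros i Hi; rewrite IH; auto).
  set (S0 := csum _ k) in *.
  assert (E : ((a k - b k) * x ^ k = (f (c + x) - (S0 + b k * x ^ k)) - (f (c + x) - (S0 + a k * x ^ k)))%C) by ring.
  apply (f_equal Cmod) in E. rewrite Cmod_mult, Cmod_pow, Hm in E. fold X in E.
  assert (T : X * x ^ k <= A * (x / ra) ^ S k + B * (x / rb) ^ S k).
  { rewrite E. unfold Cminus at 1. eapply Rle_trans; [apply Cmod_triangle|]. rewrite Cmod_opp. lra. }
  assert (P : forall y, rho < y -> (x / y) ^ S k <= x ^ S k * (/ rho) ^ S k).
  { intros y Hy. rewrite <- Rpow_mult_distr. apply pow_incr. split.
    - apply Rmult_le_pos; [lra|]. apply Rlt_le, Rinv_0_lt_compat; lra.
    - apply Rmult_le_compat_l; [lra|]. apply Rinv_le_contravar; lra. }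
  pose proof (P ra Hra). pose proof (P rb Hrb).
  assert (T2 : X * x ^ k <= K * x ^ S k).
  { unfold K. apply Rle_trans with ((A + B) * (x ^ S k * (/ rho) ^ S k)).
    - rewrite Rmult_plus_distr_r. eapply Rle_trans; [exact T|].
      apply Rplus_le_compat; apply Rmult_le_compat_l; auto.
    - pose proof (pow_lt x (S k) ltac:(lra)). nra. }
  simpl in T2. pose proof (pow_lt x k ltac:(lra)) as Px.
  assert (X <= K * x).
  { apply Rmult_le_reg_r with (x ^ k); auto. lra. }
  assert (K * x <= X / 2).
  { apply Rle_trans with (K * (X / (2 * K))); [apply Rmult_le_compat_l; lra|]. right. field. lra. }
  lra.
Qed.

Lemma rsum_geom_le (A q : R) (n : nat) : 0 <= A -> 0 <= q ->
  rsum (fun k => A * q ^ k) n <= A * INR n * (1 + q) ^ n.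
Proof.
  intros HA Hq. apply Rle_trans with (rsum (fun _ => A * (1 + q) ^ n) n).
  - apply rsum_le. intros i Hi. apply Rmult_le_compat_l; auto.
    apply Rle_trans with ((1 + q) ^ i); [apply pow_incr; lra|apply Rle_pow; [lra|lia]].
  - rewrite rsum_const. right; ring.
Qed.

(* Borel-Caratheodory bounds the Taylor coefficients of [log f] twice: by [O(1)] through the small disc, by
   [O(A)] through the large one. Cutting the series at a fixed large index leaves only [eps * A]. *)
Lemma zero_free_growth (R1 r R0 A1 eps : R) : 0 < R1 <= r -> r < R0 -> 0 < A1 -> 0 < eps ->
  exists K, forall (f : C -> C) (c : C) (A : R), 0 < A ->
    (forall z, Cmod (z - c) < R0 -> hol f z) -> (forall z, Cmod (z - c) < R0 -> f z <> 0) ->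
    (forall z, Cmod (z - c) < R0 -> Cmod (f z) <= exp A * Cmod (f c)) ->
    (forall z, Cmod (z - c) < R1 -> Cmod (f z) <= exp A1 * Cmod (f c)) ->
    forall z, Cmod (z - c) <= r -> Cmod (f z) <= exp (K + eps * A) * Cmod (f c).
Proof.
  intros HR1 Hr HA1 He.
  (* The logarithm lives in the disc of radius [R']; its Taylor coefficients are bounded by [M * A]
     on the circle of radius [r2] and by [2 * A1] on that of radius [r1]. *)
  set (R' := (r + 2 * R0) / 3). set (r2 := (2 * r + R0) / 3). set (r1 := R1 / 2).
  assert (HR' : r < r2 < R' /\ R' < R0) by (unfold R', r2; lra).
  set (M := 2 * r2 / (R' - r2)).
  assert (HM : 0 < M) by (unfold M; apply Rdiv_lt_0_compat; lra).
  assert (Hq : 0 <= r / r2 < 1) by (apply ratio_lt1; lra).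
  destruct (tails_geom (M * (r2 / (r2 - r))) (r / r2)) as [_ HT]; auto.
  { apply Rmult_le_pos; [lra|]. apply Rlt_le, Rdiv_lt_0_compat; lra. }
  destruct (HT eps He) as [N HN]. specialize (HN N (Nat.le_refl N)).
  exists (2 * A1 * INR N * (1 + r / r1) ^ N).
  intros f c A HA Hf Hn HB HB1 z Hz.
  assert (Nc : f c <> 0) by (apply Hn; rewrite Cmod_self; lra).
  pose proof (proj1 (Cmod_gt_0 _) Nc) as Pc.
  destruct (log_exists f c R' R0 ltac:(lra) Hf Hn) as [L [L0 [HL HE]]].
  assert (ReL : forall w B, Cmod (w - c) < R' -> Cmod (f w) <= exp B * Cmod (f c) -> Re (L w) <= B).
  { intros w B Hw Hb. rewrite HE, Cmod_mult, Cexp_mod, Rmult_comm in Hb by auto.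
    apply Rmult_le_reg_r in Hb; auto. destruct (Rle_or_lt (Re (L w)) B) as [|Hlt]; auto.
    apply exp_increasing in Hlt. lra. }
  assert (BL : forall w, Cmod (w - c) < R' -> Cmod (L w) <= 2 * A * Cmod (w - c) / (R' - Cmod (w - c))).
  { intros w Hw. apply borel_caratheodory; auto. intros v Hv. apply ReL; auto. apply HB. lra. }
  assert (BL1 : forall w, Cmod (w - c) < R1 -> Cmod (L w) <= 2 * A1 * Cmod (w - c) / (R1 - Cmod (w - c))).
  { intros w Hw. apply borel_caratheodory; auto; intros v Hv; [apply HL; lra|apply ReL; auto; lra]. }
  assert (Ev : forall rho t, 0 < rho -> Cmod (c + rho * cis t - c) = rho).
  { intros rho t Hrho. replace (c + rho * cis t - c)%C with (rho * cis t)%C by ring. apply circ_mod; auto. }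
  destruct (taylor L c r2 (M * A)) as [a [Ha1 Ha2]]; [lra|apply cauchy_formula with R'; auto; lra| |].
  { intros t. eapply Rle_trans; [apply BL; rewrite Ev; lra|]. rewrite Ev by lra.
    unfold M. right. field. lra. }
  destruct (taylor L c r1 (2 * A1)) as [b [Hb1 Hb2]]; [unfold r1; lra| | |].
  { apply cauchy_formula with R'; auto. unfold r1; lra. }
  { intros t. eapply Rle_trans; [apply BL1; rewrite Ev; unfold r1; lra|]. rewrite Ev by (unfold r1; lra).
    unfold r1. right. field. lra. }
  assert (Hr1 : 0 < r1 /\ r1 < r2) by (unfold r1; lra).
  assert (Eab : forall k, a k = b k).
  { apply (taylor_unique L c a b (r1 / 2) (M * A * (r2 / (r2 - r1 / 2))) (2 * A1 * (r1 / (r1 - r1 / 2))) r2 r1); try lra.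
    - apply Rmult_le_pos; [nra|]. apply Rlt_le, Rdiv_lt_0_compat; lra.
    - apply Rmult_le_pos; [nra|]. apply Rlt_le, Rdiv_lt_0_compat; lra.
    - intros w n Hw. pose proof (Cmod_ge_0 w). eapply Rle_trans; [apply Ha2; lra|].
      apply Rmult_le_compat_r; [apply pow_le, Rmult_le_pos; auto; apply Rlt_le, Rinv_0_lt_compat; lra|].
      apply Rmult_le_compat_l; [nra|]. apply Rmult_le_compat_l; [lra|]. apply Rinv_le_contravar; lra.
    - intros w n Hw. pose proof (Cmod_ge_0 w). eapply Rle_trans; [apply Hb2; lra|].
      apply Rmult_le_compat_r; [apply pow_le, Rmult_le_pos; auto; apply Rlt_le, Rinv_0_lt_compat; lra|].
      apply Rmult_le_compat_l; [nra|]. apply Rmult_le_compat_l; [lra|]. apply Rinv_le_contravar; lra. }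
  assert (BLz : Cmod (L z) <= 2 * A1 * INR N * (1 + r / r1) ^ N + eps * A).
  { pose proof (Ha2 (z - c)%C N ltac:(lra)) as T. replace (c + (z - c))%C with z in T by ring.
    pose proof (Cmod_ge_0 (z - c)) as Z0.
    assert (T1 : Cmod (csum (fun k => a k * (z - c) ^ k) N)%C <= 2 * A1 * INR N * (1 + r / r1) ^ N).
    { eapply Rle_trans; [|apply rsum_geom_le; [lra|]].
      - apply csum_bound. intros i _. rewrite Cmod_mult, Cmod_pow, Eab.
        pose proof (pow_lt r1 i ltac:(lra)) as P1.
        apply Rle_trans with (2 * A1 / r1 ^ i * r ^ i).
        + apply Rmult_le_compat; [apply Cmod_ge_0|apply pow_le; auto| |apply pow_incr; lra].
          apply Rmult_le_reg_r with (r1 ^ i); auto. unfold Rdiv. rewrite Rmult_assoc, Rinv_l by lra.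
          rewrite Rmult_1_r. auto.
        + unfold Rdiv. rewrite Rpow_mult_distr, pow_inv. right; ring.
      - apply Rlt_le, Rdiv_lt_0_compat; lra. }
    assert (T2 : M * A * (r2 / (r2 - Cmod (z - c))) * (Cmod (z - c) / r2) ^ N <= eps * A).
    { apply Rle_trans with (M * A * (r2 / (r2 - r)) * (r / r2) ^ N).
      - apply Rmult_le_compat.
        + apply Rmult_le_pos; [nra|]. apply Rlt_le, Rdiv_lt_0_compat; lra.
        + apply pow_le, Rmult_le_pos; auto. apply Rlt_le, Rinv_0_lt_compat; lra.
        + apply Rmult_le_compat_l; [nra|]. apply Rmult_le_compat_l; [lra|]. apply Rinv_le_contravar; lra.
        + apply pow_incr. split; [apply Rmult_le_pos; auto; apply Rlt_le, Rinv_0_lt_compat; lra|].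
          apply Rmult_le_compat_r; [apply Rlt_le, Rinv_0_lt_compat; lra|auto].
      - set (Y := M * (r2 / (r2 - r)) * (r / r2) ^ N) in *.
        replace (M * A * (r2 / (r2 - r)) * (r / r2) ^ N) with (Y * A) by (unfold Y; ring).
        apply Rmult_le_compat_r; [lra|].
        assert (0 <= Y).
        { unfold Y. apply Rmult_le_pos; [|apply pow_le; lra].
          apply Rmult_le_pos; [lra|]. apply Rlt_le, Rdiv_lt_0_compat; lra. }
        assert (1 <= / (1 - r / r2)).
        { rewrite <- Rinv_1 at 1. apply Rinv_le_contravar; lra. }
        nra. }
    pose proof (Cmod_tri_inv (L z) (csum (fun k => a k * (z - c) ^ k) N)%C). lra. }
  rewrite HE by lra. rewrite Cmod_mult, Cexp_mod, Rmult_comm. apply Rmult_le_compat_r; [lra|].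
  assert (Re (L z) <= 2 * A1 * INR N * (1 + r / r1) ^ N + eps * A).
  { eapply Rle_trans; [apply Rle_abs|]. eapply Rle_trans; [apply re_le_Cmod|]. auto. }
  destruct H as [H|H]; [left; apply exp_increasing; auto|rewrite H; lra].
Qed.

(** * The zeta function on the half-plane Re s > 0 *)

(** [x^(-s)] for real [x], so that it can also be differentiated in [x]. *)
Definition pw (x : R) (s : C) : C := Cexp (- s * ln x)%C.

Lemma pw_npow_neg (n : nat) (s : C) : npow_neg n s = pw (INR n) s.
Proof.
  unfold npow_neg, pw, Cexp, cis. destruct s as [a b].
  replace (Re (- (a, b) * ln (INR n))%C) with (- a * ln (INR n)) by (simpl; ring).
  replace (Im (- (a, b) * ln (INR n))%C) with (- (b * ln (INR n))) by (simpl; ring).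
  rewrite cos_neg, sin_neg. simpl Re. simpl Im. apply injective_projections; simpl; ring.
Qed.

Lemma pw_mod (x : R) (s : C) : Cmod (pw x s) = exp (- Re s * ln x).
Proof. unfold pw. rewrite Cexp_mod. f_equal. destruct s; simpl; ring. Qed.

Lemma pw_mult (x y : R) (s : C) : 0 < x -> 0 < y -> pw (x * y) s = (pw x s * pw y s)%C.
Proof.
  intros Hx Hy. unfold pw. rewrite ln_mult, <- Cexp_plus by auto. f_equal. rewrite RtoC_plus. ring.
Qed.

Lemma pw_1 (s : C) : pw 1 s = 1.
Proof. unfold pw. rewrite ln_1. replace (- s * 0)%C with (RtoC 0) by ring. apply Cexp_0. Qed.

Lemma pw_scal (x : R) (n : nat) (s : C) : pw x (INR n * s) = (pw x s ^ n)%C.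
Proof. unfold pw. rewrite Cexp_pow. f_equal. ring. Qed.

Lemma pw_pow (x : R) (n : nat) (s : C) : 0 < x -> pw (x ^ n) s = (pw x s ^ n)%C.
Proof.
  intros Hx. rewrite <- pw_scal. unfold pw. rewrite ln_pow by auto. f_equal.
  rewrite RtoC_mult. ring.
Qed.

Lemma hol_pw (x : R) (z : C) : hol (pw x) z.
Proof.
  apply (hol_comp (fun s => - s * ln x)%C Cexp); [|apply hol_Cexp].
  apply hol_mult; [apply hol_opp, hol_id|apply hol_const].
Qed.

Lemma rderiv_RtoC (a : R -> R) (t da : R) : is_derive a t da -> rderiv (fun u => RtoC (a u)) t da.
Proof.
  intros H. apply (rderiv_of_re_im a (fun _ => 0)); auto. apply @is_derive_const.
Qed.

Lemma rderiv_pw (s : C) (x : R) : 0 < x -> rderiv (fun x => pw x s) x (- s * pw x s * / x)%C.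
Proof.
  intros Hx.
  assert (Nx : RtoC x <> 0) by (intros E; apply RtoC_inj in E; lra).
  replace (- s * pw x s * / x)%C with (Cexp (- s * ln x) * (- s * RtoC (/ x)))%C.
  2:{ rewrite RtoC_inv by lra. unfold pw. ring. }
  apply (rderiv_comp Cexp (fun x => - s * ln x)%C); [|apply cderiv_Cexp].
  apply (rderiv_comp (fun z => - s * z)%C (fun x => RtoC (ln x))).
  - apply rderiv_RtoC. apply is_derive_Reals. apply derivable_pt_lim_ln. auto.
  - exists (fun _ => (- s)%C). split; [apply ccont_const|]. split; auto. intros; ring.
Qed.

Lemma ln_zero : ln 0 = 0.
Proof. unfold ln. destruct (Rlt_dec 0 0) as [a|a]; auto. exfalso; lra. Qed.

Lemma exp_ln_decr (sg x y : R) : 0 <= sg -> 0 < x <= y -> exp (- sg * ln y) <= exp (- sg * ln x).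
Proof.
  intros Hs Hxy. assert (ln x <= ln y) by (apply ln_le; lra).
  assert (H1 : - sg * ln y <= - sg * ln x) by nra.
  destruct H1 as [H1|H1]; [left; apply exp_increasing; auto|rewrite H1; lra].
Qed.

Lemma pw_diff_bound (s : C) (a b : R) : 0 <= Re s -> 0 < a <= b ->
  Cmod (pw b s - pw a s) <= Cmod s * (exp (- Re s * ln a) / a) * (b - a).
Proof.
  intros Hs Hab. apply (cmvt (fun x => pw x s) (fun x => - s * pw x s * / x)%C); [lra| |].
  - intros t Ht. apply rderiv_pw. lra.
  - intros t Ht. rewrite !Cmod_mult, Cmod_opp, pw_mod.
    rewrite <- RtoC_inv by lra. rewrite Cmod_R, Rabs_pos_eq by (apply Rlt_le, Rinv_0_lt_compat; lra).
    rewrite Rmult_assoc. apply Rmult_le_compat_l; [apply Cmod_ge_0|].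
    apply Rmult_le_compat.
    + apply Rlt_le, exp_pos.
    + apply Rlt_le, Rinv_0_lt_compat; lra.
    + apply exp_ln_decr; lra.
    + apply Rinv_le_contravar; lra.
Qed.

(** With [n = i + 1] this is [s - 1] times the difference between [n^(-s)] and the integral of
    [x^(-s)] over [[n, n + 1]]. The difference is smaller than [n^(-s)] by a factor [1 / n], which
    moves convergence to Re s > 0. *)
Definition Zterm (s : C) (i : nat) : C :=
  ((s - 1) * pw (INR (S i)) s + INR (S (S i)) * pw (INR (S (S i))) s - INR (S i) * pw (INR (S i)) s)%C.

Definition zb (sg : R) (i : nat) : R := exp (- sg * ln (INR (S i))) / INR (S i).

(** Tail of [zb] from index [m] on, by comparison with an integral. At [m = 0] the value [ln 0 = 0]
    makes this [1 / sg + 1], the extra 1 being the first term of the series. *)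
Definition zB (sg : R) (m : nat) : R :=
  exp (- sg * ln (INR m)) / sg + (match m with O => 1 | _ => 0 end).

Lemma INR_S_pos (n : nat) : 0 < INR (S n).
Proof. apply lt_0_INR. lia. Qed.

Lemma Zterm_bound (s : C) (i : nat) : 0 <= Re s ->
  Cmod (Zterm s i) <= Cmod s * Cmod (s - 1) * zb (Re s) i.
Proof.
  intros Hs. set (n := INR (S i)). assert (Hn : 0 < n) by apply INR_S_pos.
  assert (En : INR (S (S i)) = n + 1) by (unfold n; rewrite (S_INR (S i)); auto).
  set (phi := fun x : R => ((s - 1) * pw n s * (x - n) + x * pw x s)%C).
  assert (E : Zterm s i = (phi (n + 1)%R - phi n)%C).
  { unfold Zterm, phi. rewrite En. fold n. rewrite RtoC_plus. ring. }
  rewrite E.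
  replace (Cmod s * Cmod (s - 1) * zb (Re s) i) with
    (Cmod (s - 1) * (Cmod s * (exp (- Re s * ln n) / n)) * (n + 1 - n)) by (unfold zb; fold n; ring).
  apply (cmvt phi (fun x => (s - 1) * (pw n s - pw x s))%C); [lra| |].
  - intros t Ht. destruct (rderiv_pw s t ltac:(lra)) as [p [P1 [P2 P3]]].
    assert (Nt : RtoC t <> 0) by (intros E0; apply RtoC_inj in E0; lra).
    exists (fun u : R => (s - 1) * pw n s + pw t s + u * p u)%C. split; [|split].
    + apply rcat_plus; [apply rcat_const|]. apply rcat_mult; [apply rcat_RtoC|auto].
    + rewrite P2. field. auto.
    + intros u. unfold phi. rewrite (P3 u), RtoC_minus. ring.
  - intros t Ht. rewrite Cmod_mult. apply Rmult_le_compat_l; [apply Cmod_ge_0|].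
    rewrite (Cmod_minus_sym (pw n s)).
    eapply Rle_trans; [apply pw_diff_bound; lra|].
    assert (0 <= Cmod s * (exp (- Re s * ln n) / n)).
    { apply Rmult_le_pos; [apply Cmod_ge_0|]. apply Rlt_le, Rdiv_lt_0_compat; auto. apply exp_pos. }
    nra.
Qed.

Lemma zb_pos (sg : R) (i : nat) : 0 < zb sg i.
Proof. apply Rdiv_lt_0_compat; [apply exp_pos|apply INR_S_pos]. Qed.

Lemma zb_telescope (sg : R) (i : nat) : 0 < sg ->
  zb sg (S i) <= exp (- sg * ln (INR (S i))) / sg - exp (- sg * ln (INR (S (S i)))) / sg.
Proof.
  intros Hs. set (n := INR (S i)). assert (Hn : 0 < n) by apply INR_S_pos.
  assert (En : INR (S (S i)) = n + 1) by (unfold n; rewrite (S_INR (S i)); auto).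
  unfold zb. rewrite En.
  destruct (MVT_gen (fun x => exp (- sg * ln x)) n (n + 1) (fun x => - sg * (exp (- sg * ln x) / x)))
    as [c [Hc Ec]].
  - intros x Hx. rewrite Rmin_left, Rmax_right in Hx by lra. auto_derive; [lra|]. field. lra.
  - intros x Hx. rewrite Rmin_left, Rmax_right in Hx by lra. apply continuity_pt_filterlim.
    apply (ex_derive_continuous (V := R_NormedModule) (fun x => exp (- sg * ln x))). auto_derive. lra.
  - rewrite Rmin_left, Rmax_right in Hc by lra.
    assert (exp (- sg * ln (n + 1)) / (n + 1) <= exp (- sg * ln c) / c).
    { apply Rmult_le_compat.
      - apply Rlt_le, exp_pos.
      - apply Rlt_le, Rinv_0_lt_compat; lra.
      - apply exp_ln_decr; lra.
      - apply Rinv_le_contravar; lra. }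
    apply Rmult_le_reg_l with sg; auto.
    replace (sg * (exp (- sg * ln n) / sg - exp (- sg * ln (n + 1)) / sg)) with
      (- (exp (- sg * ln (n + 1)) - exp (- sg * ln n))) by (field; lra).
    rewrite Ec. nra.
Qed.

Lemma exp_ln_small (sg eps : R) : 0 < sg -> 0 < eps ->
  exists N, forall n, (N <= n)%nat -> exp (- sg * ln (INR n)) < eps.
Proof.
  intros Hs He. destruct (INR_unbounded (exp (- ln eps / sg))) as [N HN].
  exists (S N). intros n Hn. rewrite <- (exp_ln eps) by auto. apply exp_increasing.
  assert (H0 : exp (- ln eps / sg) < INR n).
  { eapply Rlt_le_trans; [exact HN|]. apply le_INR. lia. }
  apply ln_increasing in H0; [|apply exp_pos]. rewrite ln_exp in H0.
  apply Rmult_lt_compat_l with (r := sg) in H0; auto.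
  replace (sg * (- ln eps / sg)) with (- ln eps) in H0 by (field; lra). lra.
Qed.

Lemma tails_zb (sg : R) : 0 < sg -> tails (zb sg) (zB sg).
Proof.
  intros Hs.
  assert (T1 : forall n m, (1 <= m)%nat -> (m <= n)%nat -> rsum (zb sg) n - rsum (zb sg) m
     <= exp (- sg * ln (INR m)) / sg - exp (- sg * ln (INR n)) / sg).
  { intros n m Hm Hmn. induction Hmn as [|n Hmn IH]; [lra|].
    destruct n as [|n]; [lia|]. pose proof (zb_telescope sg n Hs). cbn [rsum] in *. lra. }
  assert (P : forall n, 0 < exp (- sg * ln (INR n)) / sg).
  { intros n. apply Rdiv_lt_0_compat; auto. apply exp_pos. }
  split.
  - intros m n Hmn. unfold zB. destruct m as [|m].
    + destruct n as [|n].
      * simpl rsum. pose proof (P 0%nat). lra.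
      * pose proof (T1 (S n) 1%nat ltac:(lia) ltac:(lia)) as T. pose proof (P (S n)).
        replace (rsum (zb sg) 1) with 1 in T.
        -- simpl (rsum (zb sg) 0). replace (INR 0) with 0 by auto.
           rewrite ln_zero. simpl (INR 1) in T. rewrite ln_1 in T. lra.
        -- simpl rsum. unfold zb. simpl INR. rewrite ln_1, Rmult_0_r, exp_0. field.
    + pose proof (T1 n (S m) ltac:(lia) Hmn). pose proof (P n). lra.
  - intros e He. destruct (exp_ln_small sg (e * sg) Hs) as [N HN]; [apply Rmult_lt_0_compat; auto|].
    exists (S N). intros n Hn. unfold zB. destruct n as [|n]; [lia|].
    specialize (HN (S n) ltac:(lia)). rewrite Rplus_0_r.
    apply Rmult_lt_reg_r with sg; auto. unfold Rdiv. rewrite Rmult_assoc, Rinv_l; lra.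
Qed.

Lemma tails_scal (b B : nat -> R) (c : R) : 0 <= c -> tails b B -> tails (fun i => c * b i) (fun i => c * B i).
Proof.
  intros Hc [H1 H2]. split.
  - intros m n Hmn. rewrite !rsum_scal. specialize (H1 m n Hmn). nra.
  - intros e He. destruct (H2 (e / (c + 1))) as [N HN]; [apply Rdiv_lt_0_compat; lra|].
    exists N. intros n Hn. specialize (HN n Hn).
    destruct (Rle_or_lt (B n) 0) as [L|L]; [nra|].
    apply Rle_lt_trans with ((c + 1) * B n); [nra|].
    apply Rmult_lt_compat_l with (r := c + 1) in HN; [|lra].
    replace ((c + 1) * (e / (c + 1))) with e in HN by (field; lra). auto.
Qed.

Definition ZN (s : C) (N : nat) : C :=
  ((s - 1) * csum (fun i => pw (INR (S i)) s) N + INR (S N) * pw (INR (S N)) s)%C.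

Lemma ZN_csum (s : C) (N : nat) : ZN s N = (1 + csum (Zterm s) N)%C.
Proof.
  induction N as [|N IH].
  - unfold ZN. simpl csum. simpl INR. rewrite pw_1. ring.
  - replace (ZN s (S N)) with (ZN s N + Zterm s N)%C.
    + rewrite IH. simpl. ring.
    + unfold ZN, Zterm. cbn [csum]. ring.
Qed.

(* [Zf s] is [(s - 1) zeta(s)], continued to Re s > 0 by the approximations [ZN s]. *)
Definition Zf (s : C) : C := epsilon (inhabits (RtoC 0)) (fun l => clim (ZN s) l).

Lemma Zf_spec (s : C) : 0 < Re s ->
  clim (ZN s) (Zf s) /\ forall N, Cmod (Zf s - ZN s N) <= Cmod s * Cmod (s - 1) * zB (Re s) N.
Proof.
  intros Hs.
  destruct (cseries_exists (Zterm s) _ _ (fun i => Zterm_bound s i (Rlt_le _ _ Hs))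
    (tails_scal _ _ (Cmod s * Cmod (s - 1)) (Rmult_le_pos _ _ (Cmod_ge_0 _) (Cmod_ge_0 _)) (tails_zb _ Hs)))
    as [l [Hl1 Hl2]].
  assert (Hc : clim (ZN s) (1 + l)).
  { apply clim_ext with (fun N => 1 + csum (Zterm s) N)%C; [intros; rewrite ZN_csum; auto|].
    apply clim_plus; auto. apply clim_const. }
  assert (HZ : clim (ZN s) (Zf s)) by (unfold Zf; apply epsilon_spec; eauto).
  split; auto. intros N. rewrite (clim_unique _ _ _ HZ Hc), ZN_csum.
  replace (1 + l - (1 + csum (Zterm s) N))%C with (l - csum (Zterm s) N)%C by ring. apply Hl2.
Qed.

Lemma zB_le (s1 s2 : R) (m : nat) : 0 < s1 <= s2 -> zB s2 m <= zB s1 m.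
Proof.
  intros H. unfold zB. apply Rplus_le_compat_r. apply Rmult_le_compat.
  - apply Rlt_le, exp_pos.
  - apply Rlt_le, Rinv_0_lt_compat; lra.
  - assert (0 <= ln (INR m)).
    { destruct m as [|m].
      - simpl INR. rewrite ln_zero. lra.
      - rewrite <- ln_1. apply ln_le; [lra|]. rewrite S_INR. pose proof (pos_INR m). lra. }
    assert (H1 : - s2 * ln (INR m) <= - s1 * ln (INR m)) by nra.
    destruct H1 as [H1|H1]; [left; apply exp_increasing; auto|rewrite H1; lra].
  - apply Rinv_le_contravar; lra.
Qed.

Lemma zB_0 (sg : R) : zB sg 0 = / sg + 1.
Proof.
  unfold zB. replace (ln (INR 0)) with 0.
  - rewrite Rmult_0_r, exp_0. unfold Rdiv. ring.
  - simpl INR. rewrite ln_zero. auto.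
Qed.

(** The approximation [ZN s 0 = 1] is enough to see quadratic growth in [Im s]. *)
Lemma Zf_bound (s : C) : 0 < Re s -> Cmod (Zf s) <= 1 + Cmod s * Cmod (s - 1) * (/ Re s + 1).
Proof.
  intros Hs. destruct (Zf_spec s Hs) as [_ H]. specialize (H 0%nat). rewrite zB_0 in H.
  replace (ZN s 0) with (RtoC 1) in H.
  - pose proof (Cmod_tri_inv (Zf s) 1) as T. rewrite Cmod_1 in T. lra.
  - rewrite ZN_csum. simpl. ring.
Qed.

Lemma Re_near (z c : C) (r : R) : Cmod (z - c) < r -> Re c - r < Re z < Re c + r.
Proof.
  intros H. pose proof (re_le_Cmod (z - c)) as T.
  change (Re (z - c)%C) with (Re z - Re c) in T.
  assert (Rabs (Re z - Re c) < r) by lra. apply Rabs_def2 in H0. lra.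
Qed.

Lemma Zf_hol (z : C) : 0 < Re z -> hol Zf z.
Proof.
  intros Hz. set (r := Re z / 2). assert (Hr : 0 < r) by (unfold r; lra).
  set (K := (Cmod z + r) * (Cmod (z - 1) + r)).
  assert (HK : 0 <= K).
  { unfold K. pose proof (Cmod_ge_0 z). pose proof (Cmod_ge_0 (z - 1)). nra. }
  assert (HKw : forall w, Cmod (w - z) < r -> Cmod w * Cmod (w - 1) <= K).
  { intros w Hw. unfold K. apply Rmult_le_compat; try apply Cmod_ge_0.
    - pose proof (Cmod_tri_inv w z). lra.
    - pose proof (Cmod_tri_minus w z 1). lra. }
  assert (HRe : forall w, Cmod (w - z) < r -> r < Re w).
  { intros w Hw. pose proof (Re_near w z r Hw). unfold r in *. lra. }
  assert (HB : forall w N, Cmod (w - z) < r -> Cmod (Zf w - ZN w N) <= K * zB r N).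
  { intros w N Hw. pose proof (HRe w Hw). destruct (Zf_spec w ltac:(lra)) as [_ H1].
    eapply Rle_trans; [apply H1|]. apply Rmult_le_compat.
    - apply Rmult_le_pos; apply Cmod_ge_0.
    - unfold zB. assert (0 < exp (- Re w * ln (INR N)) / Re w) by (apply Rdiv_lt_0_compat; [apply exp_pos|lra]).
      destruct N; lra.
    - auto.
    - apply zB_le. lra. }
  apply (hol_weierstrass Zf z (r / 2) r (1 + K * zB r 0)); [lra| | |rewrite Cmod_self; lra].
  - intros w Hw. specialize (HB w 0%nat Hw).
    replace (ZN w 0) with (RtoC 1) in HB by (rewrite ZN_csum; simpl; ring).
    pose proof (Cmod_tri_inv (Zf w) 1) as T. rewrite Cmod_1 in T. lra.
  - intros e He. destruct (tails_scal _ _ K HK (tails_zb r Hr)) as [_ HT]. destruct (HT e He) as [N HN].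
    exists (fun w => ZN w N). split.
    + intros w Hw. unfold ZN. apply hol_plus; apply hol_mult.
      * apply hol_minus; [apply hol_id|apply hol_const].
      * apply hol_csum. intros k. apply hol_pw.
      * apply hol_const.
      * apply hol_pw.
    + intros w Hw. eapply Rle_trans; [apply HB; auto|]. left. apply HN. auto.
Qed.

Lemma csum_re (a : nat -> C) (n : nat) : Re (csum a n) = rsum (fun i => Re (a i)) n.
Proof. induction n as [|n IH]; auto. cbn [csum rsum]. rewrite <- IH. reflexivity. Qed.

Lemma csum_im (a : nat -> C) (n : nat) : Im (csum a n) = rsum (fun i => Im (a i)) n.
Proof. induction n as [|n IH]; auto. cbn [csum rsum]. rewrite <- IH. reflexivity. Qed.

Lemma clim_CSeries (a : nat -> C) (l : C) : clim (csum a) l -> CSeries a = l.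
Proof.
  intros H. unfold CSeries. apply injective_projections; simpl.
  - apply is_series_unique. change (is_lim_seq (sum_n (fun n => Re (a n))) (Re l)).
    apply is_lim_seq_spec. intros e.
    destruct (H e (cond_pos e)) as [N HN]. exists N. intros n Hn.
    rewrite <- rsum_sum_n, <- csum_re. eapply Rle_lt_trans; [|apply (HN (S n)); lia].
    apply (re_le_Cmod (csum a (S n) - l)).
  - apply is_series_unique. change (is_lim_seq (sum_n (fun n => Im (a n))) (Im l)).
    apply is_lim_seq_spec. intros e.
    destruct (H e (cond_pos e)) as [N HN]. exists N. intros n Hn.
    rewrite <- rsum_sum_n, <- csum_im. eapply Rle_lt_trans; [|apply (HN (S n)); lia].
    apply (im_le_Cmod (csum a (S n) - l)).
Qed.

Lemma zb_shift (sg : R) (i : nat) : zb (sg - 1) i = exp (- sg * ln (INR (S i))).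
Proof.
  unfold zb. replace (- (sg - 1) * ln (INR (S i))) with (- sg * ln (INR (S i)) + ln (INR (S i))) by ring.
  rewrite exp_plus, exp_ln by apply INR_S_pos. pose proof (INR_S_pos i). field. lra.
Qed.

Lemma zeta_spec (s : C) : 1 < Re s ->
  clim (csum (fun i => pw (INR (S i)) s)) (zeta s) /\
  forall N, Cmod (zeta s - csum (fun i => pw (INR (S i)) s) N) <= zB (Re s - 1) N.
Proof.
  intros Hs.
  destruct (cseries_exists (fun i => pw (INR (S i)) s) (zb (Re s - 1)) (zB (Re s - 1))) as [l [H1 H2]].
  - intros n. rewrite pw_mod, zb_shift. lra.
  - apply tails_zb. lra.
  - assert (E : zeta s = l).
    { unfold zeta. apply clim_CSeries. apply clim_ext with (csum (fun i => pw (INR (S i)) s)); auto.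
      intros n. apply csum_ext. intros i _. rewrite pw_npow_neg. auto. }
    rewrite E. auto.
Qed.

Lemma Zf_zeta (s : C) : 1 < Re s -> Zf s = ((s - 1) * zeta s)%C.
Proof.
  intros Hs. destruct (Zf_spec s ltac:(lra)) as [H1 _]. destruct (zeta_spec s Hs) as [H2 _].
  apply (clim_unique (ZN s)); auto.
  replace ((s - 1) * zeta s)%C with ((s - 1) * zeta s + 0)%C by ring.
  unfold ZN. apply clim_plus; [apply clim_mult; auto; apply clim_const|].
  intros e He. destruct (exp_ln_small (Re s - 1) e) as [N HN]; [lra|auto|].
  exists N. intros n Hn. replace (INR (S n) * pw (INR (S n)) s - 0)%C with (INR (S n) * pw (INR (S n)) s)%C by ring.
  pose proof (INR_S_pos n).
  rewrite Cmod_RtoC_mult, pw_mod, Rabs_pos_eq by lra. rewrite <- zb_shift. unfold zb.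
  replace (INR (S n) * (exp (- (Re s - 1) * ln (INR (S n))) / INR (S n)))
    with (exp (- (Re s - 1) * ln (INR (S n)))) by (field; lra). apply HN. lia.
Qed.

Lemma zeta_lower (s : C) : 3 <= Re s -> / 2 <= Cmod (zeta s).
Proof.
  intros Hs. destruct (zeta_spec s ltac:(lra)) as [_ H]. specialize (H 1%nat).
  simpl csum in H. simpl INR in H. rewrite pw_1 in H.
  assert (B : zB (Re s - 1) 1 <= / 2).
  { unfold zB. simpl INR. rewrite ln_1, Rmult_0_r, exp_0, Rplus_0_r.
    unfold Rdiv. rewrite Rmult_1_l. apply Rinv_le_contravar; lra. }
  replace (0 + 1)%C with (RtoC 1) in H by ring.
  pose proof (Cmod_tri_inv 1 (zeta s)) as T. rewrite Cmod_1, Cmod_minus_sym in T. lra.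
Qed.

Lemma zeta_upper (s : C) : 1 < Re s -> Cmod (zeta s) <= / (Re s - 1) + 1.
Proof.
  intros Hs. destruct (zeta_spec s Hs) as [_ H]. specialize (H 0%nat). rewrite zB_0 in H.
  simpl csum in H. replace (zeta s - 0)%C with (zeta s) in H by ring. auto.
Qed.

Lemma Cconj_R (x : R) : Cconj x = x.
Proof. apply injective_projections; simpl; ring. Qed.

Lemma pw_conj (x : R) (s : C) : pw x (Cconj s) = Cconj (pw x s).
Proof.
  unfold pw, Cexp. destruct s as [a b]. simpl.
  replace (- a * ln x - - - b * 0) with (- a * ln x - - b * 0) by ring.
  replace (- a * 0 + - - b * ln x) with (- (- a * 0 + - b * ln x)) by ring.
  unfold cis. rewrite cos_neg, sin_neg. apply injective_projections; simpl; ring.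
Qed.

Lemma Zf_conj (s : C) : 0 < Re s -> Zf (Cconj s) = Cconj (Zf s).
Proof.
  intros Hs. destruct (Zf_spec s Hs) as [H1 _].
  destruct (Zf_spec (Cconj s) ltac:(rewrite re_conj; auto)) as [H2 _].
  apply (clim_unique (ZN (Cconj s))); auto.
  intros e He. destruct (H1 e He) as [N HN]. exists N. intros n Hn. specialize (HN n Hn).
  replace (ZN (Cconj s) n) with (Cconj (ZN s n)).
  - rewrite <- Cminus_conj, Cmod_conj. auto.
  - assert (Ec : forall m, Cconj (csum (fun i => pw (INR (S i)) s) m) = csum (fun i => pw (INR (S i)) (Cconj s)) m).
    { induction m as [|m IH]; cbn [csum]; [apply Cconj_R|]. rewrite Cplus_conj, IH, pw_conj. auto. }
    unfold ZN. rewrite Cplus_conj, !Cmult_conj, Ec, Cminus_conj, !Cconj_R, pw_conj. auto.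
Qed.

(** * Zeros of zeta with prescribed direction *)

(** The alternating zeta function, the continuation of the sum of [(-1)^(n-1) n^(-s)]; [2 * pw 2 s]
    is [2^(1-s)]. *)
Definition eta (s : C) : C := ((1 - 2 * pw 2 s) * Zf s / (s - 1))%C.

Definition eta_sum (s : C) (M : nat) : C :=
  csum (fun i => (- (1)) ^ i * pw (INR (S i)) s)%C (2 * M).

Lemma eta_sum_split (s : C) (M : nat) :
  eta_sum s M = (csum (fun i => pw (INR (S i)) s) (2 * M) - 2 * pw 2 s * csum (fun i => pw (INR (S i)) s) M)%C.
Proof.
  unfold eta_sum. induction M as [|M IH]; [simpl; ring|].
  replace (2 * S M)%nat with (S (S (2 * M))) by lia. cbn [csum]. rewrite IH.
  replace (INR (S (S (2 * M)))) with (2 * INR (S M)).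
  2:{ replace (S (S (2 * M))) with (2 * S M)%nat by lia. rewrite mult_INR. simpl; ring. }
  rewrite (pw_mult 2 (INR (S M))) by (try lra; apply INR_S_pos).
  rewrite Cpow_S, Cpow_mult_r. replace ((- (1)) ^ 2)%C with (RtoC 1) by (simpl; ring).
  rewrite Cpow_1_l. ring.
Qed.

(** The errors of [Zf] after [M] and after [2 M] terms enter with weights [2^(1-s)], of modulus at
    most 2, and 1: hence the factor 3. The boundary terms leave [d], an increment of [u^(1-s)] over
    an interval of length 1. *)
Lemma eta_approx (s : C) (M : nat) : 0 < Re s <= 1 -> s <> 1 -> (1 <= M)%nat ->
  Cmod (eta s - eta_sum s M) <= (3 * Cmod s / Re s + 1) * exp (- Re s * ln (INR M)).
Proof.
  intros Hs Hs1 HM. destruct (Zf_spec s ltac:(lra)) as [_ HZ].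
  assert (N1 : (s - 1)%C <> 0) by (intros E; apply Hs1, Cminus_0_eq, E).
  pose proof (proj1 (Cmod_gt_0 _) N1) as P1.
  assert (HMp : 0 < INR M) by (apply lt_0_INR; lia).
  assert (HB : forall N, (M <= N)%nat -> zB (Re s) N <= exp (- Re s * ln (INR M)) / Re s).
  { intros N HN. unfold zB. destruct N as [|N]; [lia|]. rewrite Rplus_0_r.
    apply Rmult_le_compat_r; [apply Rlt_le, Rinv_0_lt_compat; lra|].
    apply exp_ln_decr; [lra|]. split; auto. apply le_INR; auto. }
  set (x := exp (- Re s * ln (INR M))) in *. assert (Hx : 0 < x) by apply exp_pos.
  set (e1 := (Zf s - ZN s M)%C). set (e2 := (Zf s - ZN s (2 * M))%C).
  assert (B1 : Cmod e1 <= Cmod s * Cmod (s - 1) * (x / Re s)).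
  { eapply Rle_trans; [apply HZ|]. apply Rmult_le_compat_l; [apply Rmult_le_pos; apply Cmod_ge_0|auto]. }
  assert (B2 : Cmod e2 <= Cmod s * Cmod (s - 1) * (x / Re s)).
  { eapply Rle_trans; [apply HZ|]. apply Rmult_le_compat_l; [apply Rmult_le_pos; apply Cmod_ge_0|].
    apply HB. lia. }
  set (y := INR (S (2 * M))).
  assert (Ey : INR (S (S (2 * M))) = y + 1) by (unfold y; rewrite (S_INR (S _)); auto).
  assert (Hy : INR M <= y) by (unfold y; apply le_INR; lia).
  set (d := ((y + 1) * pw (y + 1) s - y * pw y s)%C).
  assert (B3 : Cmod d <= Cmod (s - 1) * x).
  { replace (Cmod (s - 1) * x) with (Cmod (s - 1) * x * (y + 1 - y)) by ring.
    unfold d. rewrite <- RtoC_plus.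
    apply (cmvt (fun u => u * pw u s)%C (fun u => (1 - s) * pw u s)%C); [lra| |].
    - intros t Ht. destruct (rderiv_pw s t ltac:(lra)) as [p [Q1 [Q2 Q3]]].
      assert (Nt : RtoC t <> 0) by (intros E0; apply RtoC_inj in E0; lra).
      exists (fun u : R => pw t s + u * p u)%C. split; [|split].
      + apply rcat_plus; [apply rcat_const|]. apply rcat_mult; [apply rcat_RtoC|auto].
      + rewrite Q2. field. auto.
      + intros u. rewrite (Q3 u), RtoC_minus. ring.
    - intros t Ht. rewrite Cmod_mult, Cmod_minus_sym, pw_mod. apply Rmult_le_compat_l; [apply Cmod_ge_0|].
      apply exp_ln_decr; lra. }
  assert (P2 : Cmod (2 * pw 2 s) <= 2).
  { rewrite Cmod_mult, pw_mod, Cmod_R, Rabs_pos_eq by lra.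
    assert (exp (- Re s * ln 2) <= 1); [|lra].
    rewrite <- exp_0. assert (0 < ln 2) by (rewrite <- ln_1; apply ln_increasing; lra).
    left. apply exp_increasing. nra. }
  apply Rmult_le_reg_l with (Cmod (s - 1)); auto. rewrite <- Cmod_mult.
  assert (E : ((s - 1) * (eta s - eta_sum s M) = e2 + (- (2 * pw 2 s * e1)) + (- d))%C).
  { rewrite eta_sum_split. unfold eta, e1, e2, d, ZN.
    assert (Ed : ((y + 1) * pw (y + 1) s = 2 * pw 2 s * (INR (S M) * pw (INR (S M)) s))%C).
    { rewrite <- RtoC_plus, <- Ey. replace (INR (S (S (2 * M)))) with (2 * INR (S M)).
      - rewrite pw_mult by (try lra; apply INR_S_pos). rewrite RtoC_mult. ring.
      - replace (S (S (2 * M))) with (2 * S M)%nat by lia. rewrite mult_INR. simpl; ring. }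
    rewrite Ed. fold y. field. auto. }
  rewrite E.
  eapply Rle_trans; [eapply Rle_trans; [apply Cmod_triangle|apply Rplus_le_compat_r, Cmod_triangle]|].
  rewrite !Cmod_opp, (Cmod_mult (2 * pw 2 s)).
  assert (Cmod (2 * pw 2 s) * Cmod e1 <= 2 * (Cmod s * Cmod (s - 1) * (x / Re s))).
  { apply Rmult_le_compat; try apply Cmod_ge_0; lra. }
  apply Rle_trans with (3 * (Cmod s * Cmod (s - 1) * (x / Re s)) + Cmod (s - 1) * x); [lra|].
  right. field. lra.
Qed.

(** * Binomial averages and the failure of a Lindelof-type bound *)

Fixpoint avg (a : R) (m : nat) (g : R -> C) (u : R) : C :=
  match m with
  | O => g u
  | S m => (/ 2 * (avg a m g (u + a) + avg a m g (u - a)))%C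
  end.

Lemma avg_bound (a B : R) (m : nat) (g : R -> C) : 0 <= a -> forall u,
  (forall v, Rabs (v - u) <= INR m * a -> Cmod (g v) <= B) -> Cmod (avg a m g u) <= B.
Proof.
  intros Ha. induction m as [|m IH]; intros u H.
  - simpl. apply H. replace (u - u) with 0 by ring. rewrite Rabs_R0. simpl. lra.
  - simpl avg. rewrite S_INR in H.
    assert (H1 : Cmod (avg a m g (u + a)) <= B).
    { apply IH. intros v Hv. apply H. apply Rabs_le_between in Hv. apply Rabs_le_between. lra. }
    assert (H2 : Cmod (avg a m g (u - a)) <= B).
    { apply IH. intros v Hv. apply H. apply Rabs_le_between in Hv. apply Rabs_le_between. lra. }
    rewrite Cmod_mult. replace (Cmod (/ 2)) with (/ 2).
    + pose proof (Cmod_triangle (avg a m g (u + a)) (avg a m g (u - a))). lra.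
    + rewrite <- RtoC_inv, Cmod_R, Rabs_pos_eq by lra. auto.
Qed.

Lemma avg_ext (a : R) (m : nat) (g h : R -> C) (u : R) : (forall v, g v = h v) -> avg a m g u = avg a m h u.
Proof. intros H. replace g with h; auto. apply functional_extensionality; auto. Qed.

Lemma avg_csum (a : R) (m N : nat) (G : nat -> R -> C) : forall u,
  avg a m (fun v => csum (fun n => G n v) N) u = csum (fun n => avg a m (G n) u) N.
Proof.
  induction m as [|m IH]; intros u; simpl avg; auto.
  rewrite !IH, csum_scal, csum_plus. ring.
Qed.

Lemma cis_sum (x : R) : (cis x + cis (- x) = 2 * cos x)%C.
Proof.
  unfold cis. rewrite cos_neg, sin_neg. apply injective_projections; simpl; ring.
Qed.

(** A frequency [xi] is damped by [cos (a xi)^m], a substitute for a Gaussian cut-off, although only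
    points within [m a] of [u] are sampled. *)
Lemma avg_cis (a xi : R) (k : C) (m : nat) : forall u,
  avg a m (fun v => k * cis (xi * v))%C u = (k * cis (xi * u) * (cos (a * xi) ^ m)%R)%C.
Proof.
  induction m as [|m IH]; intros u; simpl avg; [simpl; ring|].
  rewrite !IH. simpl pow. rewrite RtoC_mult.
  replace (xi * (u + a)) with (xi * u + a * xi) by ring.
  replace (xi * (u - a)) with (xi * u + - (a * xi)) by ring.
  rewrite !cis_plus.
  replace (/ 2 * (k * (cis (xi * u) * cis (a * xi)) * (cos (a * xi) ^ m)%R +
      k * (cis (xi * u) * cis (- (a * xi))) * (cos (a * xi) ^ m)%R))%C
    with (/ 2 * (k * cis (xi * u) * (cos (a * xi) ^ m)%R * (cis (a * xi) + cis (- (a * xi)))))%C by ring.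
  rewrite cis_sum. field.
Qed.

Lemma sin_half (x : R) : 0 <= x <= 1 -> x / 2 <= sin x.
Proof.
  intros Hx. pose proof PI2_3_2 as HP.
  destruct (MVT_gen sin 0 x cos) as [c [Hc Ec]].
  - intros t _. apply is_derive_Reals. apply derivable_pt_lim_sin.
  - intros t _. apply continuity_sin.
  - rewrite Rmin_left, Rmax_right in Hc by lra. rewrite sin_0 in Ec.
    assert (/ 2 <= cos c).
    { rewrite <- (Rmult_1_l (/ 2)). change (1 * / 2) with (1 / 2). rewrite <- cos_PI3.
      apply cos_decr_1; lra. }
    nra.
Qed.

Lemma cos2_upper (x : R) : Rabs x <= 1 -> cos x ^ 2 <= exp (- (x ^ 2 / 4)).
Proof.
  intros Hx. pose proof (sin2_cos2 x) as E. unfold Rsqr in E.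
  assert (S1 : x ^ 2 / 4 <= sin x * sin x).
  { destruct (Rle_or_lt 0 x) as [H|H].
    - rewrite Rabs_pos_eq in Hx by auto. pose proof (sin_half x ltac:(lra)). nra.
    - rewrite Rabs_left in Hx by auto. pose proof (sin_half (- x) ltac:(lra)) as H1. rewrite sin_neg in H1. nra. }
  pose proof (exp_ineq1_le (- (x ^ 2 / 4))). nra.
Qed.

Lemma bernoulli_lower (y : R) (n : nat) : 0 <= y <= 1 -> 1 - INR n * y <= (1 - y) ^ n.
Proof.
  intros Hy. induction n as [|n IH]; [simpl; lra|].
  rewrite S_INR. simpl. destruct (Rle_or_lt 0 (1 - INR n * y)) as [H|H].
  - pose proof (pos_INR n). nra.
  - assert (0 <= (1 - y) ^ n) by (apply pow_le; lra). nra.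
Qed.

Lemma cos2_pow_lower (x : R) (J : nat) : Rabs x <= 1 -> 1 - INR J * x ^ 2 <= (cos x ^ 2) ^ J.
Proof.
  intros Hx. pose proof (sin2_cos2 x) as E. unfold Rsqr in E.
  assert (S1 : sin x * sin x <= x ^ 2).
  { assert (Rabs (sin x) <= Rabs x).
    { destruct (Rle_or_lt 0 x) as [H|H].
      - destruct (Req_dec x 0) as [->|Nx]; [rewrite sin_0; lra|].
        assert (Hs := sin_lt_x x ltac:(lra)). rewrite Rabs_pos_eq in Hx by auto.
        pose proof (sin_half x ltac:(lra)). rewrite !Rabs_pos_eq; lra.
      - assert (Hs := sin_lt_x (- x) ltac:(lra)). rewrite Rabs_left in Hx by auto.
        pose proof (sin_half (- x) ltac:(lra)) as H1. rewrite sin_neg in *. rewrite !Rabs_left; lra. }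
    rewrite <- (Rabs_pos_eq (sin x * sin x)) by nra. rewrite Rabs_mult.
    replace (x ^ 2) with (Rabs x * Rabs x) by (rewrite <- Rabs_mult, Rabs_pos_eq; [ring|nra]).
    apply Rmult_le_compat; try apply Rabs_pos; auto. }
  replace (cos x ^ 2) with (1 - sin x * sin x) by nra.
  eapply Rle_trans; [|apply bernoulli_lower].
  - pose proof (pos_INR J). nra.
  - split; nra.
Qed.

Lemma ln_lower (y : R) : 0 < y -> 1 - / y <= ln y.
Proof.
  intros Hy. pose proof (exp_ineq1_le (- ln y)) as H. rewrite exp_Ropp, exp_ln in H by auto. lra.
Qed.

Lemma ln_upper (y : R) : 0 < y -> ln y <= y - 1.
Proof.
  intros Hy. pose proof (exp_ineq1_le (ln y)) as H. rewrite exp_ln in H by auto. lra.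
Qed.

(* Term [n] of the averaged, twisted eta sum: the phase is stationary at [n = X]. *)
Definition avg_term (sg X a : R) (J : nat) (n : R) : R :=
  exp (- sg * ln n) * cos (PI * (n - X) - PI * X * ln (n / X)) * (cos (a * ln (X / n)) ^ 2) ^ J.

(** The phase behaves like [pi (n - X)^2 / (2 X)]: the bounds [1 - 1/y <= ln y <= y - 1] at
    [y = n / X] cancel the linear term. *)
Lemma phase_small (n X j0 : R) : 0 < X -> Rabs (n - X) <= j0 -> j0 <= X / 2 ->
  0 <= PI * (n - X) - PI * X * ln (n / X) <= PI * (2 * j0 ^ 2 / X).
Proof.
  intros HX Hj Hj0. pose proof PI_RGT_0 as HPI. apply Rabs_le_between in Hj.
  assert (Hn : 0 < n) by lra.
  assert (Hq : 0 < n / X) by (apply Rdiv_lt_0_compat; auto).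
  pose proof (ln_upper _ Hq) as U. pose proof (ln_lower _ Hq) as L.
  assert (EU : X * (n / X - 1) = n - X) by (field; lra).
  assert (EL : X * (1 - / (n / X)) = n - X - (n - X) ^ 2 / n) by (field; lra).
  assert (B : (n - X) ^ 2 / n <= 2 * j0 ^ 2 / X).
  { apply Rmult_le_reg_r with (n * X); [nra|].
    replace ((n - X) ^ 2 / n * (n * X)) with ((n - X) ^ 2 * X) by (field; lra).
    replace (2 * j0 ^ 2 / X * (n * X)) with (j0 ^ 2 * (2 * n)) by (field; lra).
    assert (Hp : 0 <= (j0 - (n - X)) * (j0 + (n - X))) by (apply Rmult_le_pos; lra).
    assert (H1 : (n - X) ^ 2 <= j0 ^ 2) by lra. pose proof (pow2_ge_0 (n - X)).
    apply Rle_trans with (j0 ^ 2 * X); [apply Rmult_le_compat_r; lra|].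
    apply Rmult_le_compat_l; [apply pow2_ge_0|lra]. }
  assert (X * ln (n / X) <= n - X) by nra.
  assert (n - X - (n - X) ^ 2 / n <= X * ln (n / X)) by nra.
  split; nra.
Qed.

(** For [|n - X| <= sqrt X / 2] the phase stays in the first quadrant. *)
Lemma avg_term_nonneg (sg X a : R) (J : nat) (n j0 : R) : 0 < X -> Rabs (n - X) <= j0 -> j0 <= X / 2 ->
  4 * j0 ^ 2 <= X -> 0 <= avg_term sg X a J n.
Proof.
  intros HX Hj Hj0 Hj2. pose proof PI_RGT_0 as HPI. destruct (phase_small n X j0 HX Hj Hj0) as [P1 P2].
  assert (2 * j0 ^ 2 / X <= / 2).
  { apply Rmult_le_reg_r with X; auto. unfold Rdiv. rewrite Rmult_assoc, Rinv_l; lra. }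
  unfold avg_term. apply Rmult_le_pos; [apply Rmult_le_pos|].
  - apply Rlt_le, exp_pos.
  - apply cos_ge_0; nra.
  - apply pow_le, pow2_ge_0.
Qed.

(** Since [n <= 2 X], the power loses at most a factor 2; the phase is at most 1/2, with cosine at
    least 1/2; the weight is at least [1 - J a^2 (Y / X)^2 = 7/8]. The product 7/32 exceeds 1/8. *)
Lemma avg_term_main (sg X a Y : R) (J : nat) (n : R) : 0 <= sg <= 1 -> 4 <= Y -> X = Y ^ 4 ->
  X <= n <= X + Y -> 0 < a -> a <= 1 -> INR J * a ^ 2 = Y ^ 6 / 8 ->
  exp (- sg * ln X) / 8 <= avg_term sg X a J n.
Proof.
  intros Hsg HY HX Hn Ha Ha1 HJ. pose proof PI_RGT_0 as HPI.
  assert (HPI4 : PI <= 4) by apply PI_4.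
  assert (HY2 : 16 <= Y ^ 2) by nra.
  assert (HXY : 64 * Y <= X) by (rewrite HX; nra).
  assert (HXp : 0 < X) by lra.
  destruct (phase_small n X Y HXp) as [P1 P2]; [rewrite Rabs_pos_eq; lra|lra|].
  assert (B1 : 2 * Y ^ 2 / X <= / 8).
  { rewrite HX. apply Rmult_le_reg_r with (Y ^ 4); [lra|].
    replace (2 * Y ^ 2 / Y ^ 4 * Y ^ 4) with (2 * Y ^ 2) by (field; lra).
    replace (/ 8 * Y ^ 4) with (Y ^ 2 * (Y ^ 2 / 8)) by (field). nra. }
  set (th := PI * (n - X) - PI * X * ln (n / X)) in *.
  assert (Hth : th <= / 2) by nra.
  assert (C1 : / 2 <= cos th).
  { rewrite <- (Rmult_1_l (/ 2)). change (1 * / 2) with (1 / 2). rewrite <- cos_PI3.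
    pose proof PI2_3_2. apply cos_decr_1; lra. }
  assert (E1 : exp (- sg * ln X) / 2 <= exp (- sg * ln n)).
  { assert (H1 : ln n <= ln X + ln 2).
    { rewrite <- ln_mult by lra. apply ln_le; lra. }
    assert (H2 : - ln 2 + - sg * ln X <= - sg * ln n).
    { assert (0 < ln 2) by (rewrite <- ln_1; apply ln_increasing; lra). nra. }
    apply Rle_trans with (exp (- ln 2 + - sg * ln X)).
    - rewrite exp_plus, exp_Ropp, exp_ln by lra. right; field.
    - destruct H2 as [H2|H2]; [left; apply exp_increasing; auto|rewrite H2; lra]. }
  assert (L1 : 0 <= ln (n / X) <= Y / X).
  { assert (1 <= n / X). { apply Rmult_le_reg_r with X; auto. unfold Rdiv. rewrite Rmult_assoc, Rinv_l; lra. }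
    split.
    - rewrite <- ln_1. apply ln_le; lra.
    - eapply Rle_trans; [apply ln_upper; lra|].
      apply Rmult_le_reg_r with X; auto. replace ((n / X - 1) * X) with (n - X) by (field; lra).
      unfold Rdiv. rewrite Rmult_assoc, Rinv_l; lra. }
  assert (L2 : ln (X / n) = - ln (n / X)).
  { rewrite <- ln_Rinv by (apply Rdiv_lt_0_compat; lra). f_equal. field. lra. }
  assert (YX : Y / X = / Y ^ 3) by (rewrite HX; field; lra).
  assert (Y3 : 1 <= Y ^ 3) by nra.
  assert (IY : 0 < / Y ^ 3 <= 1).
  { split; [apply Rinv_0_lt_compat; lra|]. rewrite <- Rinv_1. apply Rinv_le_contravar; lra. }
  assert (C2 : 7 / 8 <= (cos (a * ln (X / n)) ^ 2) ^ J).
  { eapply Rle_trans; [|apply cos2_pow_lower].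
    - rewrite L2. replace (INR J * (a * - ln (n / X)) ^ 2) with (INR J * a ^ 2 * ln (n / X) ^ 2) by ring.
      rewrite HJ. assert (ln (n / X) ^ 2 <= (/ Y ^ 3) ^ 2) by (apply pow_incr; lra).
      assert (0 < Y ^ 6) by (apply pow_lt; lra).
      assert (Y ^ 6 / 8 * ln (n / X) ^ 2 <= Y ^ 6 / 8 * (/ Y ^ 3) ^ 2) by (apply Rmult_le_compat_l; lra).
      replace (Y ^ 6 / 8 * (/ Y ^ 3) ^ 2) with (/ 8) in H1 by (field; lra). lra.
    - rewrite L2. rewrite Rabs_left1; nra. }
  unfold avg_term. fold th.
  assert (0 < exp (- sg * ln X)) by apply exp_pos.
  assert (A1 : exp (- sg * ln X) / 2 * (/ 2) <= exp (- sg * ln n) * cos th).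
  { apply Rmult_le_compat; lra. }
  assert (A2 : exp (- sg * ln X) / 2 * (/ 2) * (7 / 8) <= exp (- sg * ln n) * cos th * (cos (a * ln (X / n)) ^ 2) ^ J).
  { apply Rmult_le_compat; try lra. }
  lra.
Qed.

(** At distance [Y^2 / 2] from [X = Y^4] one has [|ln (X / n)| >= 1 / (4 Y^2)]. The weight is at
    most [exp (- J a^2 ln (X / n)^2 / 4)], and [J a^2 = Y^6 / 8] turns this into the exponent
    [Y^2 / 512]. *)
Lemma avg_term_far (sg X a Y : R) (J : nat) (n : R) : 0 <= sg -> 4 <= Y -> X = Y ^ 4 ->
  1 <= n -> Y ^ 2 / 2 <= Rabs (n - X) -> 0 < a -> a * Rabs (ln (X / n)) <= 1 -> INR J * a ^ 2 = Y ^ 6 / 8 ->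
  - exp (- (Y ^ 2 / 512)) <= avg_term sg X a J n.
Proof.
  intros Hsg HY HX Hn Hfar Ha Hln HJ.
  assert (HXp : 0 < X) by (rewrite HX; apply pow_lt; lra).
  assert (Y2 : 16 <= Y ^ 2) by nra.
  assert (L : / (4 * Y ^ 2) <= Rabs (ln (X / n))).
  { unfold Rabs in Hfar. destruct (Rcase_abs (n - X)) as [c|c].
    - assert (H : 1 - / (X / n) <= ln (X / n)) by (apply ln_lower, Rdiv_lt_0_compat; lra).
      replace (/ (X / n)) with (n / X) in H by (field; lra).
      assert (/ (2 * Y ^ 2) <= 1 - n / X).
      { apply Rmult_le_reg_r with X; auto. replace ((1 - n / X) * X) with (X - n) by (field; lra).
        rewrite HX at 1. replace (/ (2 * Y ^ 2) * Y ^ 4) with (Y ^ 2 / 2) by (field; lra). lra. }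
      assert (/ (4 * Y ^ 2) <= / (2 * Y ^ 2)) by (apply Rinv_le_contravar; lra).
      eapply Rle_trans; [|apply Rle_abs]. lra.
    - assert (H : 1 - / (n / X) <= ln (n / X)) by (apply ln_lower, Rdiv_lt_0_compat; lra).
      assert (L2 : ln (X / n) = - ln (n / X)).
      { rewrite <- ln_Rinv by (apply Rdiv_lt_0_compat; lra). f_equal. field. lra. }
      rewrite L2, Rabs_Ropp. eapply Rle_trans; [|apply Rle_abs]. eapply Rle_trans; [|exact H].
      assert (Q : 1 + / (2 * Y ^ 2) <= n / X).
      { apply Rmult_le_reg_r with X; auto. replace (n / X * X) with n by (field; lra).
        rewrite Rmult_plus_distr_r. rewrite HX at 2.
        replace (/ (2 * Y ^ 2) * Y ^ 4) with (Y ^ 2 / 2) by (field; lra). lra. }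
      assert (Q2 : / (n / X) <= / (1 + / (2 * Y ^ 2))).
      { apply Rinv_le_contravar; auto. assert (0 < / (2 * Y ^ 2)) by (apply Rinv_0_lt_compat; lra). lra. }
      assert (Q3 : 1 - / (1 + / (2 * Y ^ 2)) = / (2 * Y ^ 2 + 1)) by (field; lra).
      assert (/ (4 * Y ^ 2) <= / (2 * Y ^ 2 + 1)) by (apply Rinv_le_contravar; lra). lra. }
  set (x := a * ln (X / n)).
  assert (Hx : Rabs x <= 1) by (unfold x; rewrite Rabs_mult, (Rabs_pos_eq a) by lra; auto).
  assert (B : (cos x ^ 2) ^ J <= exp (- (Y ^ 2 / 512))).
  { apply Rle_trans with (exp (- (x ^ 2 / 4)) ^ J).
    - apply pow_incr. split; [apply pow2_ge_0|apply cos2_upper; auto].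
    - assert (E : forall u k, exp u ^ k = exp (INR k * u)).
      { intros u k. induction k as [|k IH]; [simpl; rewrite Rmult_0_l, exp_0; auto|].
        rewrite S_INR. simpl. rewrite IH, <- exp_plus. f_equal. ring. }
      rewrite E. assert (H : INR J * - (x ^ 2 / 4) <= - (Y ^ 2 / 512)).
      { assert (X2 : x ^ 2 = a ^ 2 * Rabs (ln (X / n)) ^ 2).
        { unfold x. rewrite Rpow_mult_distr. f_equal. rewrite <- (pow2_abs (ln (X / n))). auto. }
        replace (INR J * - (x ^ 2 / 4)) with (- (INR J * a ^ 2 * Rabs (ln (X / n)) ^ 2 / 4)) by (rewrite X2; field).
        rewrite HJ.
        assert (H1 : (/ (4 * Y ^ 2)) ^ 2 <= Rabs (ln (X / n)) ^ 2).
        { apply pow_incr. split; auto. apply Rlt_le, Rinv_0_lt_compat. lra. }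
        assert (0 < Y ^ 6) by (apply pow_lt; lra).
        assert (H2 : Y ^ 6 / 8 * (/ (4 * Y ^ 2)) ^ 2 <= Y ^ 6 / 8 * Rabs (ln (X / n)) ^ 2) by (apply Rmult_le_compat_l; lra).
        replace (Y ^ 6 / 8 * (/ (4 * Y ^ 2)) ^ 2) with (Y ^ 2 / 128) in H2 by (field; lra). lra. }
      destruct H as [H|H]; [left; apply exp_increasing; auto|rewrite H; lra]. }
  unfold avg_term. fold x.
  set (th := PI * (n - X) - PI * X * ln (n / X)).
  pose proof (COS_bound th) as [c1 c2].
  assert (e1 : 0 < exp (- sg * ln n) <= 1).
  { split; [apply exp_pos|]. rewrite <- exp_0.
    assert (0 <= ln n) by (rewrite <- ln_1; apply ln_le; lra).
    assert (H1 : - sg * ln n <= 0) by nra.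
    destruct H1 as [H1|H1]; [left; apply exp_increasing; auto|rewrite H1; lra]. }
  assert (p0 : 0 <= (cos x ^ 2) ^ J) by (apply pow_le, pow2_ge_0).
  set (p := (cos x ^ 2) ^ J) in *. set (q := exp (- sg * ln n)) in *.
  assert (- 1 <= q * cos th) by nra.
  apply Rle_trans with (- p); [lra|]. nra.
Qed.

Lemma rsum_window (f : nat -> R) (p Y N : nat) (m ex : R) : 0 <= ex -> (p + Y <= N)%nat ->
  (forall i, (i < N)%nat -> - ex <= f i) -> (forall i, (p <= i < p + Y)%nat -> m <= f i) ->
  INR Y * m - INR N * ex <= rsum f N.
Proof.
  intros He HN H1 H2.
  assert (S1 : forall k, (k <= p)%nat -> - (INR k * ex) <= rsum f k).
  { induction k as [|k IH]; intros Hk; [simpl; lra|]. rewrite S_INR. simpl.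
    specialize (IH ltac:(lia)). specialize (H1 k ltac:(lia)). lra. }
  assert (S2 : forall k, (k <= Y)%nat -> INR k * m - INR p * ex <= rsum f (p + k)).
  { induction k as [|k IH]; intros Hk.
    - rewrite Nat.add_0_r. specialize (S1 p (Nat.le_refl p)). simpl. lra.
    - rewrite Nat.add_succ_r, S_INR. simpl rsum. specialize (IH ltac:(lia)). specialize (H2 (p + k)%nat ltac:(lia)). lra. }
  assert (S3 : forall k, (p + Y + k <= N)%nat -> INR Y * m - INR (p + k) * ex <= rsum f (p + Y + k)).
  { induction k as [|k IH]; intros Hk.
    - rewrite !Nat.add_0_r. apply S2; auto.
    - rewrite !Nat.add_succ_r, S_INR. simpl rsum. specialize (IH ltac:(lia)).
      specialize (H1 (p + Y + k)%nat ltac:(lia)). lra. }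
  specialize (S3 (N - p - Y)%nat ltac:(lia)).
  replace (p + Y + (N - p - Y))%nat with N in S3 by lia.
  assert (INR (p + (N - p - Y)) <= INR N) by (apply le_INR; lia). nra.
Qed.

Lemma neg1_pow_cis (n : nat) : ((- (1)) ^ n)%C = cis (PI * INR n).
Proof.
  rewrite Rmult_comm, <- cis_pow. f_equal. unfold cis. rewrite cos_PI, sin_PI.
  apply injective_projections; simpl; ring.
Qed.

Lemma pw_vertical (x sg v : R) : pw x (sg, v) = (exp (- sg * ln x) * cis (- ln x * v))%C.
Proof.
  unfold pw, Cexp. replace (Re (- (sg, v) * ln x)%C) with (- sg * ln x) by (simpl; ring).
  replace (Im (- (sg, v) * ln x)%C) with (- ln x * v) by (simpl; ring). auto.
Qed.

(** The twist by [X^(i v)], taken at height [pi X], compensates the alternating sign near [n = X];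
    the factor [(-1)^(X+1)] makes the stationary term positive. *)
Lemma avg_eta (sg a : R) (X M J : nat) : (1 <= X)%nat ->
  Re ((- (1)) ^ (S X) * avg a (2 * J) (fun v => cis (ln (INR X) * v) * eta_sum (sg, v) M) (PI * INR X))%C
  = rsum (fun i => avg_term sg (INR X) a J (INR (S i))) (2 * M).
Proof.
  intros HX. assert (HXp : 0 < INR X) by (apply lt_0_INR; lia).
  set (k := fun i => ((- (1)) ^ i * exp (- sg * ln (INR (S i))))%C).
  rewrite (avg_ext _ _ _ (fun v => csum (fun i => k i * cis ((ln (INR X) - ln (INR (S i))) * v))%C (2 * M))).
  - rewrite avg_csum, <- csum_scal, csum_re. apply rsum_ext. intros i _.
    rewrite avg_cis. set (n := INR (S i)). assert (Hn : 0 < n) by apply INR_S_pos.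
    assert (EL : ln (INR X) - ln n = ln (INR X / n)) by (rewrite ln_div; auto).
    rewrite EL. unfold k, avg_term. fold n.
    assert (E1 : ((- (1)) ^ S X * (- (1)) ^ i)%C = cis (PI * (n - INR X))).
    { rewrite <- Cpow_add_r, neg1_pow_cis.
      replace (PI * INR (S X + i)) with (PI * (n - INR X) + INR X * (2 * PI)).
      - rewrite cis_plus, <- cis_pow, cis_2PI, Cpow_1_l. ring.
      - unfold n. replace (S X + i)%nat with (S i + X)%nat by lia. rewrite plus_INR. ring. }
    replace ((- (1)) ^ S X * ((- (1)) ^ i * exp (- sg * ln n) * cis (ln (INR X / n) * (PI * INR X)) *
        (cos (a * ln (INR X / n)) ^ (2 * J))%R))%C
      with ((exp (- sg * ln n) * (cos (a * ln (INR X / n)) ^ (2 * J)))%R *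
        (cis (PI * (n - INR X)) * cis (ln (INR X / n) * (PI * INR X))))%C
      by (rewrite <- E1, RtoC_mult; ring).
    rewrite <- cis_plus.
    replace (PI * (n - INR X) + ln (INR X / n) * (PI * INR X))
      with (PI * (n - INR X) - PI * INR X * ln (n / INR X)).
    + rewrite pow_mult. unfold cis, Re, Cmult, RtoC. cbn [fst snd]. ring.
    + rewrite <- EL. rewrite ln_div by auto. ring.
  - intros v. unfold eta_sum. rewrite <- csum_scal. apply csum_ext. intros i _.
    rewrite pw_vertical. unfold k.
    replace ((ln (INR X) - ln (INR (S i))) * v) with (ln (INR X) * v + - ln (INR (S i)) * v) by ring.
    rewrite cis_plus. ring.
Qed.

(** The comparison is between powers of [y]. The [Y] aligned terms contribute about
    [y X^(-1/20) = y^(16/20)], whereas heights up to [60 y^7] are sampled and the assumed bound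
    allows only [y^(7/20)]. The surplus [y^(9/20)] outgrows the constant [D]. *)
Lemma anti_lindelof : ~ exists K, forall u : R,
  Cmod (eta (/ 20, u)) <= K * exp (/ 20 * ln (1 + Rabs u)).
Proof.
  intros [K0 HK0]. set (K := Rabs K0). assert (HKp : 0 <= K) by apply Rabs_pos.
  assert (HK : forall u : R, Cmod (eta (/ 20, u)) <= K * exp (/ 20 * ln (1 + Rabs u))).
  { intros u. eapply Rle_trans; [apply HK0|]. apply Rmult_le_compat_r; [apply Rlt_le, exp_pos|apply Rle_abs]. }
  clear HK0. pose proof PI_RGT_0 as HPI. pose proof PI_4 as HPI4.
  set (D := 8 * (60 * K + 3602) + 1).
  (* 82432 = 161 * 512 gives [ln 2 + 160 ln y <= y^2 / 512], so that all damped terms together are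
     at most 1; the second condition gives [D < y^(1/3)]. *)
  destruct (INR_unbounded (Rmax 82432 (exp (3 * ln D)))) as [Y HY].
  pose proof (Rmax_l 82432 (exp (3 * ln D))) as HY1. pose proof (Rmax_r 82432 (exp (3 * ln D))) as HY2.
  set (y := INR Y) in *.
  assert (Hy : 82432 < y) by lra.
  assert (Hly : 3 * ln D < ln y).
  { rewrite <- (ln_exp (3 * ln D)). apply ln_increasing; [apply exp_pos|lra]. }
  assert (Hl2 : ln 2 <= ln y) by (apply ln_le; lra).
  assert (Hl1 : 0 < ln y) by (rewrite <- ln_1; apply ln_increasing; lra).
  assert (Hly2 : ln y <= y) by (pose proof (ln_upper y ltac:(lra)); lra).
  assert (HYn : (1 <= Y)%nat).
  { destruct Y as [|Y']; [simpl in y; unfold y in Hy; lra|lia]. }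
  (* With [M = Y^160] the truncation factor [M^(-1/20) = y^(-8)] absorbs the height, of order
     [y^7]. *)
  remember 160%nat as b eqn:Hb.
  set (X := (Y ^ 4)%nat). set (M := (Y ^ b)%nat).
  assert (EX : INR X = y ^ 4) by (unfold X; rewrite pow_INR; auto).
  assert (EM : INR M = y ^ b) by (unfold M; rewrite pow_INR; auto).
  assert (LX : ln (INR X) = 4 * ln y) by (rewrite EX, ln_pow by lra; simpl; ring).
  assert (LM : ln (INR M) = 160 * ln y) by (rewrite EM, ln_pow, Hb by lra; rewrite INR_IZR_INZ; simpl; ring).
  (* Throughout the sum [|ln (X / n)| <= 161 ln y <= 161 y], hence [a |ln (X / n)| <= 1]; then [J]
     is dictated by [J a^2 = y^6 / 8]. *)
  set (a := / (200 * y)).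
  assert (Ha : 0 < a <= 1).
  { unfold a. split; [apply Rinv_0_lt_compat; lra|]. rewrite <- Rinv_1. apply Rinv_le_contravar; lra. }
  assert (EJ0 : exists c5 : nat, INR c5 = 5000).
  { exists (Z.to_nat 5000). rewrite INR_IZR_INZ, Z2Nat.id; [auto|lia]. }
  destruct EJ0 as [c5 Hc5].
  set (J := (c5 * Y ^ 8)%nat).
  assert (EJ : INR J = 5000 * y ^ 8) by (unfold J; rewrite mult_INR, pow_INR, Hc5; auto).
  assert (HJ : INR J * a ^ 2 = y ^ 6 / 8) by (rewrite EJ; unfold a; field; lra).
  assert (HJa : INR (2 * J) * a = 50 * y ^ 7).
  { rewrite mult_INR, EJ. unfold a. simpl INR. field. lra. }
  assert (X1 : (1 <= X)%nat) by (unfold X; pose proof (Nat.pow_nonzero Y 4 ltac:(lia)); lia).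
  assert (M1 : (1 <= M)%nat) by (unfold M; pose proof (Nat.pow_nonzero Y b ltac:(lia)); lia).
  assert (HXM : (X + Y <= 2 * M)%nat).
  { assert (X <= M)%nat by (unfold X, M; apply Nat.pow_le_mono_r; lia).
    assert (Y <= M)%nat.
    { replace Y with (Y ^ 1)%nat at 1 by (simpl; lia). unfold M. apply Nat.pow_le_mono_r; lia. }
    lia. }
  pose proof (avg_eta (/ 20) a X M J X1) as EA.
  set (A := avg _ _ _ _) in EA.
  assert (UB : Cmod A <= 60 * K * exp (7 / 20 * ln y) + 3601).
  { apply avg_bound; [lra|]. intros v Hv. rewrite HJa in Hv.
    rewrite Cmod_mult, cis_mod, Rmult_1_l.
    assert (y7 : 1 <= y ^ 7) by (apply pow_R1_Rle; lra).
    assert (y47 : y ^ 4 <= y ^ 7) by (apply Rle_pow; [lra|lia]).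
    assert (Hv2 : 1 + Rabs v <= 60 * y ^ 7).
    { replace v with ((v - PI * INR X) + PI * INR X) by ring.
      pose proof (Rabs_triang (v - PI * INR X) (PI * INR X)) as T.
      rewrite (Rabs_pos_eq (PI * INR X)) in T by (rewrite EX; apply Rmult_le_pos; [lra|apply pow_le; lra]).
      rewrite EX in *. nra. }
    assert (Hs : Cmod (/ 20, v) <= 1 + Rabs v).
    { eapply Rle_trans; [apply Cmod_le_re_im|]. simpl. rewrite Rabs_pos_eq; lra. }
    pose proof (eta_approx (/ 20, v) M) as AP. simpl Re in AP.
    assert (AP' : Cmod (eta (/ 20, v) - eta_sum (/ 20, v) M) <=
       (3 * Cmod (/ 20, v) / / 20 + 1) * exp (- / 20 * ln (INR M))).
    { apply AP; [lra| |auto]. intros E. apply (f_equal Re) in E. simpl in E. lra. }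
    rewrite LM in AP'. replace (- / 20 * (160 * ln y)) with (- (8 * ln y)) in AP' by field.
    assert (E8 : exp (- (8 * ln y)) = / y ^ 8).
    { rewrite exp_Ropp. f_equal. replace (8 * ln y) with (INR 8 * ln y) by (simpl; ring).
      rewrite <- ln_pow, exp_ln; auto; [apply pow_lt|]; lra. }
    rewrite E8 in AP'.
    assert (AP2 : (3 * Cmod (/ 20, v) / / 20 + 1) * / y ^ 8 <= 3601).
    { apply Rle_trans with (3601 * y ^ 7 * / y ^ 8).
      - apply Rmult_le_compat_r; [apply Rlt_le, Rinv_0_lt_compat, pow_lt; lra|].
        replace (3 * Cmod (/ 20, v) / / 20) with (60 * Cmod (/ 20, v)) by field. lra.
      - replace (3601 * y ^ 7 * / y ^ 8) with (3601 * / y) by (field; lra).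
        assert (/ y <= 1) by (rewrite <- Rinv_1; apply Rinv_le_contravar; lra). lra. }
    assert (HE : exp (/ 20 * ln (1 + Rabs v)) <= 60 * exp (7 / 20 * ln y)).
    { assert (L1 : ln (1 + Rabs v) <= ln 60 + 7 * ln y).
      { replace (7 * ln y) with (INR 7 * ln y) by (simpl; ring). rewrite <- ln_pow, <- ln_mult; try lra.
        apply ln_le; auto. pose proof (Rabs_pos v). lra. }
      assert (0 <= ln 60) by (rewrite <- ln_1; apply ln_le; lra).
      assert (L2 : / 20 * ln (1 + Rabs v) <= ln 60 + 7 / 20 * ln y) by lra.
      replace (60 * exp (7 / 20 * ln y)) with (exp (ln 60 + 7 / 20 * ln y))
        by (rewrite exp_plus, exp_ln by lra; auto).
      destruct L2 as [L2|L2]; [left; apply exp_increasing; auto|rewrite L2; lra]. }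
    specialize (HK v).
    pose proof (Cmod_tri_inv (eta_sum (/ 20, v) M) (eta (/ 20, v))) as T. rewrite Cmod_minus_sym in T.
    assert (K * exp (/ 20 * ln (1 + Rabs v)) <= K * (60 * exp (7 / 20 * ln y))) by (apply Rmult_le_compat_l; auto).
    lra. }
  set (ex := exp (- (y ^ 2 / 512))).
  assert (LB : y * (exp (- / 20 * ln (INR X)) / 8) - INR (2 * M) * ex <= Cmod A).
  { apply Rle_trans with (Re ((- (1)) ^ S X * A)%C).
    2:{ eapply Rle_trans; [apply Rle_abs|]. eapply Rle_trans; [apply re_le_Cmod|].
        rewrite Cmod_mult, Cmod_pow, Cmod_m1, pow1. lra. }
    rewrite EA. unfold y at 1. apply rsum_window with (p := (X - 1)%nat).
    - apply Rlt_le, exp_pos.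
    - lia.
    - intros i Hi. pose proof (INR_S_pos i).
      destruct (Rle_or_lt (Rabs (INR (S i) - INR X)) (y ^ 2 / 2)) as [H1|H1].
      + apply Rle_trans with 0; [pose proof (exp_pos (- (y ^ 2 / 512))); unfold ex; lra|].
        apply avg_term_nonneg with (y ^ 2 / 2); auto.
        * rewrite EX. apply pow_lt. lra.
        * rewrite EX. assert (1 <= y ^ 2) by (apply pow_R1_Rle; lra).
          replace (y ^ 4) with (y ^ 2 * y ^ 2) by ring. nra.
        * rewrite EX. right; field.
      + apply avg_term_far; auto; try lra.
        * rewrite <- INR_1. apply le_INR. lia.
        * assert (HXp : 0 < INR X) by (apply lt_0_INR; lia).
          rewrite ln_div by auto.
          assert (L1 : 0 <= ln (INR (S i)) <= 161 * ln y).
          { split.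
            - rewrite <- ln_1. apply ln_le; [lra|]. rewrite <- INR_1. apply le_INR. lia.
            - apply Rle_trans with (ln (INR (2 * M))).
              + apply ln_le; auto. apply le_INR. lia.
              + rewrite mult_INR, ln_mult; [|simpl; lra|apply lt_0_INR; lia]. rewrite LM.
                replace (INR 2) with 2 by (simpl; ring). lra. }
          assert (L2 : Rabs (ln (INR X) - ln (INR (S i))) <= 161 * ln y).
          { apply Rabs_le. rewrite LX. lra. }
          apply Rle_trans with (a * (200 * y)); [apply Rmult_le_compat_l; lra|].
          unfold a. right. field. lra.
    - intros i Hi. apply avg_term_main with y; auto; try lra.
      split; [apply le_INR; lia|]. unfold y. rewrite <- plus_INR. apply le_INR. lia. }
  assert (Hex : INR (2 * M) * ex <= 1).
  { assert (P2 : 0 < INR (2 * M)) by (apply lt_0_INR; lia).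
    rewrite <- (exp_ln (INR (2 * M))) by auto. unfold ex. rewrite <- exp_plus, <- exp_0.
    rewrite mult_INR, ln_mult; [|simpl; lra|apply lt_0_INR; lia]. rewrite LM.
    replace (INR 2) with 2 by (simpl; ring).
    assert (ln 2 + 160 * ln y + - (y ^ 2 / 512) <= 0) by nra.
    destruct H as [H|H]; [left; apply exp_increasing; auto|rewrite H; lra]. }
  rewrite LX in LB.
  assert (E1 : y * (exp (- / 20 * (4 * ln y)) / 8) = exp (9 / 20 * ln y) * exp (7 / 20 * ln y) / 8).
  { rewrite <- exp_plus. replace (9 / 20 * ln y + 7 / 20 * ln y) with (ln y + - / 20 * (4 * ln y)) by field.
    rewrite exp_plus, exp_ln by lra. field. }
  rewrite E1 in LB.
  assert (Q1 : 1 <= exp (7 / 20 * ln y)).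
  { rewrite <- exp_0. left. apply exp_increasing. lra. }
  assert (Q2 : D < exp (9 / 20 * ln y)).
  { assert (0 < D) by (unfold D; lra). rewrite <- (exp_ln D) by auto. apply exp_increasing.
    assert (1 <= D) by (unfold D; lra). assert (0 <= ln D) by (rewrite <- ln_1; apply ln_le; lra). lra. }
  set (q := exp (7 / 20 * ln y)) in *. set (p := exp (9 / 20 * ln y)) in *.
  assert (D * q <= p * q) by (apply Rmult_le_compat_r; lra).
  unfold D in H. nra.
Qed.

(** * Existence of zeros away from the boundary *)

Lemma Im_near (z c : C) (r : R) : Cmod (z - c) < r -> Im c - r < Im z < Im c + r.
Proof.
  intros H. pose proof (im_le_Cmod (z - c)) as T.
  change (Im (z - c)%C) with (Im z - Im c) in T.
  assert (Rabs (Im z - Im c) < r) by lra. apply Rabs_def2 in H0. lra.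
Qed.

Lemma eta_conj_mod (u : R) : Cmod (eta (/ 20, - u)) = Cmod (eta (/ 20, u)).
Proof.
  assert (E : (/ 20, - u) = Cconj (/ 20, u)) by reflexivity.
  rewrite E. unfold eta.
  assert (N : forall v, ((/ 20, v)%R - 1)%C <> 0).
  { intros v H. apply (f_equal Re) in H. simpl in H. lra. }
  rewrite !Cmod_div; [|apply N|rewrite <- E; apply N].
  rewrite !Cmod_mult, Zf_conj, Cmod_conj by (simpl; lra).
  rewrite pw_conj. set (s := (/ 20, u) : C).
  assert (Ea : Cmod (1 - 2 * Cconj (pw 2 s)) = Cmod (1 - 2 * pw 2 s)).
  { rewrite <- (Cmod_conj (1 - 2 * pw 2 s)). rewrite Cminus_conj, Cmult_conj, !Cconj_R. auto. }
  assert (Eb : Cmod (Cconj s - 1) = Cmod (s - 1)).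
  { rewrite <- (Cmod_conj (s - 1)). rewrite Cminus_conj, Cconj_R. auto. }
  rewrite Ea, Eb. auto.
Qed.

Lemma eta_le_Zf (s : C) : 0 < Re s -> s <> 1 -> Cmod (eta s) <= 3 * Cmod (Zf s) / Cmod (s - 1).
Proof.
  intros Hs N. assert (N1 : (s - 1)%C <> 0) by (intros E; apply N, Cminus_0_eq, E).
  pose proof (proj1 (Cmod_gt_0 _) N1).
  unfold eta. rewrite Cmod_div, Cmod_mult by auto. apply Rmult_le_compat_r.
  - apply Rlt_le, Rinv_0_lt_compat. auto.
  - apply Rmult_le_compat_r; [apply Cmod_ge_0|].
    unfold Cminus. eapply Rle_trans; [apply Cmod_triangle|]. rewrite Cmod_1, Cmod_opp.
    rewrite Cmod_mult, pw_mod, Cmod_R, Rabs_pos_eq by lra.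
    assert (exp (- Re s * ln 2) <= 1); [|lra].
    rewrite <- exp_0. assert (0 < ln 2) by (rewrite <- ln_1; apply ln_increasing; lra).
    left. apply exp_increasing. nra.
Qed.

(** Discs about [3 + i t] of radius 119/40 stay in [Re > 1/40], and [1/20 + i t] is at distance
    59/20 from the centre. In the disc [Zf] is [O(t^2)] times its value at the centre; in a
    zero-free region [eps = 1/40] lowers this to [t^(1/20)], which [anti_lindelof] excludes. *)
Lemma Zf_zeros_up (T : R) : exists z, T <= Im z /\ / 40 < Re z /\ Zf z = 0.
Proof.
  apply NNPP. intros Hno.
  assert (Hz : forall z, T <= Im z -> / 40 < Re z -> Zf z <> 0).
  { intros z H1 H2 E. apply Hno. exists z. auto. }
  apply anti_lindelof.
  set (T0 := Rmax T 0 + 3).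
  assert (HT0 : 3 <= T0 /\ T + 3 <= T0).
  { unfold T0. pose proof (Rmax_l T 0). pose proof (Rmax_r T 0). lra. }
  (* On the unit disc about the centre [Re > 2], and [Zf] is at most 7 times its value at the
     centre, with [7 <= exp 6]. *)
  destruct (zero_free_growth 1 (59 / 20) (119 / 40) 6 (/ 40)) as [K HK]; try lra.
  assert (Big : forall t, T0 <= t ->
    Cmod (eta (/ 20, t)) <= 30 * exp K * 42 * 9 * exp (/ 20 * ln (1 + t))).
  { intros t Ht. set (c := (3, t) : C). set (s := (/ 20, t) : C).
    assert (Hc1 : 2 <= Cmod (c - 1)).
    { eapply Rle_trans; [|apply re_le_Cmod]. simpl. rewrite Rabs_pos_eq; lra. }
    assert (Nc1 : (c - 1)%C <> 0) by (apply Cmod_gt_0; lra).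
    assert (Zc : Zf c = ((c - 1) * zeta c)%C) by (apply Zf_zeta; simpl; lra).
    pose proof (zeta_lower c ltac:(simpl; lra)) as Zl.
    assert (Zc1 : Cmod (c - 1) / 2 <= Cmod (Zf c)).
    { rewrite Zc, Cmod_mult. apply Rmult_le_compat_l; lra. }
    assert (Hcm : Cmod c <= 3 + t).
    { eapply Rle_trans; [apply Cmod_le_re_im|]. simpl. rewrite !Rabs_pos_eq; lra. }
    set (A := ln 42 + 2 * ln (9 + t)).
    assert (l42 : 0 < ln 42) by (rewrite <- ln_1; apply ln_increasing; lra).
    assert (l9 : 0 < ln (9 + t)) by (rewrite <- ln_1; apply ln_increasing; lra).
    assert (EA : exp A = 42 * (9 + t) ^ 2).
    { unfold A. replace (2 * ln (9 + t)) with (ln (9 + t) + ln (9 + t)) by ring.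
      rewrite !exp_plus, !exp_ln by lra. ring. }
    assert (HB : Cmod (Zf s) <= exp (K + / 40 * A) * Cmod (Zf c)).
    { apply HK; [unfold A; lra| | | | |].
      - intros z Hzc. apply Zf_hol. pose proof (Re_near z c _ Hzc) as Q. simpl in Q. lra.
      - intros z Hzc. pose proof (Re_near z c _ Hzc) as Q. pose proof (Im_near z c _ Hzc) as Q'. simpl in Q, Q'.
        apply Hz; lra.
      - intros z Hzc. pose proof (Re_near z c _ Hzc) as Q. simpl in Q.
        eapply Rle_trans; [apply Zf_bound; lra|].
        apply Rle_trans with (exp A * 1); [|apply Rmult_le_compat_l; [apply Rlt_le, exp_pos|lra]].
        rewrite EA, Rmult_1_r.
        assert (Z1 : Cmod z <= 9 + t) by (pose proof (Cmod_tri_inv z c); lra).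
        assert (Z2 : Cmod (z - 1) <= 9 + t).
        { unfold Cminus. eapply Rle_trans; [apply Cmod_triangle|]. rewrite Cmod_opp, Cmod_1.
          pose proof (Cmod_tri_inv z c); lra. }
        assert (Z3 : / Re z + 1 <= 41).
        { assert (/ Re z <= / / 40) by (apply Rinv_le_contravar; lra). rewrite Rinv_inv in H. lra. }
        assert (Z4 : Cmod z * Cmod (z - 1) <= (9 + t) * (9 + t)) by (apply Rmult_le_compat; auto using Cmod_ge_0).
        assert (0 < / Re z) by (apply Rinv_0_lt_compat; lra).
        assert (Cmod z * Cmod (z - 1) * (/ Re z + 1) <= (9 + t) * (9 + t) * 41).
        { apply Rmult_le_compat; try lra. apply Rmult_le_pos; apply Cmod_ge_0. }
        nra.
      - intros z Hzc. pose proof (Re_near z c _ Hzc) as Q. simpl in Q.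
        rewrite (Zf_zeta z), Cmod_mult by lra.
        pose proof (zeta_upper z ltac:(lra)) as U.
        assert (/ (Re z - 1) <= 1) by (rewrite <- Rinv_1; apply Rinv_le_contravar; lra).
        assert (Cmod (z - 1) <= Cmod (c - 1) + 1).
        { pose proof (Cmod_tri_minus z c 1). lra. }
        assert (7 <= exp 6) by (pose proof (exp_ineq1_le 6); lra).
        pose proof (Cmod_ge_0 (z - 1)). pose proof (Cmod_ge_0 (zeta z)).
        apply Rle_trans with ((Cmod (c - 1) + 1) * 2); [apply Rmult_le_compat; lra|].
        apply Rle_trans with (7 * (Cmod (c - 1) / 2)); [lra|]. apply Rmult_le_compat; lra.
      - replace (s - c)%C with (RtoC (- (59 / 20))).
        + rewrite Cmod_R, Rabs_Ropp, Rabs_pos_eq; lra.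
        + unfold s, c. apply injective_projections; simpl; field. }
    assert (Ns1 : s <> 1) by (intros E; apply (f_equal Re) in E; simpl in E; lra).
    eapply Rle_trans; [apply eta_le_Zf; auto; simpl; lra|].
    assert (Hs1 : 3 <= Cmod (s - 1)).
    { eapply Rle_trans; [|apply im_le_Cmod]. simpl. rewrite Rabs_pos_eq; lra. }
    assert (Hcs : Cmod (c - 1) <= 2 * Cmod (s - 1)).
    { pose proof (Cmod_tri_minus c s 1) as Q. replace (c - s)%C with (RtoC (59 / 20)) in Q.
      - rewrite Cmod_R, Rabs_pos_eq in Q; lra.
      - unfold s, c. apply injective_projections; simpl; field. }
    assert (Zc2 : Cmod (Zf c) <= Cmod (c - 1) * 2).
    { rewrite Zc, Cmod_mult. apply Rmult_le_compat_l; [lra|].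
      eapply Rle_trans; [apply zeta_upper; simpl; lra|]. simpl. lra. }
    apply Rmult_le_reg_r with (Cmod (s - 1)); [lra|].
    unfold Rdiv. rewrite Rmult_assoc, Rinv_l, Rmult_1_r by lra.
    set (ek := exp (K + / 40 * A)) in *. assert (0 < ek) by apply exp_pos.
    assert (Eek : ek <= exp K * 42 * 9 * exp (/ 20 * ln (1 + t))).
    { unfold ek. rewrite exp_plus, !Rmult_assoc. apply Rmult_le_compat_l; [apply Rlt_le, exp_pos|].
      assert (L1 : ln (9 + t) <= ln 9 + ln (1 + t)).
      { rewrite <- ln_mult by lra. apply ln_le; lra. }
      assert (0 < ln 9) by (rewrite <- ln_1; apply ln_increasing; lra).
      assert (L2 : / 40 * A <= ln 42 + (ln 9 + / 20 * ln (1 + t))) by (unfold A; lra).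
      rewrite <- (exp_ln 42) at 1 by lra. rewrite <- (exp_ln 9) at 1 by lra. rewrite <- !exp_plus.
      destruct L2 as [L2|L2]; [left; apply exp_increasing; auto|rewrite L2; lra]. }
    assert (Cmod (Zf s) <= ek * (4 * Cmod (s - 1))).
    { eapply Rle_trans; [exact HB|]. apply Rmult_le_compat_l; lra. }
    set (Q := exp K * 42 * 9 * exp (/ 20 * ln (1 + t))) in *.
    replace (30 * exp K * 42 * 9 * exp (/ 20 * ln (1 + t))) with (30 * Q) by (unfold Q; ring).
    assert (ek * (4 * Cmod (s - 1)) <= Q * (4 * Cmod (s - 1))) by (apply Rmult_le_compat_r; lra).
    assert (0 <= Q * Cmod (s - 1)) by (apply Rmult_le_pos; lra). nra. }
  set (Ks := 30 * exp K * 42 * 9). set (K2 := 6 * (1 + (1 + T0) * (2 + T0) * 21)).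
  assert (Pos : forall u, 0 <= u -> Cmod (eta (/ 20, u)) <= (Ks + K2) * exp (/ 20 * ln (1 + u))).
  { intros u Hu. pose proof (exp_pos K).
    assert (0 <= Ks) by (unfold Ks; lra).
    assert (0 <= K2). { unfold K2. assert (0 <= (1 + T0) * (2 + T0)) by nra. lra. }
    destruct (Rle_or_lt T0 u) as [L|L].
    - eapply Rle_trans; [apply Big; auto|]. fold Ks.
      apply Rmult_le_compat_r; [apply Rlt_le, exp_pos|lra].
    - assert (E1 : 1 <= exp (/ 20 * ln (1 + u))).
      { rewrite <- exp_0 at 1. assert (0 <= ln (1 + u)) by (rewrite <- ln_1; apply ln_le; lra).
        assert (H3 : 0 <= / 20 * ln (1 + u)) by lra.
        destruct H3 as [H3|H3]; [left; apply exp_increasing; auto|rewrite <- H3; lra]. }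
      assert (Ns1 : (/ 20, u) <> RtoC 1) by (intros E; apply (f_equal Re) in E; simpl in E; lra).
      apply Rle_trans with K2; [|nra].
      eapply Rle_trans; [apply eta_le_Zf; auto; simpl; lra|].
      assert (Hs1 : / 2 <= Cmod ((/ 20, u)%R - 1)).
      { eapply Rle_trans; [|apply re_le_Cmod]. simpl. rewrite Rabs_left; lra. }
      assert (Hm : Cmod (/ 20, u) <= 1 + T0).
      { eapply Rle_trans; [apply Cmod_le_re_im|]. simpl. rewrite !Rabs_pos_eq; lra. }
      assert (Hm1 : Cmod ((/ 20, u)%R - 1) <= 2 + T0).
      { eapply Rle_trans; [apply Cmod_triangle|]. rewrite Cmod_opp, Cmod_1. lra. }
      pose proof (Zf_bound (/ 20, u) ltac:(simpl; lra)) as B. simpl Re in B. rewrite Rinv_inv in B.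
      assert (B2 : Cmod (/ 20, u) * Cmod ((/ 20, u)%R - 1) <= (1 + T0) * (2 + T0))
        by (apply Rmult_le_compat; auto using Cmod_ge_0).
      assert (B3 : Cmod (Zf (/ 20, u)) <= 1 + (1 + T0) * (2 + T0) * 21) by lra.
      apply Rmult_le_reg_r with (Cmod ((/ 20, u)%R - 1)); [lra|].
      unfold Rdiv. rewrite Rmult_assoc, Rinv_l, Rmult_1_r by lra.
      apply Rle_trans with (3 * (1 + (1 + T0) * (2 + T0) * 21)); [lra|].
      unfold K2. assert (0 <= (1 + T0) * (2 + T0)) by nra. nra. }
  exists (Ks + K2). intros u. destruct (Rle_or_lt 0 u) as [H|H].
  - rewrite Rabs_pos_eq by auto. apply Pos. auto.
  - rewrite <- eta_conj_mod, Rabs_left by auto. apply Pos. lra.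
Qed.

(** The height is written [y * x] so that dividing the zero by an [n] close to a large [x] lands
    near [i y]. Conjugation covers negative [y]. *)
Lemma Zf_zeros (y X : R) : y <> 0 -> exists b x, X <= x /\ / 40 < b /\ Zf (b, y * x) = 0.
Proof.
  intros Hy. destruct (Zf_zeros_up (Rabs y * X)) as [[b g] [H1 [H2 H3]]]. simpl in H1, H2.
  assert (Hay : 0 < Rabs y) by (apply Rabs_pos_lt; auto).
  exists b, (g / Rabs y). split; [|split; auto].
  - apply Rmult_le_reg_l with (Rabs y); auto. replace (Rabs y * (g / Rabs y)) with g by (field; lra). auto.
  - unfold Rabs. destruct (Rcase_abs y) as [c|c].
    + replace (y * (g / - y)) with (- g) by (field; auto).
      change (b, - g) with (Cconj (b, g)). rewrite Zf_conj by (simpl; lra). rewrite H3. apply Cconj_R.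
    + replace (y * (g / y)) with g by (field; auto). auto.
Qed.

(** * Euler products *)

Definition is_prime (p : nat) : Prop := prime.prime p = true.

Module PrimeFacts.
Import ssreflect ssrfun ssrbool eqtype ssrnat seq div prime.
Local Open Scope nat_scope.

Lemma ord_mul (p a b : nat) : lt 0 a -> lt 0 b -> ord p (Nat.mul a b) = Nat.add (ord p a) (ord p b).
Proof. move=> /ltP Ha /ltP Hb. exact: lognM. Qed.

Lemma ord_pow_self (p e : nat) : is_prime p -> ord p (Nat.pow p e) = e.
Proof.
move=> pp. have -> : Nat.pow p e = expn p e by elim: e => [|e IH] //=; rewrite expnS IH.
exact: pfactorK.
Qed.

Lemma ord_pow_other (p q e : nat) : is_prime p -> is_prime q -> q <> p -> ord q (Nat.pow p e) = 0.
Proof.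
move=> pp pq /eqP npq. have -> : Nat.pow p e = expn p e by elim: e => [|e IH] //=; rewrite expnS IH.
rewrite /ord lognX logn_prime //. by rewrite (negbTE npq) muln0.
Qed.

Lemma ord_divides (p e n : nat) : is_prime p -> lt 0 n -> (le e (ord p n) <-> Nat.divide (Nat.pow p e) n).
Proof.
move=> pp /ltP Hn. have -> : Nat.pow p e = expn p e by elim: e => [|e IH] //=; rewrite expnS IH.
have H := pfactor_dvdn e pp Hn. split.
- move=> /leP; rewrite -H => /dvdnP[q ->]. by exists q.
- case=> q Eq. apply/leP. rewrite -H. apply/dvdnP. by exists q.
Qed.

Lemma prime_ge2 (p : nat) : is_prime p -> le 2 p.
Proof. move=> pp. apply/leP. exact: prime_gt1. Qed.

Lemma prime_divisor (n : nat) : lt 1 n -> exists p, is_prime p /\ le p n /\ lt 0 (ord p n).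
Proof.
move=> /ltP Hn. exists (pdiv n). split; first exact: pdiv_prime. split.
- apply/leP. apply: dvdn_leq (pdiv_dvd n). exact: ltnW.
- apply/ltP. rewrite /ord logn_gt0 mem_primes pdiv_prime // pdiv_dvd andbT. exact: ltnW.
Qed.

Lemma prime_pow_inj (p q a b : nat) : is_prime p -> is_prime q -> lt 0 a ->
  Nat.pow p a = Nat.pow q b -> p = q.
Proof.
move=> pp pq Ha E. case: (eqVneq p q) => [//|/eqP N]. exfalso.
have H1 := ord_pow_self p a pp. rewrite E in H1.
rewrite (ord_pow_other q p b pq pp N) in H1. by rewrite -H1 in Ha; move/ltP: Ha.
Qed.

Lemma is_prime_dec (p : nat) : {is_prime p} + {~ is_prime p}.
Proof. rewrite /is_prime. by case: (prime p); [left|right]. Qed.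
End PrimeFacts.
Import PrimeFacts.

(** * The local factor at one prime, in terms of indicators *)

Definition okord (k l a : nat) : Prop := (exists j, (j < l)%nat /\ a = (j * k)%nat) \/ (l * k <= a)%nat.

(** Step-powerful numbers free of primes up to [x]. The Euler product arises by letting [x] run, one
    prime at a time. *)
Definition rough (k l x n : nat) : Prop :=
  step_powerful k l n /\ forall p, is_prime p -> (p <= x)%nat -> ord p n = 0%nat.

Definition ind (P : Prop) : C := if excluded_middle_informative P then 1%C else 0%C.

Lemma ind_true (P : Prop) : P -> ind P = 1.
Proof. intros H. unfold ind. destruct (excluded_middle_informative P); tauto. Qed.

Lemma ind_false (P : Prop) : ~ P -> ind P = 0.
Proof. intros H. unfold ind. destruct (excluded_middle_informative P); tauto. Qed.

Lemma ind_iff (P Q : Prop) : (P <-> Q) -> ind P = ind Q.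
Proof.
  intros H. destruct (classic P) as [p|p].
  - rewrite !ind_true; tauto.
  - rewrite !ind_false; tauto.
Qed.

Lemma ind_and (P Q : Prop) : ind (P /\ Q) = (ind P * ind Q)%C.
Proof.
  destruct (classic P), (classic Q); rewrite ?(ind_true P), ?(ind_false P), ?(ind_true Q), ?(ind_false Q),
    ?(ind_true (P /\ Q)), ?(ind_false (P /\ Q)) by tauto; ring.
Qed.

Lemma ind_le1 (P : Prop) : Cmod (ind P) <= 1.
Proof. unfold ind. destruct (excluded_middle_informative P); rewrite ?Cmod_1, ?Cmod_0; lra. Qed.

Lemma csum_zero (a : nat -> C) (n : nat) : (forall i, (i < n)%nat -> a i = 0%C) -> csum a n = 0.
Proof. intros H. induction n as [|n IH]; simpl; auto. rewrite IH, H; auto. ring. Qed.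

Lemma csum_single (a : nat -> C) (n j : nat) : (j < n)%nat -> (forall i, (i < n)%nat -> i <> j -> a i = 0%C) ->
  csum a n = a j.
Proof.
  intros Hj H. induction n as [|n IH]; [lia|]. simpl. destruct (Nat.eq_dec j n) as [->|N].
  - rewrite csum_zero; [ring|]. intros i Hi. apply H; lia.
  - rewrite IH, (H n) by (try lia; intros; apply H; lia). ring.
Qed.

(** Coefficient form of [(1 - u^k) S(u) = Q(u)], where [S] is the sum of [u^a] over admissible [a]:
    a nonzero admissible exponent either stays admissible after subtracting [k], or lies strictly
    between [l k] and [(l + 1) k]. *)
Lemma okord_telescope (k l a : nat) : (0 < k)%nat -> (0 < l)%nat ->
  (ind (okord k l a) - ind ((k <= a)%nat /\ okord k l (a - k)) =
   ind (a = 0%nat) + csum (fun i => ind (a = l * k + 1 + i)%nat) (k - 1))%C.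
Proof.
  intros Hk Hl.
  assert (ES : csum (fun i => ind (a = l * k + 1 + i)%nat) (k - 1) =
    ind (l * k + 1 <= a <= l * k + k - 1)%nat).
  { destruct (classic (l * k + 1 <= a <= l * k + k - 1)%nat) as [H|H].
    - rewrite (ind_true _ H). rewrite (csum_single _ _ (a - l * k - 1)%nat).
      + apply ind_true. lia.
      + lia.
      + intros i Hi N. apply ind_false. lia.
    - rewrite (ind_false _ H). apply csum_zero. intros i Hi. apply ind_false. lia. }
  rewrite ES.
  assert (HBA : (k <= a)%nat /\ okord k l (a - k) -> okord k l a).
  { intros [H [[j [Hj E]]|H']]; [|right; lia].
    destruct (Nat.eq_dec (S j) l) as [El|Nl]; [right; subst l; simpl; lia|].
    left. exists (S j). split; [lia|simpl; lia]. }
  assert (HAB : okord k l a -> ~ ((k <= a)%nat /\ okord k l (a - k)) ->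
     a = 0%nat \/ (l * k + 1 <= a <= l * k + k - 1)%nat).
  { intros [[[|j] [Hj E]]|H] HB; [left; auto| |].
    - exfalso. apply HB. split; [simpl in E; lia|]. left. exists j. split; [lia|simpl in E; lia].
    - right. assert (k <= a)%nat by nia.
      assert (a <> l * k)%nat.
      { intros E. apply HB. split; auto. left. exists (l - 1)%nat. split; [lia|nia]. }
      assert (~ (l * k + k <= a)%nat); [|lia]. intros E. apply HB. split; auto. right. lia. }
  destruct (Nat.eq_dec a 0) as [E0|N0].
  - rewrite (ind_true (okord k l a)) by (left; exists 0%nat; lia).
    rewrite (ind_false ((k <= a)%nat /\ _)) by lia. rewrite (ind_true (a = 0%nat)) by auto.
    rewrite ind_false by lia. ring.
  - rewrite (ind_false (a = 0%nat)) by auto.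
    destruct (classic (l * k + 1 <= a <= l * k + k - 1)%nat) as [H|H].
    + rewrite (ind_true _ H), (ind_true (okord k l a)) by (right; lia).
      rewrite ind_false; [ring|]. intros [Hka [[j [Hj E]]|Hl2]]; [|lia]. nia.
    + rewrite (ind_false _ H). destruct (classic ((k <= a)%nat /\ okord k l (a - k))) as [B|B].
      * rewrite (ind_true _ B), (ind_true _ (HBA B)). ring.
      * rewrite (ind_false _ B). rewrite ind_false; [ring|]. intros A. destruct (HAB A B); auto.
Qed.

Lemma step_powerful_iff (k l n : nat) :
  step_powerful k l n <-> (0 < n)%nat /\ forall p, is_prime p -> okord k l (ord p n).
Proof. reflexivity. Qed.

(** What [rough] asks of [n] apart from the exponent of [p]. For [p = x + 1] both [rough x] and
    [rough (x + 1)] are this plus a condition on that exponent, and division by powers of [p]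
    preserves it. *)
Definition base (k l x p n : nat) : Prop :=
  (0 < n)%nat /\ (forall q, is_prime q -> q <> p -> okord k l (ord q n)) /\
  (forall q, is_prime q -> (q <= x)%nat -> ord q n = 0%nat).

Lemma rough_base (k l x n : nat) : is_prime (S x) ->
  (rough k l x n <-> base k l x (S x) n /\ okord k l (ord (S x) n)).
Proof.
  intros Hp. unfold rough, base. rewrite step_powerful_iff. split.
  - intros [[H1 H2] H3]. repeat split; auto.
  - intros [[H1 [H2 H3]] H4]. repeat split; auto. intros q Hq.
    destruct (Nat.eq_dec q (S x)) as [->|N]; auto.
Qed.

Lemma rough_S_base (k l x n : nat) : (0 < l)%nat -> is_prime (S x) ->
  (rough k l (S x) n <-> base k l x (S x) n /\ ord (S x) n = 0%nat).
Proof.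
  intros Hl Hp. unfold rough, base. rewrite step_powerful_iff. split.
  - intros [[H1 H2] H3]. repeat split; auto.
  - intros [[H1 [H2 H3]] H4]. repeat split; auto.
    + intros q Hq. destruct (Nat.eq_dec q (S x)) as [->|N]; auto.
      rewrite H4. left. exists 0%nat. auto.
    + intros q Hq Hle. destruct (Nat.eq_dec q (S x)) as [->|N]; auto. apply H3; auto. lia.
Qed.

Lemma base_div (k l x p e n : nat) : is_prime p -> (x < p)%nat -> Nat.divide (p ^ e) n ->
  (base k l x p (n / p ^ e) <-> base k l x p n).
Proof.
  intros Hp Hx [m E]. pose proof (prime_ge2 p Hp).
  assert (P : (0 < p ^ e)%nat) by (pose proof (Nat.pow_nonzero p e ltac:(lia)); lia).
  assert (En : (n / p ^ e = m)%nat) by (rewrite E; apply Nat.div_mul; lia). rewrite En.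
  destruct (Nat.eq_dec m 0) as [->|Nm].
  { simpl in E. subst n. reflexivity. }
  assert (Hn : (0 < n)%nat) by nia.
  assert (O : forall q, is_prime q -> q <> p -> ord q n = ord q m).
  { intros q Hq Nq. rewrite E, ord_mul by lia. rewrite ord_pow_other by auto. lia. }
  split; intros [H1 [H2 H3]]; (split; [lia|]); split; intros q Hq Hle.
  - rewrite O; auto.
  - rewrite O; auto. lia.
  - rewrite <- O; auto.
  - rewrite <- O; auto. lia.
Qed.

Lemma ord_div (p e n : nat) : is_prime p -> (0 < n)%nat -> Nat.divide (p ^ e) n ->
  ord p (n / p ^ e) = (ord p n - e)%nat.
Proof.
  intros Hp Hn [m E]. pose proof (prime_ge2 p Hp).
  assert (P : (0 < p ^ e)%nat) by (pose proof (Nat.pow_nonzero p e ltac:(lia)); lia).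
  rewrite E at 1. rewrite Nat.div_mul by lia. rewrite E, ord_mul, ord_pow_self by (auto; nia). lia.
Qed.

(** The set of products [d m] with [m] in [g]; its Dirichlet series is [d^(-s)] times that of
    [g]. *)
Definition dil (d : nat) (g : nat -> Prop) (n : nat) : Prop := Nat.divide d n /\ g (n / d)%nat.

Lemma dil_rough (k l x e n : nat) (Y : nat -> Prop) (W : nat -> Prop) : is_prime (S x) ->
  (forall m, W m <-> base k l x (S x) m /\ Y (ord (S x) m)) ->
  (dil (S x ^ e) W n <-> base k l x (S x) n /\ ((e <= ord (S x) n)%nat /\ Y (ord (S x) n - e)%nat)).
Proof.
  intros Hp HW. unfold dil. rewrite HW. split.
  - intros [Hd [Hb HY]]. rewrite base_div in Hb by auto. pose proof (proj1 Hb) as Hn.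
    rewrite ord_div in HY by auto. split; auto. split; auto. apply ord_divides; auto.
  - intros [Hb [He HY]]. pose proof (proj1 Hb) as Hn.
    assert (Hd : Nat.divide (S x ^ e) n) by (apply ord_divides; auto).
    rewrite base_div, ord_div by auto. auto.
Qed.

(** The telescoping identity for the exponent of [S x], multiplied by the indicator of [base], which
    all the sets involved share. *)
Lemma rough_step (k l x n : nat) : (0 < k)%nat -> (0 < l)%nat -> is_prime (S x) ->
  (ind (rough k l x n) - ind (dil (S x ^ k) (rough k l x) n) =
   ind (rough k l (S x) n) + csum (fun i => ind (dil (S x ^ (l * k + 1 + i)) (rough k l (S x)) n)) (k - 1))%C.
Proof.
  intros Hk Hl Hp. set (a := ord (S x) n). set (B := base k l x (S x) n).
  rewrite (ind_iff (rough k l x n) (B /\ okord k l a)) by (apply rough_base; auto).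
  rewrite (ind_iff (rough k l (S x) n) (B /\ a = 0%nat)) by (apply rough_S_base; auto).
  rewrite (ind_iff (dil _ _ n) (B /\ ((k <= a)%nat /\ okord k l (a - k)))).
  2:{ apply dil_rough; auto. intros m. apply rough_base; auto. }
  rewrite (csum_ext _ (fun i => ind B * ind (a = l * k + 1 + i)%nat)%C).
  - rewrite csum_scal, (ind_and B (okord k l a)), (ind_and B (_ /\ _)), (ind_and B (a = 0%nat)).
    transitivity (ind B * (ind (okord k l a) - ind ((k <= a)%nat /\ okord k l (a - k))))%C; [ring|].
    rewrite okord_telescope by auto. ring.
  - intros i _. rewrite <- ind_and. apply ind_iff.
    rewrite (dil_rough k l x (l * k + 1 + i) n (fun b => b = 0%nat)); auto.
    + fold a. fold B. split; intros [H1 H2]; split; auto; lia.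
    + intros m. apply rough_S_base; auto.
Qed.

(** * Dirichlet series of sets of integers *)

Definition DS (g : nat -> Prop) (s : C) : C := CSeries (fun n => (ind (g n) * pw (INR n) s)%C).

(** The series over sets start at [n = 0], with a vanishing term, so the tail bounds shift by
    one. *)
Definition zB1 (sg : R) (m : nat) : R := match m with O => zB (sg - 1) 0 | S m => zB (sg - 1) m end.

Lemma tails_zB1 (sg : R) : 1 < sg ->
  tails (fun n => match n with O => 0 | S m => zb (sg - 1) m end) (zB1 sg).
Proof.
  intros Hs. destruct (tails_zb (sg - 1)) as [T1 T2]; [lra|].
  assert (E : forall n, rsum (fun n => match n with O => 0 | S m => zb (sg - 1) m end) (S n) = rsum (zb (sg - 1)) n).
  { induction n as [|n IH]; [simpl; ring|]. cbn [rsum] in *. rewrite IH. auto. }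
  split.
  - intros [|m] [|n] Hmn; try lia; rewrite ?E; unfold zB1.
    + simpl rsum. specialize (T1 0%nat 0%nat ltac:(lia)). lra.
    + specialize (T1 0%nat n ltac:(lia)). simpl rsum in *. lra.
    + apply T1. lia.
  - intros e He. destruct (T2 e He) as [N HN]. exists (S N). intros [|n] Hn; [lia|]. apply HN. lia.
Qed.

Lemma DS_spec (g : nat -> Prop) (s : C) : ~ g 0%nat -> 1 < Re s ->
  clim (csum (fun n => (ind (g n) * pw (INR n) s)%C)) (DS g s) /\
  forall n, Cmod (DS g s - csum (fun n => (ind (g n) * pw (INR n) s)%C) n) <= zB1 (Re s) n.
Proof.
  intros Hg Hs.
  destruct (cseries_exists (fun n => (ind (g n) * pw (INR n) s)%C)
    (fun n => match n with O => 0 | S m => zb (Re s - 1) m end) (zB1 (Re s))) as [l [H1 H2]];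
    [|apply tails_zB1; auto|].
  - intros [|n].
    + rewrite (ind_false _ Hg), Cmult_0_l, Cmod_0. lra.
    + rewrite Cmod_mult, pw_mod, zb_shift. pose proof (ind_le1 (g (S n))).
      pose proof (exp_pos (- Re s * ln (INR (S n)))). nra.
  - unfold DS. rewrite (clim_CSeries _ _ H1). auto.
Qed.

(** Partial sums are compared at multiples of [d]: each block of [d] consecutive integers contains
    exactly one multiple. *)
Lemma DS_dil (d : nat) (g : nat -> Prop) (s : C) : (0 < d)%nat -> ~ g 0%nat -> 1 < Re s ->
  DS (dil d g) s = (pw (INR d) s * DS g s)%C.
Proof.
  intros Hd Hg Hs.
  assert (Hg' : ~ dil d g 0%nat). { intros [_ H]. rewrite Nat.Div0.div_0_l in H. auto. }
  destruct (DS_spec (dil d g) s Hg' Hs) as [H1 _]. destruct (DS_spec g s Hg Hs) as [H2 _].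
  set (u := fun n => (ind (dil d g n) * pw (INR n) s)%C) in *.
  assert (Hsub : clim (fun N => csum u (d * N)) (DS (dil d g) s)).
  { apply (clim_subseq (csum u) _ (fun N => (d * N)%nat)); auto. intros n. nia. }
  apply (clim_unique _ _ _ Hsub).
  apply clim_ext with (fun N => pw (INR d) s * csum (fun n => (ind (g n) * pw (INR n) s)%C) N)%C.
  - induction n as [|n IH].
    + rewrite Nat.mul_0_r. simpl. ring.
    + assert (Eb : forall j, (0 < j <= d)%nat -> csum u (d * n + j) =
         (csum u (d * n) + pw (INR d) s * (ind (g n) * pw (INR n) s))%C).
      { induction j as [|j IHj]; intros Hj; [lia|].
        rewrite Nat.add_succ_r. simpl csum. destruct (Nat.eq_dec j 0) as [->|Nj].
        - rewrite Nat.add_0_r. f_equal. unfold u.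
          rewrite (ind_iff (dil d g (d * n)) (g n)).
          + destruct (Nat.eq_dec n 0) as [->|Nn].
            * rewrite (ind_false _ Hg). ring.
            * rewrite mult_INR, pw_mult by (apply lt_0_INR; lia). ring.
          + unfold dil. rewrite (Nat.mul_comm d n), Nat.div_mul by lia. split; [tauto|].
            intros H. split; auto. exists n. auto.
        - rewrite IHj by lia. unfold u at 2. rewrite (ind_false (dil d g _)); [ring|].
          intros [[q E] _]. destruct (Nat.le_gt_cases q n) as [L|L]; [nia|]. assert (d * (n + 1) <= q * d)%nat by nia. lia. }
      replace (d * S n)%nat with (d * n + d)%nat by lia. rewrite Eb by lia. rewrite <- IH. cbn [csum]. ring.
  - apply clim_mult; auto. apply clim_const.
Qed.

Lemma clim_csum (f : nat -> nat -> C) (l : nat -> C) (m : nat) :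
  (forall i, clim (fun n => f n i) (l i)) -> clim (fun n => csum (f n) m) (csum l m).
Proof.
  intros H. induction m as [|m IH]; simpl; [apply clim_const|]. apply clim_plus; auto.
Qed.

Lemma clim_opp (x : nat -> C) (l : C) : clim x l -> clim (fun n => (- x n)%C) (- l).
Proof.
  intros H. apply clim_ext with (fun n => - (1) * x n)%C; [intros; ring|].
  replace (- l)%C with (- (1) * l)%C by ring. apply clim_mult; auto. apply clim_const.
Qed.

Definition Qpoly (k l : nat) (u : C) : C := (1 + csum (fun i => u ^ (l * k + 1 + i)) (k - 1))%C.

Lemma rough_0 (k l x : nat) : ~ rough k l x 0.
Proof. intros [[H _] _]. lia. Qed.

(** One prime is sieved out by summing a pointwise identity of indicators; no expansion of a product
    into a series has to be rearranged. *)
Lemma DS_rough_step (k l x : nat) (s : C) : (0 < k)%nat -> (0 < l)%nat -> is_prime (S x) -> 1 < Re s ->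
  (DS (rough k l x) s * (1 - pw (INR (S x)) s ^ k) =
   Qpoly k l (pw (INR (S x)) s) * DS (rough k l (S x)) s)%C.
Proof.
  intros Hk Hl Hp Hs. set (p := S x) in *.
  assert (Hp0 : (0 < p)%nat) by (unfold p; lia).
  assert (Epw : forall e, pw (INR (p ^ e)) s = (pw (INR p) s ^ e)%C).
  { intros e. rewrite pow_INR. apply pw_pow. apply lt_0_INR; auto. }
  assert (Hpe : forall e, (0 < p ^ e)%nat).
  { intros e. pose proof (Nat.pow_nonzero p e ltac:(lia)). lia. }
  assert (Hdil : forall e y, ~ dil (p ^ e) (rough k l y) 0).
  { intros e y [_ H]. rewrite Nat.Div0.div_0_l in H. apply rough_0 in H; auto. }
  set (t := fun (g : nat -> Prop) n => (ind (g n) * pw (INR n) s)%C).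
  assert (L : clim (fun n => csum (t (rough k l x)) n + - csum (t (dil (p ^ k) (rough k l x))) n)%C
    (DS (rough k l x) s + - (pw (INR p) s ^ k * DS (rough k l x) s))).
  { apply clim_plus; [apply DS_spec; auto; apply rough_0|]. apply clim_opp.
    rewrite <- Epw, <- DS_dil by (auto; apply rough_0). apply DS_spec; auto. }
  assert (R0 : clim (fun n => csum (t (rough k l p)) n +
      csum (fun i => csum (t (dil (p ^ (l * k + 1 + i)) (rough k l p))) n) (k - 1))%C
    (DS (rough k l p) s + csum (fun i => pw (INR p) s ^ (l * k + 1 + i) * DS (rough k l p) s)%C (k - 1))).
  { apply clim_plus; [apply DS_spec; auto; apply rough_0|].
    apply (clim_csum (fun n i => csum (t (dil (p ^ (l * k + 1 + i)) (rough k l p))) n)). intros i.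
    rewrite <- Epw, <- DS_dil by (auto; apply rough_0). apply DS_spec; auto. }
  assert (E : (DS (rough k l x) s + - (pw (INR p) s ^ k * DS (rough k l x) s) =
    DS (rough k l p) s + csum (fun i => pw (INR p) s ^ (l * k + 1 + i) * DS (rough k l p) s)%C (k - 1))%C).
  { apply (clim_unique _ _ _ L). revert R0. apply clim_ext. intros n.
    induction n as [|n IH].
    - simpl. rewrite csum_zero by auto. ring.
    - cbn [csum]. rewrite csum_plus.
      replace (csum (t (rough k l x)) n + t (rough k l x) n +
        - (csum (t (dil (p ^ k) (rough k l x))) n + t (dil (p ^ k) (rough k l x)) n))%C with
        ((csum (t (rough k l x)) n + - csum (t (dil (p ^ k) (rough k l x))) n) +
          (t (rough k l x) n - t (dil (p ^ k) (rough k l x)) n))%C by ring.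
      rewrite <- IH.
      assert (Et : (t (rough k l x) n - t (dil (p ^ k) (rough k l x)) n = t (rough k l p) n +
         csum (fun i => t (dil (p ^ (l * k + 1 + i)) (rough k l p)) n) (k - 1))%C).
      { unfold t. rewrite (csum_ext _ (fun i => pw (INR n) s * ind (dil (p ^ (l * k + 1 + i)) (rough k l p) n))%C)
          by (intros; ring).
        rewrite csum_scal. pose proof (rough_step k l x n Hk Hl Hp) as RS. fold p in RS.
        transitivity (pw (INR n) s * (ind (rough k l x n) - ind (dil (p ^ k) (rough k l x) n)))%C; [ring|].
        rewrite RS. ring. }
      rewrite Et. ring. }
  unfold Qpoly.
  transitivity (DS (rough k l x) s + - (pw (INR p) s ^ k * DS (rough k l x) s))%C; [ring|].
  rewrite E. rewrite (csum_ext _ (fun i => DS (rough k l p) s * pw (INR p) s ^ (l * k + 1 + i))%C) by (intros; ring).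
  rewrite csum_scal. ring.
Qed.

(** * Euler products and the closed forms for k at most 2 *)

Fixpoint pprod (f : nat -> C) (x : nat) : C :=
  match x with
  | O => 1%C
  | S x => (pprod f x * (if is_prime_dec (S x) then f (S x) else 1))%C
  end.

Lemma pprod_mult (f g : nat -> C) (x : nat) : pprod (fun p => f p * g p)%C x = (pprod f x * pprod g x)%C.
Proof. induction x as [|x IH]; simpl; [ring|]. rewrite IH. destruct (is_prime_dec (S x)); ring. Qed.

Lemma pprod_ext (f g : nat -> C) (x : nat) : (forall p, is_prime p -> f p = g p) -> pprod f x = pprod g x.
Proof. intros H. induction x as [|x IH]; simpl; auto. rewrite IH. destruct (is_prime_dec (S x)); auto. rewrite H; auto. Qed.

Lemma pprod_pow (f : nat -> C) (n x : nat) : pprod (fun p => f p ^ n)%C x = (pprod f x ^ n)%C.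
Proof.
  induction x as [|x IH]; simpl; [rewrite Cpow_1_l; auto|]. rewrite IH, Cpow_mult_l.
  destruct (is_prime_dec (S x)); auto. rewrite Cpow_1_l; auto.
Qed.

Lemma rough_not_prime (k l x n : nat) : ~ is_prime (S x) -> (rough k l x n <-> rough k l (S x) n).
Proof.
  intros Hp. unfold rough. split; intros [H1 H2]; split; auto; intros q Hq Hle.
  - destruct (Nat.eq_dec q (S x)) as [->|N]; [tauto|]. apply H2; auto. lia.
Qed.

Lemma euler_finite (k l : nat) (s : C) (x : nat) : (0 < k)%nat -> (0 < l)%nat -> 1 < Re s ->
  (DS (rough k l 0) s * pprod (fun p => 1 - pw (INR p) s ^ k) x =
   pprod (fun p => Qpoly k l (pw (INR p) s)) x * DS (rough k l x) s)%C.
Proof.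
  intros Hk Hl Hs. induction x as [|x IH]; cbn [pprod]; [cbn; ring|].
  destruct (is_prime_dec (S x)) as [Hp|Hp].
  - rewrite Cmult_assoc, IH, <- Cmult_assoc, DS_rough_step by auto. ring.
  - rewrite !Cmult_1_r, IH. f_equal. unfold DS. f_equal. apply functional_extensionality. intros n.
    rewrite (ind_iff _ _ (rough_not_prime k l x n Hp)). auto.
Qed.

(** Up to [x] only [n = 1] is rough, since every larger integer has a prime divisor not exceeding
    itself; the tail bound does not depend on the set. *)
Lemma DS_rough_lim (k l : nat) (s : C) : (0 < l)%nat -> 1 < Re s -> clim (fun x => DS (rough k l x) s) 1.
Proof.
  intros Hl Hs e He. destruct (tails_zB1 (Re s) Hs) as [_ T]. destruct (T e He) as [N HN].
  exists (S N). intros x Hx.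
  destruct (DS_spec (rough k l x) s (rough_0 k l x) Hs) as [_ H]. specialize (H (S x)).
  assert (E : csum (fun n => (ind (rough k l x n) * pw (INR n) s)%C) (S x) = 1).
  { assert (Z : forall i, (i < S x)%nat -> i <> 1%nat -> (ind (rough k l x i) * pw (INR i) s)%C = 0).
    { intros [|[|i]] Hi Ni; [rewrite ind_false by apply rough_0; ring|lia|].
      rewrite ind_false; [ring|]. intros [_ Hr].
      destruct (prime_divisor (S (S i)) ltac:(lia)) as [p [P1 [P2 P3]]].
      specialize (Hr p P1 ltac:(lia)). lia. }
    rewrite (csum_single (fun n => (ind (rough k l x n) * pw (INR n) s)%C) (S x) 1%nat ltac:(lia) Z).
    simpl INR. rewrite pw_1. rewrite ind_true; [ring|].
    assert (O1 : forall p, is_prime p -> ord p 1 = 0%nat).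
    { intros p Hp. apply (ord_pow_self p 0 Hp). }
    split.
    - apply step_powerful_iff. split; [lia|]. intros p Hp. rewrite O1 by auto. left. exists 0%nat. auto.
    - intros p Hp _. apply O1; auto. }
  rewrite E in H. eapply Rle_lt_trans; [exact H|]. apply HN. lia.
Qed.

Lemma F_DS (k l : nat) (s : C) : F k l s = DS (rough k l 0) s.
Proof.
  unfold F, DS. f_equal. apply functional_extensionality. intros n. rewrite pw_npow_neg.
  assert (E : rough k l 0 n <-> step_powerful k l n).
  { unfold rough. split; [tauto|]. intros H. split; auto. intros p Hp Hle.
    pose proof (prime_ge2 p Hp). lia. }
  rewrite (ind_iff _ _ E). unfold ind. destruct (excluded_middle_informative _), (ClassicalDescription.excluded_middle_informative _); try tauto; ring.
Qed.

Lemma F1_zeta (l : nat) (s : C) : 1 < Re s -> F 1 l s = zeta s.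
Proof.
  intros Hs. rewrite F_DS. destruct (zeta_spec s Hs) as [H1 _].
  destruct (DS_spec (rough 1 l 0) s (rough_0 1 l 0) Hs) as [H2 _].
  assert (H3 : clim (fun n => csum (fun n => (ind (rough 1 l 0 n) * pw (INR n) s)%C) (S n)) (DS (rough 1 l 0) s)).
  { apply (clim_subseq _ _ S); auto. }
  apply (clim_unique _ _ _ H3). revert H1. apply clim_ext. intros n. induction n as [|n IH].
  - simpl. rewrite ind_false by apply rough_0. ring.
  - simpl csum in *. rewrite <- IH. f_equal. rewrite ind_true; [ring|].
    split; [apply step_powerful_iff; split; [lia|]|].
    + intros p Hp. destruct (Nat.le_gt_cases l (ord p (S n))) as [H|H]; [right; lia|].
      left. exists (ord p (S n)). lia.
    + intros p Hp Hle. pose proof (prime_ge2 p Hp). lia.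
Qed.

Lemma euler_lim (k l : nat) (s : C) : (0 < k)%nat -> (0 < l)%nat -> 1 < Re s ->
  forall q, clim (pprod (fun p => Qpoly k l (pw (INR p) s))) q ->
  clim (fun x => F k l s * pprod (fun p => 1 - pw (INR p) s ^ k) x)%C q.
Proof.
  intros Hk Hl Hs q Hq. rewrite F_DS.
  apply clim_ext with (fun x => pprod (fun p => Qpoly k l (pw (INR p) s)) x * DS (rough k l x) s)%C.
  - intros x. rewrite euler_finite; auto.
  - replace q with (q * 1)%C by ring. apply clim_mult; auto. apply DS_rough_lim; auto.
Qed.

(** The case [k = 1], where [Q = 1] and [F 1 1] is zeta. Since zeta times the partial products tends
    to 1, it cannot vanish. *)
Lemma zeta_euler (s : C) : 1 < Re s -> zeta s <> 0 /\ clim (pprod (fun p => 1 - pw (INR p) s)%C) (/ zeta s).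
Proof.
  intros Hs.
  assert (H : clim (fun x => zeta s * pprod (fun p => 1 - pw (INR p) s) x)%C 1).
  { rewrite <- (F1_zeta 1 s Hs).
    pose proof (euler_lim 1 1 s ltac:(lia) ltac:(lia) Hs 1) as E.
    apply clim_ext with (fun x => F 1 1 s * pprod (fun p => 1 - pw (INR p) s ^ 1) x)%C.
    - intros x. f_equal. apply pprod_ext. intros p _. simpl. ring.
    - apply E. apply clim_ext with (fun _ => 1%C); [|apply clim_const].
      intros x. induction x as [|x IH]; simpl; auto. rewrite <- IH.
      destruct (is_prime_dec (S x)); unfold Qpoly; simpl; ring. }
  assert (N : zeta s <> 0).
  { intros E. rewrite E in H.
    assert (H0 : clim (fun x => 0 * pprod (fun p => 1 - pw (INR p) s) x)%C 0).
    { apply clim_ext with (fun _ => 0%C); [intros; ring|apply clim_const]. }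
    pose proof (clim_unique _ _ _ H H0) as E1. apply RtoC_inj in E1. lra. }
  split; auto.
  apply clim_ext with (fun x => / zeta s * (zeta s * pprod (fun p => 1 - pw (INR p) s) x))%C.
  - intros x. field. auto.
  - pose proof (clim_mult _ _ _ _ (clim_const (/ zeta s)%C) H) as L. rewrite Cmult_1_r in L. exact L.
Qed.

Lemma zeta_euler_scaled (n : nat) (s : C) : 1 < Re (INR n * s)%C ->
  clim (pprod (fun p => 1 - pw (INR p) s ^ n)%C) (/ zeta (INR n * s)).
Proof.
  intros Hs. destruct (zeta_euler _ Hs) as [_ H]. revert H. apply clim_ext. intros x.
  apply pprod_ext. intros p _. rewrite pw_scal. auto.
Qed.

Lemma Re_scal (a : R) (s : C) : Re (a * s)%C = a * Re s.
Proof. destruct s; simpl; ring. Qed.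

(** Here [Q(u) = 1 + u^M] with [M = 2 l + 1], and [Q(u) (1 - u^M) = 1 - u^(2 M)]; three Euler
    products of zeta are then compared. *)
Lemma F2_formula (l : nat) (s : C) : (0 < l)%nat -> 1 < Re s ->
  F 2 l s = (zeta (2 * s) * zeta (INR (2 * l + 1) * s) / zeta (2 * INR (2 * l + 1) * s))%C.
Proof.
  intros Hl Hs. set (M := (2 * l + 1)%nat).
  assert (HM : 3 <= INR M). { replace 3 with (INR 3) by (simpl; ring). apply le_INR. unfold M. lia. }
  assert (R2 : 1 < Re (INR 2 * s)%C) by (rewrite Re_scal; simpl; lra).
  assert (RM : 1 < Re (INR M * s)%C) by (rewrite Re_scal; nra).
  assert (R2M : 1 < Re (INR (2 * M) * s)%C) by (rewrite Re_scal, mult_INR; simpl; nra).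
  pose proof (zeta_euler_scaled 2 s R2) as L2. pose proof (zeta_euler_scaled M s RM) as LM.
  pose proof (zeta_euler_scaled (2 * M) s R2M) as L2M.
  destruct (zeta_euler _ R2) as [N2 _]. destruct (zeta_euler _ RM) as [NM _]. destruct (zeta_euler _ R2M) as [N2M _].
  assert (A : clim (fun x => F 2 l s * pprod (fun p => 1 - pw (INR p) s ^ 2) x * pprod (fun p => 1 - pw (INR p) s ^ M) x)%C
    (F 2 l s * / zeta (INR 2 * s) * / zeta (INR M * s))).
  { apply clim_mult; auto. apply clim_mult; auto. apply clim_const. }
  assert (B : clim (fun x => F 2 l s * pprod (fun p => 1 - pw (INR p) s ^ 2) x * pprod (fun p => 1 - pw (INR p) s ^ M) x)%C
    (/ zeta (INR (2 * M) * s) * 1)).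
  { apply clim_ext with (fun x => pprod (fun p => 1 - pw (INR p) s ^ (2 * M)) x * DS (rough 2 l x) s)%C.
    - intros x. rewrite F_DS, euler_finite by (auto; lia).
      replace (pprod (fun p => 1 - pw (INR p) s ^ (2 * M)) x)%C with
        (pprod (fun p => Qpoly 2 l (pw (INR p) s)) x * pprod (fun p => 1 - pw (INR p) s ^ M) x)%C; [ring|].
      rewrite <- pprod_mult. apply pprod_ext. intros p _. unfold Qpoly. cbn [csum Nat.sub].
      replace (l * 2 + 1 + 0)%nat with M by (unfold M; lia).
      rewrite (Nat.mul_comm 2 M), Cpow_mult_r. simpl (_ ^ 2)%C. ring.
    - apply clim_mult; auto. apply DS_rough_lim; auto. }
  pose proof (clim_unique _ _ _ A B) as E.
  replace (2 * s)%C with (INR 2 * s)%C by reflexivity.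
  replace (2 * INR M * s)%C with (INR (2 * M) * s)%C.
  2:{ rewrite mult_INR, RtoC_mult. reflexivity. }
  replace (F 2 l s) with (F 2 l s * / zeta (INR 2 * s) * / zeta (INR M * s) * (zeta (INR 2 * s) * zeta (INR M * s)))%C
    by (field; auto).
  rewrite E. field. auto.
Qed.

Lemma Zf_neq0 (s : C) : 1 < Re s -> Zf s <> 0.
Proof.
  intros Hs. rewrite Zf_zeta by auto. apply Cmult_neq_0; [|apply zeta_euler; auto].
  intros E. apply (f_equal Re) in E. destruct s. simpl in *. lra.
Qed.

(** * Exponents of the zeta factors *)

Definition lprod (f : C -> C) (bs : list C) : C := fold_right (fun b acc => (f b * acc)%C) 1%C bs.
Definition lsum (f : C -> C) (bs : list C) : C := fold_right (fun b acc => (f b + acc)%C) 0%C bs.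

Fixpoint zprod (b : nat -> nat) (u : C) (N : nat) : C :=
  match N with O => 1%C | S n => (zprod b u n * (1 - u ^ S n) ^ b (S n))%C end.

Definition divsum (b : nat -> nat) (N : nat) : nat :=
  fold_right (fun d acc => ((if div.dvdn d N then d * b d else 0) + acc)%nat) 0%nat (List.seq 1 N).

(** * Integer exponents of the formal product for Q *)

Module EulerFactor.
Import ssreflect ssrfun ssrbool eqtype ssrnat div seq choice fintype bigop ssralg ssrnum ssrint poly polydiv Rstruct complex.
Import GRing.Theory.
Local Open Scope ring_scope.

Definition toC (z : R[i]) : C := (complex.Re z, complex.Im z).
Definition ofC (z : C) : R[i] := complex.Complex (fst z) (snd z).

Lemma ofCK (z : C) : toC (ofC z) = z. Proof. by case: z. Qed.
Lemma toC_add (x y : R[i]) : toC (x + y) = Cplus (toC x) (toC y).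
Proof. by case: x y => [a b] [c d]. Qed.
Lemma toC_mul (x y : R[i]) : toC (x * y) = Cmult (toC x) (toC y).
Proof. by case: x y => [a b] [c d]. Qed.
Lemma toC_opp (x : R[i]) : toC (- x) = Copp (toC x).
Proof. by case: x => [a b]. Qed.
Lemma toC_1 : toC 1 = RtoC (IZR 1). Proof. by []. Qed.
Lemma toC_0 : toC 0 = RtoC (IZR 0). Proof. by []. Qed.
Lemma toC_exp (x : R[i]) n : toC (x ^+ n) = Cpow (toC x) n.
Proof. elim: n => [|n IH]; first by rewrite expr0. by rewrite exprS toC_mul IH. Qed.
Lemma toC_sub (x y : R[i]) : toC (x - y) = Cminus (toC x) (toC y).
Proof. by rewrite toC_add toC_opp. Qed.
Lemma toC_nat n : toC n%:R = RtoC (INR n).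
Proof.
elim: n => [|n IH]; first by [].
by rewrite -addn1 natrD toC_add IH toC_1 addn1 S_INR RtoC_plus.
Qed.

Section Construction.
Variables (k l : nat).
Let D := (l * k + k - 1)%N.

Definition Qint : {poly int} := 1 + \sum_(i < (k - 1)%N) 'X^(l * k + 1 + i).

(* [A = Q prod (1 - X^n)^bpos] and [B = prod (1 - X^n)^bneg] are made to agree one coefficient at a time. *)
Fixpoint AB (N : nat) : {poly int} * {poly int} :=
  match N with
  | O => (Qint, 1)
  | S N => let: (A, B) := AB N in
     match A`_(N.+1) - B`_(N.+1) with
     | Posz m => (A * (1 - 'X^(N.+1)) ^+ m, B)
     | Negz m => (A, B * (1 - 'X^(N.+1)) ^+ m.+1)
     end
  end.

(** The discrepancy in coefficient [n] left after the earlier steps, split by sign into [bpos] and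
    [bneg]. The exponent of [zeta (n s)] is [bpos n - bneg n]. *)
Definition bpos (n : nat) : nat :=
  match n with O => 0%N | S N => match ((AB N).1`_(N.+1) - (AB N).2`_(N.+1))%R with Posz m => m | Negz _ => 0%N end end.
Definition bneg (n : nat) : nat :=
  match n with O => 0%N | S N => match ((AB N).1`_(N.+1) - (AB N).2`_(N.+1))%R with Posz _ => 0%N | Negz m => m.+1 end end.

Lemma AB_prod N : (AB N).1 = Qint * \prod_(1 <= n < N.+1) (1 - 'X^n) ^+ bpos n /\
  (AB N).2 = \prod_(1 <= n < N.+1) (1 - 'X^n) ^+ bneg n.
Proof.
elim: N => [|N [IH1 IH2]]; first by rewrite !big_geq // mulr1.
rewrite !(big_nat_recr N.+1) //= -IH2 mulrA -IH1 /=.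
case: (AB N) => A B /=. case E: (A`_(N.+1) - B`_(N.+1)) => [m|m] /=.
- by rewrite expr0 mulr1.
- by rewrite expr0 mulr1.
Qed.

(** Modulo [X^(n+1)] the factor [(1 - X^n)^c] is [1 - c X^n], so coefficient [n] can be corrected
    without disturbing the lower ones. *)
Lemma coef_mul_onemXn (A : {poly int}) (n c i : nat) : (0 < n)%N -> (i <= n)%N ->
  (A * (1 - 'X^n) ^+ c)`_i = A`_i - (A`_0 *+ c) *+ (i == n).
Proof.
move=> n0. elim: c i => [|c IH] i Hi.
  by rewrite expr0 mulr1 mulr0n mul0rn subr0.
rewrite exprSr mulrA mulrBr mulr1 coefB coefMXn IH //.
case: (eqVneq i n) => [->|ne].
  by rewrite ltnn subnn IH // (ltn_eqF n0) mulr0n subr0 !mulr1n mulrS opprD addrAC addrA.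
by rewrite ltn_neqAle ne Hi /= !mulr0n !subr0.
Qed.

Lemma Qint0 : Qint`_0 = 1.
Proof.
rewrite /Qint coefD coef1 coef_sum big1 ?addr0 // => i _.
by rewrite coefXn addn1 addSn.
Qed.

Lemma AB_spec N : [/\ (AB N).1`_0 = 1, (AB N).2`_0 = 1 &
  forall i, (i <= N)%N -> (AB N).1`_i = (AB N).2`_i].
Proof.
elim: N => [|N [I1 I2 I3]].
  split; rewrite /= ?Qint0 ?coef1 //.
  by move=> i; rewrite leqn0 => /eqP ->; rewrite Qint0 coef1.
rewrite /=. case E: (AB N) I1 I2 I3 => [A B] /= I1 I2 I3.
case Ec: (A`_(N.+1) - B`_(N.+1)) => [m|m] /=.
- split=> [||i Hi]; rewrite ?coef_mul_onemXn // ?I1 ?mulr0n ?subr0 //.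
  case: (eqVneq i N.+1) Hi => [-> _|ne Hi]; last first.
    by rewrite mulr0n subr0 I3 // -ltnS ltn_neqAle ne.
  by rewrite mulr1n -[1 *+ m]/(m%:R) natz -Ec opprB addrC subrK.
- split=> [||i Hi]; rewrite ?coef_mul_onemXn // ?I2 ?mulr0n ?subr0 //.
  case: (eqVneq i N.+1) Hi => [-> _|ne Hi]; last first.
    by rewrite mulr0n subr0 I3 // -ltnS ltn_neqAle ne.
  by rewrite mulr1n -[1 *+ m.+1]/(m.+1%:R) natz -NegzE -Ec addrC subrK.
Qed.

End Construction.
End EulerFactor.

(** * Logarithmic derivatives, and the power sums of the inverse roots of Q *)

Module EulerFactorRoots.
Import ssreflect ssrfun ssrbool eqtype ssrnat div seq choice fintype bigop ssralg ssrnum ssrint poly polydiv Rstruct complex.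
Import GRing.Theory EulerFactor.
Import mathcomp.algebra_tactics.ring.
Local Open Scope ring_scope.

Section LogDerivative.
Variable F : fieldType.
Implicit Types A B t s : {poly F}.

(* [t] is [- A' / A] modulo ['X^M]. *)
Definition logder M A t := 'X^M %| A * t + A^`().

Lemma logder_1 M : logder M 1 0.
Proof. by rewrite /logder mulr0 -[1]/(1%:P) derivC addr0 dvdp0. Qed.

Lemma logder_mul M A B t s : logder M A t -> logder M B s -> logder M (A * B) (t + s).
Proof.
rewrite /logder => HA HB.
have -> : A * B * (t + s) + (A * B)^`() = B * (A * t + A^`()) + A * (B * s + B^`()).
  by rewrite derivM; ring.
by apply: dvdp_add; apply: dvdp_mull.
Qed.

Lemma logder_exp M A t n : logder M A t -> logder M (A ^+ n) (t *+ n).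
Proof.
move=> H. elim: n => [|n IH]; first by rewrite expr0 mulr0n; apply: logder_1.
by rewrite exprS mulrS; apply: logder_mul.
Qed.

Lemma logder_prod (I : Type) (r : seq I) M (A : I -> {poly F}) (t : I -> {poly F}) :
  (forall i, logder M (A i) (t i)) -> logder M (\prod_(i <- r) A i) (\sum_(i <- r) t i).
Proof.
move=> H. elim: r => [|a r IH]; first by rewrite !big_nil; apply: logder_1.
by rewrite !big_cons; apply: logder_mul.
Qed.

Lemma dvdXn_coef M (p : {poly F}) : (forall i, (i < M)%N -> p`_i = 0) -> 'X^M %| p.
Proof.
move=> H. rewrite -(poly_take_drop M p). rewrite [take_poly M p](_ : _ = 0) ?add0r ?dvdp_mulIr //.
apply/polyP => i. rewrite coef_take_poly coef0. by case: ltnP => // /H.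
Qed.

Lemma coef_dvdXn M (p : {poly F}) i : 'X^M %| p -> (i < M)%N -> p`_i = 0.
Proof. by move=> /dvdpP[q ->] Hi; rewrite coefMXn Hi. Qed.

Lemma logder_lin M (b : F) : logder M (1 - b *: 'X) (\poly_(i < M) b ^+ i.+1).
Proof.
apply: dvdXn_coef => i Hi.
rewrite derivB -[1]/(1%:P) derivC derivZ derivX sub0r mulrBl mul1r !coefD coefN -scalerAl coefZ coefXM coef_poly Hi.
rewrite coefN coefZ coef1. case: i Hi => [|i] Hi /=.
  by rewrite mulr0 subr0 mulr1 expr1 subrr.
by rewrite mulr0 oppr0 addr0 coef_poly (ltnW Hi) -exprS subrr.
Qed.

Lemma logder_onemXn M n : (0 < n)%N ->
  logder M (1 - 'X^n) (\poly_(i < M) (n%:R *+ (n %| i.+1)%N)).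
Proof.
move=> n0. apply: dvdXn_coef => i Hi.
rewrite derivB -[1]/(1%:P) derivC derivXn sub0r mulrBl mul1r !coefD coefN -['X^n * _]mulrC coefMXn coef_poly Hi.
rewrite coefN coefMn coefXn.
case: ltnP => lt.
- rewrite subr0. case: (eqVneq i n.-1) => [E|ne].
    by rewrite E prednK // dvdnn mulr1n -mulr_natl mulr1 subrr.
  have -> : (n %| i.+1)%N = false.
    apply/negbTE/negP => /dvdn_leq -/(_ isT) Hle.
    by move/negP: ne; apply; apply/eqP/succn_inj; rewrite prednK //; apply/eqP; rewrite eqn_leq lt Hle.
  by rewrite mulr0n mul0rn oppr0 addr0.
- have lt2 : (i - n < M)%N by apply: leq_ltn_trans (leq_subr _ _) Hi.
  rewrite coef_poly lt2 -subSn // dvdn_subl ?dvdnn ?leqW //.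
  rewrite subrr add0r. have -> : (i == n.-1) = false.
    apply: gtn_eqF. by apply: leq_trans lt; rewrite prednK.
  by rewrite mul0rn oppr0.
Qed.

(** Differentiation costs one power of [X], hence the congruence modulo [X^(M+1)] for a conclusion
    modulo [X^M]; there [A] is invertible because its constant term is 1. *)
Lemma logder_eqm M A B t s : A`_0 = 1 -> logder M A t -> logder M B s -> 'X^(M.+1) %| A - B ->
  forall i, (i < M)%N -> t`_i = s`_i.
Proof.
move=> A0 HA HB HAB i Hi.
have D1 : 'X^M %| A - B by apply: dvdp_trans HAB; rewrite exprS dvdp_mulIr.
have D2 : 'X^M %| A^`() - B^`().
  rewrite -derivB. apply: dvdXn_coef => j Hj. by rewrite coef_deriv (coef_dvdXn _ _ _ HAB) ?mul0rn.
have H1 : 'X^M %| A * (t - s).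
  have -> : A * (t - s) = (A * t + A^`()) - (B * s + B^`()) - (A^`() - B^`()) - (A - B) * s.
    by ring.
  by apply: dvdp_sub; [apply: dvdp_sub; [apply: dvdp_sub|]|apply: dvdp_mulr].
have cop : coprimep 'X^M A.
  apply: coprimep_expl. rewrite coprimep_sym -['X]subr0 -polyC0 coprimep_XsubC.
  by rewrite /root horner_coef0 A0 oner_eq0.
have H2 : 'X^M %| t - s by rewrite -(Gauss_dvdpr _ cop).
by apply/eqP; rewrite -subr_eq0 -coefB (coef_dvdXn _ _ _ H2).
Qed.

End LogDerivative.

Section Export.
Variables (k l : nat).
Hypotheses (k2 : (1 < k)%N) (l1 : (0 < l)%N).

Let phi (p : {poly int}) : {poly R[i]} := map_poly intr p.

Lemma toC_sum n (f : nat -> R[i]) : toC (\sum_(i < n) f i) = csum (fun i => toC (f i)) n.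
Proof. elim: n => [|n IH]; first by rewrite big_ord0. by rewrite big_ord_recr toC_add IH. Qed.

Lemma phi_Qint : phi (Qint k l) = 1 + \sum_(i < (k - 1)%N) 'X^(l * k + 1 + i).
Proof.
rewrite /phi /Qint rmorphD rmorph1 rmorph_sum. congr (_ + _). apply: eq_bigr => i _.
by rewrite /= map_polyXn.
Qed.

Lemma toC_Qint (x : R[i]) : toC (phi (Qint k l)).[x] = Qpoly k l (toC x).
Proof.
rewrite phi_Qint hornerD hornerC horner_sum toC_add /Qpoly. congr Cplus.
rewrite (eq_bigr (fun i : 'I__ => x ^+ (l * k + 1 + i))); last by move=> i _; rewrite hornerXn.
rewrite (toC_sum _ (fun i => x ^+ (l * k + 1 + i))). by apply: csum_ext => i _; rewrite toC_exp.
Qed.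

Lemma toC_zprod (b : nat -> nat) N (x : R[i]) :
  toC (phi (\prod_(1 <= n < N.+1) (1 - 'X^n) ^+ b n)).[x] = zprod b (toC x) N.
Proof.
elim: N => [|N IH]; first by rewrite big_geq // /phi rmorph1 hornerC.
rewrite big_nat_recr //= /phi rmorphM hornerM toC_mul -/(phi _) IH. congr Cmult.
rewrite rmorphXn rmorphB rmorph1 /= map_polyXn horner_exp toC_exp hornerD hornerN hornerC hornerXn.
by rewrite toC_sub toC_exp.
Qed.

Lemma horner_bounded (p : {poly R[i]}) : exists B : R, forall u : C, Rle (Cmod u) (IZR 1) -> Rle (Cmod (toC p.[ofC u])) B.
Proof.
elim/poly_ind: p => [|p c [B HB]].
  exists (IZR 0) => u _. rewrite hornerC toC_0 Cmod_0. exact: Rle_refl.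
exists (Rplus B (Cmod (toC c))) => u Hu.
rewrite hornerD hornerM hornerX hornerC toC_add toC_mul ofCK.
apply: Rle_trans (Cmod_triangle _ _) _. apply: Rplus_le_compat_r. rewrite Cmod_mult.
have H := HB u Hu. rewrite -[B]Rmult_1_r.
apply: Rmult_le_compat; [exact: Cmod_ge_0|exact: Cmod_ge_0|exact: H|exact: Hu].
Qed.

(** The two products agree modulo [X^(N+1)]. The cofactor of their difference is a polynomial, hence
    bounded on the closed unit disc. *)
Lemma exponents_factor (N : nat) : exists (S : C -> C) (B : R),
  (forall u, Rle (Cmod u) (IZR 1) -> Rle (Cmod (S u)) B) /\
  forall u, Cmult (Qpoly k l u) (zprod (bpos k l) u N) =
    Cplus (zprod (bneg k l) u N) (Cmult (Cpow u (Datatypes.S N)) (S u)).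
Proof.
have [E1 E2] := AB_prod k l N. have [_ _ E3] := AB_spec k l N.
set A := phi (AB k l N).1. set B := phi (AB k l N).2.
have HD : A - B = drop_poly N.+1 (A - B) * 'X^(N.+1).
  rewrite -[LHS](poly_take_drop N.+1) [take_poly _ _](_ : _ = 0) ?add0r //.
  apply/polyP => i. rewrite coef_take_poly coef0. case: ltnP => // Hi.
  by rewrite coefB !coef_map /= E3 // subrr.
have [Bd HBd] := horner_bounded (drop_poly N.+1 (A - B)).
exists (fun u => toC (drop_poly N.+1 (A - B)).[ofC u]), Bd. split=> // u.
have HA : toC A.[ofC u] = Cmult (Qpoly k l u) (zprod (bpos k l) u N).
  by rewrite /A E1 /phi rmorphM hornerM toC_mul -/(phi _) -/(phi _) toC_Qint toC_zprod ofCK.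
have HB : toC B.[ofC u] = zprod (bneg k l) u N by rewrite /B E2 toC_zprod ofCK.
rewrite -HA -HB -[in LHS](subrK B A). move: HD. move: (drop_poly _ _) => Dp ->.
rewrite hornerD hornerM hornerXn toC_add toC_mul toC_exp ofCK.
by rewrite [LHS]Cplus_comm [Cmult (toC _) (Cpow _ _)]Cmult_comm.
Qed.

(** The [b] are the inverses of the roots of [Q]. Leading and constant coefficient are both 1, so no
    constant appears in the factorisation and the product of the [- b] is 1. *)
Lemma Qint_factor : exists bs : seq R[i],
  [/\ phi (Qint k l) = \prod_(b <- bs) (1 - b *: 'X), size bs = (l * k + k - 1)%N &
      \prod_(b <- bs) (- b) = 1].
Proof.
set Q := phi (Qint k l).
have EQ : Q = 'X^(l * k + k - 1) + (1 + \sum_(i < (k - 2)%N) 'X^(l * k + 1 + i)).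
  rewrite /Q phi_Qint. case: k k2 => [|[|k']] // _. rewrite !subSS !subn0 big_ord_recr /=.
  rewrite addrA addrC. congr ('X^_ + _). by rewrite !addnS subn1 addn0.
have Hs : (size (1 + \sum_(i < (k - 2)%N) 'X^(l * k + 1 + i) : {poly R[i]})%R < (l * k + k - 1).+1)%N.
  apply: leq_ltn_trans (size_polyD _ _) _. rewrite gtn_max size_poly1. apply/andP; split.
    by rewrite ltnS -addnBA ?(ltnW k2) // (leq_trans _ (leq_addl _ _)) // subn_gt0.
  apply: leq_ltn_trans (size_sum _ _ _) _. rewrite ltnS. apply/bigmax_leqP => i _.
  rewrite size_polyXn -addnBA ?(ltnW k2) // -addnA -addnS leq_add2l addnC addn1.
  have := ltn_ord i. by rewrite ltn_subRL addnC addn2 -ltnS => H; rewrite ltn_subRL add1n.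
have sQ : size Q = (l * k + k - 1).+1 by rewrite EQ size_addl size_polyXn.
have lQ : lead_coef Q = 1 by rewrite EQ lead_coefDl ?lead_coefXn // size_polyXn.
have Q0 : Q`_0 = 1 by rewrite coef_map Qint0.
have [zs Hz] := closed_field_poly_normal Q. rewrite lQ scale1r in Hz.
have zs0 : forall z, z \in zs -> z != 0.
  move=> z Hin. apply/negP => /eqP E. have : root Q z by rewrite Hz root_prod_XsubC.
  by rewrite E /root horner_coef0 Q0 oner_eq0.
have P1 : \prod_(z <- zs) (- z) = 1.
  have H1 : Q.[0] = 1 by rewrite horner_coef0.
  rewrite -[RHS]H1 Hz horner_prod. apply: eq_bigr => z _. by rewrite hornerXsubC sub0r.
exists [seq z^-1 | z <- zs]. split.
- rewrite Hz big_map.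
  have -> : \prod_(z <- zs) ('X - z%:P) = \prod_(z <- zs) ((- z)%:P * (1 - z^-1 *: 'X)).
    apply: eq_big_seq => z /zs0 Hz0.
    by rewrite mulrBr mulr1 mul_polyC scalerA mulNr divff // scaleN1r opprK polyCN addrC.
  by rewrite big_split /= -rmorph_prod /= P1 mul1r.
- by rewrite size_map; apply: succn_inj; rewrite -sQ Hz size_prod_XsubC.
- have H1 : \prod_(z <- zs) (- z)^-1 = 1 by rewrite prodfV P1 invr1.
  rewrite big_map -[RHS]H1. by apply: eq_bigr => z _; rewrite invrN.
Qed.

Lemma lsum_map (f : R[i] -> R[i]) (g : C -> C) bs : (forall b, toC (f b) = g (toC b)) ->
  toC (\sum_(b <- bs) f b) = lsum g (List.map toC bs).
Proof. move=> H. elim: bs => [|b bs IH]; first by rewrite big_nil. by rewrite big_cons toC_add IH H. Qed.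

Lemma lprod_map (f : R[i] -> R[i]) (g : C -> C) bs : (forall b, toC (f b) = g (toC b)) ->
  toC (\prod_(b <- bs) f b) = lprod g (List.map toC bs).
Proof. move=> H. elim: bs => [|b bs IH]; first by rewrite big_nil. by rewrite big_cons toC_mul IH H. Qed.

Lemma divsumE (b : nat -> nat) N :
  divsum b N = (\sum_(1 <= n < N.+1) (if n %| N then n * b n else 0))%N.
Proof.
rewrite /divsum /index_iota subSS subn0.
have -> : List.seq 1 N = iota 1 N by [].
elim: (iota 1 N) => [|d s IH]; first by rewrite big_nil. by rewrite big_cons /= IH.
Qed.

Lemma roots_exist : exists bs : list C,
  length bs = Nat.sub (Nat.add (Nat.mul l k) k) 1 /\
  (forall u, Qpoly k l u = lprod (fun b => Cminus (RtoC (IZR 1)) (Cmult b u)) bs) /\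
  lprod Copp bs = RtoC (IZR 1) /\
  forall N, (0 < N)%coq_nat ->
    Cplus (lsum (fun b => Cpow b N) bs) (RtoC (INR (divsum (bpos k l) N))) = RtoC (INR (divsum (bneg k l) N)).
Proof.
have [bs [HQ Hs Hp]] := Qint_factor.
exists (List.map toC bs). split; first by rewrite length_map -[length bs]/(size bs) Hs.
split; [|split].
- move=> u. rewrite -[u in LHS]ofCK -toC_Qint HQ horner_prod.
  rewrite (eq_bigr (fun b => 1 - b * ofC u)); last by move=> b _; rewrite hornerD hornerN hornerC hornerZ hornerX.
  apply: lprod_map => b. by rewrite toC_sub toC_mul ofCK.
- by rewrite -(lprod_map (fun b => - b)) ?Hp // => b; rewrite toC_opp.
- move=> N /ltP N0.
  pose tz (b : nat -> nat) : {poly R[i]} := \sum_(1 <= n < N.+1) (\poly_(i < N) (n%:R *+ (n %| i.+1)%N)) *+ b n.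
  have Hz (b : nat -> nat) : logder _ N (phi (\prod_(1 <= n < N.+1) (1 - 'X^n) ^+ b n)) (tz b).
    rewrite /phi rmorph_prod /tz !big_nat. rewrite -!big_nat.
    rewrite (eq_big_nat _ _ (F2 := fun n => (1 - 'X^n : {poly R[i]}) ^+ b n)); last first.
      by move=> n _; rewrite rmorphXn rmorphB rmorph1 /= map_polyXn.
    rewrite !big_add1 /=. apply: logder_prod => n. apply: logder_exp. exact: logder_onemXn.
  have HA : logder _ N (phi (AB k l N).1) (\sum_(b <- bs) (\poly_(i < N) b ^+ i.+1) + tz (bpos k l)).
    have [-> _] := AB_prod k l N.
    have phiM p q : phi (p * q) = phi p * phi q by rewrite /phi rmorphM.
    rewrite phiM HQ.
    apply: logder_mul => //. by apply: logder_prod => b; apply: logder_lin.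
  have HB : logder _ N (phi (AB k l N).2) (tz (bneg k l)) by have [_ ->] := AB_prod k l N.
  have [A0 B0 E3] := AB_spec k l N.
  have A0' : (phi (AB k l N).1)`_0 = 1 by rewrite coef_map A0.
  have HAB : 'X^(N.+1) %| phi (AB k l N).1 - phi (AB k l N).2.
    by apply: dvdXn_coef => i Hi; rewrite coefB !coef_map /= E3 // subrr.
  have lt : (N.-1 < N)%N by rewrite prednK.
  have := logder_eqm _ _ _ _ _ _ A0' HA HB HAB _ lt. rewrite coefD coef_sum.
  have Et (b : nat -> nat) : (tz b)`_(N.-1) = (divsum b N)%:R.
    rewrite /tz coef_sum divsumE natr_sum. apply: eq_bigr => n _.
    rewrite coefMn coef_poly lt prednK //. case: (n %| N)%N => /=.
      by rewrite mulr1n natrM mulr_natr.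
    by rewrite mulr0n mul0rn.
  rewrite !Et (eq_bigr (fun b : R[i] => b ^+ N)); last by move=> b _; rewrite coef_poly lt prednK.
  move=> /(f_equal toC). rewrite toC_add !toC_nat => <-. congr Cplus.
  by apply/esym/lsum_map => b; rewrite toC_exp.
Qed.

End Export.
End EulerFactorRoots.

Lemma bpos_bneg (k l n : nat) : EulerFactor.bpos k l n = 0%nat \/ EulerFactor.bneg k l n = 0%nat.
Proof.
  destruct n as [|n]; [left; reflexivity|]. unfold EulerFactor.bpos, EulerFactor.bneg.
  match goal with |- context [match ?x with ssrint.Posz _ => _ | ssrint.Negz _ => _ end] => destruct x end; auto.
Qed.

Lemma euler_roots (k l : nat) : (2 <= k)%nat -> (1 <= l)%nat -> exists bs : list C,
  length bs = (l * k + k - 1)%nat /\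
  (forall u, Qpoly k l u = lprod (fun b => 1 - b * u)%C bs) /\ lprod Copp bs = 1 /\
  forall N, (0 < N)%nat ->
    (lsum (fun b => b ^ N) bs + INR (divsum (EulerFactor.bpos k l) N) = INR (divsum (EulerFactor.bneg k l) N))%C.
Proof.
  intros Hk Hl. apply EulerFactorRoots.roots_exist.
  apply (ssrbool.introT ssrnat.ltP). lia.
Qed.

(** * An inverse root outside the unit disc *)

Lemma lprod_mod (f : C -> C) (bs : list C) :
  Cmod (lprod f bs) = fold_right (fun b acc => Cmod (f b) * acc) 1 bs.
Proof. induction bs as [|b bs IH]; simpl; [apply Cmod_1|]. rewrite Cmod_mult, IH. auto. Qed.

Lemma lprod_ext_mod (f g : C -> C) (bs : list C) : (forall b, In b bs -> Cmod (f b) = Cmod (g b)) ->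
  Cmod (lprod f bs) = Cmod (lprod g bs).
Proof.
  intros H. rewrite !lprod_mod. induction bs as [|b bs IH]; simpl; auto.
  rewrite H by (left; auto). rewrite IH; auto. intros c Hc. apply H. right; auto.
Qed.

Lemma lprod_scal (c : C) (f : C -> C) (bs : list C) :
  (lprod (fun b => c * f b)%C bs = c ^ length bs * lprod f bs)%C.
Proof. induction bs as [|b bs IH]; simpl; [ring|]. rewrite IH. ring. Qed.

Lemma prod_le1_eq1 (bs : list C) : (forall b, In b bs -> Cmod b <= 1) ->
  Cmod (lprod Copp bs) = 1 -> forall b, In b bs -> Cmod b = 1.
Proof.
  rewrite lprod_mod. induction bs as [|a bs IH]; simpl; intros H1 H2 b Hb; [tauto|].
  assert (P : 0 <= fold_right (fun b acc => Cmod (- b) * acc) 1 bs <= 1).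
  { clear -H1. induction bs as [|c bs IH]; simpl; [lra|].
    assert (IH' := IH (fun b Hb => H1 b (match Hb with or_introl e => or_introl e | or_intror e => or_intror (or_intror e) end))).
    pose proof (H1 c (or_intror (or_introl eq_refl))). rewrite Cmod_opp. pose proof (Cmod_ge_0 c). nra. }
  rewrite Cmod_opp in H2. pose proof (H1 a (or_introl eq_refl)). pose proof (Cmod_ge_0 a).
  assert (Ea : Cmod a = 1) by nra.
  destruct Hb as [->|Hb]; auto. apply IH; auto. nra.
Qed.

Lemma Qpoly_real (k l : nat) (x : R) : Qpoly k l x = RtoC (1 + rsum (fun i => x ^ (l * k + 1 + i)) (k - 1)).
Proof.
  unfold Qpoly. rewrite RtoC_plus. f_equal. induction (k - 1)%nat as [|n IH]; cbn [csum rsum]; auto.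
  rewrite IH, RtoC_plus, RtoC_pow. auto.
Qed.

(* If all the roots of [Q] were on the unit circle, [|Q(1/2)|] would equal [|Q(2)| / 2^deg]. *)
Lemma large_root (k l : nat) (bs : list C) : (3 <= k)%nat -> (1 <= l)%nat ->
  length bs = (l * k + k - 1)%nat -> (forall u, Qpoly k l u = lprod (fun b => 1 - b * u)%C bs) ->
  lprod Copp bs = 1 -> exists b, In b bs /\ 1 < Cmod b.
Proof.
  intros Hk Hl Hlen HQ HP. apply NNPP. intros Hno.
  assert (H1 : forall b, In b bs -> Cmod b <= 1).
  { intros b Hb. apply Rnot_lt_le. intros H. apply Hno. exists b. auto. }
  assert (H2 := prod_le1_eq1 bs H1 ltac:(rewrite HP; apply Cmod_1)).
  set (D := (l * k + k - 1)%nat) in *.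
  (* For [|b| = 1] one has [|1 - 2 b| / 2 = |1 - b / 2|]. *)
  assert (E : Cmod (lprod (fun b => / 2 * (1 - b * 2))%C bs) = Cmod (lprod (fun b => 1 - b * / 2)%C bs)).
  { apply lprod_ext_mod. intros b Hb. pose proof (H2 b Hb) as Hb1.
    rewrite <- RtoC_inv by lra.
    apply Rsqr_inj; try apply Cmod_ge_0. rewrite !Rsqr_pow2, !Cmod2.
    assert (Hb2 : Cmod b ^ 2 = 1) by (rewrite Hb1; ring). rewrite Cmod2 in Hb2.
    destruct b as [x y]. simpl in *. nra. }
  rewrite lprod_scal, <- !HQ, Hlen, Cmod_mult, Cmod_pow in E.
  rewrite <- RtoC_inv in E by lra. rewrite !Qpoly_real, !Cmod_R in E.
  assert (P1 : forall x n, 0 < x -> 0 <= rsum (fun i => x ^ (l * k + 1 + i)) n).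
  { intros x n Hx. apply rsum_nonneg. intros i _. apply pow_le. lra. }
  rewrite (Rabs_pos_eq (/ 2)), !Rabs_pos_eq in E by
    (try lra; match goal with |- 0 <= 1 + rsum (fun i => ?x ^ _) ?n => pose proof (P1 x n ltac:(lra)); lra end).
  (* The two highest powers in [Q(2)], present because [k >= 3], alone give [1 + 1/2]. On the other
     side [l k >= 3] keeps [Q(1/2)] at most 9/8. *)
  assert (L : 3 / 2 <= (/ 2) ^ D * (1 + rsum (fun i => 2 ^ (l * k + 1 + i)) (k - 1))).
  { rewrite Rmult_plus_distr_l, <- rsum_scal.
    assert (T : 3 / 2 <= rsum (fun i => (/ 2) ^ D * 2 ^ (l * k + 1 + i)) (k - 1)).
    { replace (k - 1)%nat with (S (S (k - 3))) by lia. cbn [rsum].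
      assert (0 <= rsum (fun i => (/ 2) ^ D * 2 ^ (l * k + 1 + i)) (k - 3)).
      { apply rsum_nonneg. intros i _. apply Rmult_le_pos; apply pow_le; lra. }
      replace D with (l * k + 1 + S (k - 3))%nat by (unfold D; lia).
      rewrite <- Rpow_mult_distr, Rinv_l, pow1 by lra.
      replace (l * k + 1 + S (k - 3))%nat with (S (l * k + 1 + (k - 3))) by lia.
      assert (EE : (/ 2) ^ S (l * k + 1 + (k - 3)) * 2 ^ (l * k + 1 + (k - 3)) = / 2).
      { cbn [pow]. rewrite Rmult_assoc, <- Rpow_mult_distr, Rinv_l, pow1 by lra. ring. }
      assert (0 <= rsum (fun i => (/ 2) ^ S (l * k + 1 + (k - 3)) * 2 ^ (l * k + 1 + i)) (k - 3)).
      { apply rsum_nonneg. intros i _. apply Rmult_le_pos; apply pow_le; lra. }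
      lra. }
    pose proof (pow_le (/ 2) D ltac:(lra)). lra. }
  assert (U : 1 + rsum (fun i => (/ 2) ^ (l * k + 1 + i)) (k - 1) <= 1 + / 8).
  { assert (Q : forall n, rsum (fun i => (/ 2) ^ (l * k + 1 + i)) n <= (/ 2) ^ (l * k) * (1 - (/ 2) ^ n)).
    { induction n as [|n IH]; cbn [rsum]; [simpl; lra|].
      rewrite pow_add, (pow_add _ (l * k) 1). cbn [pow]. pose proof (pow_le (/ 2) (l * k) ltac:(lra)).
      nra. }
    specialize (Q (k - 1)%nat).
    assert (Q2 : (/ 2) ^ (l * k) <= (/ 2) ^ 3).
    { replace (l * k)%nat with (3 + (l * k - 3))%nat by nia. rewrite pow_add.
      pose proof (pow_le (/ 2) (l * k - 3) ltac:(lra)).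
      assert ((/ 2) ^ (l * k - 3) <= 1) by (rewrite <- (pow1 (l * k - 3)); apply pow_incr; lra). nra. }
    pose proof (pow_le (/ 2) (k - 1) ltac:(lra)). pose proof (pow_le (/ 2) (l * k) ltac:(lra)). simpl in Q2. nra. }
  lra.
Qed.

Lemma max_mod_root (bs : list C) : bs <> nil -> exists b, In b bs /\ forall c, In c bs -> Cmod c <= Cmod b.
Proof.
  induction bs as [|a bs IH]; intros H; [tauto|]. destruct bs as [|b bs].
  - exists a. split; [left; auto|]. intros c [->|[]]. lra.
  - destruct IH as [m [Hm1 Hm2]]; [discriminate|].
    destruct (Rle_or_lt (Cmod m) (Cmod a)) as [L|L].
    + exists a. split; [left; auto|]. intros c [->|Hc]; [lra|]. specialize (Hm2 c Hc). lra.
    + exists m. split; [right; auto|]. intros c [->|Hc]; [lra|]. auto.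
Qed.

(** * Almost periodic power sums *)

Lemma lsum_scal (c : C) (f : C -> C) (bs : list C) : (lsum (fun b => c * f b) bs = c * lsum f bs)%C.
Proof. induction bs as [|b bs IH]; simpl; [ring|]. rewrite IH. ring. Qed.

Lemma lsum_csum (f : nat -> C -> C) (bs : list C) (n : nat) :
  csum (fun i => lsum (f i) bs) n = lsum (fun b => csum (fun i => f i b) n) bs.
Proof.
  induction bs as [|b bs IH]; simpl.
  - apply csum_zero. auto.
  - rewrite <- IH, <- csum_plus. auto.
Qed.

Lemma lsum_ext (f g : C -> C) (bs : list C) : (forall b, f b = g b) -> lsum f bs = lsum g bs.
Proof. intros H. replace g with f; auto. apply functional_extensionality; auto. Qed.

Lemma lsum_conj (f : C -> C) (bs : list C) : Cconj (lsum f bs) = lsum (fun b => Cconj (f b)) bs.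
Proof. induction bs as [|b bs IH]; simpl; [apply Cconj_R|]. rewrite Cplus_conj, IH. auto. Qed.

Lemma lsum_bound (f : C -> C) (bs : list C) (M : R) : (forall b, In b bs -> Cmod (f b) <= M) ->
  Cmod (lsum f bs) <= INR (length bs) * M.
Proof.
  intros H. induction bs as [|b bs IH]; simpl lsum.
  - rewrite Cmod_0. simpl. lra.
  - simpl length. rewrite S_INR. eapply Rle_trans; [apply Cmod_triangle|].
    pose proof (H b (or_introl eq_refl)). assert (Cmod (lsum f bs) <= INR (length bs) * M).
    { apply IH. intros c Hc. apply H. right; auto. }
    lra.
Qed.

Lemma lsum_uniform_bound (f : nat -> nat -> C -> C) (bs : list C) :
  (forall b, In b bs -> exists M, forall a H, Cmod (f a H b) <= M) ->
  exists M, forall a H, Cmod (lsum (f a H) bs) <= M.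
Proof.
  induction bs as [|b bs IH]; intros Hb.
  - exists 0. intros. simpl. rewrite Cmod_0. lra.
  - destruct IH as [M1 H1]; [intros c Hc; apply Hb; right; auto|].
    destruct (Hb b (or_introl eq_refl)) as [M2 H2]. exists (M2 + M1). intros a H. simpl.
    eapply Rle_trans; [apply Cmod_triangle|]. specialize (H1 a H). specialize (H2 a H). lra.
Qed.

Lemma lsum_uniform_lower (f : nat -> nat -> C -> C) (bs : list C) :
  (forall b, In b bs -> exists M, forall a H, - M <= Re (f a H b)) ->
  exists M, forall a H, - M <= Re (lsum (f a H) bs).
Proof.
  induction bs as [|b bs IH]; intros Hb.
  - exists 0. intros. simpl. lra.
  - destruct IH as [M1 H1]; [intros c Hc; apply Hb; right; auto|].
    destruct (Hb b (or_introl eq_refl)) as [M2 H2]. exists (M2 + M1). intros a H. simpl lsum.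
    specialize (H1 a H). specialize (H2 a H).
    change (Re (f a H b + lsum (f a H) bs)%C) with (Re (f a H b) + Re (lsum (f a H) bs)). lra.
Qed.

(** Serves a double sum over pairs of roots, in which one diagonal term grows like [H] and the
    others are bounded below. *)
Lemma lsum_uniform_lower_one (f : nat -> nat -> C -> C) (bs : list C) (b0 : C) : In b0 bs ->
  (forall b, In b bs -> exists M, forall a H, - M <= Re (f a H b)) ->
  (exists M, forall a H, INR H - M <= Re (f a H b0)) ->
  exists M, forall a H, INR H - M <= Re (lsum (f a H) bs).
Proof.
  induction bs as [|b bs IH]; intros Hin Hb H0; [destruct Hin|].
  assert (EqR : forall a H, Re (lsum (f a H) (b :: bs)) = Re (f a H b) + Re (lsum (f a H) bs)) by reflexivity.
  destruct Hin as [->|Hin].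
  - destruct (lsum_uniform_lower f bs) as [M1 H1]; [intros c Hc; apply Hb; right; auto|].
    destruct H0 as [M2 H2]. exists (M2 + M1). intros a H. rewrite EqR. specialize (H1 a H). specialize (H2 a H). lra.
  - destruct IH as [M1 H1]; auto; [intros c Hc; apply Hb; right; auto|].
    destruct (Hb b (or_introl eq_refl)) as [M2 H2]. exists (M2 + M1). intros a H. rewrite EqR.
    specialize (H1 a H). specialize (H2 a H). lra.
Qed.

Lemma geom_window (g : C) : Cmod g <= 1 -> g <> 1 ->
  exists M, forall a H, Cmod (csum (fun i => g ^ (a + i))%C H) <= M.
Proof.
  intros Hg Ng. assert (N1 : (1 - g)%C <> 0) by (intros E; apply Ng; symmetry; apply Cminus_0_eq, E).
  pose proof (proj1 (Cmod_gt_0 _) N1) as P.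
  exists (2 / Cmod (1 - g)). intros a H.
  assert (E : (csum (fun i => g ^ (a + i)) H = (g ^ a - g ^ (a + H)) / (1 - g))%C).
  { induction H as [|H IH]; cbn [csum].
    - rewrite Nat.add_0_r. field. auto.
    - rewrite IH, Nat.add_succ_r, Cpow_S. field. auto. }
  rewrite E, Cmod_div by auto. apply Rmult_le_compat_r; [apply Rlt_le, Rinv_0_lt_compat; auto|].
  unfold Cminus. eapply Rle_trans; [apply Cmod_triangle|]. rewrite Cmod_opp, !Cmod_pow.
  assert (B : forall n, Cmod g ^ n <= 1).
  { intros n. rewrite <- (pow1 n). apply pow_incr. split; auto. apply Cmod_ge_0. }
  pose proof (B a). pose proof (B (a + H)%nat). lra.
Qed.

(* A nonzero almost periodic sum with no constant term has mean zero and mean square at least one, so it is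
   bounded below by a positive constant on a positive proportion of every long window. *)
Lemma power_sum_positive_often (gs : list C) (f : nat -> R) : (forall g, In g gs -> Cmod g <= 1) ->
  (forall g, In g gs -> g <> 1) -> (exists g, In g gs /\ Cmod g = 1) ->
  (forall n, lsum (fun g => g ^ n)%C gs = RtoC (f n)) ->
  exists c K, 0 < c /\ forall a H,
    c * INR H - K <= rsum (fun i => if Rle_dec c (f (a + i)%nat) then 1 else 0) H.
Proof.
  intros H1 H2 [g0 [Hg0 Hg1]] Hf.
  destruct (lsum_uniform_bound (fun a H g => csum (fun i => g ^ (a + i))%C H) gs) as [M1 HM1].
  { intros g Hg. apply geom_window; auto. }
  assert (S1 : forall a H, Rabs (rsum (fun i => f (a + i)%nat) H) <= M1).
  { intros a H. eapply Rle_trans; [|apply (HM1 a H)].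
    rewrite <- lsum_csum. rewrite (csum_ext _ (fun i => RtoC (f (a + i)%nat))) by (intros; apply Hf).
    assert (E : csum (fun i => RtoC (f (a + i)%nat)) H = RtoC (rsum (fun i => f (a + i)%nat) H)).
    { induction H as [|H IH]; cbn [csum rsum]; auto. rewrite IH, RtoC_plus. auto. }
    rewrite E, Cmod_R. lra. }
  (* Mean square: expanding the square gives powers of [g * Cconj h]. A pair with product 1
     contributes [H], any other a bounded amount, and the pair of [g0] with itself guarantees one
     full [H]. *)
  destruct (lsum_uniform_lower_one (fun a H g => lsum (fun h => csum (fun i => (g * Cconj h) ^ (a + i))%C H) gs) gs g0 Hg0)
    as [M2 HM2].
  { intros g Hg. apply lsum_uniform_lower. intros h Hh.
    destruct (Ceq_dec (g * Cconj h) 1) as [E|N].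
    - exists 0. intros a H. rewrite E. rewrite (csum_ext _ (fun _ => RtoC 1)) by (intros; apply Cpow_1_l).
      rewrite csum_re, rsum_const. simpl. pose proof (pos_INR H). lra.
    - destruct (geom_window (g * Cconj h)%C) as [M HM]; auto.
      + rewrite Cmod_mult, Cmod_conj. pose proof (H1 g Hg). pose proof (H1 h Hh).
        pose proof (Cmod_ge_0 g). pose proof (Cmod_ge_0 h). nra.
      + exists M. intros a H. specialize (HM a H).
        pose proof (re_le_Cmod (csum (fun i => (g * Cconj h) ^ (a + i))%C H)) as T.
        assert (T2 : Rabs (Re (csum (fun i => (g * Cconj h) ^ (a + i))%C H)) <= M) by lra.
        apply Rabs_le_between in T2. lra. }
  { apply lsum_uniform_lower_one with g0; auto.
    - intros h Hh.
      destruct (Ceq_dec (g0 * Cconj h) 1) as [E|N].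
      + exists 0. intros a H. rewrite E. rewrite (csum_ext _ (fun _ => RtoC 1)) by (intros; apply Cpow_1_l).
        rewrite csum_re, rsum_const. simpl. pose proof (pos_INR H). lra.
      + destruct (geom_window (g0 * Cconj h)%C) as [M HM]; auto.
        * rewrite Cmod_mult, Cmod_conj. pose proof (H1 g0 Hg0). pose proof (H1 h Hh).
          pose proof (Cmod_ge_0 g0). pose proof (Cmod_ge_0 h). nra.
        * exists M. intros a H. specialize (HM a H).
          pose proof (re_le_Cmod (csum (fun i => (g0 * Cconj h) ^ (a + i))%C H)) as T.
          assert (T2 : Rabs (Re (csum (fun i => (g0 * Cconj h) ^ (a + i))%C H)) <= M) by lra.
          apply Rabs_le_between in T2. lra.
    - exists 0. intros a H. rewrite <- Cmod2_conj, Hg1.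
      rewrite (csum_ext _ (fun _ => RtoC 1)) by (intros; rewrite pow1; apply Cpow_1_l).
      rewrite csum_re, rsum_const. simpl. lra. }
  assert (S2 : forall a H, INR H - M2 <= rsum (fun i => f (a + i)%nat ^ 2) H).
  { intros a H. eapply Rle_trans; [apply (HM2 a H)|]. right.
    rewrite (lsum_ext _ (fun g => csum (fun i => lsum (fun h => (g * Cconj h) ^ (a + i))%C gs) H))
      by (intros; rewrite lsum_csum; auto).
    rewrite <- lsum_csum, csum_re. apply rsum_ext. intros i _.
    rewrite (lsum_ext _ (fun g => lsum (fun h => h ^ (a + i))%C (map Cconj gs) * g ^ (a + i))%C).
    - rewrite lsum_scal, Hf.
      assert (E : lsum (fun h => h ^ (a + i))%C (map Cconj gs) = Cconj (lsum (fun h => h ^ (a + i))%C gs)).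
      { rewrite lsum_conj. clear. induction gs as [|g gs IH]; simpl; auto. rewrite IH, Cpow_conj. auto. }
      rewrite E, Hf, Cconj_R, <- RtoC_mult. simpl. ring.
    - intros g. clear. induction gs as [|h gs IH]; simpl; [ring|]. rewrite IH, Cpow_mult_l. ring. }
  set (D := INR (length gs)).
  assert (HD : 1 <= D).
  { unfold D. rewrite <- INR_1. apply le_INR. destruct gs; [destruct Hg0|simpl; lia]. }
  assert (Bf : forall n, Rabs (f n) <= D).
  { intros n. rewrite <- Cmod_R, <- Hf. replace D with (D * 1) by ring. apply lsum_bound.
    intros g Hg. rewrite Cmod_pow, <- (pow1 n). apply pow_incr. split; auto. apply Cmod_ge_0. }
  set (c0 := / (4 * D)).
  assert (Hc0 : 0 < c0) by (apply Rinv_0_lt_compat; lra).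
  assert (EcD : c0 * D = / 4) by (unfold c0; field; lra).
  set (c := Rmin c0 (/ (4 * (D * D)))).
  assert (Hc : 0 < c) by (apply Rmin_pos; auto; apply Rinv_0_lt_compat; nra).
  exists c, (Rabs (M2 + D * M1) / (2 * (D * D))). split; auto. intros a H.
  set (w := fun i => if Rle_dec c (f (a + i)%nat) then 1 else 0).
  (* [x^2 <= D |x|], and [|x|] is twice the positive part minus [x]; the positive part is at most
     [c0], or at most [D] at a counted index. *)
  assert (Pt : forall i, f (a + i)%nat ^ 2 <= D * (2 * (c0 + D * w i) - f (a + i)%nat)).
  { intros i. pose proof (Bf (a + i)%nat) as B. set (x := f (a + i)%nat) in *.
    assert (A : x ^ 2 <= D * Rabs x).
    { rewrite <- (pow2_abs x). simpl. rewrite Rmult_1_r. apply Rmult_le_compat_r; auto. apply Rabs_pos. }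
    eapply Rle_trans; [exact A|]. apply Rmult_le_compat_l; [lra|].
    unfold w. fold x. apply Rabs_le_between in B.
    destruct (Rle_dec c x) as [L|L].
    - rewrite Rabs_pos_eq; lra.
    - assert (x < c0) by (pose proof (Rmin_l c0 (/ (4 * (D * D)))); unfold c in L; lra).
      unfold Rabs. destruct (Rcase_abs x); lra. }
  pose proof (rsum_le _ _ H (fun i _ => Pt i)) as Sum.
  rewrite rsum_scal in Sum.
  rewrite (rsum_ext (fun i => 2 * (c0 + D * w i) - f (a + i)%nat) (fun i => (2 * c0 + 2 * D * w i) + - 1 * f (a + i)%nat)) in Sum
    by (intros; ring).
  rewrite rsum_plus, rsum_plus, rsum_const, !rsum_scal in Sum.
  pose proof (S2 a H) as L2. pose proof (S1 a H) as L1. apply Rabs_le_between in L1.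
  set (W := rsum w H) in *. set (F1 := rsum (fun i => f (a + i)%nat) H) in *.
  assert (Hh := pos_INR H).
  assert (M1pos : 0 <= M1) by lra.
  assert (Fin : INR H / 2 - (M2 + D * M1) <= 2 * (D * D) * W).
  { assert (D * (INR H * (2 * c0)) = INR H / 2) by (replace (D * (INR H * (2 * c0))) with (2 * INR H * (c0 * D)) by ring; rewrite EcD; field).
    assert (- (D * M1) <= D * F1) by nra. nra. }
  apply Rmult_le_reg_l with (2 * (D * D)); [nra|].
  replace (2 * (D * D) * (c * INR H - Rabs (M2 + D * M1) / (2 * (D * D)))) with
    (2 * (D * D) * c * INR H - Rabs (M2 + D * M1)) by (field; lra).
  assert (2 * (D * D) * c <= / 2).
  { pose proof (Rmin_r c0 (/ (4 * (D * D)))) as R2. fold c in R2.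
    apply Rle_trans with (2 * (D * D) * / (4 * (D * D))); [apply Rmult_le_compat_l; nra|]. right. field. lra. }
  pose proof (Rle_abs (M2 + D * M1)). nra.
Qed.

(** * Inversion of divisor sums and the growth of the exponents *)

Lemma pow_ge_linear (t A : R) : 1 < t -> exists N, forall n, (N <= n)%nat -> A * INR n <= t ^ n.
Proof.
  intros Ht. set (w := sqrt t).
  assert (Hw : 1 < w) by (unfold w; rewrite <- sqrt_1; apply sqrt_lt_1; lra).
  assert (Ew : w * w = t) by (apply sqrt_sqrt; lra).
  destruct (INR_unbounded (A / (w - 1) ^ 2)) as [N HN]. exists N. intros n Hn.
  assert (B : INR n * (w - 1) <= w ^ n).
  { pose proof (poly n (w - 1) ltac:(lra)) as P. replace (1 + (w - 1)) with w in P by ring. lra. }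
  rewrite <- Ew, Rpow_mult_distr. pose proof (pos_INR n). apply le_INR in Hn.
  apply Rle_trans with ((INR n * (w - 1)) * (INR n * (w - 1))); [|apply Rmult_le_compat; nra].
  assert (A <= INR n * (w - 1) ^ 2).
  { apply Rmult_le_reg_r with (/ (w - 1) ^ 2); [apply Rinv_0_lt_compat, pow_lt; lra|].
    rewrite Rmult_assoc, Rinv_r by (apply pow_nonzero; lra). unfold Rdiv in HN. lra. }
  simpl in *. nra.
Qed.

Lemma rsum_term_le (f : nat -> R) (n i : nat) : (forall j, 0 <= f j) -> (i < n)%nat -> f i <= rsum f n.
Proof.
  intros Hf. induction n as [|n IH]; intros Hi; [lia|]. cbn [rsum].
  pose proof (rsum_nonneg f n (fun j _ => Hf j)). pose proof (Hf n).
  destruct (Nat.eq_dec i n) as [->|]; [lra|]. specialize (IH ltac:(lia)). lra.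
Qed.

Lemma dvdn_half (d n : nat) : (d < n)%nat -> (0 < n)%nat -> div.dvdn d n = true -> (2 * d <= n)%nat.
Proof.
  intros H1 H0 H2. destruct (ssrbool.elimT div.dvdnP H2) as [q Hq].
  change (n = (q * d)%nat) in Hq. subst n. destruct q as [|[|q]]; nia.
Qed.

Section DivisorSums.
Variable b : nat -> R.
Definition dterm (n d : nat) : R := if div.dvdn d n then b d else 0.
Definition rdiv (n : nat) : R := fold_right (fun d acc => dterm n d + acc) 0 (List.seq 1 n).

Lemma fold_last (f : nat -> R) (L : list nat) (x : nat) :
  fold_right (fun d acc => f d + acc) 0 (L ++ x :: nil) = fold_right (fun d acc => f d + acc) 0 L + f x.
Proof. induction L as [|y L IH]; simpl; [ring|]. rewrite IH. ring. Qed.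

Lemma fold_bound (f : nat -> R) (L : list nat) (B : R) : (forall d, In d L -> Rabs (f d) <= B) ->
  Rabs (fold_right (fun d acc => f d + acc) 0 L) <= INR (length L) * B.
Proof.
  induction L as [|y L IH]; intros H; simpl fold_right; simpl length; [rewrite Rabs_R0; simpl; lra|].
  rewrite S_INR. eapply Rle_trans; [apply Rabs_triang|].
  pose proof (H y (or_introl eq_refl)). assert (T := IH (fun d Hd => H d (or_intror Hd))). lra.
Qed.

Lemma rdiv_split (n : nat) (B : R) : (0 < n)%nat -> 0 <= B ->
  (forall d, (0 < d)%nat -> (2 * d <= n)%nat -> Rabs (b d) <= B) -> Rabs (b n - rdiv n) <= INR n * B.
Proof.
  intros Hn HB H. unfold rdiv. destruct n as [|n]; [lia|]. rewrite seq_S, fold_last.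
  assert (E : dterm (S n) (1 + n) = b (S n)).
  { unfold dterm. replace (div.dvdn (1 + n) (S n)) with true; auto. symmetry. apply div.dvdnn. }
  rewrite E, Rabs_minus_sym.
  match goal with |- Rabs (?x + ?y - ?z) <= _ => replace (x + y - z) with x by ring end.
  eapply Rle_trans; [apply fold_bound with (B := B)|].
  - intros d Hd. apply in_seq in Hd. unfold dterm. destruct (div.dvdn d (S n)) eqn:Ed.
    + apply H; [lia|]. apply dvdn_half; auto; lia.
    + rewrite Rabs_R0. auto.
  - rewrite length_seq. apply Rmult_le_compat_r; auto. apply le_INR. lia.
Qed.

(** Proper divisors of [n] are at most [n / 2], so a bound [t^(6 d)] on the earlier values makes
    their total [O(n t^(3 n))]. Together with the divisor sum, of size [t^(4 n)], this reproduces
    [t^(6 n)] for large [n]; the induction closes, and the error term is read off once more. *)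
Lemma mobius_growth (t D : R) : 1 < t -> 0 <= D ->
  (forall n, (0 < n)%nat -> Rabs (rdiv n) <= D * t ^ (4 * n)) ->
  exists K, 0 <= K /\ forall n, (0 < n)%nat -> Rabs (b n - rdiv n) <= INR n * (K * t ^ (3 * n)).
Proof.
  intros Ht HD H. destruct (pow_ge_linear t (D + 1) Ht) as [N HN].
  set (K := 1 + rsum (fun i => Rabs (b i)) N).
  assert (HK : 1 <= K).
  { pose proof (rsum_nonneg (fun i => Rabs (b i)) N (fun i _ => Rabs_pos _)). unfold K. lra. }
  assert (T1 : forall n, 1 <= t ^ n) by (intros n; apply pow_R1_Rle; lra).
  assert (Step : forall n, (0 < n)%nat -> (forall d, (d < n)%nat -> (0 < d)%nat -> Rabs (b d) <= K * t ^ (6 * d)) ->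
     Rabs (b n - rdiv n) <= INR n * (K * t ^ (3 * n))).
  { intros n Hn Hd. apply rdiv_split; auto.
    - specialize (T1 (3 * n)%nat). nra.
    - intros d H0 H2. eapply Rle_trans; [apply Hd; lia|]. apply Rmult_le_compat_l; [lra|].
      apply Rle_pow; [lra|lia]. }
  assert (Main : forall n, (0 < n)%nat -> Rabs (b n) <= K * t ^ (6 * n)).
  { intros n. induction n as [n IH] using lt_wf_ind. intros Hn.
    destruct (Nat.lt_ge_cases n N) as [L|L].
    - pose proof (rsum_term_le (fun i => Rabs (b i)) N n (fun i => Rabs_pos _) L) as T. cbn beta in T.
      specialize (T1 (6 * n)%nat). unfold K in *. nra.
    - pose proof (Step n Hn (fun d L0 H0 => IH d L0 H0)) as S1. pose proof (H n Hn) as S2. pose proof (HN n L) as S3.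
      replace (b n) with ((b n - rdiv n) + rdiv n) by ring. eapply Rle_trans; [apply Rabs_triang|].
      assert (1 <= INR n) by (rewrite <- INR_1; apply le_INR; lia).
      assert (E4 : t ^ (3 * n) <= t ^ (4 * n)) by (apply Rle_pow; [lra|lia]).
      assert (E6 : t ^ (4 * n) * t ^ n <= t ^ (6 * n)) by (rewrite <- pow_add; apply Rle_pow; [lra|lia]).
      pose proof (T1 (4 * n)%nat). pose proof (T1 (3 * n)%nat).
      assert (INR n * (K * t ^ (3 * n)) <= K * (INR n * t ^ (4 * n))).
      { replace (INR n * (K * t ^ (3 * n))) with (K * (INR n * t ^ (3 * n))) by ring.
        apply Rmult_le_compat_l; [lra|]. apply Rmult_le_compat_l; lra. }
      assert (K * (t ^ (4 * n) * t ^ n) <= K * t ^ (6 * n)) by (apply Rmult_le_compat_l; lra).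
      assert (D * t ^ (4 * n) <= K * (D * INR n * t ^ (4 * n))).
      { assert (0 <= D * t ^ (4 * n)) by nra. assert (D * t ^ (4 * n) <= D * t ^ (4 * n) * INR n) by nra. nra. }
      assert (K * ((D + 1) * INR n * t ^ (4 * n)) <= K * (t ^ n * t ^ (4 * n))).
      { apply Rmult_le_compat_l; [lra|]. apply Rmult_le_compat_r; lra. }
      nra. }
  exists K. split; [lra|]. intros n Hn. apply Step; auto.
Qed.
End DivisorSums.

Lemma divsum_real (p m : nat -> nat) (n : nat) :
  INR (divsum m n) - INR (divsum p n) = rdiv (fun d => INR d * INR (m d) - INR d * INR (p d)) n.
Proof.
  unfold divsum, rdiv. induction (List.seq 1 n) as [|d L IH]; [simpl; ring|]. cbn [fold_right].
  rewrite <- IH, !plus_INR. unfold dterm. destruct (div.dvdn d n); rewrite ?mult_INR; simpl; ring.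
Qed.

(* The exponents [bneg - bpos] of the zeta factors: Moebius inversion of the power sums of the roots, the largest
   of which has modulus [r > 1]. *)
Theorem exponents_growth (k l : nat) (bp bm : nat -> nat) : (3 <= k)%nat -> (1 <= l)%nat ->
  bp = EulerFactor.bpos k l -> bm = EulerFactor.bneg k l ->
  exists r c K C : R, exists N1 : nat, 1 < r /\ 0 < c /\ 0 < C /\
    (forall n, (0 < n)%nat -> INR (bp n) + INR (bm n) <= C * r ^ n) /\
    (forall a H, (N1 <= a)%nat -> c * INR H - K <=
      rsum (fun i => if excluded_middle_informative (bp (a + i)%nat = 0%nat /\ c * r ^ (a + i) <= INR (a + i) * INR (bm (a + i)%nat))
                     then 1 else 0) H).
Proof.
  intros Hk Hl Ep Em.
  destruct (euler_roots k l ltac:(lia) Hl) as (bs & Hlen & HQ & HP & HS).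
  destruct (large_root k l bs Hk Hl Hlen HQ HP) as (b1 & Hb1 & Lb1).
  destruct (max_mod_root bs) as (b0 & Hb0 & Mx). { intros ->. destruct Hb1. }
  set (r := Cmod b0). assert (Hr : 1 < r) by (specialize (Mx b1 Hb1); unfold r; lra).
  assert (Hr0 : RtoC r <> 0%C) by (intros E0; apply RtoC_inj in E0; lra).
  set (V := fun d => INR d * INR (bm d) - INR d * INR (bp d)).
  assert (HV : forall n, (0 < n)%nat -> lsum (fun b => b ^ n)%C bs = RtoC (rdiv V n)).
  { intros n Hn. unfold V. rewrite <- divsum_real, RtoC_minus, Ep, Em, <- HS by auto. ring. }
  set (D := INR (length bs)). assert (HD : 0 <= D) by apply pos_INR.
  (* [t^4 = r], so the error [O(n t^(3 n))] of the inversion is of smaller order than the power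
     sums, of size [r^n]. *)
  set (t := sqrt (sqrt r)).
  assert (Hs : 1 < sqrt r) by (rewrite <- sqrt_1; apply sqrt_lt_1; lra).
  assert (Ht : 1 < t) by (unfold t; rewrite <- sqrt_1; apply sqrt_lt_1; lra).
  assert (Et : forall n, t ^ (4 * n) = r ^ n).
  { intros n. rewrite pow_mult. f_equal. unfold t. replace 4%nat with (2 * 2)%nat by auto. rewrite pow_mult.
    rewrite !pow2_sqrt; auto; try lra. }
  destruct (mobius_growth V t D Ht HD) as (K & HK & HKn).
  { intros n Hn. rewrite Et, <- Cmod_R, <- HV by auto. apply lsum_bound. intros b Hb. rewrite Cmod_pow.
    apply pow_incr. split; [apply Cmod_ge_0|]. apply Mx; auto. }
  (* Normalisation to modulus at most 1, attained by [b0 / r]. The value 1 cannot occur: [1 / r]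
     would be a positive zero of [Q], whose coefficients are nonnegative with constant term 1. *)
  set (gs := map (fun b => b / r)%C bs).
  set (f := fun n => Re (lsum (fun g => g ^ n)%C gs)).
  assert (Egs : forall n, lsum (fun g => g ^ n)%C gs = (lsum (fun b => b ^ n)%C bs / r ^ n)%C).
  { intros n. unfold gs. clear -Hr0. assert (Hn : (RtoC r ^ n)%C <> 0%C) by (apply Cpow_nz; auto).
    induction bs as [|b bs IH]; cbn [map lsum fold_right].
    - field. auto.
    - unfold lsum in IH. rewrite IH. unfold Cdiv. rewrite Cpow_mult_l, Cpow_inv by auto. ring. }
  assert (Ef : forall n, (0 < n)%nat -> lsum (fun g => g ^ n)%C gs = RtoC (rdiv V n / r ^ n)).
  { intros n Hn. rewrite Egs, HV, RtoC_div, RtoC_pow by (auto; apply pow_nonzero; lra). auto. }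
  assert (Ef0 : forall n, lsum (fun g => g ^ n)%C gs = RtoC (f n)).
  { intros [|n].
    - unfold f. assert (Ex : exists x : R, lsum (fun g => g ^ 0)%C gs = RtoC x).
      { clear. induction gs as [|g gs [x IH]]; [exists 0; auto|]. exists (1 + x). cbn [lsum fold_right].
        unfold lsum in IH. rewrite IH, RtoC_plus. auto. }
      destruct Ex as [x ->]. auto.
    - unfold f. rewrite Ef by lia. auto. }
  destruct (power_sum_positive_often gs f) as (c & K2 & Hc & HW).
  { intros g Hg. unfold gs in Hg. apply in_map_iff in Hg as (b & <- & Hb). rewrite Cmod_div, Cmod_R, Rabs_pos_eq by (auto; lra).
    apply Rmult_le_reg_r with r; [lra|]. unfold Rdiv. rewrite Rmult_assoc, Rinv_l, Rmult_1_r, Rmult_1_l by lra. apply Mx; auto. }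
  { intros g Hg Eg. unfold gs in Hg. apply in_map_iff in Hg as (b & Eb & Hb).
    assert (Ebr : b = RtoC r). { rewrite <- Eb in Eg. replace b with (b / r * r)%C by (field; auto). rewrite Eg. ring. }
    assert (Z : Qpoly k l (/ r)%C = 0%C).
    { rewrite HQ. clear -Hb Ebr Hr0. induction bs as [|a bs IH]; [destruct Hb|]. cbn [lprod fold_right].
      destruct Hb as [->|Hb].
      - rewrite Ebr. replace (1 - r * / r)%C with (RtoC 0) by (field; auto). ring.
      - unfold lprod in IH. rewrite IH by auto. ring. }
    rewrite <- RtoC_inv in Z by lra. rewrite Qpoly_real in Z. apply RtoC_inj in Z.
    assert (0 <= rsum (fun i => (/ r) ^ (l * k + 1 + i)) (k - 1)).
    { apply rsum_nonneg. intros i _. apply pow_le. apply Rlt_le, Rinv_0_lt_compat. lra. }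
    lra. }
  { exists (b0 / r)%C. split; [unfold gs; apply in_map_iff; exists b0; auto|].
    rewrite Cmod_div, Cmod_R, Rabs_pos_eq by (auto; lra). fold r. field. lra. }
  { exact Ef0. }
  assert (Efr : forall n, (0 < n)%nat -> f n = rdiv V n / r ^ n) by (intros n Hn; unfold f; rewrite Ef by auto; auto).
  assert (Rp : forall n, 0 < r ^ n) by (intros n; apply pow_lt; lra).
  set (c2 := Rmin (c / 2) 1).
  assert (Hc2 : 0 < c2 /\ c2 <= c / 2 /\ c2 <= 1).
  { unfold c2. split; [apply Rmin_pos; lra|]. split; [apply Rmin_l|apply Rmin_r]. }
  destruct (pow_ge_linear t (2 * K / c) Ht) as (N1 & HN1).
  exists r, c2, K2, (D + K / (t - 1) + 1), (S N1).
  assert (HKt : 0 <= K / (t - 1)) by (apply Rdiv_le_0_compat; lra).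
  split; [auto|]. split; [lra|]. split; [lra|]. split.
  - intros n Hn. 
    assert (A : Rabs (V n) <= D * r ^ n + K / (t - 1) * r ^ n).
    { replace (V n) with ((V n - rdiv V n) + rdiv V n) by ring. eapply Rle_trans; [apply Rabs_triang|].
      assert (B1 : Rabs (rdiv V n) <= D * r ^ n).
      { rewrite <- Cmod_R, <- HV by auto. apply lsum_bound. intros b Hb. rewrite Cmod_pow.
        apply pow_incr. split; [apply Cmod_ge_0|]. apply Mx; auto. }
      pose proof (HKn n Hn) as B2.
      assert (B3 : INR n * (t - 1) <= t ^ n).
      { pose proof (poly n (t - 1) ltac:(lra)) as P. replace (1 + (t - 1)) with t in P by ring. lra. }
      assert (INR n * (K * t ^ (3 * n)) <= K / (t - 1) * r ^ n).
      { rewrite <- Et. replace (4 * n)%nat with (3 * n + n)%nat by lia. rewrite pow_add.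
        assert (0 < t ^ (3 * n)) by (apply pow_lt; lra).
        apply Rle_trans with (K / (t - 1) * (t ^ (3 * n) * (INR n * (t - 1)))).
        - right. field. lra.
        - apply Rmult_le_compat_l; auto. apply Rmult_le_compat_l; lra. }
      lra. }
    assert (1 <= INR n) by (rewrite <- INR_1; apply le_INR; lia).
    pose proof (Rp n). pose proof (pos_INR (bp n)). pose proof (pos_INR (bm n)).
    assert (INR (bp n) + INR (bm n) <= Rabs (V n)).
    { unfold V. destruct (bpos_bneg k l n) as [E|E]; rewrite <- ?Ep, <- ?Em in E; rewrite E; simpl.
      - rewrite Rabs_pos_eq; nra.
      - rewrite Rabs_left1; nra. }
    lra.
  - intros a H Ha. apply Rle_trans with (c * INR H - K2); [pose proof (pos_INR H); nra|].
    eapply Rle_trans; [apply (HW a H)|]. apply rsum_le. intros i _.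
    destruct (Rle_dec c (f (a + i)%nat)) as [L|L].
    2: { clear -L. destruct (excluded_middle_informative (bp (a + i)%nat = 0%nat /\ c2 * r ^ (a + i) <= INR (a + i) * INR (bm (a + i)%nat))); lra. }
    destruct (excluded_middle_informative (bp (a + i)%nat = 0%nat /\ c2 * r ^ (a + i) <= INR (a + i) * INR (bm (a + i)%nat))) as [|NE]; [lra|]. exfalso. apply NE. clear NE.
    set (n := (a + i)%nat) in *. assert (Hn : (0 < n)%nat) by (unfold n; lia).
    rewrite Efr in L by auto. pose proof (Rp n).
    assert (L2 : c * r ^ n <= rdiv V n).
    { apply Rmult_le_reg_r with (/ r ^ n); [apply Rinv_0_lt_compat; auto|].
      rewrite Rmult_assoc, Rinv_r by lra. unfold Rdiv in L. lra. }
    pose proof (HKn n Hn) as B2. pose proof (HN1 n ltac:(unfold n; lia)) as B3.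
    assert (B4 : INR n * (K * t ^ (3 * n)) <= c / 2 * r ^ n).
    { rewrite <- Et. replace (4 * n)%nat with (3 * n + n)%nat by lia. rewrite pow_add.
      assert (0 < t ^ (3 * n)) by (apply pow_lt; lra).
      apply Rle_trans with (c / 2 * (t ^ (3 * n) * (2 * K / c * INR n))).
      - right. field. lra.
      - apply Rmult_le_compat_l; [lra|]. apply Rmult_le_compat_l; lra. }
    apply Rabs_le_between in B2.
    assert (B5 : c / 2 * r ^ n <= V n) by lra.
    assert (1 <= INR n) by (rewrite <- INR_1; apply le_INR; lia).
    assert (VP : 0 < V n) by nra.
    destruct (bpos_bneg k l n) as [E|E]; rewrite <- ?Ep, <- ?Em in E.
    + split; auto. unfold V in B5. rewrite E in B5. simpl INR in B5. 
      apply Rle_trans with (c / 2 * r ^ n); [apply Rmult_le_compat_r; lra|]. lra.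
    + exfalso. unfold V in VP. rewrite E in VP. simpl INR in VP. pose proof (pos_INR (bp n)). nra.
Qed.

(** * Meromorphic continuation *)

Lemma exp_le (x y : R) : x <= y -> exp x <= exp y.
Proof. intros [H| ->]; [apply Rlt_le, exp_increasing; auto|apply Rle_refl]. Qed.

Lemma exp_pow (x : R) (n : nat) : exp x ^ n = exp (INR n * x).
Proof.
  induction n as [|n IH]; [rewrite Rmult_0_l, exp_0; auto|].
  rewrite S_INR, Rmult_plus_distr_r, exp_plus, <- IH, Rmult_1_l. simpl. ring.
Qed.

Lemma tails_nonneg (b B : nat -> R) (n : nat) : tails b B -> 0 <= B n.
Proof. intros [H _]. specialize (H n n ltac:(lia)). lra. Qed.

(** The factor [Cmod (x m)] on the right serves twice: it yields the Cauchy property and, once the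
    exponential is below 2, shows that the limit is not 0. *)
Lemma product_increment (x a : nat -> C) (b : nat -> R) : (forall n, x (S n) = x n * (1 + a n))%C ->
  (forall n, Cmod (a n) <= b n) -> forall m n, (m <= n)%nat ->
  Cmod (x n - x m) <= Cmod (x m) * (exp (rsum b n - rsum b m) - 1).
Proof.
  intros Hx Hb m n Hmn. induction n as [|n IH].
  - replace m with 0%nat by lia. rewrite Cmod_self, Rminus_diag, exp_0. lra.
  - destruct (Nat.eq_dec m (S n)) as [->|N]; [rewrite Cmod_self, Rminus_diag, exp_0; lra|].
    specialize (IH ltac:(lia)). cbn [rsum]. set (T := rsum b n - rsum b m) in *.
    replace (rsum b n + b n - rsum b m) with (T + b n) by (unfold T; ring). rewrite exp_plus.
    rewrite Hx. replace (x n * (1 + a n) - x m)%C with ((x n - x m) + (x m + (x n - x m)) * a n)%C by ring.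
    pose proof (Cmod_ge_0 (x m)) as P0. pose proof (Cmod_ge_0 (a n)) as P1. pose proof (Hb n) as Hbn.
    pose proof (exp_ineq1_le (b n)) as E1. pose proof (exp_pos T).
    assert (T1 : Cmod (x m + (x n - x m)) <= Cmod (x m) * exp T).
    { eapply Rle_trans; [apply Cmod_triangle|]. lra. }
    pose proof (Cmod_ge_0 (x m + (x n - x m))) as P2.
    eapply Rle_trans; [apply Cmod_triangle|]. rewrite Cmod_mult.
    assert (Cmod (x m + (x n - x m)) * Cmod (a n) <= Cmod (x m) * exp T * b n) by (apply Rmult_le_compat; lra).
    assert (0 <= Cmod (x m) * exp T) by nra. nra.
Qed.

Lemma product_converges (x a : nat -> C) (b B : nat -> R) : x 0%nat = 1 ->
  (forall n, x (S n) = x n * (1 + a n))%C -> (forall n, Cmod (a n) <= b n) -> tails b B ->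
  exists v, clim x v /\ (forall n, Cmod (v - x n) <= exp (B 0%nat) * (exp (B n) - 1)) /\
    ((forall n, x n <> 0) -> v <> 0).
Proof.
  intros H0 Hx Hb HB. pose proof (product_increment x a b Hx Hb) as Inc.
  assert (Inc2 : forall m n, (m <= n)%nat -> Cmod (x n - x m) <= Cmod (x m) * (exp (B m) - 1)).
  { intros m n Hmn. eapply Rle_trans; [apply Inc; auto|]. apply Rmult_le_compat_l; [apply Cmod_ge_0|].
    apply Rplus_le_compat_r. apply exp_le. apply HB; auto. }
  assert (Bd : forall n, Cmod (x n) <= exp (B 0%nat)).
  { intros n. pose proof (Inc2 0%nat n ltac:(lia)) as I. rewrite H0, Cmod_1 in I.
    replace (x n) with (x n - 1 + 1)%C by ring. eapply Rle_trans; [apply Cmod_triangle|]. rewrite Cmod_1. lra. }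
  assert (E1 : forall n, 0 <= exp (B n) - 1).
  { intros n. pose proof (tails_nonneg _ _ n HB). pose proof (exp_ineq1_le (B n)). lra. }
  assert (Small : forall eps, 0 < eps -> exists N, forall n, (N <= n)%nat -> exp (B n) - 1 < eps).
  { intros eps He. destruct (proj2 HB (ln (1 + eps))) as [N HN]; [rewrite <- ln_1; apply ln_increasing; lra|].
    exists N. intros n Hn. specialize (HN n Hn). apply exp_increasing in HN. rewrite exp_ln in HN; lra. }
  destruct (clim_exists x (fun m => exp (B 0%nat) * (exp (B m) - 1))) as [v Hv].
  - intros m n Hmn. eapply Rle_trans; [apply Inc2; auto|]. apply Rmult_le_compat_r; auto.
  - intros eps He. pose proof (exp_pos (B 0%nat)) as P. destruct (Small (eps / exp (B 0%nat))) as [N HN].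
    { apply Rdiv_lt_0_compat; auto. }
    exists N. intros n Hn. specialize (HN n Hn). apply Rmult_lt_reg_r with (/ exp (B 0%nat)).
    { apply Rinv_0_lt_compat; auto. }
    rewrite (Rmult_comm (exp (B 0%nat))), Rmult_assoc, Rinv_r by lra. unfold Rdiv in HN. lra.
  - exists v. split; auto. split.
    + intros n. apply clim_le with x n; auto. intros m Hm. eapply Rle_trans; [apply Inc2; auto|].
      apply Rmult_le_compat_r; auto.
    + intros Hn E. destruct (Small 1 ltac:(lra)) as [N HN]. specialize (HN N (le_n N)).
      assert (C1 : Cmod (v - x N) <= Cmod (x N) * (exp (B N) - 1)).
      { apply clim_le with x N; auto. }
      rewrite E in C1. replace (0 - x N)%C with (- x N)%C in C1 by ring. rewrite Cmod_opp in C1.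
      pose proof (proj1 (Cmod_gt_0 _) (Hn N)). nra.
Qed.

Lemma hol_pprod (f : nat -> C -> C) (z : C) (n : nat) : (forall p, is_prime p -> hol (f p) z) ->
  hol (fun w => pprod (fun p => f p w) n) z.
Proof.
  intros H. induction n as [|n IH]; simpl; [apply hol_const|]. apply hol_mult; auto.
  destruct (is_prime_dec (S n)); [auto|apply hol_const].
Qed.

Lemma pprod_neq0 (f : nat -> C) (n : nat) : (forall p, is_prime p -> f p <> 0) -> pprod f n <> 0.
Proof.
  intros H. induction n as [|n IH]; simpl; [apply C1_nz|]. apply Cmult_neq_0; auto.
  destruct (is_prime_dec (S n)); [auto|apply C1_nz].
Qed.

Lemma one_minus_pow_lower (u : C) (u0 : R) (n : nat) : Cmod u <= u0 -> u0 < 1 -> (1 <= n)%nat ->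
  1 - u0 <= Cmod (1 - u ^ n).
Proof.
  intros H1 H2 Hn. pose proof (Cmod_tri_inv 1 (u ^ n)) as T. rewrite Cmod_1, Cmod_pow in T.
  pose proof (Cmod_ge_0 u).
  assert (Cmod u ^ n <= u0).
  { destruct n as [|n]; [lia|]. simpl. assert (Cmod u ^ n <= 1) by (rewrite <- (pow1 n); apply pow_incr; lra).
    assert (0 <= Cmod u ^ n) by (apply pow_le; lra). nra. }
  lra.
Qed.

(** Uniformity on the disc makes the constant in [EN_bound] the same for all primes, since every
    [p^(-s)] lies in the disc obtained from [p = 2]. *)
Lemma zprod_lower (b : nat -> nat) (u0 : R) (N : nat) : 0 <= u0 < 1 ->
  exists kap, 0 < kap /\ forall u, Cmod u <= u0 -> kap <= Cmod (zprod b u N).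
Proof.
  intros H0. induction N as [|N [kap [Hk IH]]].
  - exists 1. split; [lra|]. intros. simpl. rewrite Cmod_1. lra.
  - exists (kap * (1 - u0) ^ b (S N)). split; [apply Rmult_lt_0_compat; auto; apply pow_lt; lra|].
    intros u Hu. simpl. rewrite Cmod_mult, Cmod_pow. apply Rmult_le_compat; auto; try lra.
    + apply pow_le; lra.
    + apply pow_incr. split; [lra|]. apply (one_minus_pow_lower u u0 (S N)); auto; try lra. lia.
Qed.

Lemma zprod_neq0 (b : nat -> nat) (u : C) (N : nat) : Cmod u < 1 -> zprod b u N <> 0.
Proof.
  intros Hu. destruct (zprod_lower b (Cmod u) N) as (kap & Hk & H); [split; auto; apply Cmod_ge_0|].
  intros E. specialize (H u (Rle_refl _)). rewrite E, Cmod_0 in H. lra.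
Qed.

Lemma hol_zprod (b : nat -> nat) (N : nat) (f : C -> C) (z : C) : hol f z -> hol (fun w => zprod b (f w) N) z.
Proof.
  intros Hf. induction N as [|N IH]; cbn [zprod]; [apply hol_const|].
  apply hol_mult; auto. apply hol_pow, hol_minus; [apply hol_const|apply hol_pow; auto].
Qed.

Lemma hol_Qpoly (k l : nat) (f : C -> C) (z : C) : hol f z -> hol (fun w => Qpoly k l (f w)) z.
Proof.
  intros Hf. unfold Qpoly. apply hol_plus; [apply hol_const|].
  apply (hol_csum (fun i w => f w ^ (l * k + 1 + i))%C). intros i. apply hol_pow; auto.
Qed.

Lemma prime_pw_le (p : nat) (s : C) (sg : R) : is_prime p -> 0 < sg <= Re s -> Cmod (pw (INR p) s) <= exp (- sg * ln (INR p)).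
Proof.
  intros Hp Hs. rewrite pw_mod. apply exp_le.
  assert (0 <= ln (INR p)). { rewrite <- ln_1. apply ln_le; [lra|]. apply prime_ge2 in Hp. apply (le_INR 1). lia. }
  nra.
Qed.

Lemma exp_prime_lt1 (sg : R) : 0 < sg -> 0 <= exp (- sg * ln 2) < 1.
Proof.
  intros H. split; [apply Rlt_le, exp_pos|]. rewrite <- exp_0. apply exp_increasing.
  assert (0 < ln 2) by (rewrite <- ln_1; apply ln_increasing; lra). nra.
Qed.

Lemma prime_pw_le2 (p : nat) (s : C) (sg : R) : is_prime p -> 0 < sg <= Re s -> Cmod (pw (INR p) s) <= exp (- sg * ln 2).
Proof.
  intros Hp Hs. eapply Rle_trans; [apply (prime_pw_le p s sg); auto|]. apply exp_ln_decr; [lra|].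
  split; [lra|]. apply prime_ge2 in Hp. apply (le_INR 2) in Hp. simpl in Hp. lra.
Qed.

Lemma prime_pw_lt1 (p : nat) (s : C) : is_prime p -> 0 < Re s -> Cmod (pw (INR p) s) < 1.
Proof.
  intros Hp Hs. eapply Rle_lt_trans; [apply (prime_pw_le2 p s (Re s)); auto; lra|]. apply exp_prime_lt1; auto.
Qed.

Section EulerRemainder.
Variables (k l : nat).
Let bp := EulerFactor.bpos k l.
Let bm := EulerFactor.bneg k l.

(* The factor left of [Q] after extracting the first [N] zeta factors: [1 + O(u^(N+1))]. *)
Definition EN (N : nat) (u : C) : C := (Qpoly k l u * zprod bp u N / zprod bm u N)%C.

Lemma EN_bound (N : nat) (u0 : R) : 0 <= u0 < 1 ->
  exists K, 0 <= K /\ forall u, Cmod u <= u0 -> Cmod (EN N u - 1) <= K * Cmod u ^ S N.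
Proof.
  intros H0. destruct (EulerFactorRoots.exponents_factor k l N) as (Sf & B & HB & HE).
  destruct (zprod_lower bm u0 N H0) as (kap & Hk & HL).
  assert (B0 : 0 <= B). { eapply Rle_trans; [apply Cmod_ge_0|]. apply (HB 0%C). rewrite Cmod_0. lra. }
  exists (B / kap). split; [apply Rdiv_le_0_compat; auto|]. intros u Hu. specialize (HL u Hu).
  assert (Nz : zprod bm u N <> 0) by (apply zprod_neq0; lra).
  unfold EN. rewrite HE. fold bm.
  replace ((zprod bm u N + u ^ S N * Sf u) / zprod bm u N - 1)%C with (u ^ S N * (Sf u / zprod bm u N))%C by (field; auto).
  rewrite Cmod_mult, Cmod_pow, Cmod_div, Rmult_comm by auto. apply Rmult_le_compat_r; [apply pow_le, Cmod_ge_0|].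
  apply Rmult_le_compat; [apply Cmod_ge_0| |apply HB; lra|apply Rinv_le_contravar; auto].
  apply Rlt_le, Rinv_0_lt_compat. lra.
Qed.

Lemma EN_neq0 (N : nat) (u : C) : Cmod u < 1 -> Qpoly k l u <> 0 -> EN N u <> 0.
Proof.
  intros Hu HQ. unfold EN. apply Cmult_neq_0; [apply Cmult_neq_0; auto; apply zprod_neq0; auto|].
  intros E. pose proof (zprod_neq0 bm u N Hu) as Nz. apply C1_nz.
  rewrite <- (Cinv_r (zprod bm u N) Nz), E. ring.
Qed.

Lemma EN_step (N : nat) (u : C) : Cmod u < 1 ->
  (EN (S N) u * (1 - u ^ S N) ^ bm (S N) = EN N u * (1 - u ^ S N) ^ bp (S N))%C.
Proof.
  intros Hu. pose proof (zprod_neq0 bm u N Hu) as N1. pose proof (zprod_neq0 bm u (S N) Hu) as N2.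
  unfold EN. cbn [zprod] in *.
  assert (N3 : ((1 - u ^ S N) ^ bm (S N))%C <> 0) by (intros E; apply N2; rewrite E; ring).
  generalize dependent ((1 - u ^ S N) ^ bm (S N))%C. intros y N2 N3. field. auto.
Qed.

Definition EP (N : nat) (s : C) : C := epsilon (inhabits (RtoC 0)) (fun v => clim (pprod (fun p => EN N (pw (INR p) s))) v).

(** The factors differ from 1 by at most [K p^(- tau)] with [tau = (N + 1) sg > 1]. The constants
    depend on [sg] alone, so convergence is uniform on the half-plane [Re s >= sg]. *)
Lemma EP_uniform (N : nat) (sg : R) : 0 < sg -> 1 < INR (S N) * sg -> exists M : R, exists E : nat -> R,
  (forall eps, 0 < eps -> exists n, E n <= eps) /\
  forall s, sg <= Re s -> clim (pprod (fun p => EN N (pw (INR p) s))) (EP N s) /\ Cmod (EP N s) <= M /\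
    (forall n, Cmod (EP N s - pprod (fun p => EN N (pw (INR p) s)) n) <= E n) /\
    ((forall p, is_prime p -> Qpoly k l (pw (INR p) s) <> 0) -> EP N s <> 0).
Proof.
  intros Hsg H1. destruct (EN_bound N (exp (- sg * ln 2)) (exp_prime_lt1 sg Hsg)) as (K & HK & HB).
  set (tau := INR (S N) * sg) in *.
  assert (HT := tails_scal _ _ K HK (tails_zb (tau - 1) ltac:(lra))).
  set (b := fun i => K * zb (tau - 1) i) in *. set (B := fun i => K * zB (tau - 1) i) in *.
  assert (Main : forall s, sg <= Re s -> exists v, clim (pprod (fun p => EN N (pw (INR p) s))) v /\
     (forall n, Cmod (v - pprod (fun p => EN N (pw (INR p) s)) n) <= exp (B 0%nat) * (exp (B n) - 1)) /\
     ((forall n, pprod (fun p => EN N (pw (INR p) s)) n <> 0) -> v <> 0)).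
  { intros s Hs. apply product_converges with
      (a := fun n => if is_prime_dec (S n) then (EN N (pw (INR (S n)) s) - 1)%C else 0%C) (b := b); auto.
    - intros n. cbn [pprod]. f_equal. destruct (is_prime_dec (S n)); ring.
    - intros n. destruct (is_prime_dec (S n)) as [Hp|_].
      2: { rewrite Cmod_0. unfold b. pose proof (zb_pos (tau - 1) n). nra. }
      eapply Rle_trans; [apply HB, prime_pw_le2; auto|]. unfold b. apply Rmult_le_compat_l; auto.
      rewrite zb_shift. eapply Rle_trans; [apply pow_incr; split; [apply Cmod_ge_0|apply (prime_pw_le _ s sg); auto]|].
      rewrite exp_pow. right. f_equal. unfold tau. ring. }
  exists (exp (B 0%nat) * (exp (B 0%nat) - 1) + 1), (fun n => exp (B 0%nat) * (exp (B n) - 1)).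
  split.
  - intros eps He. pose proof (exp_pos (B 0%nat)) as P.
    assert (He2 : 0 < eps / exp (B 0%nat)) by (apply Rdiv_lt_0_compat; auto).
    destruct (proj2 HT (ln (1 + eps / exp (B 0%nat)))) as [n Hn].
    { rewrite <- ln_1. apply ln_increasing; lra. }
    exists n. specialize (Hn n (le_n n)). apply exp_increasing in Hn. rewrite exp_ln in Hn by lra.
    apply Rmult_le_reg_r with (/ exp (B 0%nat)); [apply Rinv_0_lt_compat; auto|].
    rewrite (Rmult_comm (exp (B 0%nat))), Rmult_assoc, Rinv_r by lra. unfold Rdiv in Hn. fold B in Hn. lra.
  - intros s Hs. destruct (Main s Hs) as (v & V1 & V2 & V3).
    assert (Ev : EP N s = v).
    { unfold EP. eapply clim_unique; [|exact V1]. apply epsilon_spec. exists v; auto. }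
    rewrite Ev. split; auto. split; [|split; auto].
    + specialize (V2 0%nat). cbn [pprod] in V2. replace v with (v - 1 + 1)%C by ring.
      eapply Rle_trans; [apply Cmod_triangle|]. rewrite Cmod_1. lra.
    + intros HQ. apply V3. intros n. apply pprod_neq0. intros p Hp. apply EN_neq0; auto.
      apply prime_pw_lt1; auto. lra.
Qed.

Lemma EP_clim (N : nat) (s : C) : 0 < Re s -> 1 < INR (S N) * Re s ->
  clim (pprod (fun p => EN N (pw (INR p) s))) (EP N s).
Proof. intros H0 H1. destruct (EP_uniform N (Re s) H0 H1) as (M & E & _ & H). apply H. lra. Qed.

Lemma EP_neq0 (N : nat) (s : C) : 0 < Re s -> 1 < INR (S N) * Re s ->
  (forall p, is_prime p -> Qpoly k l (pw (INR p) s) <> 0) -> EP N s <> 0.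
Proof. intros H0 H1 HQ. destruct (EP_uniform N (Re s) H0 H1) as (M & E & _ & H). apply H; auto. lra. Qed.

Lemma EP_bounded (N : nat) (sg : R) : 0 < sg -> 1 < INR (S N) * sg ->
  exists M, forall s, sg <= Re s -> Cmod (EP N s) <= M.
Proof. intros H0 H1. destruct (EP_uniform N sg H0 H1) as (M & E & _ & H). exists M. intros s Hs. apply H; auto. Qed.

Lemma EP_hol (N : nat) (z : C) : 0 < Re z -> 1 < INR (S N) * Re z -> hol (EP N) z.
Proof.
  intros H0 H1. pose proof (INR_S_pos N) as PN. set (a := / INR (S N)).
  assert (Ha : 0 < a) by (apply Rinv_0_lt_compat; auto).
  assert (Ez : a < Re z). { apply Rmult_lt_reg_l with (INR (S N)); auto. unfold a. rewrite Rinv_r; lra. }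
  set (r' := (Re z - a) / 2). assert (Hr : 0 < r') by (unfold r'; lra).
  assert (HS : 1 < INR (S N) * (Re z - r')).
  { assert (INR (S N) * a = 1) by (unfold a; field; lra). unfold r'. nra. }
  destruct (EP_uniform N (Re z - r') ltac:(unfold r'; lra) HS) as (M & E & HE & H).
  assert (Near : forall w, Cmod (w - z) < r' -> Re z - r' <= Re w).
  { intros w Hw. apply Re_near in Hw. lra. }
  apply (hol_weierstrass (EP N) z (r' / 2) r' M); [lra| | |rewrite Cmod_self; lra].
  - intros w Hw. apply H; auto.
  - intros eps He. destruct (HE eps He) as [n Hn].
    exists (fun s => pprod (fun p => EN N (pw (INR p) s)) n). split.
    + intros w Hw. apply (hol_pprod (fun p s => EN N (pw (INR p) s))). intros p Hp. unfold EN.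
      apply hol_div; [apply hol_mult; [apply hol_Qpoly|apply hol_zprod]|apply hol_zprod|]; try apply hol_pw.
      apply zprod_neq0, prime_pw_lt1; auto. specialize (Near w Hw). unfold r' in Near. lra.
    + intros w Hw. destruct (H w (Near w Hw)) as (_ & _ & H2 & _). specialize (H2 n). lra.
Qed.

(** Where [Re s > 1 / (N + 1)], [zeta ((N + 1) s)] is still given by its Euler product, so shifting
    it between the explicit part and the remainder is an identity of limits. *)
Lemma EP_step (N : nat) (s : C) : 0 < Re s -> 1 < INR (S N) * Re s ->
  (EP N s * zeta (INR (S N) * s) ^ bm (S N) = EP (S N) s * zeta (INR (S N) * s) ^ bp (S N))%C.
Proof.
  intros H0 H1. set (n := S N).
  assert (Hn : 1 < Re (INR n * s)%C) by (rewrite Re_scal; auto).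
  destruct (zeta_euler _ Hn) as [Nz _].
  pose proof (zeta_euler_scaled n s Hn) as HZ.
  assert (L : forall M (f : nat -> nat), clim (pprod (fun p => EN M (pw (INR p) s))) (EP M s) ->
    clim (pprod (fun p => EN M (pw (INR p) s) * (1 - pw (INR p) s ^ n) ^ f n)%C) (EP M s * (/ zeta (INR n * s)) ^ f n)%C).
  { intros M f HM. apply clim_ext with (fun x => pprod (fun p => EN M (pw (INR p) s)) x * (pprod (fun p => 1 - pw (INR p) s ^ n) x) ^ f n)%C.
    - intros x. rewrite <- pprod_pow, <- pprod_mult. auto.
    - apply clim_mult; auto. apply (clim_ccont (fun w => w ^ f n)%C); auto. apply ccont_pow, ccont_id. }
  assert (E : (EP (S N) s * (/ zeta (INR n * s)) ^ bm n = EP N s * (/ zeta (INR n * s)) ^ bp n)%C).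
  { apply (clim_unique (pprod (fun p => EN (S N) (pw (INR p) s) * (1 - pw (INR p) s ^ n) ^ bm n)%C)).
    - apply L. apply EP_clim; auto. rewrite S_INR. nra.
    - eapply clim_ext; [|apply (L N bp), EP_clim; auto]. intros x. apply pprod_ext. intros p Hp. symmetry. apply EN_step.
      apply prime_pw_lt1; auto. }
  set (Z := zeta (INR n * s)) in *.
  assert (P : forall m, (Z ^ m)%C <> 0) by (intros m; apply Cpow_nz; auto).
  rewrite !Cpow_inv in E by auto. pose proof (P (bm n)) as P1. pose proof (P (bp n)) as P2.
  transitivity (EP N s * (/ Z ^ bp n) * Z ^ bp n * Z ^ bm n)%C; [field; auto|]. rewrite <- E. change (S N) with n. field. auto.
Qed.
End EulerRemainder.

(** * Poles, continuation and the local notions of the statement *)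

Lemma cderiv_C_differentiable (f : C -> C) (z d : C) : cderiv f z d -> C_differentiable f z.
Proof.
  intros (phi & Hc & E & H). exists d. split.
  - apply is_linear_scal_l.
  - intros x Hx eps.
    assert (Ex : x = z).
    { symmetry. apply (is_filter_lim_locally_unique (V := AbsRing_NormedModule C_AbsRing)). exact Hx. }
    subst x. destruct (Hc eps (cond_pos eps)) as [del [Hd Hn]].
    exists (mkposreal del Hd). intros w Hw. change (Cmod (w - z) < del) in Hw.
    change (Cmod (f w - f z - (w - z) * d) <= eps * Cmod (w - z)).
    assert (Ew : (f w - f z - (w - z) * d = (phi w - phi z) * (w - z))%C).
    { rewrite (H w), (H z), E. ring. }
    rewrite Ew, Cmod_mult. apply Rmult_le_compat_r; [apply Cmod_ge_0|]. apply Rlt_le, Hn, Hw.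
Qed.

Lemma C_differentiable_bounded (f : C -> C) (z : C) : C_differentiable f z ->
  exists del M, 0 < del /\ forall w, Cmod (w - z) < del -> Cmod (f w) <= M.
Proof.
  intros H. apply ex_derive_continuous in H.
  assert (Hb : @locally (NormedModule.UniformSpace C_AbsRing C_NormedModule) (f z) (fun y => Cmod y < Cmod (f z) + 3)).
  { exists (mkposreal 1 Rlt_0_1). intros y [H1 H2]. change (Rabs (Re y - Re (f z)) < 1) in H1. change (Rabs (Im y - Im (f z)) < 1) in H2.
    replace y with (f z + (y - f z))%C by ring. eapply Rle_lt_trans; [apply Cmod_triangle|].
    pose proof (Cmod_le_re_im (y - f z)) as T.
    change (Re (y - f z)%C) with (Re y - Re (f z)) in T. change (Im (y - f z)%C) with (Im y - Im (f z)) in T. lra. }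
  destruct (H _ Hb) as [d Hd]. exists d, (Cmod (f z) + 3). split; [apply cond_pos|].
  intros w Hw. apply Rlt_le, Hd. exact Hw.
Qed.

(** Neighbourhoods in the product topology are squares; half the radius makes the square fit inside
    the disc. *)
Lemma filterlim_Cmod_infty (f : C -> C) (z : C) :
  (forall M, exists d, 0 < d /\ forall w, Cmod (w - z) < d -> w <> z -> M < Cmod (f w)) ->
  filterlim (fun w => Cmod (f w)) (locally' z) (Rbar_locally p_infty).
Proof.
  intros H Q [M HM]. destruct (H M) as [d [Hd Hw]]. exists (mkposreal (d / 2) ltac:(lra)).
  intros w [H1 H2] Nw. apply HM, Hw; auto.
  change (Rabs (Re w - Re z) < d / 2) in H1. change (Rabs (Im w - Im z) < d / 2) in H2.
  pose proof (Cmod_le_re_im (w - z)) as T.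
  change (Re (w - z)%C) with (Re w - Re z) in T. change (Im (w - z)%C) with (Im w - Im z) in T. lra.
Qed.

Lemma filterlim_Cmod_infty_inv (f : C -> C) (z : C) (M : R) :
  filterlim (fun w => Cmod (f w)) (locally' z) (Rbar_locally p_infty) ->
  exists d, 0 < d /\ forall w, Cmod (w - z) < d -> w <> z -> M < Cmod (f w).
Proof.
  intros H. destruct (H (fun y => M < y)) as [d Hd]; [exists M; auto|].
  exists d. split; [apply cond_pos|]. intros w Hw Nw. apply Hd; auto. split.
  - change (Rabs (Re w - Re z) < d). pose proof (re_le_Cmod (w - z)) as T.
    change (Re (w - z)%C) with (Re w - Re z) in T. lra.
  - change (Rabs (Im w - Im z) < d). pose proof (im_le_Cmod (w - z)) as T.
    change (Im (w - z)%C) with (Im w - Im z) in T. lra.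
Qed.

(* A holomorphic continuation [H] stays bounded near each of its regular points, so it cannot agree with a function
   whose poles cluster there. *)
Lemma clustering_poles_no_continuation (G : C -> C) (P : C -> Prop) (y : R) :
  meromorphic_on right_half_plane G P ->
  (forall eps, 0 < eps -> exists p, P p /\ Cmod (p - iy y) < eps) ->
  ~ exists (r : R) (H : C -> C) (Q : C -> Prop), 0 < r /\ meromorphic_on (Cdisc (iy y) r) H Q /\
      forall z, Cdisc (iy y) r z -> right_half_plane z -> ~ P z -> ~ Q z -> H z = G z.
Proof.
  intros (GO & GP & GD & _ & GI) Hacc (r & H & Q & Hr & (HO & HQ & HD & Hh & _) & Heq).
  assert (Hc : Cdisc (iy y) r (iy y)) by (unfold Cdisc; rewrite Cmod_self; auto).
  destruct (HD _ Hc) as (r1 & R1 & D1).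
  destruct (Hacc (Rmin r r1)) as (p & Pp & Dp); [apply Rmin_pos; auto|].
  pose proof (Rmin_l r r1). pose proof (Rmin_r r r1).
  pose proof (GP p Pp) as Up.
  assert (Np : p <> iy y). { intros E. rewrite E in Up. unfold right_half_plane, iy in Up. simpl in Up. lra. }
  assert (NQ : ~ Q p). { intros Qp. specialize (D1 p Qp Np). lra. }
  assert (Dp' : Cdisc (iy y) r p) by (unfold Cdisc; lra).
  destruct (C_differentiable_bounded H p (Hh p Dp' NQ)) as (d1 & M & Hd1 & HM).
  destruct (HO p Dp') as (d2 & Hd2 & HO2). destruct (GO p Up) as (d3 & Hd3 & HO3).
  destruct (HD p Dp') as (d4 & Hd4 & HD4). destruct (GD p Up) as (d5 & Hd5 & HD5).
  destruct (filterlim_Cmod_infty_inv G p M (GI p Pp)) as (d6 & Hd6 & HI).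
  set (d := Rmin d1 (Rmin d2 (Rmin d3 (Rmin d4 (Rmin d5 d6))))).
  assert (Hd : 0 < d) by (unfold d; repeat apply Rmin_pos; auto).
  (* One point near [p], outside both pole sets, at which [H] is at most [M] while [G] exceeds
     [M]. *)
  set (w := (p + RtoC (d / 2))%C).
  assert (Ew : Cmod (w - p) = d / 2).
  { unfold w. replace (p + RtoC (d / 2) - p)%C with (RtoC (d / 2)) by ring. rewrite Cmod_R, Rabs_pos_eq; lra. }
  assert (Nw : w <> p). { intros E. rewrite E, Cmod_self in Ew. lra. }
  assert (L : d / 2 < d1 /\ d / 2 < d2 /\ d / 2 < d3 /\ d / 2 < d4 /\ d / 2 < d5 /\ d / 2 < d6).
  { unfold d in *. repeat split; apply Rlt_le_trans with d; unfold d; try lra;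
      repeat (apply Rle_refl || apply Rmin_l || (eapply Rle_trans; [apply Rmin_r|])). }
  rewrite <- Ew in L. destruct L as (L1 & L2 & L3 & L4 & L5 & L6).
  assert (E : H w = G w).
  { apply Heq; auto.
    - intros Pw. specialize (HD5 w Pw Nw). lra.
    - intros Qw. specialize (HD4 w Qw Nw). lra. }
  specialize (HM w L1). specialize (HI w L6 Nw). rewrite E in HM. lra.
Qed.

Lemma zord_punctured_neq0 (f : C -> C) (z : C) (m : nat) : zord f z m ->
  exists d, 0 < d /\ forall w, Cmod (w - z) < d -> w <> z -> f w <> 0.
Proof.
  intros (rho & g & Hr & Hg & Ng & H).
  destruct (ccont_neq0 g z (hol_ccont _ _ Hg) Ng) as (r & Rr & H2).
  exists (Rmin rho r). split; [apply Rmin_pos; auto|]. intros w Hw Nw.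
  pose proof (Rmin_l rho r). pose proof (Rmin_r rho r). rewrite H by lra.
  apply Cmult_neq_0.
  - apply Cpow_nz. intros E. apply Nw, Cminus_0_eq, E.
  - intros E. specialize (H2 w ltac:(lra)). rewrite E, Cmod_0 in H2. pose proof (Cmod_ge_0 (g z)). lra.
Qed.

(** * Gluing a compatible sequence of quotients into one meromorphic function *)

Section MeromorphicQuotient.
Variables A B : nat -> C -> C.
(** The half-plane [Re z > 1 / (N + 1)]; these exhaust the right half-plane. *)
Definition dom (N : nat) (z : C) : Prop := 0 < Re z /\ 1 < INR (S N) * Re z.
Hypothesis HA : forall N z, dom N z -> hol (A N) z.
Hypothesis HB : forall N z, dom N z -> hol (B N) z.
Hypothesis ZA : forall N z, dom N z -> exists m, zord (A N) z m.
Hypothesis ZB : forall N z, dom N z -> exists m, zord (B N) z m.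
Hypothesis HC : forall N z, dom N z -> (A N z * B (S N) z = A (S N) z * B N z)%C.

Lemma dom_mono (N M : nat) (z : C) : (N <= M)%nat -> dom N z -> dom M z.
Proof.
  intros HN [H1 H2]. split; auto. apply Rlt_le_trans with (1 := H2). apply Rmult_le_compat_r; [lra|].
  apply le_INR. lia.
Qed.

Lemma dom_open (N : nat) (z : C) : dom N z -> exists d, 0 < d /\ forall w, Cmod (w - z) < d -> dom N w.
Proof.
  intros [H1 H2]. pose proof (lt_0_INR (S N) ltac:(lia)) as P. set (n := INR (S N)) in *.
  set (d := Rmin (Re z) ((n * Re z - 1) / n)).
  assert (Hd : 0 < d). { apply Rmin_pos; auto. apply Rdiv_lt_0_compat; lra. }
  exists d. split; auto. intros w Hw.
  pose proof (re_le_Cmod (w - z)) as T. change (Re (w - z)%C) with (Re w - Re z) in T.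
  apply Rabs_le_between in T. pose proof (Rmin_l (Re z) ((n * Re z - 1) / n)) as L1.
  pose proof (Rmin_r (Re z) ((n * Re z - 1) / n)) as L2. fold d in L1, L2.
  split; [lra|]. fold n.
  assert (n * ((n * Re z - 1) / n) = n * Re z - 1) by (field; lra). nra.
Qed.

Lemma dom_exists (z : C) : 0 < Re z -> exists N, dom N z.
Proof.
  intros H. destruct (INR_unbounded (/ Re z)) as [N HN]. exists N. split; auto.
  rewrite S_INR. assert (/ Re z * Re z = 1) by (field; lra). nra.
Qed.

(** Cross-multiplied equalities compose only after cancelling [B M], which is nonzero on a punctured
    neighbourhood; continuity then recovers the point itself. *)
Lemma quotient_compat (N M : nat) (z : C) : (N <= M)%nat -> dom N z -> (A N z * B M z = A M z * B N z)%C.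
Proof.
  intros HNM. revert z. induction HNM as [|M HNM IH]; intros z Hz; [auto|].
  destruct (ZB M z (dom_mono N M z HNM Hz)) as [m Hm].
  destruct (zord_punctured_neq0 _ _ _ Hm) as (d1 & Hd1 & N1).
  destruct (dom_open N z Hz) as (d2 & Hd2 & N2).
  apply (ccont_punctured_eq (fun w => A N w * B (S M) w)%C (fun w => A (S M) w * B N w)%C z (Rmin d1 d2)).
  - apply Rmin_pos; auto.
  - apply ccont_mult; apply hol_ccont; auto. apply HB, (dom_mono N); auto.
  - apply ccont_mult; apply hol_ccont; auto. apply HA, (dom_mono N); auto.
  - intros w Hw Nw. pose proof (Rmin_l d1 d2). pose proof (Rmin_r d1 d2).
    assert (Dw : dom N w) by (apply N2; lra). assert (Bw : B M w <> 0) by (apply N1; auto; lra).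
    pose proof (HC M w (dom_mono N M w HNM Dw)) as E1. pose proof (IH w Dw) as E2.
    assert (E3 : (A N w * B (S M) w * B M w = A (S M) w * B N w * B M w)%C).
    { transitivity (A N w * B M w * B (S M) w)%C; [ring|]. rewrite E2.
      transitivity (A M w * B (S M) w * B N w)%C; [ring|]. rewrite E1. ring. }
    rewrite <- (Cmult_1_r (A N w * B (S M) w)), <- (Cmult_1_r (A (S M) w * B N w)), <- (Cinv_r (B M w)), !Cmult_assoc, E3 by auto.
    auto.
Qed.

(* The quotients [A N / B N] agree on common domains; [v] is the value at [z] after removing a singularity. *)
Definition Val (z v : C) : Prop := exists N g d, dom N z /\ 0 < d /\ hol g z /\ g z = v /\
  forall w, Cmod (w - z) < d -> (g w * B N w = A N w)%C.

Lemma Val_unique_le (z : C) (N M : nat) (g h : C -> C) (d1 d2 : R) : (N <= M)%nat -> dom N z -> 0 < d1 -> 0 < d2 ->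
  hol g z -> hol h z ->
  (forall w, Cmod (w - z) < d1 -> (g w * B N w = A N w)%C) ->
  (forall w, Cmod (w - z) < d2 -> (h w * B M w = A M w)%C) -> g z = h z.
Proof.
  intros HNM Hz Hd1 Hd2 Hg Hh Eg Eh.
  destruct (ZB N z Hz) as [m Hm]. destruct (ZB M z (dom_mono N M z HNM Hz)) as [m' Hm'].
  destruct (zord_punctured_neq0 _ _ _ Hm) as (d3 & Hd3 & N3).
  destruct (zord_punctured_neq0 _ _ _ Hm') as (d4 & Hd4 & N4).
  destruct (dom_open N z Hz) as (d5 & Hd5 & N5).
  set (d := Rmin d1 (Rmin d2 (Rmin d3 (Rmin d4 d5)))).
  assert (L : d <= d1 /\ d <= d2 /\ d <= d3 /\ d <= d4 /\ d <= d5).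
  { unfold d. repeat split; repeat (apply Rle_refl || apply Rmin_l || (eapply Rle_trans; [apply Rmin_r|])). }
  apply (ccont_punctured_eq g h z d); try (apply hol_ccont; auto); [unfold d; repeat apply Rmin_pos; auto|].
  intros w Hw Nw. specialize (Eg w ltac:(lra)). specialize (Eh w ltac:(lra)).
  specialize (N3 w ltac:(lra) Nw). specialize (N4 w ltac:(lra) Nw).
  pose proof (quotient_compat N M w HNM (N5 w ltac:(lra))) as E. rewrite <- Eg, <- Eh in E.
  assert (Nn : (B N w * B M w)%C <> 0) by (apply Cmult_neq_0; auto).
  rewrite <- (Cmult_1_r (g w)), <- (Cmult_1_r (h w)), <- (Cinv_r _ Nn).
  transitivity (g w * B N w * B M w * / (B N w * B M w))%C; [ring|]. rewrite E. ring.
Qed.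

Lemma Val_unique (z v v' : C) : Val z v -> Val z v' -> v = v'.
Proof.
  intros (N & g & d & D1 & Hd & Hg & <- & Eg) (M & h & e & D2 & He & Hh & <- & Eh).
  destruct (Nat.le_ge_cases N M) as [L|L].
  - apply (Val_unique_le z N M g h d e); auto.
  - symmetry. apply (Val_unique_le z M N h g e d); auto.
Qed.

Definition quot (z : C) : C := epsilon (inhabits (RtoC 0)) (Val z).
(** Defined by the failure of any holomorphic extension, since a zero of [B] may be cancelled by one
    of [A]. *)
Definition pole (z : C) : Prop := 0 < Re z /\ ~ exists v, Val z v.

Lemma quot_eq (z v : C) : Val z v -> quot z = v.
Proof. intros H. apply (Val_unique z); auto. unfold quot. apply epsilon_spec. exists v; auto. Qed.

Lemma Val_near (N : nat) (g : C -> C) (z : C) (d : R) : dom N z -> 0 < d -> hol g z ->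
  (forall w, Cmod (w - z) < d -> (g w * B N w = A N w)%C) ->
  exists e, 0 < e /\ forall w, Cmod (w - z) < e -> Val w (g w).
Proof.
  intros Hz Hd Hg E. destruct (hol_open g z Hg) as (d1 & Hd1 & H1). destruct (dom_open N z Hz) as (d2 & Hd2 & H2).
  exists (Rmin (d / 2) (Rmin d1 d2)). split; [repeat apply Rmin_pos; lra|]. intros w Hw.
  assert (L : Cmod (w - z) < d / 2 /\ Cmod (w - z) < d1 /\ Cmod (w - z) < d2).
  { pose proof (Rmin_l (d / 2) (Rmin d1 d2)). pose proof (Rmin_r (d / 2) (Rmin d1 d2)).
    pose proof (Rmin_l d1 d2). pose proof (Rmin_r d1 d2). lra. }
  exists N, g, (d / 2). split; [apply H2; lra|]. split; [lra|]. split; [apply H1; lra|]. split; auto.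
  intros v Hv. apply E. replace (v - z)%C with ((v - w) + (w - z))%C by ring.
  eapply Rle_lt_trans; [apply Cmod_triangle|]. lra.
Qed.

Lemma Val_of_neq0 (N : nat) (z : C) : dom N z -> B N z <> 0 -> Val z (A N z / B N z)%C.
Proof.
  intros Hz Nz. destruct (ccont_neq0 _ _ (hol_ccont _ _ (HB N z Hz)) Nz) as (d & Hd & H).
  exists N, (fun w => A N w / B N w)%C, d. split; auto. split; auto. split; [apply hol_div; auto|]. split; auto.
  intros w Hw. field. intros E. specialize (H w Hw). rewrite E, Cmod_0 in H. pose proof (Cmod_ge_0 (B N z)). lra.
Qed.

Lemma quotient_compat2 (N M : nat) (z : C) : dom N z -> dom M z -> (A N z * B M z = A M z * B N z)%C.
Proof.
  intros H1 H2. destruct (Nat.le_ge_cases N M) as [L|L]; [apply quotient_compat; auto|].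
  symmetry. apply quotient_compat; auto.
Qed.

(** An extension [u] would force [g = u (w - z)^(b - a) h] between the nonvanishing cofactors [g] of
    [A N] and [h] of [B N], so [g] would vanish at [z]. The extension may come with another index
    [M], whence the passage through [quotient_compat2]. *)
Lemma pole_of_orders (N : nat) (z : C) (a b : nat) : dom N z -> zord (A N) z a -> zord (B N) z b -> (a < b)%nat -> pole z.
Proof.
  intros Hz (r1 & g & R1 & Hg & Ng & E1) (r2 & h & R2 & Hh & Nh & E2) Hab.
  split; [apply Hz|]. intros (v & M & u & d & D & Hd & Hu & _ & E). apply Ng.
  destruct (dom_open N z Hz) as (d1 & Hd1 & D1). destruct (dom_open M z D) as (d2 & Hd2 & D2).
  destruct (ZB M z D) as [m Hm]. destruct (zord_punctured_neq0 _ _ _ Hm) as (d3 & Hd3 & D3).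
  set (e := Rmin d (Rmin r1 (Rmin r2 (Rmin d1 (Rmin d2 d3))))).
  assert (L : e <= d /\ e <= r1 /\ e <= r2 /\ e <= d1 /\ e <= d2 /\ e <= d3).
  { unfold e. repeat split; repeat (apply Rle_refl || apply Rmin_l || (eapply Rle_trans; [apply Rmin_r|])). }
  transitivity (u z * ((z - z) ^ (b - a) * h z))%C.
  2: { replace (z - z)%C with (RtoC 0) by ring. replace (b - a)%nat with (S (b - a - 1)) by lia. rewrite Cpow_S. ring. }
  apply (ccont_punctured_eq g (fun w => u w * ((w - z) ^ (b - a) * h w))%C z e).
  - unfold e; repeat apply Rmin_pos; auto.
  - apply hol_ccont; auto.
  - apply ccont_mult; [apply hol_ccont; auto|]. apply ccont_mult; [|apply hol_ccont; auto].
    apply ccont_pow, hol_ccont, hol_minus; [apply hol_id|apply hol_const].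
  - intros w Hw Nw. specialize (E w ltac:(lra)). specialize (E1 w ltac:(lra)). specialize (E2 w ltac:(lra)).
    specialize (D3 w ltac:(lra) Nw).
    pose proof (quotient_compat2 N M w (D1 w ltac:(lra)) (D2 w ltac:(lra))) as C.
    rewrite E1, E2, <- E in C.
    replace b with (a + (b - a))%nat in C by lia. rewrite Cpow_add_r in C.
    assert (N1 : ((w - z) ^ a)%C <> 0). { apply Cpow_nz. intros E0. apply Nw, Cminus_0_eq, E0. }
    replace (a + (b - a) - a)%nat with (b - a)%nat in C by lia.
    set (q := ((w - z) ^ (b - a))%C) in *. set (p := ((w - z) ^ a)%C) in *.
    transitivity (p * g w * B M w * / (p * B M w))%C; [field; auto|]. rewrite C. field. auto.
Qed.

(** At a pole the denominator vanishes to higher order than the numerator; otherwise the quotient of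
    the cofactors, times a power of [w - z], would be an extension. *)
Lemma pole_local (z : C) : pole z -> forall X, exists d, 0 < d /\ forall w, Cmod (w - z) < d -> w <> z ->
  exists v, Val w v /\ X < Cmod v.
Proof.
  intros [Hz Hno] X. destruct (dom_exists z Hz) as [N D].
  destruct (ZA N z D) as (a & r1 & g & R1 & Hg & Ng & E1). destruct (ZB N z D) as (b & r2 & h & R2 & Hh & Nh & E2).
  destruct (Nat.le_gt_cases b a) as [L|L].
  { exfalso. apply Hno. exists ((z - z) ^ (a - b) * (g z / h z))%C.
    destruct (ccont_neq0 h z (hol_ccont _ _ Hh) Nh) as (r3 & R3 & H3).
    exists N, (fun w => (w - z) ^ (a - b) * (g w / h w))%C, (Rmin r1 (Rmin r2 r3)).
    split; auto. split; [repeat apply Rmin_pos; auto|]. split.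
    { apply hol_mult; [apply hol_pow, hol_minus; [apply hol_id|apply hol_const]|apply hol_div; auto]. }
    split; auto. intros w Hw.
    pose proof (Rmin_l r1 (Rmin r2 r3)). pose proof (Rmin_r r1 (Rmin r2 r3)).
    pose proof (Rmin_l r2 r3). pose proof (Rmin_r r2 r3).
    rewrite E1, E2 by lra. replace a with (a - b + b)%nat at 2 by lia. rewrite Cpow_add_r. field.
    intros E. specialize (H3 w ltac:(lra)). rewrite E, Cmod_0 in H3. pose proof (Cmod_ge_0 (h z)). lra. }
  destruct (ccont_neq0 g z (hol_ccont _ _ Hg) Ng) as (r3 & R3 & H3).
  destruct (ccont_neq0 h z (hol_ccont _ _ Hh) Nh) as (r4 & R4 & H4).
  destruct (ccont_bounded h z (hol_ccont _ _ Hh)) as (r5 & K & R5 & HK & H5).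
  destruct (dom_open N z D) as (r6 & R6 & H6).
  assert (Pg : 0 < Cmod (g z) / 2) by (apply Cmod_gt_0 in Ng; lra).
  set (c := Cmod (g z) / 2) in *.
  assert (PX : 0 < c / (K * (Rabs X + 1))).
  { pose proof (Rabs_pos X). apply Rdiv_lt_0_compat; auto. nra. }
  set (d0 := Rmin 1 (c / (K * (Rabs X + 1)))).
  set (d := Rmin d0 (Rmin r1 (Rmin r2 (Rmin r3 (Rmin r4 (Rmin r5 r6)))))).
  exists d. split; [unfold d, d0; repeat apply Rmin_pos; auto; lra|]. intros w Hw Nw.
  assert (LL : d <= d0 /\ d <= r1 /\ d <= r2 /\ d <= r3 /\ d <= r4 /\ d <= r5 /\ d <= r6).
  { unfold d. repeat split; repeat (apply Rle_refl || apply Rmin_l || (eapply Rle_trans; [apply Rmin_r|])). }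
  assert (NZ : (w - z)%C <> 0) by (intros E0; apply Nw, Cminus_0_eq, E0).
  specialize (H3 w ltac:(lra)). specialize (H4 w ltac:(lra)). specialize (H5 w ltac:(lra)).
  assert (Nhw : h w <> 0) by (intros E0; rewrite E0, Cmod_0 in H4; pose proof (Cmod_ge_0 (h z)); lra).
  assert (NB : B N w <> 0) by (rewrite E2 by lra; apply Cmult_neq_0; auto; apply Cpow_nz; auto).
  exists (A N w / B N w)%C. split; [apply Val_of_neq0; auto; apply H6; lra|].
  rewrite E1, E2 by lra. replace b with (a + S (b - a - 1))%nat by lia. rewrite Cpow_add_r, Cpow_S.
  assert (N1 : ((w - z) ^ a)%C <> 0) by (apply Cpow_nz; auto).
  assert (N2 : ((w - z) ^ (b - a - 1))%C <> 0) by (apply Cpow_nz; auto).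
  match goal with |- _ < Cmod ?e => replace e with (g w / ((w - z) * ((w - z) ^ (b - a - 1) * h w)))%C by (field; auto) end.
  rewrite Cmod_div by (repeat apply Cmult_neq_0; auto). rewrite !Cmod_mult, Cmod_pow.
  set (t := Cmod (w - z)) in *. assert (Ht : 0 < t) by (apply Cmod_gt_0; auto).
  pose proof (Rmin_l 1 (c / (K * (Rabs X + 1)))) as M1. pose proof (Rmin_r 1 (c / (K * (Rabs X + 1)))) as M2. fold d0 in M1, M2.
  assert (T1 : t ^ (b - a - 1) <= 1) by (rewrite <- (pow1 (b - a - 1)); apply pow_incr; lra).
  assert (T0 : 0 < t ^ (b - a - 1)) by (apply pow_lt; auto).
  assert (Ph : 0 < Cmod (h w)) by (apply Cmod_gt_0; auto).
  assert (Den : t * (t ^ (b - a - 1) * Cmod (h w)) <= t * K).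
  { apply Rmult_le_compat_l; [lra|]. nra. }
  assert (PD : 0 < t * (t ^ (b - a - 1) * Cmod (h w))) by (repeat apply Rmult_lt_0_compat; auto).
  apply Rle_lt_trans with (Rabs X); [apply Rle_abs|].
  apply Rmult_lt_reg_r with (t * (t ^ (b - a - 1) * Cmod (h w))); auto.
  unfold Rdiv. rewrite Rmult_assoc, Rinv_l, Rmult_1_r by lra.
  pose proof (Rabs_pos X) as AX.
  assert (Tc : t * (K * (Rabs X + 1)) < c).
  { apply Rmult_lt_reg_r with (/ (K * (Rabs X + 1))); [apply Rinv_0_lt_compat; nra|].
    rewrite Rmult_assoc, Rinv_r by nra. unfold Rdiv in M2. lra. }
  nra.
Qed.

Lemma quot_meromorphic : meromorphic_on right_half_plane quot pole.
Proof.
  assert (Reg : forall z, right_half_plane z -> ~ pole z -> exists v, Val z v).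
  { intros z Hz Np. apply NNPP. intros Hno. apply Np. split; auto. }
  split; [|split; [|split; [|split]]].
  - intros z Hz. exists (Re z). split; auto. intros c Hc. apply Re_near in Hc. unfold right_half_plane. lra.
  - intros p [H _]. exact H.
  - intros z Hz. destruct (classic (pole z)) as [Pz|Nz].
    + destruct (pole_local z Pz 0) as (d & Hd & H). exists d. split; auto. intros w [_ Hw] Nw.
      apply Rnot_lt_le. intros L. destruct (H w L Nw) as (v & Hv & _). apply Hw. exists v; auto.
    + destruct (Reg z Hz Nz) as (v & N & g & d & D & Hd & Hg & _ & E).
      destruct (Val_near N g z d D Hd Hg E) as (e & He & Hv). exists e. split; auto. intros w [_ Hw] _.
      apply Rnot_lt_le. intros L. apply Hw. exists (g w). auto.
  - intros z Hz Nz. destruct (Reg z Hz Nz) as (v & N & g & d & D & Hd & Hg & _ & E).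
    destruct (Val_near N g z d D Hd Hg E) as (e & He & Hv).
    assert (Hq : hol quot z). { apply (hol_ext_loc g quot z e He); auto. intros w Hw. symmetry. apply quot_eq, Hv, Hw. }
    destruct (hol_cderiv _ _ Hq) as [q Hd']. apply cderiv_C_differentiable with q; auto.
  - intros p Hp. apply filterlim_Cmod_infty. intros X. destruct (pole_local p Hp X) as (d & Hd & H).
    exists d. split; auto. intros w Hw Nw. destruct (H w Hw Nw) as (v & Hv & L). rewrite (quot_eq w v Hv). auto.
Qed.
End MeromorphicQuotient.

Lemma zord_of_neq0 (f : C -> C) (z : C) : hol f z -> f z <> 0 -> zord f z 0.
Proof. intros Hf Hz. exists 1, f. split; [lra|]. split; auto. split; auto. intros. simpl. ring. Qed.

Lemma zord_mult (f g : C -> C) (z : C) (a b : nat) : zord f z a -> zord g z b -> zord (fun w => f w * g w)%C z (a + b).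
Proof.
  intros (r1 & f1 & R1 & Hf & Nf & E1) (r2 & g1 & R2 & Hg & Ng & E2).
  exists (Rmin r1 r2), (fun w => f1 w * g1 w)%C. split; [apply Rmin_pos; auto|]. split; [apply hol_mult; auto|].
  split; [apply Cmult_neq_0; auto|]. intros w Hw. pose proof (Rmin_l r1 r2). pose proof (Rmin_r r1 r2).
  rewrite E1, E2, Cpow_add_r by lra. ring.
Qed.

Lemma zord_pow (f : C -> C) (z : C) (a n : nat) : zord f z a -> zord (fun w => f w ^ n)%C z (n * a).
Proof.
  intros H. induction n as [|n IH]; [apply (zord_of_neq0 (fun _ => 1%C)); [apply hol_const|apply C1_nz]|].
  simpl. apply (zord_mult f (fun w => f w ^ n)%C); auto.
Qed.

Lemma zord_scale (f : C -> C) (c z : C) (m : nat) : c <> 0 -> zord f (c * z) m -> zord (fun w => f (c * w)%C) z m.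
Proof.
  intros Hc (r & g & R1 & Hg & Ng & E). pose proof (proj1 (Cmod_gt_0 _) Hc) as Pc.
  exists (r / Cmod c), (fun w => c ^ m * g (c * w))%C.
  split; [apply Rdiv_lt_0_compat; auto|]. split; [|split].
  - apply hol_mult; [apply hol_const|]. apply (hol_comp (fun w => c * w)%C g); auto.
    apply hol_mult; [apply hol_const|apply hol_id].
  - apply Cmult_neq_0; auto. apply Cpow_nz; auto.
  - intros w Hw. rewrite E.
    + replace (c * w - c * z)%C with (c * (w - z))%C by ring. rewrite Cpow_mult_l. ring.
    + replace (c * w - c * z)%C with (c * (w - z))%C by ring. rewrite Cmod_mult.
      apply Rmult_lt_reg_r with (/ Cmod c); [apply Rinv_0_lt_compat; auto|].
      rewrite (Rmult_comm (Cmod c)), Rmult_assoc, Rinv_r by lra. unfold Rdiv in Hw. lra.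
Qed.

Fixpoint nprod (f : nat -> C) (N : nat) : C :=
  match N with O => 1%C | S n => (nprod f n * f (S n))%C end.

Fixpoint nsum (f : nat -> nat) (N : nat) : nat :=
  match N with O => 0%nat | S n => (nsum f n + f (S n))%nat end.

Lemma hol_nprod (f : nat -> C -> C) (z : C) (N : nat) : (forall n, (1 <= n)%nat -> hol (f n) z) ->
  hol (fun w => nprod (fun n => f n w) N) z.
Proof.
  intros H. induction N as [|N IH]; simpl; [apply hol_const|]. apply hol_mult; auto. apply H. lia.
Qed.

Lemma nprod_neq0 (f : nat -> C) (N : nat) : (forall n, (1 <= n)%nat -> f n <> 0) -> nprod f N <> 0.
Proof.
  intros H. induction N as [|N IH]; simpl; [apply C1_nz|]. apply Cmult_neq_0; auto. apply H. lia.
Qed.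

Lemma zord_nprod (f : nat -> C -> C) (z : C) (m : nat -> nat) (N : nat) :
  (forall n, (1 <= n)%nat -> zord (f n) z (m n)) -> zord (fun w => nprod (fun n => f n w) N) z (nsum m N).
Proof.
  intros H. induction N as [|N IH]; simpl; [apply (zord_of_neq0 (fun _ => 1%C)); [apply hol_const|apply C1_nz]|].
  apply (zord_mult (fun w => nprod (fun n => f n w) N) (f (S N))); auto. apply H. lia.
Qed.

Definition bounded_on (U : C -> Prop) (f : C -> C) : Prop := exists M, forall z, U z -> Cmod (f z) <= M.

Lemma bounded_mult (U : C -> Prop) (f g : C -> C) : bounded_on U f -> bounded_on U g -> bounded_on U (fun w => f w * g w)%C.
Proof.
  intros [M HM] [M' HM']. exists (M * M'). intros z Hz. rewrite Cmod_mult.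
  apply Rmult_le_compat; auto; apply Cmod_ge_0.
Qed.

Lemma bounded_pow (U : C -> Prop) (f : C -> C) (n : nat) : bounded_on U f -> bounded_on U (fun w => f w ^ n)%C.
Proof.
  intros H. induction n as [|n IH]; [exists 1; intros; simpl; rewrite Cmod_1; lra|].
  simpl. apply (bounded_mult U f (fun w => f w ^ n)%C); auto.
Qed.

Lemma bounded_nprod (U : C -> Prop) (f : nat -> C -> C) (N : nat) : (forall n, (1 <= n)%nat -> bounded_on U (f n)) ->
  bounded_on U (fun w => nprod (fun n => f n w) N).
Proof.
  intros H. induction N as [|N IH]; simpl; [exists 1; intros; rewrite Cmod_1; lra|].
  apply (bounded_mult U (fun w => nprod (fun n => f n w) N) (f (S N))); auto. apply H. lia.
Qed.

(** [zord_exists] asks for a bounded function on a disc whose centre is not a zero. Real centres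
    [c > 1] qualify for all factors below, and a large enough disc about such a centre reaches any
    point of the half-plane. *)
Lemma half_plane_disc (z : C) (N : nat) : dom N z -> exists (c r a : R), 1 < c /\ 0 < a /\ 1 < INR (S N) * a /\
  Cmod (z - c) < r /\ forall w, Cmod (w - c) < r -> a <= Re w.
Proof.
  intros [H1 H2]. destruct z as [x y]. simpl in H1.
  assert (H2' : 1 < INR (S N) * x) by exact H2. pose proof (lt_0_INR (S N) ltac:(lia)) as PN.
  set (n := INR (S N)) in *. set (a := (x + / n) / 2).
  assert (Pn : 0 < / n) by (apply Rinv_0_lt_compat; auto).
  assert (Ha : / n < a < x).
  { assert (/ n < x). { apply Rmult_lt_reg_l with n; auto. rewrite Rinv_r; lra. } unfold a; lra. }
  (* Solves [(c - 2 - x) (x - a) = y^2 + x^2], which puts [z] inside the circle of radius [c - a]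
     about [c]. *)
  set (c := 2 + x + (y ^ 2 + x ^ 2) / (x - a)).
  assert (Hc : 0 <= (y ^ 2 + x ^ 2) / (x - a)).
  { apply Rdiv_le_0_compat; [|lra]. pose proof (pow2_ge_0 x). pose proof (pow2_ge_0 y). lra. }
  exists c, (c - a), a. split; [unfold c; lra|]. split; [lra|]. split.
  { apply Rmult_lt_reg_l with (/ n); auto. rewrite <- Rmult_assoc, Rinv_l; lra. }
  split.
  - apply Rsqr_incrst_0; [|apply Cmod_ge_0|unfold c; lra]. rewrite !Rsqr_pow2, Cmod2. simpl Re. simpl Im.
    assert (E : (c - 2 - x) * (x - a) = y ^ 2 + x ^ 2) by (unfold c; field; lra).
    unfold c in *. set (q := (y ^ 2 + x ^ 2) / (x - a)) in *. nra.
  - intros w Hw. apply Re_near in Hw. simpl in Hw. lra.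
Qed.

(** * The continuation of F and the order of its poles *)

Section ZetaQuotient.
Variables (k l : nat).
Hypothesis Hk : (1 <= k)%nat.
Let bp := EulerFactor.bpos k l.
Let bm := EulerFactor.bneg k l.

(** Each [zeta (n s)] is written as [Zf (n s) / (n s - 1)] and negative exponents are moved across
    the fraction, so that [numer] and [denom] are both holomorphic on [dom N]. *)
Definition numer (N : nat) (s : C) : C :=
  (Zf (INR k * s) * nprod (fun n => Zf (INR n * s) ^ bp n * (INR n * s - 1) ^ bm n) N * EP k l N s)%C.
Definition denom (N : nat) (s : C) : C :=
  ((INR k * s - 1) * nprod (fun n => (INR n * s - 1) ^ bp n * Zf (INR n * s) ^ bm n) N)%C.

Lemma Re_scal_pos (n : nat) (s : C) : (1 <= n)%nat -> 0 < Re s -> 0 < Re (INR n * s)%C.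
Proof. intros Hn Hs. rewrite Re_scal. apply Rmult_lt_0_compat; auto. apply lt_0_INR. lia. Qed.

Lemma hol_Zf_scal (n : nat) (s : C) : (1 <= n)%nat -> 0 < Re s -> hol (fun s => Zf (INR n * s)%C) s.
Proof.
  intros Hn Hs. apply (hol_comp (fun s => INR n * s)%C Zf).
  - apply hol_mult; [apply hol_const|apply hol_id].
  - apply Zf_hol, Re_scal_pos; auto.
Qed.

Lemma hol_lin (n : nat) (s : C) : hol (fun s => INR n * s - 1)%C s.
Proof. apply hol_minus; [apply hol_mult; [apply hol_const|apply hol_id]|apply hol_const]. Qed.

Lemma numer_hol (N : nat) (z : C) : dom N z -> hol (numer N) z.
Proof.
  intros [H1 H2]. apply hol_mult; [apply hol_mult|apply EP_hol; auto].
  - apply hol_Zf_scal; auto.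
  - apply (hol_nprod (fun n s => Zf (INR n * s) ^ bp n * (INR n * s - 1) ^ bm n)%C). intros n Hn.
    apply hol_mult; apply hol_pow; [apply hol_Zf_scal; auto|apply hol_lin].
Qed.

Lemma denom_hol (N : nat) (z : C) : dom N z -> hol (denom N) z.
Proof.
  intros [H1 H2]. apply hol_mult; [apply hol_lin|].
  apply (hol_nprod (fun n s => (INR n * s - 1) ^ bp n * Zf (INR n * s) ^ bm n)%C). intros n Hn.
  apply hol_mult; apply hol_pow; [apply hol_lin|apply hol_Zf_scal; auto].
Qed.

Lemma bounded_lin (n : nat) (c : C) (r : R) : bounded_on (fun w => Cmod (w - c) < r) (fun s => INR n * s - 1)%C.
Proof.
  exists (INR n * (r + Cmod c) + 1). intros z Hz. pose proof (pos_INR n).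
  unfold Cminus. eapply Rle_trans; [apply Cmod_triangle|]. rewrite Cmod_opp, Cmod_1, Cmod_mult, Cmod_R, Rabs_pos_eq by auto.
  apply Rplus_le_compat_r, Rmult_le_compat_l; auto.
  replace z with (z - c + c)%C by ring. eapply Rle_trans; [apply Cmod_triangle|]. lra.
Qed.

Lemma bounded_Zf (n : nat) (c : C) (r a : R) : (1 <= n)%nat -> 0 < a -> (forall w, Cmod (w - c) < r -> a <= Re w) ->
  bounded_on (fun w => Cmod (w - c) < r) (fun s => Zf (INR n * s)%C).
Proof.
  intros Hn Ha Hr. destruct (bounded_lin n c r) as [M HM].
  exists (1 + (M + 1) * M * (/ a + 1)). intros z Hz. specialize (HM z Hz). specialize (Hr z Hz).
  assert (H1 : 1 <= INR n) by (apply (le_INR 1); auto).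
  eapply Rle_trans; [apply Zf_bound; rewrite Re_scal; nra|].
  rewrite Re_scal. apply Rplus_le_compat_l. pose proof (Cmod_ge_0 (INR n * z)). pose proof (Cmod_ge_0 (INR n * z - 1)).
  assert (Cmod (INR n * z)%C <= M + 1).
  { replace (INR n * z)%C with (INR n * z - 1 + 1)%C by ring. eapply Rle_trans; [apply Cmod_triangle|]. rewrite Cmod_1. lra. }
  assert (/ (INR n * Re z) <= / a) by (apply Rinv_le_contravar; nra).
  assert (0 < / (INR n * Re z)) by (apply Rinv_0_lt_compat; nra).
  apply Rmult_le_compat; try nra.
Qed.

Lemma Qpoly_pw_real_neq0 (p : nat) (c : R) : Qpoly k l (pw (INR p) c) <> 0.
Proof.
  unfold pw. replace (- c * ln (INR p))%C with (RtoC (- c * ln (INR p))) by (rewrite RtoC_mult, RtoC_opp; auto).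
  rewrite Cexp_RtoC, Qpoly_real. intros E. apply RtoC_inj in E.
  assert (0 <= rsum (fun i => exp (- c * ln (INR p)) ^ (l * k + 1 + i)) (k - 1)).
  { apply rsum_nonneg. intros i _. apply pow_le, Rlt_le, exp_pos. }
  lra.
Qed.

Lemma lin_neq0 (n : nat) (c : R) : (1 <= n)%nat -> 1 < c -> (INR n * c - 1)%C <> 0.
Proof.
  intros Hn Hc E. apply (f_equal Re) in E. simpl in E. assert (1 <= INR n) by (apply (le_INR 1); auto). nra.
Qed.

Lemma Zf_scal_neq0 (n : nat) (c : R) : (1 <= n)%nat -> 1 < c -> Zf (INR n * c)%C <> 0.
Proof.
  intros Hn Hc. apply Zf_neq0. rewrite Re_scal. simpl. assert (1 <= INR n) by (apply (le_INR 1); auto). nra.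
Qed.

Lemma numer_zord (N : nat) (z : C) : dom N z -> exists m, zord (numer N) z m.
Proof.
  intros Hz. destruct (half_plane_disc z N Hz) as (c & r & a & Hc & Ha & HN & Hin & Hre).
  destruct (bounded_mult (fun w => Cmod (w - c) < r)
     (fun s => Zf (INR k * s) * nprod (fun n => Zf (INR n * s) ^ bp n * (INR n * s - 1) ^ bm n) N)%C (EP k l N)) as [M HM].
  { apply bounded_mult; [apply (bounded_Zf k c r a); auto|].
    apply (bounded_nprod _ (fun n s => Zf (INR n * s) ^ bp n * (INR n * s - 1) ^ bm n)%C). intros n Hn.
    apply bounded_mult; apply bounded_pow; [apply (bounded_Zf n c r a); auto|apply bounded_lin]. }
  { destruct (EP_bounded k l N a Ha HN) as [M HM]. exists M. auto. }
  apply (zord_exists (numer N) c z r M); auto.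
  - intros w Hw. apply numer_hol. specialize (Hre w Hw). split; [lra|].
    apply Rlt_le_trans with (1 := HN). apply Rmult_le_compat_l; auto. apply pos_INR.
  - unfold numer. apply Cmult_neq_0; [apply Cmult_neq_0|].
    + apply Zf_scal_neq0; auto.
    + apply nprod_neq0. intros n Hn. apply Cmult_neq_0; apply Cpow_nz; [apply Zf_scal_neq0|apply lin_neq0]; auto.
    + apply EP_neq0; simpl Re; try lra.
      * rewrite S_INR. pose proof (pos_INR N). nra.
      * intros p _. apply Qpoly_pw_real_neq0.
Qed.

Lemma denom_zord (N : nat) (z : C) : dom N z -> exists m, zord (denom N) z m.
Proof.
  intros Hz. destruct (half_plane_disc z N Hz) as (c & r & a & Hc & Ha & HN & Hin & Hre).
  destruct (bounded_mult (fun w => Cmod (w - c) < r) (fun s => INR k * s - 1)%C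
     (fun s => nprod (fun n => (INR n * s - 1) ^ bp n * Zf (INR n * s) ^ bm n) N)%C) as [M HM].
  { apply bounded_lin. }
  { apply (bounded_nprod _ (fun n s => (INR n * s - 1) ^ bp n * Zf (INR n * s) ^ bm n)%C). intros n Hn.
    apply bounded_mult; apply bounded_pow; [apply bounded_lin|apply (bounded_Zf n c r a); auto]. }
  apply (zord_exists (denom N) c z r M); auto.
  - intros w Hw. apply denom_hol. specialize (Hre w Hw). split; [lra|].
    apply Rlt_le_trans with (1 := HN). apply Rmult_le_compat_l; auto. apply pos_INR.
  - unfold denom. apply Cmult_neq_0; [apply lin_neq0; auto|].
    apply nprod_neq0. intros n Hn. apply Cmult_neq_0; apply Cpow_nz; [apply lin_neq0|apply Zf_scal_neq0]; auto.
Qed.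

Lemma numer_denom_step (N : nat) (z : C) : dom N z -> (numer N z * denom (S N) z = numer (S N) z * denom N z)%C.
Proof.
  intros [H1 H2]. pose proof (EP_step k l N z H1 H2) as E. fold bp bm in E.
  unfold numer, denom. cbn [nprod].
  rewrite (Zf_zeta (INR (S N) * z)) by (rewrite Re_scal; auto). rewrite !Cpow_mult_l.
  set (X := (zeta (INR (S N) * z) ^ bm (S N))%C) in *. set (Y := (zeta (INR (S N) * z) ^ bp (S N))%C) in *.
  set (e1 := ((INR (S N) * z - 1) ^ bp (S N))%C) in *. set (e2 := ((INR (S N) * z - 1) ^ bm (S N))%C) in *.
  match goal with |- (?a * ?b * _ * (?c * (?d * _)) = _)%C =>
    transitivity (a * b * c * d * e1 * e2 * (EP k l N z * X))%C; [ring|]; rewrite E; ring end.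
Qed.

(** For [Re s > 1] the index [N = 0] is available, where the quotient is [zeta (k s)] times the
    whole product of the [Q(p^(-s))]. *)
Lemma quot_F (s : C) : (1 <= l)%nat -> 1 < Re s -> quot numer denom s = F k l s.
Proof.
  intros Hl Hs. assert (D : dom 0 s) by (split; simpl; lra).
  assert (Hks : 1 < Re (INR k * s)%C). { rewrite Re_scal. assert (1 <= INR k) by (apply (le_INR 1); auto). nra. }
  destruct (zeta_euler _ Hks) as [Nz _]. pose proof (zeta_euler_scaled k s Hks) as HZ.
  assert (Nk : (INR k * s - 1)%C <> 0). { intros E. apply Cminus_0_eq in E. rewrite E in Hks. simpl in Hks. lra. }
  assert (ND : denom 0 s <> 0). { unfold denom. simpl nprod. rewrite Cmult_1_r. auto. }
  rewrite (quot_eq numer denom numer_hol denom_hol denom_zord numer_denom_step s (numer 0 s / denom 0 s)%C)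
    by (apply Val_of_neq0; auto using numer_hol, denom_hol).
  assert (HE : clim (pprod (fun p => Qpoly k l (pw (INR p) s))) (EP k l 0 s)).
  { eapply clim_ext; [|apply (EP_clim k l 0 s); [lra|simpl; lra]]. intros x. apply pprod_ext. intros p _.
    unfold EN. simpl zprod. field. }
  pose proof (euler_lim k l s ltac:(lia) ltac:(lia) Hs _ HE) as H1.
  assert (H2 : clim (fun x => F k l s * pprod (fun p => 1 - pw (INR p) s ^ k) x)%C (F k l s * / zeta (INR k * s))%C).
  { apply clim_mult; auto. apply clim_const. }
  pose proof (clim_unique _ _ _ H1 H2) as E.
  unfold numer, denom. simpl nprod. rewrite E, Zf_zeta by auto. field. auto.
Qed.

(** Off the real axis the linear factors do not vanish, and neither does the remaining product if no
    local factor does; the orders then come from [Zf] alone. The summand [m k] belongs to the factor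
    [zeta (k s)]. *)
Lemma pole_criterion (N : nat) (s : C) (m : nat -> nat) : dom N s -> Im s <> 0 ->
  (forall p, is_prime p -> Qpoly k l (pw (INR p) s) <> 0) ->
  (forall n, (1 <= n)%nat -> zord Zf (INR n * s) (m n)) ->
  (m k + nsum (fun n => bp n * m n) N < nsum (fun n => bm n * m n) N)%nat -> pole numer denom s.
Proof.
  intros D Hi HQ Hm Hlt.
  assert (Hz : forall n, (1 <= n)%nat -> zord (fun w => Zf (INR n * w)%C) s (m n)).
  { intros n Hn. apply zord_scale; auto. intros E. apply RtoC_inj in E. apply (not_0_INR n); auto. lia. }
  assert (Hl1 : forall n, (1 <= n)%nat -> zord (fun w => INR n * w - 1)%C s 0).
  { intros n Hn. apply zord_of_neq0; [apply hol_lin|]. intros E. apply (f_equal Im) in E. destruct s as [x y]. simpl in E, Hi.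
    assert (0 < INR n) by (apply lt_0_INR; lia). apply Hi. apply Rmult_eq_reg_l with (INR n); lra. }
  apply (pole_of_orders numer denom numer_hol denom_hol denom_zord numer_denom_step N s
     (m k + nsum (fun n => bp n * m n + bm n * 0)%nat N + 0)%nat (0 + nsum (fun n => bp n * 0 + bm n * m n)%nat N)%nat); auto.
  - apply (zord_mult (fun s => Zf (INR k * s) * nprod (fun n => Zf (INR n * s) ^ bp n * (INR n * s - 1) ^ bm n) N)%C (EP k l N)).
    + apply (zord_mult (fun s => Zf (INR k * s)%C)); auto.
      apply (zord_nprod (fun n s => Zf (INR n * s) ^ bp n * (INR n * s - 1) ^ bm n)%C). intros n Hn.
      apply (zord_mult (fun s => Zf (INR n * s) ^ bp n)%C); [apply (zord_pow (fun s => Zf (INR n * s)%C))|apply (zord_pow (fun s => INR n * s - 1)%C)]; auto.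
    + destruct D. apply zord_of_neq0; [apply EP_hol|apply EP_neq0]; auto.
  - apply (zord_mult (fun s => INR k * s - 1)%C); auto.
    apply (zord_nprod (fun n s => (INR n * s - 1) ^ bp n * Zf (INR n * s) ^ bm n)%C). intros n Hn.
    apply (zord_mult (fun s => (INR n * s - 1) ^ bp n)%C); [apply (zord_pow (fun s => INR n * s - 1)%C)|apply (zord_pow (fun s => Zf (INR n * s)%C))]; auto.
  - assert (E1 : forall M, nsum (fun n => bp n * m n + bm n * 0)%nat M = nsum (fun n => bp n * m n)%nat M).
    { induction M as [|M IH]; simpl; lia. }
    assert (E2 : forall M, nsum (fun n => bp n * 0 + bm n * m n)%nat M = nsum (fun n => bm n * m n)%nat M).
    { induction M as [|M IH]; simpl; lia. }
    rewrite E1, E2. lia.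
Qed.

Lemma quot_meromorphic_zeta : meromorphic_on right_half_plane (quot numer denom) (pole numer denom).
Proof. apply quot_meromorphic; auto using numer_hol, denom_hol, numer_zord, denom_zord, numer_denom_step. Qed.
End ZetaQuotient.

(** * Poles near the boundary *)

Lemma scal_pair (t a b : R) : (RtoC t * (a, b))%C = (t * a, t * b).
Proof. apply injective_projections; simpl; ring. Qed.

(** The zeros on a ray are bounded because [Zf] has none for [Re > 1]; the supremum of their
    parameters is again a zero by continuity. *)
Lemma ray_maximal_zero (y X : R) : y <> 0 -> 0 < X -> exists b x, X <= x /\ / 40 < b <= 1 /\
  Zf (b, y * x) = 0 /\ forall t, 1 < t -> Zf (RtoC t * (b, y * x)%R)%C <> 0.
Proof.
  intros Hy HX. destruct (Zf_zeros y X Hy) as (b & x & Hx & Hb & Hz).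
  set (rho := (b, y * x) : C).
  set (E := fun t => 1 <= t /\ Zf (RtoC t * rho)%C = 0).
  assert (Up : forall t, E t -> t * b <= 1).
  { intros t [H1 H2]. apply Rnot_lt_le. intros L. apply (Zf_neq0 (RtoC t * rho)%C); auto.
    rewrite Re_scal. exact L. }
  destruct (completeness E) as [T [T1 T2]].
  - exists (/ b). intros t Ht. specialize (Up t Ht). apply Rmult_le_reg_r with b; [lra|]. rewrite Rinv_l; lra.
  - exists 1. split; [lra|]. rewrite Cmult_1_l. exact Hz.
  - assert (HT : 1 <= T). { apply T1. split; [lra|]. rewrite Cmult_1_l. exact Hz. }
    assert (ZT : Zf (RtoC T * rho)%C = 0).
    { destruct (Ceq_dec (Zf (RtoC T * rho)%C) 0) as [|N]; auto. exfalso.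
      assert (Pos : 0 < Re (RtoC T * rho)%C) by (rewrite Re_scal; unfold rho; simpl; nra).
      destruct (ccont_neq0 Zf _ (hol_ccont _ _ (Zf_hol _ Pos)) N) as (d & Hd & H).
      set (e := d / (Cmod rho + 1)). pose proof (Cmod_ge_0 rho) as Pr.
      assert (He : 0 < e) by (apply Rdiv_lt_0_compat; lra).
      assert (T <= T - e); [|lra]. apply T2. intros t Ht. apply Rnot_lt_le. intros L.
      assert (t <= T) by (apply T1; auto).
      specialize (H (RtoC t * rho)%C). destruct Ht as [_ Ht]. rewrite Ht, Cmod_0 in H.
      assert (Cmod (Zf (RtoC T * rho)%C) / 2 < 0).
      { apply H. replace (RtoC t * rho - RtoC T * rho)%C with (RtoC (t - T) * rho)%C by (rewrite RtoC_minus; ring).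
        rewrite Cmod_mult, Cmod_R, Rabs_left1 by lra.
        apply Rle_lt_trans with (e * Cmod rho); [apply Rmult_le_compat_r; lra|].
        unfold e. apply Rlt_le_trans with (d / (Cmod rho + 1) * (Cmod rho + 1)); [|right; field; lra].
        apply Rmult_lt_compat_l; [exact He|lra]. }
      pose proof (Cmod_ge_0 (Zf (RtoC T * rho)%C)). lra. }
    exists (T * b), (T * x).
    assert (Eq : (T * b, y * (T * x)) = (RtoC T * rho)%C).
    { unfold rho. rewrite scal_pair. f_equal. ring. }
    rewrite Eq. split; [nra|]. split; [|split; auto].
    + split; [nra|]. apply Up. split; auto.
    + intros t Ht N. assert (t * T <= T); [|nra]. apply T1. split; [nra|].
      rewrite RtoC_mult, <- Cmult_assoc. exact N.
Qed.

(** Bounds [Zf] on the disc of radius [3 - a / 2] about [3 + i tau], where [w] and [w - 1] have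
    modulus at most [7 + |tau|] and [Re w > a / 2]. *)
Definition zeta_growth (a tau : R) : R := 1 + (7 + Rabs tau) ^ 2 * (2 / a + 1).

Lemma zeta_growth_ge1 (a tau : R) : 0 < a -> 1 <= zeta_growth a tau.
Proof.
  intros Ha. unfold zeta_growth. pose proof (pow2_ge_0 (7 + Rabs tau)).
  assert (0 < 2 / a) by (apply Rdiv_lt_0_compat; lra). nra.
Qed.

Section DiscAroundThree.
Variables (a tau : R).
Hypothesis Ha : 0 < a <= 1.
Let c0 : C := (3, tau).

Lemma disc_three_Re (w : C) : Cmod (w - c0) < 3 - a / 2 -> a / 2 < Re w.
Proof. intros Hw. apply Re_near in Hw. simpl in Hw. lra. Qed.

Lemma disc_three_bound (w : C) : Cmod (w - c0) < 3 - a / 2 -> Cmod (Zf w) <= zeta_growth a tau.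
Proof.
  intros Hw. pose proof (disc_three_Re w Hw) as R1.
  eapply Rle_trans; [apply Zf_bound; lra|]. unfold zeta_growth. apply Rplus_le_compat_l.
  assert (Hc : Cmod c0 <= 3 + Rabs tau).
  { eapply Rle_trans; [apply Cmod_le_re_im|]. simpl. rewrite (Rabs_pos_eq 3); lra. }
  assert (Hc1 : Cmod (c0 - 1) <= 2 + Rabs tau).
  { eapply Rle_trans; [apply Cmod_le_re_im|]. change (Re (c0 - 1)%C) with (3 - 1). change (Im (c0 - 1)%C) with (tau - 0).
    rewrite Rminus_0_r, (Rabs_pos_eq (3 - 1)); lra. }
  assert (W1 : Cmod w <= 7 + Rabs tau).
  { replace w with ((w - c0) + c0)%C by ring. eapply Rle_trans; [apply Cmod_triangle|]. lra. }
  assert (W2 : Cmod (w - 1) <= 7 + Rabs tau).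
  { replace (w - 1)%C with ((w - c0) + (c0 - 1))%C by ring. eapply Rle_trans; [apply Cmod_triangle|]. lra. }
  assert (W3 : / Re w <= 2 / a).
  { replace (2 / a) with (/ (a / 2)) by (field; lra). apply Rinv_le_contravar; lra. }
  assert (0 < / Re w) by (apply Rinv_0_lt_compat; lra).
  pose proof (Cmod_ge_0 w). pose proof (Cmod_ge_0 (w - 1)).
  replace ((7 + Rabs tau) ^ 2) with ((7 + Rabs tau) * (7 + Rabs tau)) by ring.
  apply Rmult_le_compat; [nra|lra| |lra]. apply Rmult_le_compat; auto.
Qed.

Lemma disc_three_hol (w : C) : Cmod (w - c0) < 3 - a / 2 -> hol Zf w.
Proof. intros Hw. apply Zf_hol. pose proof (disc_three_Re w Hw). lra. Qed.

Lemma disc_three_center : 1 <= Cmod (Zf c0).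
Proof.
  rewrite Zf_zeta, Cmod_mult by (simpl; lra).
  assert (2 <= Cmod (c0 - 1)).
  { eapply Rle_trans; [|apply re_le_Cmod]. change (Re (c0 - 1)%C) with (3 - 1). rewrite Rabs_pos_eq; lra. }
  pose proof (zeta_lower c0 ltac:(simpl; lra)). nra.
Qed.

(** Jensen's inequality with a centre value of modulus at least 1 gives [1 <= M (s / q)^m]; this
    turns it into a linear bound on [m]. *)
Lemma ratio_exp (s q e : R) (m : nat) (M : R) : 0 < M -> 0 <= s -> 0 < q -> s / q <= 1 - e ->
  1 <= M * (s / q) ^ m -> INR m * e <= ln M.
Proof.
  intros HM Hs Hq He H.
  assert (Hp : 0 <= s / q) by (apply Rdiv_le_0_compat; auto).
  assert (E : (s / q) ^ m <= exp (- e) ^ m).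
  { apply pow_incr. split; auto. pose proof (exp_ineq1_le (- e)). lra. }
  rewrite exp_pow in E.
  assert (L : 1 <= M * exp (INR m * - e)) by nra.
  apply Rle_trans with (ln M + 0); [|lra].
  assert (L2 : ln 1 <= ln (M * exp (INR m * - e))) by (apply ln_le; lra).
  rewrite ln_1, ln_mult, ln_exp in L2 by (auto; apply exp_pos). lra.
Qed.

(** A zero at the height of the centre is at distance at most [3 - a], so the ratio of radii is at
    most [1 - a / 6]. *)
Lemma zeta_mult_bound (z : C) (m : nat) : Im z = tau -> a <= Re z <= 1 -> vanishes Zf z m ->
  INR m * a <= 6 * ln (zeta_growth a tau).
Proof.
  intros Hi Hr Hv. pose proof (zeta_growth_ge1 a tau ltac:(lra)) as HM.
  assert (Ez : Cmod (z - c0) = 3 - Re z).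
  { destruct z as [u v]. simpl in *. subst v. unfold c0.
    replace ((u, tau) - (3, tau))%C with (RtoC (u - 3)) by (apply injective_projections; simpl; ring).
    rewrite Cmod_R, Rabs_left1; lra. }
  pose proof (jensen_mult m Zf c0 z (3 - a / 2) (zeta_growth a tau) ltac:(lra) disc_three_hol disc_three_bound ltac:(lra) Hv) as J.
  pose proof disc_three_center as C3.
  assert (INR m * (a / 6) <= ln (zeta_growth a tau)); [|lra].
  apply ratio_exp with (3 - Re z) (3 - a / 2); try lra.
  - apply Rmult_le_reg_r with (3 - a / 2); [lra|]. unfold Rdiv at 1. rewrite Rmult_assoc, Rinv_l, Rmult_1_r by lra. nra.
  - rewrite <- Ez. lra.
Qed.

(** Heights may deviate by [a / 4]: the distance is then at most [3 - 3 a / 4] and the ratio of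
    radii at most [1 - a / 12]. *)
Lemma zeta_zero_count (zs : list C) : NoDup zs ->
  (forall z, In z zs -> a <= Re z <= 1 /\ Rabs (Im z - tau) <= a / 4 /\ Zf z = 0) ->
  INR (length zs) * a <= 12 * ln (zeta_growth a tau).
Proof.
  intros Hnd Hz. pose proof (zeta_growth_ge1 a tau ltac:(lra)) as HM.
  assert (J : Cmod (Zf c0) <= zeta_growth a tau * ((3 - 3 * a / 4) / (3 - a / 2)) ^ length zs).
  { apply jensen_zeros; auto; try lra; [apply disc_three_hol|apply disc_three_bound|].
    intros z Hin. destruct (Hz z Hin) as (H1 & H2 & H3). split; auto.
    eapply Rle_trans; [apply Cmod_le_re_im|]. change (Im (z - c0)%C) with (Im z - tau).
    change (Re (z - c0)%C) with (Re z - 3). rewrite (Rabs_left1 (Re z - 3)) by lra. lra. }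
  pose proof disc_three_center as C3.
  assert (INR (length zs) * (a / 12) <= ln (zeta_growth a tau)); [|lra].
  apply ratio_exp with (3 - 3 * a / 4) (3 - a / 2); try lra.
  apply Rmult_le_reg_r with (3 - a / 2); [lra|]. unfold Rdiv at 1. rewrite Rmult_assoc, Rinv_l, Rmult_1_r by lra. nra.
Qed.
End DiscAroundThree.

Lemma Zf_zord (z : C) : 0 < Re z -> exists m, zord Zf z m.
Proof.
  intros Hz. destruct (dom_exists z Hz) as [N D].
  destruct (half_plane_disc z N D) as (c & r & a & Hc & Ha & _ & Hin & Hre).
  destruct (bounded_Zf 1 c r a (le_n 1) Ha Hre) as [M HM].
  apply (zord_exists Zf c z r M); auto.
  - intros w Hw. apply Zf_hol. specialize (Hre w Hw). lra.
  - intros w Hw. specialize (HM w Hw). simpl INR in HM. rewrite Cmult_1_l in HM. auto.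
  - apply Zf_neq0. simpl. auto.
Qed.

Lemma zord_neq0 (f : C -> C) (z : C) (m : nat) : zord f z m -> f z <> 0 -> m = 0%nat.
Proof.
  intros (r & g & Hr & _ & _ & E) Hz. destruct m as [|m]; auto. exfalso. apply Hz.
  rewrite E by (rewrite Cmod_self; auto). replace (z - z)%C with (RtoC 0) by ring. rewrite Cpow_S. ring.
Qed.

Lemma zord_zero (f : C -> C) (z : C) (m : nat) : zord f z m -> f z = 0 -> (1 <= m)%nat.
Proof.
  intros (r & g & Hr & _ & Ng & E) Hz. destruct m as [|m]; [|lia]. exfalso. apply Ng.
  rewrite E in Hz by (rewrite Cmod_self; auto). simpl in Hz. rewrite Cmult_1_l in Hz. auto.
Qed.

(** * Counting the indices spoiled by other zeros *)

Definition cnt (P : nat -> Prop) (H : nat) : R := rsum (fun i => if excluded_middle_informative (P i) then 1 else 0) H.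

Lemma cnt_list (P : nat -> Prop) (H : nat) : exists L, NoDup L /\ (forall i, In i L -> (i < H)%nat /\ P i) /\ cnt P H = INR (length L).
Proof.
  induction H as [|H (L & H1 & H2 & H3)]; [exists nil; split; [constructor|]; split; [intros i []|auto]|].
  unfold cnt in *. cbn [rsum]. destruct (excluded_middle_informative (P H)) as [p|n].
  - exists (H :: L). split; [|split].
    + constructor; auto. intros Hi. apply H2 in Hi. lia.
    + intros i [<-|Hi]; [split; auto; lia|]. destruct (H2 i Hi). split; auto; lia.
    + rewrite H3. simpl length. rewrite S_INR. auto.
  - exists L. split; auto. split; [|rewrite H3; ring]. intros i Hi. destruct (H2 i Hi). split; auto; lia.
Qed.

Lemma cnt_union (P Q T : nat -> Prop) (H : nat) : (forall i, (i < H)%nat -> P i -> Q i \/ T i) -> cnt P H <= cnt Q H + cnt T H.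
Proof.
  intros HH. unfold cnt. rewrite <- rsum_plus. apply rsum_le. intros i Hi.
  destruct (excluded_middle_informative (P i)), (excluded_middle_informative (Q i)), (excluded_middle_informative (T i)); try lra.
  destruct (HH i); tauto.
Qed.

Lemma cnt_exists_lt (R0 : nat -> nat -> Prop) (q H : nat) (B : R) : (forall j, (j < q)%nat -> cnt (R0 j) H <= B) ->
  cnt (fun i => exists j, (j < q)%nat /\ R0 j i) H <= INR q * B.
Proof.
  induction q as [|q IH]; intros HB.
  - destruct (cnt_list (fun i => exists j, (j < 0)%nat /\ R0 j i) H) as (L & _ & H2 & ->).
    destruct L as [|i L]; [simpl; lra|]. destruct (H2 i (or_introl eq_refl)) as [_ (j & Hj & _)]. lia.
  - rewrite S_INR. eapply Rle_trans; [apply (cnt_union _ (fun i => exists j, (j < q)%nat /\ R0 j i) (R0 q))|].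
    + intros i _ (j & Hj & Hr). destruct (Nat.eq_dec j q) as [->|N]; [auto|left; exists j; split; auto; lia].
    + specialize (IH (fun j Hj => HB j (Nat.lt_lt_succ_r _ _ Hj))). specialize (HB q ltac:(lia)). lra.
Qed.

Lemma cnt_exists_list (R0 : C -> nat -> Prop) (bs : list C) (H : nat) : (forall b, cnt (R0 b) H <= 1) ->
  cnt (fun i => exists b, In b bs /\ R0 b i) H <= INR (length bs).
Proof.
  intros HB. induction bs as [|b bs IH].
  - destruct (cnt_list (fun i => exists b, In b nil /\ R0 b i) H) as (L & _ & H2 & ->).
    destruct L as [|i L]; [simpl; lra|]. destruct (H2 i (or_introl eq_refl)) as [_ (j & Hj & _)]. destruct Hj.
  - simpl length. rewrite S_INR. eapply Rle_trans; [apply (cnt_union _ (fun i => exists b, In b bs /\ R0 b i) (R0 b))|].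
    + intros i _ (d & [<-|Hd] & Hr); [auto|left; exists d; auto].
    + specialize (HB b). lra.
Qed.

Lemma cnt_unique (P : nat -> Prop) (H : nat) : (forall i j, P i -> P j -> i = j) -> cnt P H <= 1.
Proof.
  intros HU. destruct (cnt_list P H) as (L & H1 & H2 & ->). destruct L as [|i [|j L]]; [simpl; lra|simpl; lra|].
  exfalso. inversion H1 as [|? ? Hn _]; subst. apply Hn. left. symmetry.
  apply HU; [apply (H2 i); left|apply (H2 j); right; left]; auto.
Qed.

(* Each root of [Q] is hit by at most one pair (p, n): equality of moduli forces [p^n' = p'^n]. *)
Lemma root_hit_unique (beta rho : C) (p p' n n' : nat) : is_prime p -> is_prime p' -> (1 <= n)%nat -> (1 <= n')%nat ->
  0 < Re rho -> (1 - beta * pw (INR p) (RtoC (/ INR n) * rho))%C = 0 ->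
  (1 - beta * pw (INR p') (RtoC (/ INR n') * rho))%C = 0 -> n = n'.
Proof.
  intros Hp Hp' Hn Hn' Hr E1 E2. apply Cminus_0_eq in E1. apply Cminus_0_eq in E2.
  assert (Nb : beta <> 0). { intros E. rewrite E, Cmult_0_l in E1. apply RtoC_inj in E1. lra. }
  assert (E : Cmod (pw (INR p) (RtoC (/ INR n) * rho)) = Cmod (pw (INR p') (RtoC (/ INR n') * rho))).
  { assert (M1 := f_equal Cmod E1). assert (M2 := f_equal Cmod E2). rewrite Cmod_mult in M1, M2.
    apply Rmult_eq_reg_l with (Cmod beta); [lra|]. intros Z. apply Nb, Cmod_eq_0, Z. }
  assert (P1 : 0 < INR n) by (apply lt_0_INR; lia). assert (P2 : 0 < INR n') by (apply lt_0_INR; lia).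
  rewrite !pw_mod, !Re_scal in E. apply exp_inv in E.
  assert (G1 := prime_ge2 p Hp). assert (G2 := prime_ge2 p' Hp').
  assert (I1 : 1 < INR p) by (apply (lt_INR 1); lia). assert (I2 : 1 < INR p') by (apply (lt_INR 1); lia).
  assert (L : INR n' * ln (INR p) = INR n * ln (INR p')).
  { apply Rmult_eq_reg_l with (- (Re rho)); [|lra].
    transitivity (INR n * INR n' * (- (/ INR n * Re rho) * ln (INR p))); [field; lra|]. rewrite E. field. lra. }
  assert (LP : forall (x : R) (m : nat), 0 < x -> ln (x ^ m) = INR m * ln x).
  { intros x m Hx. apply ln_pow; auto. }
  rewrite <- !LP in L by lra. apply ln_inv in L; [|apply pow_lt; lra|apply pow_lt; lra].
  rewrite <- !pow_INR in L. apply INR_eq in L.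
  assert (Epp : p = p') by (apply (prime_pow_inj p p' n' n); auto; lia). subst p'.
  apply Nat.pow_inj_r in L; auto; lia.
Qed.

Lemma poly_lt_exp (t A : R) (d : nat) : 1 < t -> exists N, forall q, (N <= q)%nat -> A * (INR q + 1) ^ d <= t ^ q.
Proof.
  revert t A. induction d as [|d IH]; intros t A Ht.
  - destruct (pow_ge_linear t (Rabs A) Ht) as [N HN]. exists (max N 1). intros q Hq. simpl.
    specialize (HN q ltac:(lia)). assert (1 <= INR q) by (apply (le_INR 1); lia).
    pose proof (Rle_abs A). pose proof (Rabs_pos A). nra.
  - set (w := sqrt t). assert (Hw : 1 < w) by (unfold w; rewrite <- sqrt_1; apply sqrt_lt_1; lra).
    destruct (IH w (2 * Rabs A) Hw) as [N1 H1]. destruct (pow_ge_linear w 1 Hw) as [N2 H2].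
    exists (max (max N1 N2) 1). intros q Hq. specialize (H1 q ltac:(lia)). specialize (H2 q ltac:(lia)).
    assert (1 <= INR q) by (apply (le_INR 1); lia).
    assert (Ew : t ^ q = w ^ q * w ^ q).
    { rewrite <- Rpow_mult_distr. f_equal. unfold w. rewrite sqrt_sqrt; lra. }
    rewrite Ew. pose proof (Rle_abs A). pose proof (Rabs_pos A).
    assert (P : 0 <= (INR q + 1) ^ d) by (apply pow_le; lra).
    apply Rle_trans with ((2 * Rabs A * (INR q + 1) ^ d) * (1 * INR q)).
    + simpl. 
      apply Rle_trans with (Rabs A * ((INR q + 1) * (INR q + 1) ^ d)); [apply Rmult_le_compat_r; nra|].
      replace (2 * Rabs A * (INR q + 1) ^ d * (1 * INR q)) with (Rabs A * (2 * INR q * (INR q + 1) ^ d)) by ring.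
      apply Rmult_le_compat_l; auto. apply Rmult_le_compat_r; lra.
    + apply Rmult_le_compat; nra.
Qed.

Lemma nsum_bound (f : nat -> nat) (n N : nat) (B : R) : 0 <= B -> (forall i, (n < i)%nat -> f i = 0%nat) ->
  (forall i, (1 <= i <= n)%nat -> INR (f i) <= B) -> INR (nsum f N) <= INR n * B.
Proof.
  intros HB H1 H2.
  assert (G : INR (nsum f N) <= INR (min n N) * B).
  { induction N as [|N IH]; [simpl; rewrite Nat.min_0_r; simpl; lra|]. cbn [nsum]. rewrite plus_INR.
    destruct (Nat.lt_ge_cases n (S N)) as [L|L].
    - rewrite H1 by lia. rewrite Nat.min_l in * by lia. simpl. lra.
    - specialize (H2 (S N) ltac:(lia)). rewrite Nat.min_r in * by lia. rewrite S_INR. lra. }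
  eapply Rle_trans; [apply G|]. apply Rmult_le_compat_r; auto. apply le_INR. lia.
Qed.

Lemma nsum_term_le (f : nat -> nat) (n N : nat) : (1 <= n <= N)%nat -> (f n <= nsum f N)%nat.
Proof.
  intros H. induction N as [|N IH]; [lia|]. simpl. destruct (Nat.eq_dec n (S N)) as [->|]; lia.
Qed.

Lemma lprod_zero (f : C -> C) (bs : list C) : lprod f bs = 0 -> exists b, In b bs /\ f b = 0.
Proof.
  induction bs as [|b bs IH]; intros H; [exfalso; apply C1_nz, H|].
  destruct (Ceq_dec (f b) 0) as [E|N]; [exists b; split; [left|]; auto|].
  destruct IH as (d & Hd & E).
  - apply NNPP. intros N2. revert H. apply Cmult_neq_0; auto.
  - exists d. split; [right|]; auto.
Qed.

Lemma fourth_root (n0 : nat) : exists q, (q ^ 4 <= n0 < (q + 1) ^ 4)%nat.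
Proof.
  exists (Nat.sqrt (Nat.sqrt n0)). pose proof (Nat.sqrt_spec n0 ltac:(lia)) as [H1 H2].
  pose proof (Nat.sqrt_spec (Nat.sqrt n0) ltac:(lia)) as [H3 H4].
  set (u := Nat.sqrt n0) in *. set (q := Nat.sqrt u) in *. simpl. rewrite !Nat.mul_1_r. split; [|].
  - assert (q * q * (q * q) <= u * u)%nat by (apply Nat.mul_le_mono; auto). nia.
  - assert (S u <= (q + 1) * (q + 1))%nat by lia.
    assert (S u * S u <= (q + 1) * (q + 1) * ((q + 1) * (q + 1)))%nat by (apply Nat.mul_le_mono; auto). nia.
Qed.

Lemma zeta_growth_le (a a' tau tau' : R) : 0 < a <= a' -> Rabs tau' <= Rabs tau -> zeta_growth a' tau' <= zeta_growth a tau.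
Proof.
  intros Ha Ht. unfold zeta_growth. apply Rplus_le_compat_l. pose proof (Rabs_pos tau').
  assert (/ a' <= / a) by (apply Rinv_le_contravar; lra). assert (0 < / a') by (apply Rinv_0_lt_compat; lra).
  apply Rmult_le_compat; [apply pow2_ge_0|unfold Rdiv; lra|apply pow_incr; lra|unfold Rdiv; lra].
Qed.

Section RayMaximalZero.
Variables (b x y : R).
Hypothesis Hb : / 40 < b <= 1.
Hypothesis Hx : 0 < x.
Let rho : C := (b, y * x).

(* For fixed [j] the zeros [(1 - j/n) rho] are distinct and lie in one disc, so Jensen limits how many [n] give a zero. *)
Lemma near_zeros_count (j q n0 H : nat) : (1 <= j <= q)%nat -> (2 * q <= n0)%nat -> x <= INR n0 ->
  Rabs y * (INR q * INR H) <= / 320 * INR n0 ->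
  cnt (fun i => Zf (RtoC (1 - INR j / INR (n0 + i)) * rho)%C = 0) H <= 960 * ln (zeta_growth (/ 80) (Rabs y * INR n0)).
Proof.
  intros Hj Hq Hxn Hy.
  destruct (cnt_list (fun i => Zf (RtoC (1 - INR j / INR (n0 + i)) * rho)%C = 0) H) as (L & L1 & L2 & ->).
  assert (P0 : 0 < INR n0) by (apply lt_0_INR; lia). assert (Pj : 1 <= INR j) by (apply (le_INR 1); lia).
  assert (Pn : forall i, INR n0 <= INR (n0 + i)) by (intros i; apply le_INR; lia).
  set (pt := fun i : nat => (RtoC (1 - INR j / INR (n0 + i)) * rho)%C).
  (* The height of the point with [i = 0]. The others deviate from it by at most
     [|y| q H / n0 <= 1/320], a quarter of [1/80], and [j / n <= 1/2] keeps real parts above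
     [1/80]. *)
  set (tau := (1 - INR j / INR n0) * (y * x)).
  assert (Hjq : INR j / INR n0 <= / 2).
  { apply Rmult_le_reg_r with (INR n0); auto. unfold Rdiv. rewrite Rmult_assoc, Rinv_l by lra.
    assert (2 * INR j <= INR n0). { change 2 with (INR 2). rewrite <- mult_INR. apply le_INR. lia. } lra. }
  assert (Pjn : 0 < INR j / INR n0) by (apply Rdiv_lt_0_compat; lra).
  assert (Ht : Rabs tau <= Rabs (Rabs y * INR n0)).
  { unfold tau. rewrite !Rabs_mult, Rabs_Rabsolu, (Rabs_pos_eq (1 - _)), (Rabs_pos_eq x), (Rabs_pos_eq (INR n0)) by lra.
    pose proof (Rabs_pos y). assert (Rabs y * x <= Rabs y * INR n0) by (apply Rmult_le_compat_l; auto).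
    assert (0 <= Rabs y * x) by (apply Rmult_le_pos; lra). nra. }
  assert (HM := zeta_growth_le (/ 80) (/ 80) (Rabs y * INR n0) tau ltac:(lra) Ht).
  assert (HC : INR (length (map pt L)) * / 80 <= 12 * ln (zeta_growth (/ 80) tau)).
  { apply zeta_zero_count; [lra| |].
    - apply FinFun.Injective_map_NoDup; auto. intros i i' E. apply (f_equal Re) in E. unfold pt in E.
      rewrite !Re_scal in E. unfold rho in E. simpl Re in E. pose proof (Pn i). pose proof (Pn i').
      apply Rmult_eq_reg_r in E; [|lra].
      assert (E2 : INR (n0 + i) = INR (n0 + i')).
      { assert (E3 : INR j / INR (n0 + i) = INR j / INR (n0 + i')) by lra.
        unfold Rdiv in E3. apply Rmult_eq_reg_l in E3; [|lra]. apply Rinv_eq_reg in E3. auto. }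
      apply INR_eq in E2. lia.
    - intros z Hz. apply in_map_iff in Hz as (i & <- & Hi). destruct (L2 i Hi) as [Hi1 Hi2]. pose proof (Pn i) as Pi.
      assert (Q1 : INR j / INR (n0 + i) <= INR j / INR n0).
      { unfold Rdiv. apply Rmult_le_compat_l; [lra|]. apply Rinv_le_contravar; auto. }
      assert (Q2 : 0 < INR j / INR (n0 + i)) by (apply Rdiv_lt_0_compat; lra).
      unfold pt. rewrite Re_scal. unfold rho at 1 2. simpl Re. split; [nra|]. split; auto.
      unfold rho. rewrite scal_pair. simpl Im. unfold tau.
      replace ((1 - INR j / INR (n0 + i)) * (y * x) - (1 - INR j / INR n0) * (y * x)) with
        ((INR j / INR n0 - INR j / INR (n0 + i)) * (y * x)) by ring.
      rewrite !Rabs_mult, (Rabs_pos_eq (_ - _)), (Rabs_pos_eq x) by lra.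
      assert (E : INR j / INR n0 - INR j / INR (n0 + i) = INR j * INR i / (INR n0 * INR (n0 + i))).
      { rewrite plus_INR in *. pose proof (pos_INR i). field. lra. }
      rewrite E.
      assert (B1 : INR j * INR i <= INR q * INR H).
      { apply Rmult_le_compat; try apply pos_INR; apply le_INR; lia. }
      pose proof (Rabs_pos y).
      apply Rle_trans with (INR q * INR H / (INR n0 * INR n0) * (Rabs y * INR n0)).
      + apply Rmult_le_compat.
        * apply Rdiv_le_0_compat; [apply Rmult_le_pos; apply pos_INR|nra].
        * apply Rmult_le_pos; lra.
        * unfold Rdiv. apply Rmult_le_compat; auto; [apply Rmult_le_pos; apply pos_INR|apply Rlt_le, Rinv_0_lt_compat; nra|].
          apply Rinv_le_contravar; nra.
        * apply Rmult_le_compat_l; auto.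
      + apply Rmult_le_reg_r with (INR n0); auto.
        replace (INR q * INR H / (INR n0 * INR n0) * (Rabs y * INR n0) * INR n0) with (Rabs y * (INR q * INR H)) by (field; lra).
        lra. }
  rewrite length_map in HC. pose proof (zeta_growth_ge1 (/ 80) tau ltac:(lra)).
  assert (ln (zeta_growth (/ 80) tau) <= ln (zeta_growth (/ 80) (Rabs y * INR n0))) by (apply ln_le; lra). lra.
Qed.

(** The point [n' rho / n] has real part above [1 / (40 n)]. Jensen on a disc reaching that close to
    the imaginary axis still bounds the order by a power of [n], even with the logarithm crudely
    replaced by its argument. *)
Lemma far_mult_bound (n n' m : nat) : (1 <= n' <= n)%nat -> x <= INR n ->
  zord Zf (INR n' * (RtoC (/ INR n) * rho))%C m ->
  INR m <= 240 * (1 + 81 * (7 + Rabs y) ^ 2) * INR n ^ 4.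
Proof.
  intros Hn Hxn Hm. assert (P1 : 1 <= INR n') by (apply (le_INR 1); lia).
  assert (P2 : INR n' <= INR n) by (apply le_INR; lia). pose proof (Rabs_pos y) as Py.
  set (z := (INR n' * (RtoC (/ INR n) * rho))%C) in *. set (v := INR n) in *.
  assert (Ez : z = (INR n' / v * b, INR n' / v * (y * x))).
  { unfold z. unfold rho. rewrite !scal_pair. f_equal; field; lra. }
  assert (Q0 : / v <= INR n' / v <= 1).
  { split; unfold Rdiv.
    - rewrite <- (Rmult_1_l (/ v)) at 1. apply Rmult_le_compat_r; [apply Rlt_le, Rinv_0_lt_compat; lra|lra].
    - apply Rmult_le_reg_r with v; [lra|]. rewrite Rmult_assoc, Rinv_l; lra. }
  assert (Pv : 0 < / v <= 1).
  { split; [apply Rinv_0_lt_compat; lra|]. rewrite <- Rinv_1. apply Rinv_le_contravar; lra. }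
  set (a := / v * / 40).
  assert (Ha : 0 < a <= 1) by (unfold a; split; nra).
  assert (B := zeta_mult_bound a (Im z) Ha z m eq_refl).
  assert (HB : INR m * a <= 6 * ln (zeta_growth a (Im z))).
  { apply B; [|apply zord_vanishes; auto]. rewrite Ez. simpl Re. unfold a. split; nra. }
  assert (Ht : Rabs (Im z) <= Rabs (Rabs y * v)).
  { rewrite Ez. simpl Im. rewrite !Rabs_mult, Rabs_Rabsolu, (Rabs_pos_eq (INR n' / v)), (Rabs_pos_eq x), (Rabs_pos_eq v) by lra.
    assert (0 <= Rabs y * x) by (apply Rmult_le_pos; lra). assert (Rabs y * x <= Rabs y * v) by (apply Rmult_le_compat_l; auto). nra. }
  assert (HM := zeta_growth_le a a (Rabs y * v) (Im z) ltac:(lra) Ht).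
  pose proof (zeta_growth_ge1 a (Im z) ltac:(lra)) as G1.
  assert (HL : ln (zeta_growth a (Im z)) <= zeta_growth a (Rabs y * v)).
  { apply Rle_trans with (zeta_growth a (Im z)); auto.
    pose proof (exp_ineq1_le (ln (zeta_growth a (Im z)))) as E. rewrite exp_ln in E; lra. }
  assert (HZ : zeta_growth a (Rabs y * v) <= (1 + 81 * (7 + Rabs y) ^ 2) * v ^ 3).
  { unfold zeta_growth. rewrite Rabs_mult, Rabs_Rabsolu, (Rabs_pos_eq v) by lra.
    replace (2 / a) with (80 * v) by (unfold a; field; lra).
    assert (S1 : (7 + Rabs y * v) ^ 2 <= ((7 + Rabs y) * v) ^ 2) by (apply pow_incr; nra).
    assert (S2 : 1 <= v ^ 3) by (apply pow_R1_Rle; lra).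
    assert (S3 : (7 + Rabs y * v) ^ 2 * (80 * v + 1) <= ((7 + Rabs y) * v) ^ 2 * (81 * v)).
    { apply Rmult_le_compat; [apply pow2_ge_0|lra|auto|lra]. }
    replace ((1 + 81 * (7 + Rabs y) ^ 2) * v ^ 3) with (v ^ 3 + ((7 + Rabs y) * v) ^ 2 * (81 * v)) by ring. lra. }
  apply Rle_trans with (40 * v * (INR m * a)).
  - right. unfold a. field. lra.
  - apply Rle_trans with (40 * v * (6 * ((1 + 81 * (7 + Rabs y) ^ 2) * v ^ 3))); [|right; ring].
    apply Rmult_le_compat_l; lra.
Qed.
End RayMaximalZero.

(** * Choice of the index and poles accumulating at the boundary *)

Section PoleNearBoundary.
Variables (k l : nat).
Hypothesis Hk : (3 <= k)%nat.
Hypothesis Hl : (1 <= l)%nat.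
Let bp := EulerFactor.bpos k l.
Let bm := EulerFactor.bneg k l.

(* A pole of order [bneg n] coming from [zeta (n s)]: the competing factors [zeta (n' s)], [n' < n], vanish at
   [rho / n] to too small a total order. *)
Lemma pole_at_scaled_zero (b x y r c C1 : R) (q n : nat) : / 40 < b <= 1 -> 0 < x <= INR n -> y <> 0 ->
  Zf (b, y * x) = 0 -> (forall t, 1 < t -> Zf (RtoC t * (b, y * x)%R)%C <> 0) ->
  1 < r -> 0 < c -> 0 < C1 -> (forall i, (0 < i)%nat -> INR (bp i) + INR (bm i) <= C1 * r ^ i) ->
  (k <= n)%nat -> (q <= n)%nat -> bp n = 0%nat -> c * r ^ n <= INR n * INR (bm n) ->
  240 * (1 + 81 * (7 + Rabs y) ^ 2) * (1 + C1) * INR n ^ 6 < c * r ^ q ->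
  (forall j, (j < q)%nat -> Zf (RtoC (1 - INR (S j) / INR n) * (b, y * x)%R)%C <> 0) ->
  (forall p, is_prime p -> Qpoly k l (pw (INR p) (RtoC (/ INR n) * (b, y * x)%R)%C) <> 0) ->
  pole (numer k l) (denom k l) (RtoC (/ INR n) * (b, y * x)%R)%C.
Proof.
  intros Hb Hx Hy HZ Hray Hr Hc HC1 HC Hkn Hqn Hbp Hbm Hbig Hnear HQ.
  set (rho := (b, y * x) : C) in *. set (s0 := (RtoC (/ INR n) * rho)%C) in *.
  assert (Pn : 1 <= INR n) by (apply (le_INR 1); lia).
  assert (Es : forall i, (INR i * s0 = RtoC (INR i / INR n) * rho)%C).
  { intros i. unfold s0. rewrite Cmult_assoc, <- RtoC_mult. auto. }
  assert (Rs : 0 < Re s0).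
  { unfold s0, rho. rewrite Re_scal. simpl. apply Rmult_lt_0_compat; [apply Rinv_0_lt_compat|]; lra. }
  destruct (dom_exists s0 Rs) as [N1 D1].
  assert (D : dom (max n N1) s0) by (apply (dom_mono N1); auto; lia).
  assert (Hex : forall i, exists m, (1 <= i)%nat -> zord Zf (INR i * s0) m).
  { intros i. destruct (Nat.eq_dec i 0) as [->|Ni]; [exists 0%nat; lia|].
    destruct (Zf_zord (INR i * s0)%C) as [m Hm]; [|exists m; auto].
    rewrite Re_scal. apply Rmult_lt_0_compat; auto. apply lt_0_INR. lia. }
  set (m := fun i => proj1_sig (constructive_indefinite_description _ (Hex i))).
  assert (Hm : forall i, (1 <= i)%nat -> zord Zf (INR i * s0) (m i)).
  { intros i. exact (proj2_sig (constructive_indefinite_description _ (Hex i))). }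
  set (A2 := 240 * (1 + 81 * (7 + Rabs y) ^ 2)) in *.
  assert (HA2 : 0 < A2) by (unfold A2; pose proof (pow2_ge_0 (7 + Rabs y)); lra).
  assert (Bm : forall i, (1 <= i <= n)%nat -> INR (m i) <= A2 * INR n ^ 4).
  { intros i Hi. apply (far_mult_bound b x y Hb ltac:(lra) n i); auto; [lra|]. apply Hm. lia. }
  clearbody A2.
  assert (Rp : forall i, 1 <= r ^ i) by (intros i; apply pow_R1_Rle; lra).
  (* Four ranges of [i]: above [n] there is no zero by maximality on the ray; at [n] the exponent
     [bp n] is 0; at the [q] indices just below, [Hnear] excludes zeros; the rest have exponent at
     most [C1 r^(n - q)] and polynomially bounded order. *)
  assert (B1 : INR (nsum (fun i => bp i * m i)%nat (max n N1)) <= INR n * (C1 * r ^ (n - q) * (A2 * INR n ^ 4))).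
  { apply nsum_bound.
    - pose proof (Rp (n - q)%nat). pose proof (pow_le (INR n) 4 ltac:(lra)). apply Rmult_le_pos; apply Rmult_le_pos; lra.
    - intros i Hi. rewrite (zord_neq0 Zf _ (m i) (Hm i ltac:(lia))); [lia|].
      rewrite Es. apply Hray. apply Rmult_lt_reg_r with (INR n); [lra|]. unfold Rdiv. rewrite Rmult_assoc, Rinv_l by lra.
      apply lt_INR in Hi. lra.
    - intros i Hi. rewrite mult_INR. pose proof (Rp (n - q)%nat) as Rq. pose proof (pow_le (INR n) 4 ltac:(lra)) as P4.
      assert (Pos : 0 <= C1 * r ^ (n - q) * (A2 * INR n ^ 4)) by (apply Rmult_le_pos; apply Rmult_le_pos; lra).
      destruct (Nat.eq_dec i n) as [->|Nin]; [rewrite Hbp; simpl INR; lra|].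
      destruct (Nat.lt_ge_cases (n - q - 1) i) as [L|L].
      + rewrite (zord_neq0 Zf _ (m i) (Hm i ltac:(lia))); [simpl INR; lra|].
        rewrite Es. specialize (Hnear (n - i - 1)%nat ltac:(lia)).
        replace (INR i / INR n) with (1 - INR (S (n - i - 1)) / INR n); auto.
        replace (S (n - i - 1)) with (n - i)%nat by lia. rewrite minus_INR by lia. field. lra.
      + apply Rmult_le_compat; try apply pos_INR; [|apply Bm; lia].
        pose proof (HC i ltac:(lia)). pose proof (pos_INR (bm i)).
        apply Rle_trans with (C1 * r ^ i); [lra|]. apply Rmult_le_compat_l; [lra|]. apply Rle_pow; [lra|lia]. }
  apply (pole_criterion k l ltac:(lia) (max n N1) s0 m D); auto.
  - unfold s0, rho. rewrite scal_pair. simpl. intros E.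
    apply Rmult_integral in E as [E|E]; [|apply Rmult_integral in E as [E|E]; lra].
    pose proof (Rinv_0_lt_compat (INR n) ltac:(lra)). lra.
  - fold bp bm. apply INR_lt. rewrite plus_INR.
    assert (B2 : INR (bm n) <= INR (nsum (fun i => bm i * m i)%nat (max n N1))).
    { apply le_INR. apply Nat.le_trans with (bm n * m n)%nat; [|apply (nsum_term_le (fun i => bm i * m i)%nat n); lia].
      assert (1 <= m n)%nat; [|nia]. apply (zord_zero Zf (INR n * s0)%C); [apply Hm; lia|].
      rewrite Es. unfold Rdiv. rewrite Rinv_r, Cmult_1_l by lra. auto. }
    apply Rlt_le_trans with (INR (bm n)); auto. pose proof (Bm k ltac:(lia)) as B3.
    apply Rmult_lt_reg_l with (INR n); [lra|]. apply Rlt_le_trans with (c * r ^ n); auto.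
    replace n with (n - q + q)%nat at 3 by lia. rewrite pow_add. pose proof (Rp (n - q)%nat) as Rq.
    apply Rle_lt_trans with (r ^ (n - q) * (A2 * (1 + C1) * INR n ^ 6)).
    + set (T := r ^ (n - q)) in *. set (v := INR n) in *.
      apply Rle_trans with (v * (A2 * v ^ 4 + v * (C1 * T * (A2 * v ^ 4)))); [apply Rmult_le_compat_l; lra|].
      replace (T * (A2 * (1 + C1) * v ^ 6)) with (A2 * v ^ 4 * (v * v * T) + C1 * T * A2 * v ^ 6) by ring.
      assert (A2 * v ^ 4 * v <= A2 * v ^ 4 * (v * v * T)).
      { apply Rmult_le_compat_l; [apply Rmult_le_pos; [lra|apply pow_le; lra]|]. nra. }
      replace (v * (A2 * v ^ 4 + v * (C1 * T * (A2 * v ^ 4)))) with (A2 * v ^ 4 * v + C1 * T * A2 * v ^ 6) by ring. lra.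
    + replace (c * (r ^ (n - q) * r ^ q)) with (r ^ (n - q) * (c * r ^ q)) by ring.
      apply Rmult_lt_compat_l; lra.
Qed.

(** Of the [q^2] indices from [n0] on, at least [c q^2 - K2] have a large [bm]. Each of the [q] gaps
    spoils at most [c q / 2] of them and each root of [Q] at most one, so some index survives. *)
Lemma good_index (b x y r c K2 C1 : R) (bs : list C) (N1 n0 q : nat) : / 40 < b <= 1 -> 0 < x <= INR n0 ->
  (forall u, Qpoly k l u = lprod (fun b => 1 - b * u)%C bs) ->
  (forall a H, (N1 <= a)%nat -> c * INR H - K2 <=
      rsum (fun i => if excluded_middle_informative (bp (a + i)%nat = 0%nat /\ c * r ^ (a + i) <= INR (a + i) * INR (bm (a + i)%nat))
                     then 1 else 0) H) ->
  (N1 <= n0)%nat -> (2 <= q)%nat -> (q ^ 4 <= n0)%nat -> 320 * Rabs y <= INR q ->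
  960 * ln (zeta_growth (/ 80) (Rabs y * INR n0)) <= c / 2 * INR q ->
  INR (length bs) + K2 < c / 2 * (INR q * INR q) ->
  exists n, (n0 <= n < n0 + q * q)%nat /\ bp n = 0%nat /\ c * r ^ n <= INR n * INR (bm n) /\
    (forall j, (j < q)%nat -> Zf (RtoC (1 - INR (S j) / INR n) * (b, y * x)%R)%C <> 0) /\
    (forall p, is_prime p -> Qpoly k l (pw (INR p) (RtoC (/ INR n) * (b, y * x)%R)%C) <> 0).
Proof.
  intros Hb Hx HQ HW HN1 Hq2 Hq4 Hqy HL Hfin.
  set (H := (q * q)%nat). set (rho := (b, y * x) : C).
  set (R1 := fun j i => Zf (RtoC (1 - INR (S j) / INR (n0 + i)) * rho)%C = 0).
  set (R2 := fun (beta : C) i => exists p, is_prime p /\ (1 - beta * pw (INR p) (RtoC (/ INR (n0 + i)) * rho))%C = 0).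
  apply NNPP. intros Hno.
  specialize (HW n0 H HN1). 
  change (c * INR H - K2 <= cnt (fun i => bp (n0 + i)%nat = 0%nat /\ c * r ^ (n0 + i) <= INR (n0 + i) * INR (bm (n0 + i)%nat)) H) in HW.
  assert (Q3 : (q * (q * q) <= n0)%nat) by (simpl in Hq4; nia).
  assert (Hq0 : (2 * q <= n0)%nat) by nia.
  assert (C1' : cnt (fun i => exists j, (j < q)%nat /\ R1 j i) H <= INR q * (c / 2 * INR q)).
  { apply cnt_exists_lt. intros j Hj. eapply Rle_trans; [|exact HL].
    apply (near_zeros_count b x y Hb ltac:(lra) (S j) q n0 H); auto; [lia|lra|].
    unfold H. rewrite mult_INR. pose proof (Rabs_pos y) as Py. pose proof (pos_INR q) as Pq.
    assert (Hn0 : INR q * INR q * (INR q * INR q) <= INR n0).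
    { rewrite <- !mult_INR. apply le_INR. simpl in Hq4. nia. }
    assert (0 <= INR q * (INR q * INR q)) by (repeat apply Rmult_le_pos; auto).
    assert (Rabs y * (INR q * (INR q * INR q)) <= / 320 * INR q * (INR q * (INR q * INR q))) by (apply Rmult_le_compat_r; lra).
    nra. }
  assert (C2' : cnt (fun i => exists beta, In beta bs /\ R2 beta i) H <= INR (length bs)).
  { apply cnt_exists_list. intros beta. apply cnt_unique. intros i j (p & Hp & E1) (p' & Hp' & E2).
    assert (n0 + i = n0 + j)%nat; [|lia].
    apply (root_hit_unique beta rho p p'); auto; try lia. unfold rho. simpl. lra. }
  assert (CU := cnt_union (fun i => bp (n0 + i)%nat = 0%nat /\ c * r ^ (n0 + i) <= INR (n0 + i) * INR (bm (n0 + i)%nat))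
    (fun i => exists j, (j < q)%nat /\ R1 j i) (fun i => exists beta, In beta bs /\ R2 beta i) H).
  assert (CU' : forall i, (i < H)%nat -> bp (n0 + i)%nat = 0%nat /\ c * r ^ (n0 + i) <= INR (n0 + i) * INR (bm (n0 + i)%nat) ->
    (exists j, (j < q)%nat /\ R1 j i) \/ (exists beta, In beta bs /\ R2 beta i)).
  { intros i Hi [P1 P2]. apply NNPP. intros Hn. apply not_or_and in Hn as [Hn1 Hn2]. apply Hno. exists (n0 + i)%nat.
    unfold H in Hi. split; [lia|]. split; auto. split; auto. split.
    - intros j Hj E. apply Hn1. exists j. auto.
    - intros p Hp E. rewrite HQ in E. apply lprod_zero in E as (beta & Hin & E). apply Hn2. exists beta. split; auto. exists p. auto. }
  specialize (CU CU'). unfold H in HW at 1. rewrite mult_INR in HW. lra.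
Qed.

(** All scales are tied to [q], about the fourth root of [x]: [log n0] is small against [q], [n^6]
    against [r^q], and [n - x <= q^2 + 1] against [n >= q^4], which leaves the pole within
    [(1 + 2 |y|) / q] of [i y]. *)
Theorem pole_near_boundary (y eps : R) : y <> 0 -> 0 < eps ->
  exists p, pole (numer k l) (denom k l) p /\ Cmod (p - iy y) < eps.
Proof.
  intros Hy Heps.
  destruct (exponents_growth k l bp bm Hk Hl eq_refl eq_refl) as (r & c & K2 & C1 & N1 & Hr & Hc & HC1 & HC & HW).
  destruct (euler_roots k l ltac:(lia) Hl) as (bs & _ & HQ & _ & _).
  pose proof (Rabs_pos y) as Py. set (Y := Rabs y) in *.
  assert (Ht : 1 < exp (c / 1920)).
  { pose proof (exp_ineq1 (c / 1920) ltac:(lra)). lra. }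
  (* The growth bound is quadratic in [n0 <= (q + 1)^4], hence the degree 8; the rate [c / 1920]
     turns [960 ln] of it into at most [c q / 2]. The degree 24 below is that of [n^6] with
     [n <= 2 (q + 1)^4]. *)
  destruct (poly_lt_exp (exp (c / 1920)) (1 + (7 + Y) ^ 2 * 161) 8 Ht) as (T1 & HT1).
  set (A2 := 240 * (1 + 81 * (7 + Y) ^ 2) * (1 + C1)).
  destruct (poly_lt_exp r (A2 * 64 / c + 1) 24 Hr) as (T2 & HT2).
  destruct (INR_unbounded (320 * Y)) as (T3 & HT3).
  destruct (INR_unbounded ((1 + 2 * Y) / eps)) as (T4 & HT4).
  destruct (INR_unbounded (2 * (INR (length bs) + Rabs K2) / c)) as (T5 & HT5).
  set (Q0 := (T1 + T2 + T3 + T4 + T5 + N1 + k + 2)%nat).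
  destruct (ray_maximal_zero y (INR (Q0 ^ 4)) Hy) as (b & x & Hx & Hb & HZ & Hray).
  { apply lt_0_INR. apply Nat.neq_0_lt_0, Nat.pow_nonzero. unfold Q0. lia. }
  assert (Px : 0 < x). { eapply Rlt_le_trans; [|exact Hx]. apply lt_0_INR. apply Nat.neq_0_lt_0, Nat.pow_nonzero. unfold Q0. lia. }
  destruct (nfloor_ex x) as (n1 & Hn1); [lra|].
  set (n0 := S n1). assert (Hn0 : x <= INR n0 <= x + 1) by (unfold n0; rewrite S_INR; lra).
  destruct (fourth_root n0) as (q & Hq1 & Hq2).
  assert (Hq : (Q0 <= q)%nat).
  { assert (Q0 ^ 4 < (q + 1) ^ 4)%nat.
    { apply Nat.le_lt_trans with n0; auto. apply INR_le. lra. }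
    apply Nat.pow_lt_mono_l_iff in H; lia. }
  assert (IQ : forall T, (T <= Q0)%nat -> INR T <= INR q) by (intros T HT; apply le_INR; lia).
  pose proof (IQ T3 ltac:(unfold Q0; lia)) as I3. pose proof (IQ T4 ltac:(unfold Q0; lia)) as I4.
  pose proof (IQ T5 ltac:(unfold Q0; lia)) as I5. pose proof (IQ 2%nat ltac:(unfold Q0; lia)) as I6. simpl in I6.
  assert (Hn0q : INR n0 <= (INR q + 1) ^ 4).
  { replace (INR q + 1) with (INR (q + 1)) by (rewrite plus_INR; auto). rewrite <- pow_INR. apply le_INR. lia. }
  assert (Hq1' : (1 <= q)%nat) by (unfold Q0 in Hq; lia).
  assert (Hqn : (q <= q ^ 4)%nat) by (rewrite <- (Nat.pow_1_r q) at 1; apply Nat.pow_le_mono_r; lia).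
  assert (Hqq : (q * q <= q ^ 4)%nat) by (rewrite <- Nat.pow_2_r; apply Nat.pow_le_mono_r; lia).
  destruct (good_index b x y r c K2 C1 bs N1 n0 q) as (n & Hn & Gbp & Gbm & Gnear & Groot); auto.
  { lra. } { unfold Q0 in Hq; lia. } { unfold Q0 in Hq; lia. } { fold Y. lra. }
  { fold Y. specialize (HT1 q ltac:(unfold Q0 in Hq; lia)). rewrite exp_pow in HT1.
    assert (G : zeta_growth (/ 80) (Y * INR n0) <= exp (INR q * (c / 1920))).
    { eapply Rle_trans; [|exact HT1]. unfold zeta_growth. rewrite (Rabs_pos_eq (Y * INR n0)) by (apply Rmult_le_pos; [auto|apply pos_INR]).
      replace (2 / / 80 + 1) with 161 by field.
      set (w := (INR q + 1) ^ 4) in *. assert (Hw : 1 <= w) by (unfold w; apply pow_R1_Rle; lra).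
      assert (S1 : (7 + Y * INR n0) ^ 2 <= ((7 + Y) * w) ^ 2).
      { pose proof (pos_INR n0). apply pow_incr. split; nra. }
      replace ((INR q + 1) ^ 8) with (w ^ 2) by (unfold w; ring).
      replace ((1 + (7 + Y) ^ 2 * 161) * w ^ 2) with (w ^ 2 + ((7 + Y) * w) ^ 2 * 161) by ring.
      assert (1 <= w ^ 2) by (apply pow_R1_Rle; lra). lra. }
    pose proof (zeta_growth_ge1 (/ 80) (Y * INR n0) ltac:(lra)).
    apply ln_le in G; [|lra]. rewrite ln_exp in G. lra. }
  { assert (2 * (INR (length bs) + Rabs K2) < c * INR q).
    { apply Rmult_lt_reg_r with (/ c); [apply Rinv_0_lt_compat; lra|].
      replace (c * INR q * / c) with (INR q) by (field; lra). unfold Rdiv in HT5. lra. }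
    pose proof (Rle_abs K2). pose proof (pos_INR (length bs)). pose proof (Rabs_pos K2). nra. }
  assert (Pn0 : INR n0 <= INR n) by (apply le_INR; lia).
  assert (Pn1 : INR n <= 2 * (INR q + 1) ^ 4).
  { replace (INR q + 1) with (INR (q + 1)) by (rewrite plus_INR; auto). rewrite <- pow_INR.
    change 2 with (INR 2). rewrite <- mult_INR. apply le_INR. lia. }
  exists (RtoC (/ INR n) * (b, y * x)%R)%C. split.
  - apply (pole_at_scaled_zero b x y r c C1 q n); auto; try lra.
    + unfold Q0 in Hq. lia.
    + lia.
    + fold Y. specialize (HT2 q ltac:(unfold Q0 in Hq; lia)).
      set (w := INR q + 1) in *. assert (Hw : 1 <= w) by (unfold w; lra).
      assert (HA2 : 0 <= A2). { unfold A2. pose proof (pow2_ge_0 (7 + Y)). apply Rmult_le_pos; lra. }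
      assert (N6 : INR n ^ 6 <= 64 * w ^ 24).
      { replace (64 * w ^ 24) with ((2 * w ^ 4) ^ 6) by ring. apply pow_incr. split; [apply pos_INR|auto]. }
      fold A2. assert (0 < w ^ 24) by (apply pow_lt; lra).
      apply Rle_lt_trans with (A2 * (64 * w ^ 24)); [apply Rmult_le_compat_l; auto|].
      apply Rlt_le_trans with (c * ((A2 * 64 / c + 1) * w ^ 24)); [|apply Rmult_le_compat_l; lra].
      replace (c * ((A2 * 64 / c + 1) * w ^ 24)) with (A2 * (64 * w ^ 24) + c * w ^ 24) by (field; lra).
      assert (0 < c * w ^ 24) by (apply Rmult_lt_0_compat; auto). lra.
  - set (v := INR n) in *. assert (Hq0 : 0 < INR q) by lra.
    assert (Hqv : INR q * INR q * (INR q * INR q) <= v).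
    { unfold v. rewrite <- !mult_INR. apply le_INR. simpl in Hq1. lia. }
    assert (Hv : 0 < v) by nra.
    assert (Hvn : v - x <= INR q * INR q + 1).
    { assert (v <= INR n0 + INR q * INR q); [|lra]. unfold v. rewrite <- mult_INR, <- plus_INR. apply le_INR. lia. }
    rewrite scal_pair. eapply Rle_lt_trans; [apply Cmod_le_re_im|].
    change (Re (((/ v * b)%R, (/ v * (y * x))%R) - iy y)%C) with (/ v * b - 0).
    change (Im (((/ v * b)%R, (/ v * (y * x))%R) - iy y)%C) with (/ v * (y * x) - y).
    assert (Iv : 0 < / v) by (apply Rinv_0_lt_compat; auto).
    rewrite (Rabs_pos_eq (/ v * b - 0)) by nra.
    replace (/ v * (y * x) - y) with (- (y * ((v - x) / v))) by (field; lra).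
    rewrite Rabs_Ropp, Rabs_mult, (Rabs_pos_eq ((v - x) / v)) by (apply Rdiv_le_0_compat; lra). fold Y.
    assert (V1 : / v <= / INR q) by (apply Rinv_le_contravar; auto; nra).
    assert (V2 : (v - x) / v <= 2 * / INR q).
    { apply Rmult_le_reg_r with v; auto. unfold Rdiv. rewrite Rmult_assoc, Rinv_l, Rmult_1_r by lra.
      eapply Rle_trans; [exact Hvn|].
      apply Rle_trans with (2 * / INR q * (INR q * INR q * (INR q * INR q))); [|apply Rmult_le_compat_l; [|exact Hqv]].
      - replace (2 * / INR q * (INR q * INR q * (INR q * INR q))) with (2 * (INR q * INR q * INR q)) by (field; lra). nra.
      - apply Rmult_le_pos; [lra|]. apply Rlt_le, Rinv_0_lt_compat; lra. }
    apply Rle_lt_trans with ((1 + 2 * Y) * / INR q).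
    + assert (/ v * b <= / INR q) by nra. assert (Y * ((v - x) / v) <= Y * (2 * / INR q)) by (apply Rmult_le_compat_l; auto). lra.
    + apply Rmult_lt_reg_r with (INR q); auto. rewrite Rmult_assoc, Rinv_l, Rmult_1_r by lra.
      apply Rmult_lt_reg_r with (/ eps); [apply Rinv_0_lt_compat; auto|].
      replace (eps * INR q * / eps) with (INR q) by (field; lra). unfold Rdiv in HT4. lra.
Qed.
End PoleNearBoundary.

Theorem theorem16 :
  forall l : nat, (0 < l)%nat ->
    (forall s : C, 1 < Re s -> F 1 l s = zeta s) /\
    (forall s : C, 1 < Re s ->
       F 2 l s = (zeta (2 * s) * zeta (INR (2 * l + 1) * s)
                  / zeta (2 * INR (2 * l + 1) * s))%C) /\
    (forall k : nat, (3 <= k)%nat ->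
       exists (G : C -> C) (P : C -> Prop),
         meromorphic_on right_half_plane G P /\
         (forall s : C, 1 < Re s -> G s = F k l s) /\
         (* every point of Re s = 0 is a limit point of poles *)
         (forall (y eps : R), 0 < eps ->
            exists p, P p /\ Cmod (p - (iy y))%C < eps) /\
         (* no meromorphic continuation to a neighbourhood of any point of Re s = 0 *)
         (forall y : R, ~ exists (r : R) (H : C -> C) (Q : C -> Prop),
              0 < r /\ meromorphic_on (Cdisc (iy y) r) H Q /\
              forall z, Cdisc (iy y) r z -> right_half_plane z -> ~ P z -> ~ Q z ->
                        H z = G z)).
Proof.
  intros l Hl. split; [|split].
  - intros s Hs. apply F1_zeta; auto.
  - intros s Hs. apply F2_formula; auto.
  - intros k Hk. exists (quot (numer k l) (denom k l)), (pole (numer k l) (denom k l)).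
    assert (Hmero : meromorphic_on right_half_plane (quot (numer k l) (denom k l)) (pole (numer k l) (denom k l)))
      by (apply quot_meromorphic_zeta; lia).
    assert (Hpole : forall y eps : R, 0 < eps -> exists p, pole (numer k l) (denom k l) p /\ Cmod (p - (iy y))%C < eps).
    { intros y eps He. destruct (Req_dec y 0) as [->|Hy]; [|apply pole_near_boundary; auto; lia].
      destruct (pole_near_boundary k l Hk Hl (eps / 2) (eps / 2)) as (p & Hp & Hd); [lra|lra|].
      exists p. split; auto. replace (p - iy 0)%C with ((p - iy (eps / 2)) + iy (eps / 2))%C
        by (apply injective_projections; simpl; ring).
      eapply Rle_lt_trans; [apply Cmod_triangle|]. assert (Cmod (iy (eps / 2)) <= eps / 2); [|lra].
      eapply Rle_trans; [apply Cmod_le_re_im|]. simpl. rewrite Rabs_R0, Rabs_pos_eq; lra. }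
    split; auto. split; [|split; auto].
    + intros s Hs. apply quot_F; auto; lia.
    + intros y. apply clustering_poles_no_continuation; auto.
Qed.
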